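(* Let $\mathcal{D}=(d_1,\ldots,d_m)$ be positive integers with $\sum_i d_i=n$. In $H^*(\mathrm{Fl}_{2\mathcal{D}}(\mathbb{R}^{2n});\mathbb{Q})$ the structure constants are given, for $I,J\in\mathrm{OSP}(\mathcal{D})$, by $$[\sigma_{DI}^{\mathbb{R}}]\cdot[\sigma_{DJ}^{\mathbb{R}}]=\sum_{K\in\mathrm{OSP}(\mathcal{D})}c_{IJ}^K\,[\sigma_{DK}^{\mathbb{R}}],$$ where $c_{IJ}^K$ are the Littlewood-Richardson coefficients of the complex Schubert varieties, i.e. in $H^*(\mathrm{Fl}_{\mathcal{D}}(\mathbb{C}^n);\mathbb{Q})$ $$[\sigma_{I}^{\mathbb{C}}]\cdot[\sigma_{J}^{\mathbb{C}}]=\sum_{K\in\mathrm{OSP}(\mathcal{D})}c_{IJ}^K\,[\sigma_{K}^{\mathbb{C}}].$$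
   Context: For $\mathbb{F}=\mathbb{R},\mathbb{C}$ and positive integers $\mathcal{E}=(e_1,\ldots,e_m)$ with sum $M$, $\mathrm{Fl}_{\mathcal{E}}(\mathbb{F}^M)$ is the manifold of flags $F_1\subset\cdots\subset F_m=\mathbb{F}^M$ with $\dim_{\mathbb F} F_i=e_1+\cdots+e_i$; $\mathrm{OSP}(\mathcal{E})$ is the set of ordered set partitions $I=(I_1,\ldots,I_m)$ of $\{1,\ldots,M\}$ with $|I_j|=e_j$; write $I(c)=j$ if $c\in I_j$. With $E_k$ the span of the first $k$ standard basis vectors, the Schubert variety $\sigma_I^{\mathbb{F}}$ is the closure of the cell $\Omega_I=\{F_\bullet:\dim (F_i\cap E_k)=|\{l\in I_1\cup\cdots\cup I_i:l\le k\}|\text{ for all } i,k\}$. For $I\in\mathrm{OSP}(\mathcal{D})$, $DI\in\mathrm{OSP}(2\mathcal{D})$ is obtained by replacing each $i\in I_j$ by $2i-1,2i\in (DI)_j$. Coorientations in the real case: at the coordinate flag $E^I_\bullet$, $E^I_i=\langle e_l:l\in I_1\cup\cdots\cup I_i\rangle$, the normal space of $\Omega_I$ has basis the homomorphisms $e_c\mapsto e_d$ with $c<d$, $I(c)<I(d)$; it is oriented by listing these in lexicographic order of $(c,d)$, and this orientation is extended over the contractible cell $\Omega_I$. The varieties $\sigma^{\mathbb{R}}_{DI}$ have fundamental cohomology classes $[\sigma^{\mathbb{R}}_{DI}]$, which form a basis of $H^*(\mathrm{Fl}_{2\mathcal{D}}(\mathbb{R}^{2n});\mathbb{Q})$. 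*)

(* Defs.v *)
From HB Require Import structures.
From mathcomp Require Import all_boot all_order all_algebra.
From mathcomp Require Import complex.
From mathcomp Require Import all_classical all_reals all_analysis.

Set Implicit Arguments.
Unset Strict Implicit.
Unset Printing Implicit Defensive.

Import Order.TTheory GRing.Theory Num.Theory.
Import numFieldNormedType.Exports.
Local Open Scope classical_set_scope.
Local Open Scope quotient_scope.
Local Open Scope ring_scope.

Definition stdsimplex (R : realType) (k : nat) : set 'rV[R]_k.+1 :=
  [set t | (forall i, 0 <= t 0 i) /\ \sum_i t 0 i = 1].
Arguments stdsimplex : clear implicits.

Section simplex_map.
Context (R : realType) (p n : nat) (theta : 'I_p.+1 -> 'I_n.+1).

Definition pushrv (t : 'rV[R]_p.+1) : 'rV[R]_n.+1 :=
  \row_j \sum_(i | theta i == j) t 0 i.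

Lemma pushrv_stdsimplex (t : stdsimplex R p) :
  pushrv (set_val t) \in stdsimplex R n.
Proof.
have [t0 t1] : stdsimplex R p (set_val t) by apply/set_mem; case: t.
apply/mem_set; split; first by move=> j; rewrite mxE; apply: sumr_ge0.
by under eq_bigr do rewrite mxE; rewrite -t1 [RHS](partition_big theta xpredT).
Qed.

(* the affine map of standard simplices sending the i-th vertex to the
   (theta i)-th one *)
Definition simplex_map (t : stdsimplex R p) : stdsimplex R n :=
  exist _ (pushrv (set_val t)) (pushrv_stdsimplex t).

Lemma pushrv_continuous : continuous pushrv.
Proof.
move=> t A [B tB BA].
have sum_cont i j : continuous (fun s => pushrv s i j).
  have -> : (fun s => pushrv s i j) =
      (fun s : 'rV[R]_p.+1 => \sum_(k | theta k == j) s 0 k).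
    by apply/funext => s; rewrite mxE.
  apply: continuous_big => [|k _]; first exact: add_continuous.
  exact: coord_continuous.
have tBs : \forall s \near t, forall i j, B i j (pushrv s i j).
  apply: (@filter_forall _ _ (fun i s => forall j, B i j (pushrv s i j))
    (nbhs t) (nbhs_filter t)) => i.
  apply: (@filter_forall _ _ (fun j s => B i j (pushrv s i j))
    (nbhs t) (nbhs_filter t)) => j.
  exact/sum_cont/tB.
by apply: filterS tBs => s sB; apply: BA.
Qed.

Lemma simplex_map_continuous : continuous simplex_map.
Proof.
apply: continuous_comp_initial.
have -> : set_val \o simplex_map = pushrv \o set_val by [].
move=> t; apply: continuous_comp; last exact: pushrv_continuous.
exact: initial_continuous.
Qed.

HB.instance Definition _ := @isContinuous.Build (stdsimplex R p)
  (stdsimplex R n) simplex_map simplex_map_continuous.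

End simplex_map.
Arguments simplex_map R {p n} theta t.

Section cohomology.
Context (R : realType) (X : topologicalType).

Record simplex := Simplex {
  sdim : nat;
  smap :> continuousType (stdsimplex R sdim) X }.

(* the p-simplex spanned by the vertices theta 0, ..., theta p of s *)
Definition face (p : nat) (theta : nat -> nat) (s : simplex) : simplex :=
  Simplex (smap s \o simplex_map R (fun i : 'I_p.+1 =>
    inord (theta i) : 'I_(sdim s).+1)).

Lemma eq_face p theta eta s :
  (forall i, (i <= p)%N -> theta i = eta i) -> face p theta s = face p eta s.
Proof.
move=> e; rewrite /face; congr (Simplex (smap s \o simplex_map R _)).
by apply/funext => i; rewrite e // -ltnS ltn_ord.
Qed.

Lemma face_comp q eta p theta s : (forall i, (i <= q)%N -> (eta i <= p)%N) ->
  face q eta (face p theta s) = face q (theta \o eta) s.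
Proof.
move=> etap; rewrite /face /=; congr Simplex; apply/continuousEP => t /=.
congr (smap s _); apply: val_inj => /=; apply/rowP => j; rewrite !mxE.
under eq_bigr do rewrite mxE.
rewrite [RHS](partition_big (fun i : 'I_q.+1 => inord (eta i) : 'I_p.+1)
  (fun k => inord (theta k) == j)) /=; last first.
  by move=> i /eqP <-; rewrite inordK // ltnS etap // -ltnS ltn_ord.
apply: eq_bigr => k /eqP <-; apply: eq_bigl => i.
case: (inord (eta i) =P k) => [<-|]; last by rewrite andbF.
by rewrite inordK ?eqxx // ltnS etap // -ltnS ltn_ord.
Qed.

(* An inhomogeneous cochain: a family (a_k)_k of singular cochains, one in each
   degree k.  The cohomology below is thus the product of the H^k(X; Q), which
   is their direct sum when X is a compact manifold. *)
Definition cochain := simplex -> rat^o.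

HB.instance Definition _ := GRing.Lmodule.on cochain.

Definition coboundary (a : cochain) : cochain := fun s =>
  if sdim s is n.+1
  then \sum_(i < n.+2) (-1) ^+ i * a (face n (bump i) s) else 0.

Definition cupc (a b : cochain) : cochain := fun s =>
  \sum_(p < (sdim s).+1) a (face p id s) * b (face (sdim s - p) (addn p) s).

Lemma coboundary_is_linear : linear coboundary.
Proof.
move=> c a b; apply/funext => s.
rewrite -[RHS]/(c * coboundary a s + coboundary b s) /coboundary.
case: (sdim s) => [|n]; first by rewrite mulr0 addr0.
rewrite mulr_sumr -big_split /=; apply: eq_bigr => i _.
rewrite -[(c *: a + b) _]/(c * a (face n (bump i) s) + b (face n (bump i) s)).
by rewrite mulrDr mulrCA.
Qed.

HB.instance Definition _ := GRing.isLinear.Build rat cochain cochain _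
  coboundary coboundary_is_linear.

Definition is_cocycle : {pred cochain} := fun a => `[< coboundary a = 0 >].

Lemma is_cocycleP a : reflect (coboundary a = 0) (a \in is_cocycle).
Proof. exact: asboolP. Qed.

Lemma is_cocycle_submod_closed : submod_closed is_cocycle.
Proof.
split=> [|c a b]; first by apply/is_cocycleP; exact: linear0.
move=> /is_cocycleP a0 /is_cocycleP b0; apply/is_cocycleP.
by rewrite linearP /= a0 b0 scaler0 addr0.
Qed.

HB.instance Definition _ := GRing.isSubmodClosed.Build rat cochain is_cocycle
  is_cocycle_submod_closed.

Lemma is_cocycle_cupc a b :
  a \in is_cocycle -> b \in is_cocycle -> cupc a b \in is_cocycle.
Proof.
move=> /is_cocycleP a0 /is_cocycleP b0; apply/is_cocycleP/funext => s.
rewrite /coboundary; case Es : (sdim s) => [//|n].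
transitivity (\sum_(i < n.+2) \sum_(p < n.+1) (-1) ^+ i *
  (a (face p id (face n (bump i) s)) *
   b (face (n - p) (addn p) (face n (bump i) s)))).
  by apply: eq_bigr => i _; rewrite /cupc mulr_sumr.
rewrite exchange_big; apply: big1 => -[p /= pn] _; rewrite ltnS in pn.
have frontE i : face p id (face n (bump i) s) =
    if (i <= p)%N then face p (bump i) (face p.+1 id s) else face p id s.
  rewrite face_comp => [|j jp]; last exact: leq_trans pn.
  case: leqP => ip.
    rewrite face_comp // => j jp; rewrite /bump.
    by rewrite -add1n leq_add // leq_b1.
  by apply: eq_face => j jp /=; rewrite /bump leqNgt (leq_ltn_trans jp ip).
have backE i : face (n - p) (addn p) (face n (bump i) s) =
    if (i <= p)%N then face (n - p) (addn p.+1) s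
    else face (n - p) (bump (i - p)) (face (n - p).+1 (addn p) s).
  rewrite face_comp => [|j jp]; last by rewrite -leq_subRL.
  case: leqP => ip.
    apply: eq_face => j jp /=; rewrite /bump (leq_trans ip) ?leq_addr //.
  rewrite face_comp => [|j jp]; last first.
    by rewrite /bump -add1n leq_add // leq_b1.
  by apply: eq_face => j jp /=; rewrite /bump leq_subLR addnCA.
have aE : \sum_(i < p.+1) (-1) ^+ i * a (face p (bump i) (face p.+1 id s)) =
    (-1) ^+ p * a (face p id s).
  have := congr1 (@^~ (face p.+1 id s)) a0.
  rewrite /coboundary /= big_ord_recr /= => /eqP.
  rewrite addr_eq0 => /eqP ->; rewrite exprS mulN1r mulNr opprK.
  rewrite face_comp; last by move=> j jp; rewrite /bump -add1n leq_add ?leq_b1.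
  congr (_ * a _); apply: eq_face => j jp.
  by rewrite /= /bump leqNgt ltnS jp.
have bE : \sum_(i < (n - p).+1) (-1) ^+ i *
      b (face (n - p) (bump i.+1) (face (n - p).+1 (addn p) s)) =
    b (face (n - p) (addn p.+1) s).
  have := congr1 (@^~ (face (n - p).+1 (addn p) s)) b0.
  rewrite /coboundary /= big_ord_recl /= expr0 mul1r => /eqP.
  rewrite addr_eq0 face_comp; last first.
    by move=> j jp; rewrite /bump -add1n leq_add ?leq_b1.
  rewrite (@eq_face _ _ (addn p.+1)) => [/eqP ->|j jp]; last first.
    by rewrite /= /bump addnCA.
  rewrite -sumrN; apply: eq_bigr => i _.
  by rewrite /bump /= add1n exprS mulN1r mulNr opprK.
rewrite -(big_mkord xpredT (fun i => (-1) ^+ i *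
  (a (face p id (face n (bump i) s)) *
   b (face (n - p) (addn p) (face n (bump i) s))))).
rewrite (@big_cat_nat _ _ _ p.+1) //=; last by rewrite ltnS leqW.
rewrite [X in X + _](_ : _ = (-1) ^+ p * a (face p id s) *
    b (face (n - p) (addn p.+1) s)); last first.
  rewrite -aE mulr_suml big_mkord; apply: eq_bigr => -[i /= ip] _.
  by rewrite frontE backE -ltnS ip mulrA.
rewrite [X in _ + X](_ : _ = - ((-1) ^+ p * a (face p id s) *
    b (face (n - p) (addn p.+1) s))) ?subrr //.
rewrite -bE mulr_sumr -sumrN -{1}(add0n p.+1) big_addn.
rewrite subSS subSn // big_mkord; apply: eq_bigr => -[i /= ip] _.
rewrite frontE backE leqNgt addnS ltnS leq_addl /=.
rewrite -addSn addnK addSn exprS exprD mulN1r !mulNr.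
by congr (- _); rewrite [X in X * _ = _]mulrC mulrACA.
Qed.

Record cocycle := Cocycle {
  cocycle_val :> cochain; _ : is_cocycle cocycle_val }.

HB.instance Definition _ := [isSub for cocycle_val].
HB.instance Definition _ := [Choice of cocycle by <:].
HB.instance Definition _ := [SubChoice_isSubLmodule of cocycle by <:].

Definition is_exact : {pred cocycle} := fun z =>
  `[< exists b : cochain, coboundary b = val z >].

Lemma is_exactP (z : cocycle) :
  reflect (exists b : cochain, coboundary b = val z) (z \in is_exact).
Proof. exact: asboolP. Qed.

Lemma is_exact_submod_closed : submod_closed is_exact.
Proof.
split=> [|c y z]; first by apply/is_exactP; exists 0; exact: linear0.
move=> /is_exactP[a ya] /is_exactP[b zb]; apply/is_exactP; exists (c *: a + b).
by rewrite linearP /= ya zb.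
Qed.

HB.instance Definition _ := GRing.isSubmodClosed.Build rat cocycle is_exact
  is_exact_submod_closed.

Definition cohomology := Quotient.quot is_exact.

HB.instance Definition _ := GRing.Zmodule.on cohomology.

Definition coclass (z : cocycle) : cohomology := \pi z.

Definition cohomology_scale (c : rat) (x : cohomology) : cohomology :=
  coclass (c *: repr x).

Lemma coclassD : {morph coclass : y z / y + z}.
Proof. by move=> y z; rewrite /coclass piE. Qed.

Lemma coclass_eq y z : reflect (coclass y = coclass z) (y - z \in is_exact).
Proof. by rewrite Quotient.idealrBE; exact: eqP. Qed.

Lemma coclassZ c z : coclass (c *: z) = cohomology_scale c (coclass z).
Proof.
apply/coclass_eq; rewrite -scalerBr rpredZ //; apply/coclass_eq.
by rewrite /coclass reprK.
Qed.

Fact cohomology_scalerA c d x :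
  cohomology_scale c (cohomology_scale d x) = cohomology_scale (c * d) x.
Proof.
by rewrite -[x]reprK -[\pi _]/(coclass _) -!coclassZ scalerA.
Qed.

Fact cohomology_scale1r : left_id 1 cohomology_scale.
Proof.
by move=> x; rewrite -[x]reprK -[\pi _]/(coclass _) -!coclassZ scale1r.
Qed.

Fact cohomology_scalerDr : right_distributive cohomology_scale +%R.
Proof.
move=> c x y; rewrite -[x]reprK -[y]reprK -![\pi _]/(coclass _).
by rewrite -coclassD -!coclassZ scalerDr coclassD.
Qed.

Fact cohomology_scalerDl x : {morph cohomology_scale^~ x : c d / c + d}.
Proof.
move=> c d; rewrite -[x]reprK -![\pi _]/(coclass _).
by rewrite -!coclassZ -coclassD scalerDl.
Qed.

HB.instance Definition _ := GRing.Zmodule_isLmodule.Build rat cohomology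
  cohomology_scalerA cohomology_scale1r cohomology_scalerDr
  cohomology_scalerDl.

Definition cocycle_cup (y z : cocycle) : cocycle :=
  Cocycle (is_cocycle_cupc (valP y) (valP z)).

Definition cup (x y : cohomology) : cohomology :=
  coclass (cocycle_cup (repr x) (repr y)).

End cohomology.

Definition row_span (F : fieldType) (M : nat) (A : pred 'I_M) (g : 'M[F]_M) :
  {vspace 'rV[F]_M} := <<[seq row l g | l in A]>>%VS.

Section flag.
Context (F : fieldType) (m : nat) (e : 'I_m -> nat) (M : nat).

Definition flag_dim (i : 'I_m) : nat := (\sum_(j < m | j <= i) e j)%N.

Definition is_flag (V : {ffun 'I_m -> {vspace 'rV[F]_M}}) : bool :=
  [forall i, \dim (V i) == flag_dim i] &&
  [forall i : 'I_m, forall j : 'I_m, (i <= j)%N ==> (V i <= V j)%VS].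

Record flag := Flag {
  flag_space :> {ffun 'I_m -> {vspace 'rV[F]_M}}; _ : is_flag flag_space }.

HB.instance Definition _ := [isSub for flag_space].
HB.instance Definition _ := [Choice of flag by <:].

End flag.
Arguments flag F {m} e M.

Section flag_topology.
Context (F : numFieldType) (m : nat) (e : 'I_m -> nat) (M : nat).

(* The topology of Fl_e(F^M) is the quotient topology of the map from GL_M(F)
   to Fl_e(F^M) that sends g to the flag whose i-th space is spanned by the
   first e_1 + ... + e_i rows of g: a set O is open when its preimage in
   GL_M(F) is the trace of an open set U of matrices. *)
Definition flag_open : set_system (flag F e M) := [set O |
  exists2 U : set 'M[F]_M, open U &
    forall (g : 'M[F]_M) (V : flag F e M), g \in unitmx ->
      (forall i, V i = row_span [pred l : 'I_M | (l < flag_dim e i)%N] g) ->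
      O V <-> U g].

Lemma flag_openT : flag_open setT.
Proof. by exists setT; [exact: openT|]. Qed.

Lemma flag_openI : setI_closed flag_open.
Proof.
move=> O O' [U oU UP] [U' oU' UP']; exists (U `&` U'); first exact: openI.
by move=> g V gu gV; split=> -[/(UP g V gu gV) ? /(UP' g V gu gV)].
Qed.

Lemma flag_open_bigU (I : Type) (f : I -> set (flag F e M)) :
  (forall i, flag_open (f i)) -> flag_open (\bigcup_i f i).
Proof.
move=> /(_ _)/cid2-/all_sig2[U oU UP].
exists (\bigcup_i U i); first exact: bigcup_open.
by move=> g V gu gV; split=> -[i _ /(UP i g V gu gV)]; exists i.
Qed.

HB.instance Definition _ := isOpenTopological.Build (flag F e M)
  flag_openT flag_openI flag_open_bigU.

End flag_topology.

(* An ordered set partition (I_1, ..., I_m) is given by the function mapping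
   each c to the index I(c) of its block. *)
Section osp.
Context (m : nat) (e : 'I_m -> nat) (M : nat).

Record osp := Osp {
  osp_label :> {ffun 'I_M -> 'I_m};
  _ : [forall j, #|[pred c | osp_label c == j]| == e j] }.

HB.instance Definition _ := [isSub for osp_label].
HB.instance Definition _ := [Finite of osp by <:].

End osp.

Section double.
Context (m : nat) (d : 'I_m -> nat) (n : nat).

Lemma half_ord_subproof (k : 'I_n.*2) : (k./2 < n)%N.
Proof. by rewrite ltn_half_double. Qed.

Definition half_ord (k : 'I_n.*2) : 'I_n := Ordinal (half_ord_subproof k).

Lemma double_osp_subproof (I : osp d n) :
  [forall j, #|[pred k | [ffun k => I (half_ord k)] k == j]| == (d j).*2].
Proof.
case: I => I /= /forallP Id; apply/forallP => j; rewrite -(eqP (Id j)).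
have half2 (c : 'I_n) : (\sum_(k | half_ord k == c) 1 = 2)%N.
  have lt0 : (c.*2 < n.*2)%N by rewrite ltn_double.
  have lt1 : (c.*2.+1 < n.*2)%N by rewrite ltn_Sdouble.
  rewrite sum1_card.
  rewrite -(_ : #|[set Ordinal lt0; Ordinal lt1]%SET| = 2%N); last first.
    by rewrite cards2 -val_eqE /= neq_ltn ltnSn.
  apply: eq_card => k; rewrite !inE -!val_eqE /=.
  apply/eqP/orP => [<-|[]/eqP->]; last 2 first.
  - by rewrite doubleK.
  - by rewrite /= uphalf_double.
  have := odd_double_half k.
  by case: (odd k) => /= kE; [right|left]; rewrite -[X in X == _]kE.
rewrite -[X in _ == X]muln2 -sum_nat_const -sum1_card.
rewrite (partition_big half_ord [pred c | I c == j]) /=; last first.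
  by move=> k; rewrite !inE ffunE.
apply/eqP/eq_bigr => c /eqP Ic; rewrite -[RHS](half2 c).
apply: eq_bigl => k; rewrite !inE ffunE.
by case: (half_ord k =P c) => [->|]; rewrite ?Ic ?eqxx ?andbF.
Qed.

(* Indices are counted from 0, so c is replaced by 2c and 2c+1. *)
Definition double_osp (I : osp d n) : osp (fun i => (d i).*2) n.*2 :=
  Osp (double_osp_subproof I).

End double.

Section schubert.
Context (F : numFieldType) (m : nat) (e : 'I_m -> nat) (M : nat).
Implicit Type I : osp e M.

Definition std_space (k : nat) : {vspace 'rV[F]_M} :=
  row_span [pred l : 'I_M | (l < k)%N] 1%:M.

Definition schubert_cell I : set (flag F e M) := [set V |
  forall (i : 'I_m) (k : nat), (k <= M)%N ->
    \dim (V i :&: std_space k) =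
      #|[pred l : 'I_M | (I l <= i)%N && (l < k)%N]|].

Definition schubert_variety I : set (flag F e M) := closure (schubert_cell I).

End schubert.

Section normal.
Context (m : nat) (e : 'I_m -> nat) (M : nat) (I : osp e M).

(* the pairs (c, d) indexing the basis e_c |-> e_d of the normal space of
   Omega_I at E^I, in lexicographic order *)
Definition normal_pairs : seq ('I_M * 'I_M) :=
  [seq p : 'I_M * 'I_M <- [seq (c, d) | c <- enum 'I_M, d <- enum 'I_M] |
    (p.1 < p.2)%N && (I p.1 < I p.2)%N].

Definition codim : nat := size normal_pairs.

(* matrices act on row vectors from the right: delta_mx c d is e_c |-> e_d *)
Definition normal_basis (F : fieldType) (j : 'I_codim) : 'M[F]_M :=
  let p := tnth (in_tuple normal_pairs) j in delta_mx p.1 p.2.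

(* The normal vector of real coordinates x_0, x_1, ... in the oriented real
   basis of the normal space: in the complex case, where the coorientation is
   the complex one, this basis is v_0, i v_0, v_1, i v_1, ... for v_0, v_1, ...
   the complex basis. *)
Definition real_normal (R : realType) (x : nat -> R) : 'M[R]_M :=
  \sum_(j < codim) x j *: normal_basis R j.

Definition complex_normal (R : realType) (x : nat -> R) : 'M[R[i]]_M :=
  \sum_(j < codim) (x j.*2 +i* x j.*2.+1)%C *: normal_basis R[i] j.

End normal.

Section schubert_class.
Context (R : realType) (F : numFieldType) (m : nat) (e : 'I_m -> nat) (M : nat).
Local Notation X := (flag F e M).
Variables (I : osp e M) (k : nat) (N : (nat -> R) -> 'M[F]_M).

(* [s] is the normal slice N |-> (1 + N) E^I of Omega_I at E^I, restricted to
   the simplex of R^k with vertices -(1, ..., 1), b_1, ..., b_k, where b is the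
   standard basis.  These vertices are positively ordered and 0 is interior to
   the simplex. *)
Definition normal_simplex (s : continuousType (stdsimplex R k) X) : Prop :=
  forall t i, s t i = row_span [pred l : 'I_M | (I l <= i)%N]
    (1%:M + N (fun j => set_val t 0 (inord j.+1) - set_val t 0 0)).

(* A class in H^k(X; Q) is the fundamental class of the closed set sigma_I if it
   comes from a class in H^k(X, X \ sigma_I; Q) that restricts to the Thom class
   of the cooriented cell Omega_I, i.e. takes the value 1 on the oriented normal
   slice of Omega_I at E^I (Omega_I being connected, one point is enough).  The
   class in H^k(X, X \ sigma_I; Q) is determined by this condition, because the
   codimension of sigma_I \ Omega_I is more than k. *)
Definition is_schubert_class (x : cohomology R X) : Prop :=
  exists a : cocycle R X, [/\ coclass a = x,
    forall s, sdim s != k -> cocycle_val a s = 0,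
    forall s, (forall t, ~ schubert_variety I (smap s t)) ->
      cocycle_val a s = 0 &
    exists2 s, normal_simplex s & cocycle_val a (Simplex s) = 1].

Definition schubert_class_of : cohomology R X := xget 0 is_schubert_class.

End schubert_class.

Section classes.
Context (R : realType) (m : nat) (e : 'I_m -> nat) (M : nat) (I : osp e M).

Definition real_schubert_class : cohomology R (flag R e M) :=
  schubert_class_of I (codim I) (@real_normal _ _ _ I R).

Definition complex_schubert_class : cohomology R (flag R[i] e M) :=
  schubert_class_of I (codim I).*2 (@complex_normal _ _ _ I R).

End classes.

(* Main.v *)
(** Both rings are computed on Schubert cochains.  Cells are stratified by charts, and for a closed
union of cells the classes supported on it are spanned by the Schubert classes; in the real case the
cells that are not doubled come in pairs joined by a rotation of the plane of two basis vectors, which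
cancels them.  Pulling back to complete flags (with blocks of size one in the complex case and two in
the real case) reduces the structure constants to those of a product on functions on permutations.  In
either case that product is commutative, graded and compatible with the projections forgetting the j-th
member of the flag, and the product of a divisor class with [v], for [v] pulled back along such a
projection, is [v s_j] up to classes pulled back as well.  These properties determine the product, by
divided differences, so the two products agree. *)
From HB Require Import structures.
Require Import Defs.
From mathcomp Require Import all_boot all_order all_algebra.
From mathcomp Require Import fingroup perm complex.
From mathcomp Require Import all_classical all_reals all_analysis.
From mathcomp Require Import ring lra zify.

Set Implicit Arguments.
Unset Strict Implicit.
Unset Printing Implicit Defensive.

Import Order.TTheory GRing.Theory Num.Theory.
Import numFieldNormedType.Exports.
Local Open Scope classical_set_scope.
Local Open Scope quotient_scope.
Local Open Scope ring_scope.

(** No map relates the two flag manifolds, so the two products are compared through properties that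
    pin both down. The twisted Leibniz rule for the divided difference [dj] involves one class
    [alphaj] of degree one. The braid relations, which hold on the Schubert basis whatever the
    product, force the Cartan numbers of these classes; hence [alphaj] is common to both products,
    and an element of positive degree killed by every [dj] is zero. Relative groups are replaced by
    cochains that vanish on open sets; excision, extension and local products all come from one
    theorem on small simplices, [small_exact]. Two parity counts matter: rotation by pi reflects an
    odd number of normal coordinates, because the blocks have even size, so over the rationals the
    cells that are not doubled carry nothing; and doubled cells have even codimension, so no
    obstruction arises in the next degree and cup products commute. Multiplicity one in the divisor
    formula is local: the divisor is translated into transverse position and the normal slice
    becomes a product. *)

Local Notation cob := coboundary.
Local Notation simp := stdsimplex.
Local Notation topT := topologicalType.
Local Notation cts_at t f := {for t, continuous f}.

(** * Cochains on tuples of points: coboundary, homotopies, subdivision, reversal *)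

Section tuples.
Variable V : Type.
Implicit Types (phi psi : seq V -> rat) (u w : seq V) (x y : V).
(** Coning with [x], which is a null-homotopy of the tuple complex ([kap_td]); every homotopy below
    rests on it. *)
Definition kp x phi : seq V -> rat := fun u => phi (x :: u).
(** Coboundary of the augmented complex: the empty tuple is the term of degree -1, so a tuple of
    size n has degree n - 1. The recursion suits the coning arguments; [td_sum] gives the
    alternating sum. *)
Fixpoint td phi u : rat :=
 if u is x :: u' then phi u' - td (kp x phi) u' else 0.
Definition tin (A : set V) u := forall x, List.In x u -> A x.

Lemma tin_cons A x u : tin A (x :: u) <-> A x /\ tin A u.
split=> [h|]; first by split=> [|y yu]; apply: h; [left|right].
by move=> [Ax h] y; case=> [<-//|]; apply: h.
Qed.

Lemma tin_cat A u w : tin A (u ++ w) <-> tin A u /\ tin A w.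
elim: u => [|x u ih] /=; first by split=> [?|[_ ?]] //; split.
by rewrite !tin_cons ih; tauto.
Qed.

Lemma tin_sub A B u : A `<=` B -> tin A u -> tin B u.
by move=> AB h x /h /AB. Qed.
Lemma tdE_cons phi x u : td phi (x :: u) = phi u - td (kp x phi) u.
by []. Qed.

Lemma eq_td phi psi A u : tin A u ->
 (forall w, size u = (size w).+1 -> tin A w -> phi w = psi w) ->
 td phi u = td psi u.
elim: u phi psi => //= x u ih phi psi /tin_cons[Ax Au] e.
rewrite e //; congr (_ - _); apply: ih => // w sw Aw; apply: e => /=.
 by rewrite sw.
by apply/tin_cons.
Qed.

Lemma eq_td_all phi psi u : phi =1 psi -> td phi u = td psi u.
by move=> e; congr td; apply/funext. Qed.

Lemma tdB phi psi u : td (phi \- psi) u = td phi u - td psi u.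
elim: u phi psi => [|x u ih] phi psi /=; first by rewrite subr0.
rewrite [td (kp x _) u](_ : _ = td (kp x phi \- kp x psi) u) // ih; ring.
Qed.

Lemma tdZ c phi u : td (fun w => c * phi w) u = c * td phi u.
elim: u phi => [|x u ih] phi /=; first by rewrite mulr0.
rewrite [td (kp x _) u](_ : _ = td (fun w => c * kp x phi w) u) // ih; ring.
Qed.

Lemma td0 u : td (fun=> 0) u = 0.
by elim: u => //= x u; rewrite /kp => ->; rewrite subr0. Qed.
Lemma td_eq0 phi A u : tin A u ->
 (forall w, size u = (size w).+1 -> tin A w -> phi w = 0) -> td phi u = 0.
by move=> Au h; rewrite (eq_td (psi := fun=> 0) Au h) td0. Qed.
Lemma kap_td x phi : kp x (td phi) = phi \- td (kp x phi).
by apply/funext. Qed.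

Lemma td_td phi u : td (td phi) u = 0.
elim: u phi => //= x u ih phi.
by rewrite kap_td tdB ih subr0 subrr.
Qed.

Lemma td_sum phi u : td phi u =
 \sum_(i < size u) (-1) ^+ i * phi (take i u ++ drop i.+1 u).
elim: u phi => [|x u ih] phi; first by rewrite big_ord0.
rewrite tdE_cons big_ord_recl /= expr0 mul1r drop0; congr (_ + _).
rewrite ih -sumrN; apply: eq_bigr => i _.
by rewrite /bump /= add1n exprS mulN1r mulNr.
Qed.

End tuples.

Lemma td_map V V' (L : V -> V') (phi : seq V' -> rat) u :
 td phi (map L u) = td (fun w => phi (map L w)) u.
elim: u phi => //= x u ih phi; rewrite ih; congr (_ - _).
Qed.

Lemma tin_map V V' (L : V -> V') A u : tin A (map L u) <-> tin (L @^-1` A) u.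
elim: u => [|x u ih] /=; last by rewrite !tin_cons ih.
by split=> _ y [].
Qed.

(* The acyclic-carrier argument: two chain maps [f], [g] of tuple complexes that
 agree on the empty tuple are homotopic; the homotopy is built by recursion on
 the length of the tuple, coning at each step from the point [beta u]. *)
Section homotopy.
Variables (V W : Type) (f g : (seq W -> rat) -> seq V -> rat).
Variable beta : seq V -> W.

Fixpoint thn (n : nat) (phi : seq W -> rat) (u : seq V) : rat :=
 if n is n'.+1 then
 let k := kp (beta u) phi in f k u - g k u - td (thn n' k) u
 else 0.

Definition th phi u := thn (size u) phi u.
Lemma th_nil phi : th phi [::] = 0. Proof. by []. Qed.

Lemma thE phi u : (0 < size u)%N ->
 th phi u = f (kp (beta u) phi) u - g (kp (beta u) phi) u -
 td (th (kp (beta u) phi)) u.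
case: u => // x u _; rewrite /th [size _]/= /thn -/thn; congr (_ - _).
apply: (@eq_td _ _ _ setT) => // w [sw] _; rewrite /th sw //.
Qed.

Hypothesis fB : forall phi psi, f (phi \- psi) = f phi \- f psi.
Hypothesis gB : forall phi psi, g (phi \- psi) = g phi \- g psi.

Lemma thB phi psi u : th (phi \- psi) u = th phi u - th psi u.
have [n] := ubnP (size u); elim: n => // n ih in phi psi u *; rewrite ltnS => sn.
case: (posnP (size u)) => [/size0nil->|un]; first by rewrite !th_nil subr0.
rewrite !thE //.
set x := beta u; have -> : kp x (phi \- psi) = kp x phi \- kp x psi by [].
rewrite fB gB /= (@eq_td _ _ (th (kp x phi) \- th (kp x psi)) setT u) //.
 by rewrite tdB; ring.
by move=> w sw _; rewrite ih //= -sw.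
Qed.

Hypothesis f_td : forall phi, f (td phi) =1 td (f phi).
Hypothesis g_td : forall phi, g (td phi) =1 td (g phi).
Hypothesis fg_nil : forall phi, f phi [::] = g phi [::].

Lemma th_homotopy phi u :
 th (td phi) u + td (th phi) u = f phi u - g phi u.
have [n] := ubnP (size u); elim: n => // n ih in phi u *; rewrite ltnS => sn.
case: (posnP (size u)) => [/size0nil->|un]; first by rewrite fg_nil [RHS]subrr; exact: addr0.
set x := beta u; set k := kp x phi.
have kE : kp x (td phi) = phi \- td k by exact: kap_td.
rewrite thE // -/x kE fB gB /= f_td g_td.
have -> : td (th (phi \- td k)) u = td (th phi) u - td (th (td k)) u.
 rewrite -tdB; congr td; apply/funext => w; exact: thB.
have -> : td (th (td k)) u = td (f k) u - td (g k) u.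
 rewrite -tdB -[RHS]subr0 -(td_td (th k) u) -tdB.
 apply: (@eq_td _ _ _ setT) => // w sw _ /=.
 by rewrite -ih ?addrK // -sw.
by ring.
Qed.

(** The homotopy at [u] only sees values of [phi] on tuples of the carrier [B] with one more entry.
    Vanishing on open sets passes in this way through all the homotopies that follow. *)
Lemma th_eq0 (A : set V) (B : set W) phi u :
 (forall u, tin A u -> (0 < size u)%N -> B (beta u)) ->
 (forall psi u, tin A u -> (forall w, tin B w -> size w = size u -> psi w = 0) ->
 f psi u = 0 /\ g psi u = 0) ->
 tin A u -> (forall w, tin B w -> size w = (size u).+1 -> phi w = 0) ->
 th phi u = 0.
move=> AB loc; have [n] := ubnP (size u).
elim: n => // n ih in phi u *; rewrite ltnS => sn Au phi0.
case: (posnP (size u)) => [/size0nil->//|un]; rewrite thE //.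
set k := kp _ _; have k0 w : tin B w -> size w = size u -> k w = 0.
 move=> Bw sw; apply: phi0; last by rewrite /= sw.
 by apply/tin_cons; split=> //; apply: AB.
have [-> ->] := loc k _ Au k0; rewrite subrr sub0r (td_eq0 Au) ?oppr0 // => w sw Aw.
by apply: ih => //; rewrite -?sw // => v Bv sv; apply: k0; rewrite ?sv ?sw.
Qed.

End homotopy.

(** Naturality of the homotopy; with [L] a face map it turns tuple homotopies into operators on
    singular cochains. *)
Lemma th_map V W V' W' (f g : (seq W -> rat) -> seq V -> rat)
 (f' g' : (seq W' -> rat) -> seq V' -> rat)
 (beta : seq V -> W) (beta' : seq V' -> W') (L : V -> V') (L' : W -> W') :
 (forall phi u, f' phi (map L u) = f (fun w => phi (map L' w)) u) ->
 (forall phi u, g' phi (map L u) = g (fun w => phi (map L' w)) u) ->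
 (forall u, (0 < size u)%N -> beta' (map L u) = L' (beta u)) ->
 forall phi u, th f' g' beta' phi (map L u) =
 th f g beta (fun w => phi (map L' w)) u.
move=> fL gL bL phi u; have [n] := ubnP (size u).
elim: n => // n ih in phi u *; rewrite ltnS => sn.
case: (posnP (size u)) => [/size0nil->//|un]; rewrite !thE //; last by case: u un {sn}.
rewrite bL // fL gL; set k := kp _ _; congr (_ - _).
rewrite td_map; apply: (@eq_td _ _ _ setT) => // w sw _.
by rewrite ih // -sw.
Qed.

(* [tsd] is the barycentric subdivision, with [bary u] an arbitrary point. *)
Section subdivision.
Variables (V : Type) (bary : seq V -> V).
Fixpoint tsdn (n : nat) (phi : seq V -> rat) (u : seq V) : rat :=
 if n is n'.+1 then td (tsdn n' (kp (bary u) phi)) u else phi [::].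
Definition tsd phi u := tsdn (size u) phi u.

Lemma tsdE phi u : (0 < size u)%N ->
 tsd phi u = td (tsd (kp (bary u) phi)) u.
case: u => // x u _; rewrite /tsd [size _]/= /tsdn -/tsdn.
by apply: (@eq_td _ _ _ setT) => // w [sw] _; rewrite sw.
Qed.

Lemma tsdB phi psi : tsd (phi \- psi) = tsd phi \- tsd psi.
apply/funext => u; have [n] := ubnP (size u).
elim: n => // n ih in phi psi u *; rewrite ltnS => sn.
case: (posnP (size u)) => [/size0nil->//|un]; rewrite /= !tsdE // -tdB.
apply: (@eq_td _ _ _ setT) => // w sw _; rewrite -[RHS]ih //.
by rewrite -sw.
Qed.

Lemma tsd_td phi u : tsd (td phi) u = td (tsd phi) u.
have [n] := ubnP (size u); elim: n => // n ih in phi u *; rewrite ltnS => sn.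
case: (posnP (size u)) => [/size0nil->//|un].
rewrite tsdE // kap_td tsdB tdB; set k := kp _ _.
rewrite [X in _ - X](_ : _ = 0) ?subr0 // -(td_td (tsd k) u).
by apply: (@eq_td _ _ _ setT) => // w sw _; rewrite ih // -sw.
Qed.

Lemma tsd_eq0 (A : set V) phi u :
 (forall u, tin A u -> (0 < size u)%N -> A (bary u)) -> tin A u ->
 (forall w, tin A w -> size w = size u -> phi w = 0) -> tsd phi u = 0.
move=> Ab; have [n] := ubnP (size u).
elim: n => // n ih in phi u *; rewrite ltnS => sn Au phi0.
case: (posnP (size u)) => [/size0nil e|un].
 by rewrite e in Au phi0 *; exact: phi0.
rewrite tsdE // (td_eq0 Au) // => w sw Aw; apply: ih => //; first by rewrite -sw.
move=> w' Aw' sw'; apply: phi0; last by rewrite /= sw'.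
by apply/tin_cons; split=> //; apply: Ab.
Qed.

Definition tsdh := th (fun phi => phi) tsd bary.

Lemma tsdh_homotopy phi u : tsdh (td phi) u + td (tsdh phi) u = phi u - tsd phi u.
apply: th_homotopy => //; first exact: tsdB.
by move=> psi w; rewrite tsd_td.
Qed.

Lemma tsdh_eq0 (A : set V) phi u :
 (forall u, tin A u -> (0 < size u)%N -> A (bary u)) -> tin A u ->
 (forall w, tin A w -> size w = (size u).+1 -> phi w = 0) -> tsdh phi u = 0.
move=> Ab Au phi0; apply: (th_eq0 (A := A) (B := A)) => // psi w Aw psi0.
by rewrite psi0 //; split=> //; apply: tsd_eq0 psi0.
Qed.

End subdivision.

Lemma tsd_map V V' (bary : seq V -> V) (bary' : seq V' -> V') (L : V -> V') :
 (forall u, (0 < size u)%N -> bary' (map L u) = L (bary u)) ->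
 forall phi u, tsd bary' phi (map L u) = tsd bary (fun w => phi (map L w)) u.
move=> bL phi u; have [n] := ubnP (size u).
elim: n => // n ih in phi u *; rewrite ltnS => sn.
case: (posnP (size u)) => [/size0nil->//|un]; rewrite !tsdE //; last by case: u un {sn}.
rewrite bL // td_map; apply: (@eq_td _ _ _ setT) => // w sw _.
by rewrite ih // -sw.
Qed.

Lemma tsdh_map V V' (bary : seq V -> V) (bary' : seq V' -> V') (L : V -> V') :
 (forall u, (0 < size u)%N -> bary' (map L u) = L (bary u)) ->
 forall phi u, tsdh bary' phi (map L u) = tsdh bary (fun w => phi (map L w)) u.
move=> bL; apply: th_map => // phi u; exact: tsd_map.
Qed.

Section reversal.
Variable V : Type.
(** The sign is that of the permutation reversing [size u] letters; it makes [trev] a chain map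
    ([trev_td]). *)
Definition trev (phi : seq V -> rat) (u : seq V) : rat :=
 (-1) ^+ 'C(size u, 2) * phi (rev u).

Lemma td_rev (phi : seq V -> rat) u :
 td phi (rev u) = - (-1) ^+ size u * td (phi \o @rev V) u.
have rcE : forall psi (x : V) w, td psi (rcons w x) =
 td (fun v => psi (rcons v x)) w + (-1) ^+ size w * psi w.
 move=> psi x w; elim: w psi => [|y w ih] psi /=.
 by rewrite /= expr0 mul1r subr0 add0r.
 by rewrite ih exprS /kp; ring.
elim: u phi => [|x u ih] phi; first by rewrite mulr0.
rewrite rev_cons rcE ih size_rev /= exprS.
rewrite (_ : kp x (phi \o @rev V) = (fun v => phi (rcons v x)) \o @rev V); first by rewrite /comp; ring.
by apply/funext => w; rewrite /kp /= rev_cons.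
Qed.

Lemma trev_td phi u : trev (td phi) u = td (trev phi) u.
case: u => [|x u]; first by rewrite /trev mulr0.
rewrite /trev td_rev.
transitivity (td (fun w => (-1) ^+ 'C(size u, 2) * (phi \o @rev V) w) (x :: u)).
 rewrite tdZ [size _]/= exprS mulN1r opprK binS bin1 exprD.
 by rewrite mulrA -[X in X * _]mulrA -expr2 sqrr_sign mulr1.
apply: (@eq_td _ _ _ setT) => // w [->] _ //.
Qed.

End reversal.

(** * Singular cochains evaluated on affine simplices *)

Section cochain_values.
Context (R : realType).
(** A cochain applied to a bare function, so that formulas need not carry continuity proofs; the
    default 0 on discontinuous functions keeps [app] additive in [a]. *)
Definition app (Y : topT) (a : cochain R Y) (p : nat)
 (f : simp R p -> Y) : rat :=
 if pselect (continuous f) is left fc then a (Simplex (mkcts fc)) else 0.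
Definition img_in (Y : topT) (A : set Y) (s : simplex R Y) :=
 forall t, A (smap s t).
(** Relative cochains: for open [A] this condition plays the part of the complex of the pair formed
    by the space and [A]. *)
Definition van (Y : topT) (A : set Y) (a : cochain R Y) :=
 forall s, img_in A s -> a s = 0.

Lemma app_simp (Y : topT) (a : cochain R Y) p
 (c : continuousType (simp R p) Y) (f : simp R p -> Y) :
 c =1 f -> app a f = a (Simplex c).
move=> /funext <-; rewrite /app; case: pselect => [fc|nc].
 by congr (a (Simplex _)); apply/continuousEP.
by case: nc; exact: cts_fun.
Qed.

Lemma app_smap (Y : topT) (a : cochain R Y) (s : simplex R Y) :
 app a (smap s : _ -> _) = a s.
by rewrite (@app_simp _ _ _ (smap s)) //; case: s. Qed.
Lemma eq_app (Y : topT) (a : cochain R Y) p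
 (f g : simp R p -> Y) : f =1 g -> app a f = app a g.
by move=> /funext ->. Qed.
Lemma app_van (Y : topT) (A : set Y) (a : cochain R Y) p
 (f : simp R p -> Y) : van A a -> (forall t, A (f t)) -> app a f = 0.
by move=> a0 Af; rewrite /app; case: pselect => // fc; apply: a0. Qed.
Lemma appB (Y : topT) (a b : cochain R Y) p
 (f : simp R p -> Y) : app (a - b) f = app a f - app b f.
by rewrite /app; case: pselect => // _; rewrite subr0. Qed.

Lemma app_cob (Y : topT) (a : cochain R Y) n
 (f : simp R n.+1 -> Y) : continuous f -> app (cob a) f =
 \sum_(i < n.+2) (-1) ^+ i *
 app a (fun t => f (simplex_map R (fun k : 'I_n.+1 => inord (bump i k)) t)).
move=> fc; rewrite (@app_simp _ _ _ (mkcts fc)) // /cob /=.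
by apply: eq_bigr => i _; congr (_ * _); rewrite /face; exact/esym/app_simp.
Qed.

Lemma app_cob0 (Y : topT) (a : cochain R Y)
 (f : simp R 0 -> Y) : app (cob a) f = 0.
by rewrite /app; case: pselect. Qed.
Definition comb (W : lmodType R) p (u : seq W) (t : 'rV[R]_p.+1) : W :=
 \sum_(i < p.+1) t 0 i *: nth 0 u i.

Lemma comb_push (W : lmodType R) p n (u : seq W) (theta : 'I_p.+1 -> 'I_n.+1)
 (t : 'rV[R]_p.+1) :
 comb u (pushrv theta t) = \sum_(i < p.+1) t 0 i *: nth 0 u (theta i).
rewrite /comb (partition_big theta xpredT) //=; apply: eq_bigr => j _.
by rewrite mxE scaler_suml; apply: eq_bigr => i /eqP ->.
Qed.

Lemma comb_omit (W : lmodType R) n (u : seq W) (i : 'I_n.+2)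
 (t : 'rV[R]_n.+1) : size u = n.+2 ->
 comb u (pushrv (fun k : 'I_n.+1 => inord (bump i k) : 'I_n.+2) t) =
 comb (take i u ++ drop i.+1 u) t.
move=> su; rewrite comb_push; apply: eq_bigr => k _; congr (_ *: _).
have kn := ltn_ord k; have iN := ltn_ord i.
rewrite inordK; last by rewrite ltnS /bump (leq_trans (leq_add (leq_b1 _) (leqnn k))).
rewrite nth_cat size_take su iN nth_drop /bump; case: leqP => ik.
 by congr nth; lia.
by rewrite nth_take.
Qed.

(* [evl a g u] is the value of [a] on the composite of [g] with the affine
 simplex of vertices [u]; the empty tuple has value [0]. *)
Definition evl (W : lmodType R) (Y : topT) (a : cochain R Y)
 (g : W -> Y) (u : seq W) : rat :=
 if u is [::] then 0
 else app a (fun t : simp R (size u).-1 => g (comb u (set_val t))).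

Definition cts_on (W : lmodType R) (Y : topT) (g : W -> Y)
 (K : set W) := forall p (u : seq W), size u = p.+1 -> tin K u ->
 continuous (fun t : simp R p => g (comb u (set_val t))).

Lemma ev_size (W : lmodType R) (Y : topT) (a : cochain R Y)
 (g : W -> Y) (u : seq W) p : size u = p.+1 ->
 evl a g u = app a (fun t : simp R p => g (comb u (set_val t))).
by case: u => // x u [<-]. Qed.

(** Omitting a vertex of an affine simplex is a face map ([comb_omit]), so identities proved for
    [td] become identities for [coboundary]. *)
Lemma td_ev (W : lmodType R) (Y : topT) (a : cochain R Y)
 (g : W -> Y) (K : set W) (u : seq W) : cts_on g K -> tin K u ->
 td (evl a g) u = evl (cob a) g u.
case: u => [//|x [|y u]] gK Ku.
 by rewrite /= subr0 app_cob0.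
have su : size (x :: y :: u) = (size u).+2 by [].
rewrite td_sum (ev_size _ _ su) app_cob; last exact: gK.
rewrite su; apply: eq_bigr => i _; congr (_ * _); rewrite (@ev_size _ _ _ _ _ (size u)).
 by apply: eq_app => t /=; rewrite comb_omit.
by rewrite size_cat size_take size_drop su ltn_ord subSS; have := ltn_ord i; lia.
Qed.

Lemma ev_van (W : lmodType R) (Y : topT) (A : set Y)
 (a : cochain R Y) (g : W -> Y) (u : seq W) : van A a ->
 (forall t : 'rV_(size u).-1.+1, simp R _ t -> A (g (comb u t))) ->
 evl a g u = 0.
move=> a0 Au; case: u Au => // x u Au; apply: app_van a0 _ => t.
by apply: Au; apply/set_mem; case: t.
Qed.

End cochain_values.
Section vertices.
Context (R : realType).
Definition verts q : seq 'rV[R]_q.+1 := [seq delta_mx 0 i | i <- enum 'I_q.+1].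
Lemma size_verts q : size (verts q) = q.+1.
by rewrite size_map size_enum_ord. Qed.
Lemma nth_verts q (i : 'I_q.+1) : nth 0 (verts q) i = delta_mx 0 i.
by rewrite (nth_map i) ?size_enum_ord // nth_ord_enum. Qed.

Lemma comb_verts q (v : 'rV[R]_q.+1) : comb (verts q) v = v.
rewrite /comb; under eq_bigr do rewrite nth_verts.
by apply/esym/row_sum_delta.
Qed.

Lemma simp_delta q (i : 'I_q.+1) : simp R q (delta_mx 0 i).
split=> [j|]; first by rewrite mxE ler0n.
rewrite (bigD1 i) //= mxE !eqxx big1 ?addr0 // => j ji.
by rewrite mxE (negbTE ji) andbF.
Qed.

Lemma tin_verts q : tin (simp R q) (verts q).
move=> x; rewrite /verts; elim: (enum _) => //= i s ih [<-|/ih//].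
exact: simp_delta.
Qed.

Definition spt q (v : 'rV[R]_q.+1) (h : simp R q v) : simp R q :=
 exist (fun v => v \in simp R q) v (mem_set h).

(** A total function, to be composed with affine combinations. Outside the simplex it takes the
    value at the first vertex, so that [ext_img_in] holds for every argument. *)
Definition ext (Y : topT) (s : simplex R Y) :
 'rV[R]_(sdim s).+1 -> Y := fun v =>
 if pselect (simp R (sdim s) v) is left h
 then smap s (spt h)
 else smap s (spt (simp_delta ord0)).

Arguments ext [Y] s _.

Lemma extE (Y : topT) (s : simplex R Y) t : ext s (set_val t) = smap s t.
rewrite /ext; case: pselect => [h|[]]; last by apply/set_mem; case: t.
by congr (smap s _); exact: val_inj.
Qed.

Lemma ext_img_in (Y : topT) (A : set Y) (s : simplex R Y) v :
 img_in A s -> A (ext s v).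
by move=> As; rewrite /ext; case: pselect => *; exact: As. Qed.

Lemma ev_verts (Y : topT) (a : cochain R Y) (s : simplex R Y) :
 evl a (ext s) (verts (sdim s)) = a s.
rewrite (ev_size _ _ (size_verts _)) -[RHS]app_smap; apply: eq_app => t /=.
by rewrite comb_verts extE.
Qed.

Definition convex_set (W : lmodType R) (K : set W) := forall p (u : seq W)
 (t : 'rV[R]_p.+1), size u = p.+1 -> tin K u -> simp R p t -> K (comb u t).

Lemma tin_nth (W : lmodType R) (K : set W) (u : seq W) i :
 tin K u -> (i < size u)%N -> K (nth 0 u i).
elim: u i => // x u ih [|i] /tin_cons[Kx Ku]; first by [].
by rewrite ltnS => /ih; apply.
Qed.

Lemma convex_simp q : convex_set (simp R q).
move=> p u t su Ku [t0 t1]; split=> [i|].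
 rewrite summxE sumr_ge0 // => j _; rewrite mxE mulr_ge0 //.
 by have [] := tin_nth Ku (_ : (j < size u)%N); rewrite ?su.
under eq_bigr do rewrite summxE; rewrite exchange_big /= -t1.
apply: eq_bigr => j _; under eq_bigr do rewrite mxE.
rewrite -mulr_sumr; have ju : (j < size u)%N by rewrite su.
by have [_ ->] := tin_nth Ku ju; rewrite mulr1.
Qed.

End vertices.
Arguments ext [R Y] s _.
Arguments verts : clear implicits.
Section cont.
Context (R : realType).
Lemma setv_cts (W : topT) (A : set W) :
 continuous (set_val : A -> W).
exact: initial_continuous. Qed.

Lemma comb_cts (W : normedModType R) p (u : seq W) :
 continuous (@comb R W p u).
move=> t; rewrite /comb; apply: continuous_big => [|i _]; first exact: add_continuous.
move=> s; apply: cvgZr_tmp; first exact: nbhs_filter.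
exact: (@coord_continuous R 1 p.+1 0 i s).
Qed.

End cont.

Lemma eq_th V W f g beta (A : set V) (B : set W) phi psi :
 (forall phi psi, f (phi \- psi) = f phi \- f psi) ->
 (forall phi psi, g (phi \- psi) = g phi \- g psi) ->
 (forall u, tin A u -> (0 < size u)%N -> B (beta u)) ->
 (forall psi u, tin A u -> (forall w, tin B w -> size w = size u -> psi w = 0) ->
 f psi u = 0 /\ g psi u = 0) ->
 (forall w, tin B w -> phi w = psi w) ->
 forall u, tin A u -> th f g beta phi u = th f g beta psi u.
move=> fB gB AB loc e u Au; apply/eqP; rewrite -subr_eq0 -thB //; apply/eqP.
by apply: (th_eq0 AB loc) => // w Bw _ /=; rewrite e // subrr.
Qed.

Section faces.
Context (R : realType).

Lemma pushrv_linear p n (theta : 'I_p.+1 -> 'I_n.+1) : linear (@pushrv R p n theta).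
move=> c x y; apply/rowP => j; rewrite !mxE mulr_sumr -big_split /=.
by apply: eq_bigr => i _; rewrite !mxE.
Qed.

Lemma pushrv_delta p n (theta : 'I_p.+1 -> 'I_n.+1) i :
 pushrv theta (delta_mx 0 i) = delta_mx 0 (theta i) :> 'rV[R]_n.+1.
apply/rowP => j; rewrite !mxE /= big_mkcond (bigD1 i) //= mxE !eqxx.
rewrite big1 => [|k ki]; last by rewrite mxE (negbTE ki) andbF if_same.
by rewrite addr0 eq_sym; case: eqP.
Qed.

Lemma pushrv_in p n (theta : 'I_p.+1 -> 'I_n.+1) v :
 simp R p v -> simp R n (pushrv theta v).
by move=> h; have /set_mem := pushrv_stdsimplex theta (spt h). Qed.

Lemma comb_linear (W W' : lmodType R) (L : W -> W') p (u : seq W)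
 (t : 'rV[R]_p.+1) : linear L -> comb (map L u) t = L (comb u t).
move=> lL; pose L' : {linear W -> W'} := HB.pack L (GRing.isLinear.Build _ _ _ _ L lL).
rewrite -[L]/(L' : W -> W') /comb linear_sum; apply: eq_bigr => i _; rewrite linearZ /=.
have [iu|ui] := ltnP i (size u); first by rewrite (nth_map 0).
by rewrite (nth_default 0 ui) nth_default ?size_map // -[L 0]/(L' 0) [L' 0]linear0.
Qed.

Lemma map_pushrv_verts n (i : 'I_n.+2) :
 map (pushrv (fun k : 'I_n.+1 => inord (bump i k) : 'I_n.+2)) (verts R n) =
 take i (verts R n.+1) ++ drop i.+1 (verts R n.+1).
have iN := ltn_ord i.
have ss : size (take i (verts R n.+1) ++ drop i.+1 (verts R n.+1)) = n.+1.
 by rewrite size_cat size_take size_drop size_verts iN; lia.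
apply: (@eq_from_nth _ 0) => [|k]; first by rewrite ss size_map size_verts.
rewrite size_map size_verts => kn.
rewrite (nth_map 0) ?size_verts // (nth_verts R (Ordinal kn)) pushrv_delta.
rewrite nth_cat size_take size_verts iN /=.
have bk : (bump i k < n.+2)%N by rewrite ltnS /bump (leq_trans (leq_add (leq_b1 _) (leqnn k))).
have -> : inord (bump i k) = Ordinal bk by apply/val_inj; rewrite /= inordK.
rewrite -nth_verts /= nth_drop /bump; case: leqP => ik; first by congr nth; lia.
by rewrite nth_take.
Qed.

Variable X : topT.

Lemma ext_face (s : simplex R X) n theta (v : 'rV[R]_n.+1) : simp R n v ->
 ext (face n theta s) v =
 ext s (pushrv (fun i : 'I_n.+1 => inord (theta i) : 'I_(sdim s).+1) v).
by move=> h; rewrite -[v]/(set_val (spt h)) extE -[RHS]/(ext s (set_val (simplex_map R _ (spt h)))) extE.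
Qed.

(** Transfer principle: a tuple formula on the vertices of each simplex that is natural for faces
    defines a cochain operator, whose coboundary is computed by [td]. The value on the empty tuple
    enters only for 0-simplices. *)
Lemma cob_op (Phi : forall s : simplex R X, seq 'rV[R]_(sdim s).+1 -> rat) s :
 Phi s [::] = 0 ->
 (forall n theta, Phi (face n theta s) (verts R n) = Phi s (map (pushrv
 (fun i : 'I_n.+1 => inord (theta i) : 'I_(sdim s).+1)) (verts R n))) ->
 cob (fun s => Phi s (verts R (sdim s))) s = td (Phi s) (verts R (sdim s)).
case: s => [[|n] c] /= P0 Pf; rewrite /cob /=.
 rewrite td_sum size_verts big_ord1 expr0 mul1r.
 by rewrite take0 drop_oversize ?size_verts //= P0.
rewrite td_sum size_verts; apply: eq_bigr => i _; congr (_ * _).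
by rewrite Pf /= map_pushrv_verts.
Qed.

Lemma img_in_face (A : set X) n theta (s : simplex R X) : img_in A s -> img_in A (face n theta s).
by move=> As t; apply: As. Qed.

Lemma ev_face (a : cochain R X) n theta (s : simplex R X) w :
 tin (simp R n) w ->
 evl a (ext (face n theta s)) w = evl a (ext s) (map (pushrv
 (fun i : 'I_n.+1 => inord (theta i) : 'I_(sdim s).+1)) w).
case: w => // x w Kw; rewrite (ev_size _ _ (erefl : size (x :: w) = (size w).+1)).
rewrite (@ev_size _ _ _ _ _ _ (size w)) ?size_map //; apply: eq_app => t.
rewrite comb_linear; last exact: pushrv_linear.
apply: ext_face; apply: convex_simp => //; by apply/set_mem; case: t.
Qed.

Lemma spt_continuous (Z : topT) q (f : Z -> simp R q) :
 continuous (set_val \o f) -> continuous f.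
exact: continuous_comp_initial. Qed.

Lemma cts_ext (s : simplex R X) : cts_on (ext s) (simp R (sdim s)).
move=> p u su Ku.
have h (t : simp R p) : simp R (sdim s) (comb u (set_val t)).
 by apply: convex_simp => //; apply/set_mem; case: t.
have -> : (fun t : simp R p => ext s (comb u (set_val t))) =
 smap s \o (fun t => spt (h t)).
 by apply/funext => t /=; rewrite -extE.
have c : continuous (fun t => spt (h t)).
 apply: spt_continuous.
 have -> : set_val \o (fun t => spt (h t)) = @comb R 'rV[R]_(sdim s).+1 p u \o set_val by [].
 move=> t; apply: continuous_comp; first exact: setv_cts.
 exact: comb_cts.
by move=> t; apply: continuous_comp; [exact: c|exact: cts_fun].
Qed.

End faces.

Lemma pair_cts (T U V : topT) (f : T -> U) (g : T -> V) t :
 cts_at t f -> cts_at t g ->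
 cts_at t (fun x => (f x, g x)).
by move=> fc gc; apply: cvg_pair. Qed.

(** * The prism operator of a homotopy *)

Section homotopy_operator.
Context (R : realType) (X Y : topT) (h : X -> R -> Y).
Definition hmap (s : simplex R X) (p : 'rV[R]_(sdim s).+1 * R^o) : Y :=
 h (ext s p.1) p.2.
Definition cyl q : set ('rV[R]_q.+1 * R^o) :=
 [set p | simp R q p.1 /\ 0 <= p.2 <= 1].
Let f1 q (phi : seq ('rV[R]_q.+1 * R^o) -> rat) u := phi [seq (v, 1) | v <- u].
Let f0 q (phi : seq ('rV[R]_q.+1 * R^o) -> rat) u := phi [seq (v, 0) | v <- u].
Let beta q (u : seq 'rV[R]_q.+1) : 'rV[R]_q.+1 * R^o := (head 0 u, 0).
(** Acyclic carriers on the cylinder: [f1] and [f0] place a simplex at heights 1 and 0, and the cone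
    point of a tuple is its first vertex at height 0. No triangulation of the prism has to be
    written down. *)
Definition prism (a : cochain R Y) : cochain R X := fun s =>
 th (@f1 _) (@f0 _) (@beta _) (evl a (@hmap s)) (verts R (sdim s)).

Let loc q (psi : seq ('rV[R]_q.+1 * R^o) -> rat) u :
 tin (simp R q) u ->
 (forall w, tin (@cyl q) w -> size w = size u -> psi w = 0) ->
 f1 psi u = 0 /\ f0 psi u = 0.
move=> Ku psi0; split; (apply: psi0; last by rewrite size_map);
 apply/tin_map; apply: tin_sub Ku => v; by rewrite /cyl /= ?lexx ?ler01.
Qed.

Let beta_cyl q (u : seq 'rV[R]_q.+1) : tin (simp R q) u -> (0 < size u)%N ->
 cyl (beta u).
by case: u => // v u /tin_cons[Kv _] _; split; rewrite //= lexx ler01. Qed.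

Lemma comb_pair (W W' : lmodType R) p (u : seq (W * W')) (t : 'rV[R]_p.+1) :
 comb u t = (comb (map fst u) t, comb (map snd u) t).
have -> : comb (map fst u) t = (comb u t).1 by apply: (comb_linear (L := fst)).
have -> : comb (map snd u) t = (comb u t).2 by apply: (comb_linear (L := snd)).
by case: (comb u t).
Qed.

Lemma convex_cyl q : convex_set (@cyl q).
move=> p u t su Ku Kt; rewrite comb_pair; split=> /=.
 apply: convex_simp => //; first by rewrite size_map.
 by apply/tin_map; apply: tin_sub Ku => v [].
have [t0 t1] := Kt; rewrite /comb; apply/andP; split.
 apply: sumr_ge0 => i _; rewrite (nth_map 0) ?su // mulr_ge0 //.
 have iu : (i < size u)%N by rewrite su.
 by have [_ /andP[]] := tin_nth Ku iu.
rewrite -t1; apply: ler_sum => i _; rewrite (nth_map 0) ?su //.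
rewrite -[leRHS]mulr1 ler_wpM2l //.
have iu : (i < size u)%N by rewrite su.
by have [_ /andP[]] := tin_nth Ku iu.
Qed.

Lemma prism_van (a : cochain R Y) (B : set Y) s : van B a ->
 (forall t (r : R), 0 <= r <= 1 -> B (h (smap s t) r)) -> prism a s = 0.
move=> a0 sB; apply: (th_eq0 (A := simp R (sdim s)) (B := @cyl _)) => //.
- exact: beta_cyl.
- exact: loc.
- exact: tin_verts.
- move=> w Kw _; case: w Kw => // x w Kw; apply: ev_van a0 _ => t Kt.
 have [K1 K2] : cyl (comb (x :: w) t) by apply: convex_cyl.
 by rewrite /hmap -[X in ext s X]/(set_val (spt K1)) extE; apply: sB.
Qed.

Variable A : set X.
Hypothesis h_cts : forall x (r : R), A x -> cts_at (x, r) (fun p => h p.1 p.2).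

Lemma cts_hmap (s : simplex R X) : img_in A s -> cts_on (@hmap s) (@cyl (sdim s)).
move=> As p u su Ku t.
apply: (@continuous_comp _ _ _ (fun t : simp R p =>
 (ext s (comb u (set_val t)).1, (comb u (set_val t)).2)) (fun p => h p.1 p.2)); last first.
 by apply: h_cts; apply: ext_img_in.
apply: pair_cts => /=.
 have e : (fun t : simp R p => ext s (comb u (set_val t)).1) =
 (fun t => ext s (comb (map fst u) (set_val t))).
 by apply/funext => t'; rewrite comb_pair.
 rewrite e; apply: (@cts_ext _ _ s p (map fst u) _ _ t).
 by rewrite size_map.
 by apply/tin_map; apply: tin_sub Ku => v [].
apply: (@continuous_comp _ _ _ set_val (fun v => (@comb R _ p u v).2)).
 exact: setv_cts.
apply: (@continuous_comp _ _ _ (@comb R _ p u) snd); first exact: comb_cts.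
exact: cvg_snd.
Qed.

Lemma prismP (a : cochain R Y) s : img_in A s ->
 prism (cob a) s + cob (prism a) s =
 app a (fun t => h (smap s t) 1) - app a (fun t => h (smap s t) 0).
move=> As.
have As' n theta : img_in A (face n theta s) by apply: img_in_face.
have -> : cob (prism a) s =
 td (th (@f1 _) (@f0 _) (@beta _) (evl a (@hmap s))) (verts R (sdim s)).
 apply: (@cob_op R X (fun s => th (@f1 _) (@f0 _) (@beta _) (evl a (@hmap s)))) => //.
 move=> n theta /=.
 set L := pushrv _; pose L' (p : 'rV[R]_n.+1 * R^o) := (L p.1, p.2).
 rewrite (@th_map _ _ _ _ (@f1 n) (@f0 n) _ _ (@beta n) _ L L').
 - apply: (@eq_th _ _ _ _ _ (simp R n) (@cyl n)) => //.
 + exact: beta_cyl.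
 + exact: loc.
 + case=> // x w Kw; rewrite (ev_size _ _ (erefl : size (x :: w) = (size w).+1)).
 rewrite (@ev_size _ _ _ _ _ _ (size w)) ?size_map //; apply: eq_app => t.
 rewrite comb_linear; last first.
 move=> c y z; rewrite /L' /=; congr pair.
 exact: pushrv_linear.
 rewrite /hmap /=; congr h; apply: ext_face.
 have [] : cyl (comb (x :: w) (set_val t)) by apply: convex_cyl => //; apply/set_mem; case: t.
 by [].
 + exact: tin_verts.
 - by move=> phi u; rewrite /f1 -!map_comp.
 - by move=> phi u; rewrite /f0 -!map_comp.
 - by case.
have -> : prism (cob a) s =
 th (@f1 _) (@f0 _) (@beta _) (td (evl a (@hmap s))) (verts R (sdim s)).
 apply: (@eq_th _ _ _ _ _ (simp R (sdim s)) (@cyl (sdim s))) => //.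
 - exact: beta_cyl.
 - exact: loc.
 - by move=> w Kw; rewrite (td_ev _ (cts_hmap As)).
 - exact: tin_verts.
rewrite th_homotopy //; first last.
- by move=> phi u; rewrite /f0 td_map.
- by move=> phi u; rewrite /f1 td_map.
have sv (r : R^o) : size [seq (v, r) | v <- verts R (sdim s)] = (sdim s).+1.
 by rewrite size_map size_verts.
have e1 (r : R^o) : map fst [seq (v, r) | v <- verts R (sdim s)] = verts R (sdim s).
 by rewrite -map_comp map_id_in.
have e2 (r : R^o) (t : simp R (sdim s)) :
 comb (map snd [seq (v, r) | v <- verts R (sdim s)]) (set_val t) = r.
 rewrite -[RHS]mul1r -(_ : \sum_i set_val t 0 i = 1); last first.
 by have [] : simp R _ (set_val t) by apply/set_mem; case: t.
 rewrite mulr_suml /comb; apply: eq_bigr => i _.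
 by rewrite -map_comp (nth_map 0) ?size_verts.
rewrite /f1 /f0 !(ev_size _ _ (sv _)).
by congr (_ - _); apply: eq_app => t; rewrite /hmap comb_pair /= e1 e2 comb_verts extE.
Qed.

End homotopy_operator.

(** * Barycentric subdivision and small simplices *)

Section mesh.
Context (R : realType) (W : normedModType R).
Implicit Types (u w : seq W) (r : R) (K : set W).
Definition bary u : W := (size u)%:R^-1 *: \sum_(x <- u) x.
Definition dle r u := forall x y, List.In x u -> List.In y u -> `|x - y| <= r.
(** The intersection of the closed balls containing [u]: larger than the convex hull, but enough for
    bounds on distances. *)
Definition chull u : set W :=
 [set y | forall z r, tin [set x | `|x - z| <= r] u -> `|y - z| <= r].

Lemma baryB u z : (0 < size u)%N -> bary u - z = bary [seq x - z | x <- u].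
move=> u0; rewrite /bary size_map big_map sumrB scalerBr; congr (_ - _).
rewrite big_const_seq count_predT iter_addr_0 -[z *+ _]scaler_nat scalerA mulVf ?scale1r //.
by rewrite pnatr_eq0 -lt0n.
Qed.

Lemma norm_bary u r : 0 <= r -> tin [set x | `|x| <= r] u -> `|bary u| <= r.
move=> r0 ur; have [/size0nil ->|u0] := posnP (size u).
 by rewrite /bary big_nil scaler0 normr0.
rewrite /bary normrZ ger0_norm ?invr_ge0 ?ler0n // ler_pdivrMl ?ltr0n //.
elim: u ur {u0} => [|x u ih] /=; first by rewrite big_nil normr0 mul0r.
move=> /tin_cons[xr /ih ur]; rewrite big_cons (le_trans (ler_normD _ _)) //.
by rewrite -nat1r mulrDl mul1r lerD.
Qed.

Lemma bary_chull u : (0 < size u)%N -> chull u (bary u).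
move=> u0 z r ur; rewrite baryB //; apply: norm_bary.
 by case: u u0 ur => // x u _ /tin_cons[/= h _]; exact: le_trans h.
by apply/tin_map.
Qed.

Lemma chull_sub u w : tin [set x | List.In x u] w -> chull w `<=` chull u.
by move=> wu y hy z r ur; apply: hy => x /wu /ur. Qed.
(** The classical factor q / (q + 1) by which subdivision shrinks a q-simplex, [n] being the number
    q + 1 of vertices. *)
Definition shrink n : R := n.-1%:R / n%:R.
Lemma shrink_ge0 n : 0 <= shrink n. Proof. by rewrite divr_ge0 // ler0n. Qed.

Lemma shrink_lt1 n : shrink n < 1.
case: n => [|n]; first by rewrite /shrink mul0r.
by rewrite ltr_pdivrMr ?ltr0n // mul1r ltr_nat.
Qed.

Lemma shrinkS n : shrink n <= shrink n.+1.
case: n => [|n]; first by rewrite /shrink /= mul0r divr_ge0.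
rewrite /shrink /= ler_pdivrMr ?ltr0n // mulrAC ler_pdivlMr ?ltr0n //.
by rewrite -!natrM ler_nat; lia.
Qed.

Lemma dle_bary u r x : 0 <= r -> dle r u -> List.In x u ->
 `|x - bary u| <= shrink (size u) * r.
move=> r0 ur xu; have u0 : (0 < size u)%N by case: u xu {ur}.
rewrite distrC baryB // /bary size_map big_map normrZ ger0_norm ?invr_ge0 ?ler0n //.
rewrite ler_pdivrMl ?ltr0n // /shrink mulrA mulrCA divff ?mulr1; last by rewrite pnatr_eq0 -lt0n.
have {ur} : tin [set y | `|y - x| <= r] u by move=> y yu; apply: ur.
elim: u xu {u0} => // y u ih xyu /tin_cons[yr ur]; rewrite big_cons.
case: xyu => [->|xu].
 rewrite subrr add0r /= {ih}.
 elim: u ur => [|z u ih] /=; first by rewrite big_nil normr0 mul0r.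
 move=> /tin_cons[zr /ih ur]; rewrite big_cons (le_trans (ler_normD _ _)) //.
 by rewrite -nat1r mulrDl mul1r lerD.
rewrite (le_trans (ler_normD _ _)) //= (le_trans (lerD yr (ih xu ur))) //.
by case: u xu {ih ur} => //= z u _; rewrite -nat1r mulrDl mul1r.
Qed.

(** A simplex of the subdivision is the barycentre followed by a simplex of the subdivided boundary.
    The hull condition is carried along because it bounds the distance from the barycentre to the
    later vertices; [shrinkS] covers the distances inside a face. *)
Lemma tsd_mesh K n (phi : seq W -> rat) u r :
 (forall u, tin K u -> (0 < size u)%N -> K (bary u)) -> 0 <= r ->
 size u = n -> tin K u -> dle r u ->
 (forall w, size w = n -> tin K w -> tin (chull u) w -> dle (shrink n * r) w ->
 phi w = 0) -> tsd bary phi u = 0.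
move=> Kb r0; elim: n phi u => [|n ih] phi u su Ku ur phi0.
 have e := size0nil su; rewrite e; apply: phi0; rewrite ?e //.
rewrite tsdE ?su //.
apply: (@td_eq0 _ _ [set x | List.In x u]) => // w; rewrite su => -[sw] wu.
have Kw : tin K w by move=> x /wu /Ku.
apply: ih => //; first by move=> x y /wu xu /wu yu; apply: ur.
move=> v sv Kv hv dv; apply: phi0; rewrite /= ?sv //.
- by apply/tin_cons; split=> //; apply: Kb => //; rewrite su.
- apply/tin_cons; split; first by apply: bary_chull; rewrite su.
 by apply: tin_sub hv; apply: chull_sub.
have hb y : List.In y v -> `|y - bary u| <= shrink n.+1 * r.
 move=> yv; have := chull_sub wu (hv y yv); apply => x xu.
 by rewrite /= -su; apply: dle_bary.
move=> x y [<-|xv] [<-|yv].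
- by rewrite subrr normr0 mulr_ge0 // shrink_ge0.
- by rewrite distrC hb.
- exact: hb.
- by rewrite (le_trans (dv _ _ xv yv)) // ler_wpM2r // shrinkS.
Qed.

Lemma iter_tsd_mesh K n (phi : seq W -> rat) m u r :
 (forall u, tin K u -> (0 < size u)%N -> K (bary u)) -> 0 <= r ->
 size u = n -> tin K u -> dle r u ->
 (forall w, size w = n -> tin K w -> dle (shrink n ^+ m * r) w -> phi w = 0) ->
 iter m (tsd bary) phi u = 0.
move=> Kb r0 + + + phi0; elim: m u r r0 phi0 => [|m ih] u r r0 phi0 su Ku ur.
 by rewrite /= phi0 // expr0 mul1r.
rewrite iterS; apply: (tsd_mesh Kb r0 su) => // w sw Kw _ dw.
apply: (ih _ _ _ _ sw Kw dw); first by rewrite mulr_ge0 // shrink_ge0.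
by move=> v sv Kv dv; apply: phi0; rewrite // exprSr -mulrA.
Qed.

Lemma bary_comb u : (0 < size u)%N ->
 bary u = comb u (const_mx (size u)%:R^-1 : 'rV[R]_(size u).-1.+1).
case: u => // x u _; rewrite /bary /comb scaler_sumr big_tnth /=.
by apply: eq_bigr => i _; rewrite mxE (tnth_nth 0).
Qed.

Lemma convex_bary K : convex_set K ->
 forall u, tin K u -> (0 < size u)%N -> K (bary u).
move=> cK u Ku u0; rewrite bary_comb //; apply: cK => //; first by rewrite prednK.
split=> [i|]; first by rewrite mxE invr_ge0 ler0n.
under eq_bigr do rewrite mxE.
by rewrite sumr_const card_ord prednK // -[LHS]mulr_natr mulVf // pnatr_eq0 -lt0n.
Qed.

End mesh.

Lemma bary_linear (R : realType) (W W' : normedModType R) (L : W -> W') u :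
 linear L -> (0 < size u)%N -> bary (map L u) = L (bary u).
move=> lL u0; rewrite !bary_comb ?size_map // comb_linear //.
Qed.

Section small.
Context (R : realType) (X : topT).
Implicit Types (a b : cochain R X) (s : simplex R X).
Definition sdc a : cochain R X := fun s =>
 tsd (@bary R _) (evl a (ext s)) (verts R (sdim s)).
Definition sdhc a : cochain R X := fun s =>
 tsdh (@bary R _) (evl a (ext s)) (verts R (sdim s)).
Let Kbary q := convex_bary (@convex_simp R q).

Lemma eq_tsd q (phi psi : seq 'rV[R]_q.+1 -> rat) u : tin (simp R q) u ->
 (forall w, tin (simp R q) w -> phi w = psi w) ->
 tsd (@bary R _) phi u = tsd (@bary R _) psi u.
move=> Ku e; apply/eqP; rewrite -subr_eq0.
have <- : tsd (@bary R _) (phi \- psi) u = tsd (@bary R _) phi u - tsd (@bary R _) psi u.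
 by rewrite tsdB.
apply/eqP/(tsd_eq0 (A := simp R q)) => // [|w Kw _ /=]; first exact: Kbary.
by rewrite e // subrr.
Qed.

Lemma eq_tsdh q (phi psi : seq 'rV[R]_q.+1 -> rat) u : tin (simp R q) u ->
 (forall w, tin (simp R q) w -> phi w = psi w) ->
 tsdh (@bary R _) phi u = tsdh (@bary R _) psi u.
move=> Ku e; rewrite /tsdh.
apply: (@eq_th _ _ _ _ _ (simp R q) (simp R q)) => //.
- exact: tsdB.
- exact: Kbary.
- move=> f w Kw f0; split; first exact: f0.
 by apply: tsd_eq0 Kw f0; exact: Kbary.
Qed.

Lemma sdhcP a s : sdhc (cob a) s + cob (sdhc a) s = a s - sdc a s.
have -> : cob (sdhc a) s =
 td (tsdh (@bary R _) (evl a (ext s))) (verts R (sdim s)).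
 apply: (@cob_op R X (fun s => tsdh (@bary R _) (evl a (ext s)))) => //.
 move=> n theta.
 set L := pushrv _; rewrite (@tsdh_map _ _ (@bary R _) _ L); last first.
 by move=> u u0; rewrite bary_linear //; exact: pushrv_linear.
 apply: eq_tsdh; first exact: tin_verts.
 by move=> w Kw; rewrite ev_face.
have -> : sdhc (cob a) s =
 tsdh (@bary R _) (td (evl a (ext s))) (verts R (sdim s)).
 apply: eq_tsdh; first exact: tin_verts.
 by move=> w Kw; rewrite (td_ev _ (@cts_ext _ _ s)).
by rewrite tsdh_homotopy ev_verts.
Qed.

Lemma ev_sdc a s u : tin (simp R (sdim s)) u ->
 evl (sdc a) (ext s) u = tsd (@bary R _) (evl a (ext s)) u.
case: u => // x u Ku; set p := size u.
rewrite (ev_size _ _ (erefl : size (x :: u) = p.+1)).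
have fc := cts_ext (erefl : size (x :: u) = p.+1) Ku.
rewrite (@app_simp _ _ _ _ (mkcts fc)) // /sdc /=.
pose L := @comb R _ p (x :: u).
have lL : linear L.
 move=> c y z; rewrite /L /comb scaler_sumr -big_split /=.
 by apply: eq_bigr => i _; rewrite !mxE scalerDl scalerA.
have mapL : map L (verts R p) = x :: u.
 apply: (@eq_from_nth _ 0) => [|i]; first by rewrite size_map size_verts.
 rewrite size_map size_verts => ip; rewrite (nth_map 0) ?size_verts //.
 rewrite (nth_verts R (Ordinal ip)) /L /comb (bigD1 (Ordinal ip)) //= mxE !eqxx scale1r.
 rewrite big1 ?addr0 // => j ji; by rewrite mxE (negbTE ji) andbF scale0r.
rewrite -[in RHS]mapL (@tsd_map _ _ (@bary R _) _ L); last first.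
 by move=> w w0; rewrite bary_linear.
apply: eq_tsd; first exact: tin_verts.
case=> // y w Kw; rewrite (ev_size _ _ (erefl : size (y :: w) = (size w).+1)).
rewrite (@ev_size _ _ _ _ _ _ (size w)) ?size_map //; apply: eq_app => t.
rewrite comb_linear // .
have Kt : simp R p (comb (y :: w) (set_val t)).
 by apply: convex_simp => //; apply/set_mem; case: t.
by rewrite -[X in ext _ X]/(set_val (spt Kt)) extE.
Qed.

Lemma ev_iter_sdc m a s u : tin (simp R (sdim s)) u ->
 evl (iter m sdc a) (ext s) u = iter m (tsd (@bary R _)) (evl a (ext s)) u.
elim: m u => // m ih u Ku; rewrite !iterS ev_sdc //; exact: eq_tsd.
Qed.

Lemma iter_sdcE m a s :
 iter m sdc a s = iter m (tsd (@bary R _)) (evl a (ext s)) (verts R (sdim s)).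
by rewrite -ev_verts ev_iter_sdc //; exact: tin_verts. Qed.

Lemma sdhc_van A a : van A a -> van A (sdhc a).
move=> a0 s As; apply: (tsdh_eq0 (A := simp R (sdim s)));
 [exact: Kbary|exact: tin_verts|].
by case=> // x w Kw _; apply: ev_van a0 _ => t Kt; apply: ext_img_in.
Qed.

Lemma sdc_van A a : van A a -> van A (sdc a).
move=> a0 s As; apply: (tsd_eq0 (A := simp R (sdim s)));
 [exact: Kbary|exact: tin_verts|].
by case=> // x w Kw _; apply: ev_van a0 _ => t Kt; apply: ext_img_in.
Qed.

Lemma simp_le1 q (v : 'rV[R]_q.+1) : simp R q v -> `|v| <= 1.
move=> [v0 v1]; rewrite {1}/Num.norm /= mx_normrE; apply/bigmax_leP; split=> [|[i j] _ /=]; first exact: ler01.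
rewrite (ord1 i) ger0_norm ?v0 // -v1 (bigD1 j) //= lerDl sumr_ge0 //.
Qed.

Lemma simp_compact q : compact (simp R q).
apply: bounded_closed_compact.
 exists 1; split; first exact: num_real.
 by move=> x x1 v /simp_le1 h; apply: le_trans (ltW x1).
have -> : simp R q = (\bigcap_(i in [set: 'I_q.+1]) [set v : 'rV[R]_q.+1 | 0 <= v 0 i]) `&`
 ((fun v : 'rV[R]_q.+1 => \sum_i v 0 i) @^-1` [set 1]).
 by apply/seteqP; split=> v /= [h1 h2]; split=> // i //=; apply: h1.
apply: closedI.
 apply: closed_bigI => i _.
 apply: (@preimage_closed _ _ (fun v : 'rV[R]_q.+1 => v 0 i) [set x | 0 <= x]).
 by move=> v _; exact: coord_continuous.
 exact: closed_ge.
apply: preimage_closed; last exact: closed_eq.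
move=> v _; apply: continuous_big => [|i _]; first exact: add_continuous.
exact: coord_continuous.
Qed.

(** Compactness of the simplex, used as a near-covering property: a radius that works at [x] works
    for all nearby points, so one radius serves the whole simplex. *)
Lemma lebesgue_number (A1 A2 : set X) s : open A1 -> open A2 -> img_in (A1 `|` A2) s ->
 exists2 r : R, 0 < r & forall w, tin (simp R (sdim s)) w -> dle r w ->
 (0 < size w)%N ->
 (forall p (t : 'rV[R]_p.+1), size w = p.+1 -> simp R p t -> A1 (ext s (comb w t))) \/
 (forall p (t : 'rV[R]_p.+1), size w = p.+1 -> simp R p t -> A2 (ext s (comb w t))).
move=> oA1 oA2 As; pose K := simp R (sdim s).
pose P (r : R) (x : 'rV[R]_(sdim s).+1) :=
 (forall y, K y -> `|y - x| <= r -> A1 (ext s y)) \/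
 (forall y, K y -> `|y - x| <= r -> A2 (ext s y)).
have locP A x : open A -> K x -> A (ext s x) ->
 \forall x' \near x & r \near 0^'+, forall y, K y -> `|y - x'| <= r -> A (ext s y).
 move=> oA Kx Ax.
 have oB : open (smap s @^-1` A).
 by apply: open_comp => // t _; exact: cts_fun.
 have [U oU UE] := oB.
 have Ux : U x.
 suff : (set_val @^-1` U) (spt Kx) by [].
 by rewrite UE /= -extE.
 have /nbhs_ballP[e /= e0 xe] : nbhs x U by apply: open_nbhs_nbhs.
 have e2 : 0 < e / 2 by rewrite divr_gt0.
 exists (ball x (e / 2), [set r | r < e / 2]) => /=.
 split; first exact: nbhsx_ballx.
 exact: nbhs_right_lt.
 move=> [x' r] [/= xx' re] y Ky yx'.
 have Uy : U y.
 apply: xe; rewrite -ball_normE /= in xx' *.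
 rewrite (splitr e) (le_lt_trans (ler_distD x' _ _)) // ltrD //.
 by rewrite distrC (le_lt_trans yx').
 suff : (smap s @^-1` A) (spt Ky) by rewrite /= -extE.
 by rewrite -UE.
have : \forall r \near 0^'+, K `<=` P r.
 have /compact_near_coveringP := simp_compact (q := sdim s); apply => x Kx.
 have [/(locP _ _ oA1 Kx)|/(locP _ _ oA2 Kx)] : (A1 `|` A2) (ext s x).
 - by rewrite -[x]/(set_val (spt Kx)) extE; apply: As.
 - by apply: filterS => -[x' r] /= h; left.
 - by apply: filterS => -[x' r] /= h; right.
move=> h; have : \forall r \near 0^'+, 0 < r /\ K `<=` P r.
 by apply: filterI => //; exact: nbhs_right_gt.
move=> /filter_ex[r [r0 Kr]]; exists r => // -[//|x w] Kw dw _.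
have Kx : K x by have /tin_cons[] := Kw.
have near p (t : 'rV[R]_p.+1) : size (x :: w) = p.+1 -> simp R p t ->
 K (comb (x :: w) t) /\ `|comb (x :: w) t - x| <= r.
 move=> sw [t0 t1]; split; first exact: convex_simp.
 have -> : comb (x :: w) t - x = \sum_i t 0 i *: (nth 0 (x :: w) i - x).
 rewrite /comb -[X in _ - X]scale1r -t1 scaler_suml -sumrB.
 by apply: eq_bigr => i _; rewrite scalerBr.
 rewrite (le_trans (ler_norm_sum _ _ _)) // -[leRHS]mul1r -t1 mulr_suml.
 apply: ler_sum => i _; rewrite normrZ ger0_norm // ler_wpM2l //.
 have iw : (i < size (x :: w))%N by rewrite sw.
 have xxw : tin [set y | `|y - x| <= r] (x :: w).
 by move=> y yw; apply: dw => //; left.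
 exact: (tin_nth xxw iw).
by case: (Kr x Kx) => h'; [left|right] => p t sw Kt;
 have [? ?] := near _ _ sw Kt; apply: h'.
Qed.

Lemma shrink_cvg0 n (r e : R) : 0 < e -> 0 <= r ->
 exists M, forall m, (M <= m)%N -> shrink R n ^+ m * r <= e.
move=> e0 r0; have h : shrink R n ^+ m @[m --> \oo] --> (0 : R).
 by apply: cvg_expr; rewrite ger0_norm ?shrink_ge0 // shrink_lt1.
have {h} : shrink R n ^+ m * r @[m --> \oo] --> (0 : R).
 by rewrite -(mul0r r); apply: cvgM h _; exact: cvg_cst.
move=> /cvgr0Pnorm_le /(_ e e0) [M _ hM]; exists M => m Mm.
by apply: le_trans (hM m Mm); rewrite ler_norm.
Qed.

Lemma iter_sdc_small (A1 A2 : set X) a s : open A1 -> open A2 ->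
 img_in (A1 `|` A2) s -> van A1 a -> van A2 a ->
 exists M, forall m, (M <= m)%N -> iter m sdc a s = 0 /\ sdhc (iter m sdc a) s = 0.
move=> oA1 oA2 As a1 a2; have [r r0 small] := lebesgue_number oA1 oA2 As.
set q := sdim s; pose K := simp R q.
have van_small w : tin K w -> dle r w -> evl a (ext s) w = 0.
 case: w => // x w Kw dw.
 by have [//|h|h] := small _ Kw dw; [apply: ev_van a1 _|apply: ev_van a2 _] => t Kt; apply: h.
have diam w : tin K w -> dle 2 w.
 move=> Kw x y /Kw/simp_le1 x1 /Kw/simp_le1 y1.
 by rewrite (le_trans (ler_normB _ _)) // lerD.
have [M1 hM1] := shrink_cvg0 q.+1 r0 (ler0n R 2).
have [M2 hM2] := shrink_cvg0 q.+2 r0 (ler0n R 2).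
have dleW (x y : R) w : x <= y -> dle x w -> dle y w.
 by move=> xy h u v uw vw; apply: le_trans (h _ _ uw vw) xy.
have iter0 m n w : shrink R n ^+ m * 2 <= r -> size w = n -> tin K w ->
 iter m (tsd (@bary R _)) (evl a (ext s)) w = 0.
 move=> mr sw Kw; apply: (iter_tsd_mesh (Kbary (q := q)) (ler0n R 2) sw Kw (diam _ Kw)).
 by move=> v sv Kv dv; apply: van_small => //; apply: dleW dv.
exists (maxn M1 M2) => m; rewrite geq_max => /andP[/hM1 m1 /hM2 m2]; split.
 by rewrite iter_sdcE; apply: iter0 m1 _ _; [rewrite size_verts|exact: tin_verts].
rewrite /sdhc; apply: (tsdh_eq0 (A := K)); [exact: Kbary|exact: tin_verts|].
move=> w Kw; rewrite size_verts => sw; rewrite ev_iter_sdc //; exact: iter0 m2 sw Kw.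
Qed.

Lemma cob_cob a : cob (cob a) = 0.
apply/funext => -[[|n] c]; first by [].
set s := Simplex c.
have -> : cob (cob a) s = td (td (evl a (ext s))) (verts R n.+1).
 rewrite -[LHS]ev_verts -(td_ev _ (@cts_ext _ _ s)); last exact: tin_verts.
 apply: (eq_td (@tin_verts R n.+1)) => w _ Kw.
 by rewrite (td_ev _ (@cts_ext _ _ s)).
by rewrite td_td.
Qed.

Lemma van_cob A a : van A a -> van A (cob a).
move=> a0 s As; rewrite /cob; case: (sdim s) => // n.
by apply: big1 => i _; rewrite a0 ?mulr0 //; apply: img_in_face.
Qed.

(** On a given simplex of the union some iterated subdivision consists of pieces lying in [A1] or in
    [A2], where [a] vanishes. The subdivision homotopies of all iterates therefore have a finite sum
    on each simplex, and their coboundaries telescope to [a]. *)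
Theorem small_exact (A1 A2 : set X) a : open A1 -> open A2 ->
 van (A1 `|` A2) (cob a) -> van A1 a -> van A2 a ->
 exists b, [/\ van A1 b, van A2 b & forall s, img_in (A1 `|` A2) s -> cob b s = a s].
Proof.
move=> oA1 oA2 ac a1 a2.
pose N s := xget 0%N [set M | forall m, (M <= m)%N ->
 iter m sdc a s = 0 /\ sdhc (iter m sdc a) s = 0].
have NP s : img_in (A1 `|` A2) s -> forall m, (N s <= m)%N ->
 iter m sdc a s = 0 /\ sdhc (iter m sdc a) s = 0.
 move=> As; rewrite /N; case: xgetP => [M _ /= //|h].
 have [M hM] := iter_sdc_small oA1 oA2 As a1 a2.
 by have := h M.
(* The number of terms depends on [s]; beyond [N s] all terms vanish, so any larger bound gives the
   same value. *)
pose b s := \sum_(0 <= m < N s) sdhc (iter m sdc a) s.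
have bE s M : img_in (A1 `|` A2) s -> (N s <= M)%N ->
 b s = \sum_(0 <= m < M) sdhc (iter m sdc a) s.
 move=> As NM; rewrite (big_cat_nat (n := N s)) //= [X in _ = _ + X]big1_seq ?addr0 //.
 by move=> m /=; rewrite mem_index_iota => /andP[/(NP _ As)[_ ->]].
have vansd m A : van A a -> van A (iter m sdc a).
 by move=> h; elim: m => //= m; exact: sdc_van.
have vsum A : van A a -> van A b.
 by move=> h s As; apply: big1 => m _; apply: sdhc_van As; apply: vansd.
exists b; split; [exact: vsum|exact: vsum|] => s As.
(* One bound for [s] and all its faces: there [b] agrees with the fixed finite sum [B], to which
   linearity of the coboundary applies. *)
pose M := (\max_(i < (sdim s).+1) N (face (sdim s).-1 (bump i) s) + N s)%N.
pose B : cochain R X := \sum_(0 <= m < M) sdhc (iter m sdc a).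
have sumE (f : nat -> cochain R X) (r : seq nat) t : (\sum_(m <- r) f m) t = \sum_(m <- r) f m t.
 by elim/big_rec2: _ => // i x y _ <-.
have key n k : sdim s = n.+1 -> (k < n.+2)%N -> (N (face n (bump k) s) <= M)%N.
 move=> E kn; have -> : n = (sdim s).-1 by rewrite E.
 have kN : (k < (sdim s).+1)%N by rewrite E.
 by apply: leq_trans (leq_addr _ _); exact: (leq_bigmax (Ordinal kN)).
have -> : cob b s = cob B s.
 rewrite /cob; case E: (sdim s) => [//|n]; apply: eq_bigr => i _.
 congr (_ * _); rewrite /B sumE; apply: bE; first exact: img_in_face.
 exact: key E (ltn_ord i).
(* The iterates remain cocycles on the union, so the term [sdhc] of their coboundary drops out of
   the homotopy formula. *)
have ac' m : van (A1 `|` A2) (cob (iter m sdc a)).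
 move=> t At; elim: m t At => [|m ih] t At; first exact: ac.
 have e : iter m.+1 sdc a = iter m sdc a - sdhc (cob (iter m sdc a)) -
 cob (sdhc (iter m sdc a)).
 apply/funext => t'; rewrite iterS.
 have h := sdhcP (iter m sdc a) t'.
 rewrite -[RHS]/(iter m sdc a t' - sdhc (cob (iter m sdc a)) t' -
 cob (sdhc (iter m sdc a)) t').
 by rewrite -addrA -opprD h opprB addrC subrK.
 rewrite e !linearB /= cob_cob subr0.
 rewrite -[LHS]/(cob (iter m sdc a) t - cob (sdhc (cob (iter m sdc a))) t).
 rewrite ih // sub0r; apply/eqP; rewrite oppr_eq0; apply/eqP.
 exact: van_cob (sdhc_van ih) _ At.
have -> : cob B s = \sum_(0 <= m < M) cob (sdhc (iter m sdc a)) s.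
 by rewrite /B linear_sum sumE.
have -> : \sum_(0 <= m < M) cob (sdhc (iter m sdc a)) s =
 \sum_(0 <= m < M) (iter m sdc a s - iter m.+1 sdc a s).
 apply: eq_bigr => m _; rewrite iterS -sdhcP.
 by rewrite (sdhc_van (ac' m)) // add0r.
rewrite -(opprK (\sum_(0 <= m < M) _)) -sumrN; under eq_bigr do rewrite opprB.
rewrite telescope_sumr // opprB.
by have [-> _] := NP s As M (leq_addl _ _); rewrite subr0.
Qed.

End small.

(** * Relative cocycles, excision and retraction *)

Section relative.
Context (R : realType).
Section one_space.
Variable X : topT.
Implicit Types (a b : cochain R X) (s : simplex R X) (A U V N : set X).
Definition coc A a := van A (cob a).
Lemma vanD A a b : van A a -> van A b -> van A (a + b).
by move=> ha hb s As; rewrite -[LHS]/(a s + b s) ha ?hb ?addr0. Qed.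
Lemma vanN A a : van A a -> van A (- a).
by move=> ha s As; rewrite -[LHS]/(- a s) ha ?oppr0. Qed.
Lemma vanB A a b : van A a -> van A b -> van A (a - b).
by move=> ha hb; apply: vanD => //; apply: vanN. Qed.
Lemma vanZ A (c : rat) a : van A a -> van A (c *: a).
by move=> ha s As; rewrite -[LHS]/(c * a s) ha ?mulr0. Qed.
Lemma van_sub A B a : A `<=` B -> van B a -> van A a.
by move=> AB h s As; apply: h => t; apply: AB. Qed.

Lemma eq_cob A a b s : (forall s, img_in A s -> a s = b s) -> img_in A s ->
 cob a s = cob b s.
move=> e As; apply/eqP; rewrite -subr_eq0; apply/eqP.
rewrite -[LHS]/((cob a - cob b) s) -linearB.
apply: van_cob As => s' As'.
by rewrite -[LHS]/(a s' - b s') e // subrr.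
Qed.

(** Restriction to [A] followed by extension by zero. Since cochains are arbitrary functions this
    always makes sense; the price is that a cocycle on [A] need not stay a cocycle elsewhere. *)
Definition cut A a : cochain R X := fun s => if `[< img_in A s >] then a s else 0.
Lemma cutE A a s : img_in A s -> cut A a s = a s.
by move=> As; rewrite /cut asboolT. Qed.

Lemma van_cut N A a : van (N `&` A) a -> van A (cut N a).
move=> h s As; rewrite /cut; case: asboolP => // Ns; apply: h => t; split;
 [exact: Ns|exact: As].
Qed.

Definition hdeg i a := forall s, sdim s <> i -> a s = 0.
Definition trunc i a : cochain R X := fun s => if sdim s == i then a s else 0.
Lemma hdeg_trunc i a : hdeg i (trunc i a).
by move=> s /eqP/negbTE; rewrite /trunc => ->. Qed.
Lemma trunc_id i a : hdeg i a -> trunc i a = a.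
by move=> ha; apply/funext => s; rewrite /trunc; case: eqP => // /ha ->.
Qed.
Lemma van_trunc A i a : van A a -> van A (trunc i a).
by move=> h s As; rewrite /trunc h // if_same. Qed.

Lemma cob_trunc i a : cob (trunc i a) = trunc i.+1 (cob a).
apply/funext => s; rewrite /trunc /cob; case: (sdim s) => [|n] //.
rewrite eqSS; case: ifP => // ni; by apply: big1 => j _ /=; rewrite mulr0.
Qed.

Lemma hdeg_cob i a : hdeg i a -> hdeg i.+1 (cob a).
by move=> /trunc_id <-; rewrite cob_trunc; exact: hdeg_trunc. Qed.
Lemma hdegB i a b : hdeg i a -> hdeg i b -> hdeg i (a - b).
by move=> ha hb s si; rewrite -[LHS]/(a s - b s) ha ?hb ?subr0. Qed.
Lemma hdegZ i (c : rat) a : hdeg i a -> hdeg i (c *: a).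
by move=> ha s si; rewrite -[LHS]/(c * a s) ha ?mulr0. Qed.

Lemma exact_trunc U V i a b : hdeg i.+1 a -> van V b ->
 (forall s, img_in U s -> cob b s = a s) ->
 [/\ hdeg i (trunc i b), van V (trunc i b) &
 forall s, img_in U s -> cob (trunc i b) s = a s].
move=> ha bV bU; split; [exact: hdeg_trunc|exact: van_trunc|] => s Us.
by rewrite cob_trunc -(trunc_id ha) /trunc bU.
Qed.

(** Injectivity of excision. Cutting [b] off at [N] gives a cochain whose coboundary agrees with [a]
    on [N]; the difference vanishes on [N] and on [V], and [small_exact] absorbs it. *)
Lemma excise U V N a b : open U -> open V -> open N -> V `<=` U -> N `<=` U ->
 U `<=` N `|` V -> coc U a -> van V a -> van (N `&` V) b ->
 (forall s, img_in N s -> cob b s = a s) ->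
 exists2 b', van V b' & forall s, img_in U s -> cob b' s = a s.
move=> oU oV oN VU NU UNV aU aV bNV bN; set c := cut N b.
have UE : N `|` V = U.
 by apply/seteqP; split=> // x [/NU|/VU].
have cV : van V c by exact: van_cut.
have cN s : img_in N s -> cob c s = a s.
 by move=> Ns; rewrite -bN //; apply: eq_cob Ns => s' Ns'; rewrite /c cutE.
have [e [eN eV eU]] : exists e, [/\ van N e, van V e & forall s, img_in (N `|` V) s ->
 cob e s = (a - cob c) s].
 apply: small_exact => //.
 - by rewrite UE linearB /= cob_cob subr0.
 - by move=> s Ns; rewrite -[LHS]/(a s - cob c s) cN // subrr.
 - by apply: vanB => //; exact: van_cob.
exists (c + e); first exact: vanD.
move=> s Us; rewrite linearD -[LHS]/(cob c s + cob e s) eU ?UE //.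
by rewrite -[X in _ + X]/(a s - cob c s) addrC subrK.
Qed.

(** Surjectivity of excision: the coboundary of the cut cochain vanishes on [N] and on [V]
    separately, and [small_exact] corrects it without changing values on [N]. *)
Lemma extend U V N a : open U -> open V -> open N -> V `<=` U -> N `<=` U ->
 U `<=` N `|` V -> coc N a -> van (N `&` V) a ->
 exists a', [/\ coc U a', van V a' & forall s, img_in N s -> a' s = a s].
move=> oU oV oN VU NU UNV aN aNV; set c := cut N a.
have UE : N `|` V = U by apply/seteqP; split=> // x [/NU|/VU].
have cV : van V c by exact: van_cut.
have [e [eN eV eU]] : exists e, [/\ van N e, van V e & forall s, img_in (N `|` V) s ->
 cob e s = cob c s].
 apply: small_exact => //.
 - by move=> s _; rewrite cob_cob.
 - move=> s Ns; rewrite -(aN s Ns).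
 by apply: eq_cob Ns => s' Ns'; rewrite /c cutE.
 - exact: van_cob.
exists (c - e); split; last 1 first.
- by move=> s Ns; rewrite -[LHS]/(c s - e s) /c cutE // eN // subr0.
- move=> s Us; rewrite linearB -[LHS]/(cob c s - cob e s).
 by rewrite eU ?UE // subrr.
- exact: vanB.
Qed.

Lemma app_homotopy U V a k (h : simp R k -> R -> X) :
 (forall t r, cts_at (t, r) (fun p => h p.1 p.2)) ->
 (forall t r, 0 <= r <= 1 -> U (h t r)) ->
 (forall (t : simp R k) (r : R) i, 0 <= r <= 1 -> set_val t 0 i = 0 -> V (h t r)) ->
 coc U a -> van V a -> app a (h^~ 1) = app a (h^~ 0).
move=> hc hU hV aU aV.
have idc : continuous (fun t : simp R k => t) by move=> t; exact: cvg_id.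
pose s := @Simplex R (simp R k : topT) k (mkcts idc).
have := @prismP R (simp R k : topT) X h setT (fun x r _ => hc x r) a s (fun _ => I).
rewrite (prism_van aU) ?add0r; last by move=> t r r01; apply: hU.
rewrite (_ : cob (prism h a) s = 0).
 by move/esym/eqP; rewrite subr_eq0 => /eqP.
rewrite /cob /= /s; clear s; case: k h hc hU hV idc => // n h hc hU hV idc.
apply: big1 => i _; rewrite (prism_van aV) ?mulr0 // => t r r01.
apply: (hV _ _ i) => //=; rewrite mxE big1 // => j /eqP/(congr1 val) /=.
have jn := ltn_ord j; rewrite inordK; last by rewrite ltnS /bump (leq_trans (leq_add (leq_b1 _) (leqnn j))).
by move=> e; have := neq_bump i j; rewrite e eqxx.
Qed.

End one_space.
Section pullback.
Variables (X Y : topT) (f : X -> Y).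
Definition pb (a : cochain R Y) : cochain R X := fun s => app a (fun t => f (smap s t)).

Lemma cts_comp_img (A : set X) (s : simplex R X) :
 (forall x, A x -> cts_at x f) -> img_in A s ->
 continuous (fun t => f (smap s t)).
move=> fc As t; apply: (@continuous_comp _ _ _ (smap s) f); last exact: fc.
exact: cts_fun.
Qed.

Lemma pb_cob (A : set X) a s : (forall x, A x -> cts_at x f) ->
 img_in A s -> cob (pb a) s = pb (cob a) s.
move=> fc As; have sc := cts_comp_img fc As.
rewrite /pb; case: s As sc => -[|n] c As sc.
 by rewrite app_cob0.
by rewrite app_cob.
Qed.

Lemma pb_app (a : cochain R Y) k (g : simp R k -> X) : continuous g ->
 app (pb a) g = app a (fun t => f (g t)).
by move=> gc; rewrite (@app_simp _ _ _ _ (mkcts gc)). Qed.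
Lemma pb_van (A : set X) (B : set Y) a : (forall x, A x -> B (f x)) -> van B a ->
 van A (pb a).
by move=> AB aB s As; apply: app_van aB _ => t; apply: AB; apply: As. Qed.
Lemma pb_hdeg i a : hdeg i a -> hdeg i (pb a).
move=> ha s si; rewrite /pb /app; case: pselect => // fc; exact: ha.
Qed.
Lemma pbB a b : pb (a - b) = pb a - pb b.
by apply/funext => s; rewrite /pb appB. Qed.

Lemma pb_coc (A : set X) (B : set Y) a : (forall x, A x -> cts_at x f) ->
 (forall x, A x -> B (f x)) -> coc B a -> coc A (pb a).
by move=> fc AB aB s As; rewrite (pb_cob _ fc As); apply: pb_van aB _ As.
Qed.

End pullback.

(** Pull the primitive on the slice [E] back along [y] and correct it by the prism of the
    retraction; both terms vanish on [V] because the retraction preserves [V] and [y] maps [V] into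
    [E']. *)
Lemma retract_exact (X E : topT) (N V : set X) (E' : set E)
 (y : X -> E) (sg : E -> X) (h : X -> R -> X) (a : cochain R X) (b : cochain R E) :
 (forall x (r : R), N x -> cts_at (x, r) (fun p => h p.1 p.2)) ->
 (forall x, N x -> cts_at x y) ->
 (forall x, N x -> h x 0 = x) -> (forall x, N x -> h x 1 = sg (y x)) ->
 (forall x r, 0 <= r <= 1 -> N x -> N (h x r)) ->
 (forall x r, 0 <= r <= 1 -> V x -> V (h x r)) ->
 (forall x, V x -> E' (y x)) ->
 coc N a -> van V a -> van E' b -> (forall s, cob b s = pb sg a s) ->
 exists2 b', van V b' & forall s, img_in N s -> cob b' s = a s.
move=> hc yc h0 h1 hN hV yV aN aV bE bE'.
exists (pb y b - prism h a).
 apply: vanB; first exact: pb_van bE.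
 by move=> s Vs; apply: prism_van aV _ => t r r01; apply: hV.
move=> s Ns; rewrite linearB -[LHS]/(cob (pb y b) s - cob (prism h a) s).
have := prismP hc a Ns.
rewrite (prism_van aN); last by move=> t r r01; apply: hN.
rewrite add0r => ->.
rewrite (pb_cob _ yc Ns) {1}/pb.
have -> : app (cob b) (fun t => y (smap s t)) = app a (fun t => h (smap s t) 1).
 have -> : cob b = pb sg a by apply/funext.
 rewrite (@pb_app _ _ _ _ _ (fun t => y (smap s t))); last exact: cts_comp_img yc Ns.
 by apply: eq_app => t; rewrite h1.
rewrite (@eq_app _ _ _ _ (fun t => h (smap s t) 0) (smap s)) => [|t]; last by rewrite h0.
by rewrite app_smap opprB addrC subrK.
Qed.

End relative.

Lemma mx_cts (K : numFieldType) (T : topT) m n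
 (f : T -> 'M[K]_(m, n)) t :
 (forall i j, cts_at t (fun x => f x i j)) -> cts_at t f.
move=> fc A [B tB BA].
have tBs : \forall s \near t, forall i j, B i j (f s i j).
 apply: (@filter_forall _ _ (fun i s => forall j, B i j (f s i j))
 (nbhs t) (nbhs_filter t)) => i.
 apply: (@filter_forall _ _ (fun j s => B i j (f s i j))
 (nbhs t) (nbhs_filter t)) => j.
 exact/fc/tB.
by apply: filterS tBs => s sB; apply: BA.
Qed.

Lemma coord_cts (K : numFieldType) (T : topT) m n
 (f : T -> 'M[K]_(m, n)) t i j :
 cts_at t f -> cts_at t (fun x => f x i j).
move=> fc; apply: (@continuous_comp _ _ _ f (fun M : 'M[K]_(m, n) => M i j)) => //.
exact: coord_continuous.
Qed.

Section arith_cts.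
Variables (K : numFieldType) (T : topT) (f g : T -> K^o) (t : T).
Lemma addf_cts : cts_at t f -> cts_at t g ->
 cts_at t (fun x => f x + g x).
by move=> fc gc; apply: (@cvgD K K^o). Qed.
Lemma oppf_cts : cts_at t f -> cts_at t (fun x => - f x).
by move=> fc; apply: (@cvgN K K^o). Qed.
Lemma subf_cts : cts_at t f -> cts_at t g ->
 cts_at t (fun x => f x - g x).
by move=> fc gc; apply: (@cvgB K K^o). Qed.
Lemma mulf_cts : cts_at t f -> cts_at t g ->
 cts_at t (fun x => f x * g x).
by move=> fc gc; apply: (@cvgM K). Qed.
Lemma cstf_cts (c : K^o) : cts_at t (fun=> c : K^o).
exact: cvg_cst. Qed.
End arith_cts.
Lemma stdP (R : realType) k (t : simp R k) : simp R k (set_val t).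
by apply/set_mem; case: t. Qed.

(** * Cohomology of Euclidean space relative to the complement of the origin *)

Section local.
Context (R : realType).
(** Affine coordinates on the simplex with vertices -(1, ..., 1), b_1, ..., b_c that normalises the
    Schubert classes. Only the barycentre goes to the origin, so the boundary avoids it
    ([simp_eq_gt0]). *)
Definition vsimp c (t : 'rV[R]_c.+1) : 'rV[R]_c := \row_j (t 0 (lift ord0 j) - t 0 0).
Definition vproj c (v : 'rV[R]_c.+1) : 'rV[R]_c := \row_j v 0 (lift ord_max j).
Definition vlift c (w : 'rV[R]_c) (z : R) : 'rV[R]_c.+1 :=
 \row_j (if unlift ord_max j is Some k then w 0 k else z).
Lemma vproj_lift c w z : vproj (@vlift c w z) = w.
by apply/rowP => j; rewrite !mxE liftK. Qed.
Lemma vlift_max c w z : @vlift c w z 0 ord_max = z.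
by rewrite mxE unlift_none. Qed.
Lemma vlift_proj c (v : 'rV[R]_c.+1) : vlift (vproj v) (v 0 ord_max) = v.
by apply/rowP => j; rewrite !mxE; case: unliftP => [k ->|->]; rewrite ?mxE.
Qed.

Lemma vlift_eq0 c w z : (@vlift c w z == 0) = (w == 0) && (z == 0).
apply/eqP/andP => [e|[/eqP -> /eqP ->]].
 split; apply/eqP; first by rewrite -(vproj_lift w z) e; apply/rowP => j; rewrite !mxE.
 by rewrite -(vlift_max w z) e mxE.
by apply/rowP => j; rewrite !mxE; case: unliftP => //= k; rewrite mxE.
Qed.

Lemma vlift_cts (T : topT) c (f : T -> 'rV[R]_c) (g : T -> R) t :
 cts_at t f -> cts_at t g ->
 cts_at t (fun x => vlift (f x) (g x)).
move=> fc gc; apply: mx_cts => i j.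
have -> : (fun x => vlift (f x) (g x) i j) =
 (fun x => if unlift ord_max j is Some k then f x 0 k else g x).
 by apply/funext => x; rewrite mxE.
by case: unlift => [k|] //; exact: coord_cts.
Qed.

Lemma vproj_cts c : continuous (@vproj c).
move=> v; apply: mx_cts => i j.
have -> : (fun x => @vproj c x i j) = (fun x => x 0 (lift ord_max j)).
 by apply/funext => x; rewrite mxE.
exact: coord_continuous.
Qed.

Lemma vsimp_cts c : continuous (@vsimp c).
move=> v; apply: mx_cts => i j.
have -> : (fun x => @vsimp c x i j) = (fun x => x 0 (lift ord0 j) - x 0 0).
 by apply/funext => x; rewrite mxE.
by apply: subf_cts; exact: coord_continuous.
Qed.

Lemma vsimp_face c (t : 'rV[R]_c.+1) :
 vsimp (pushrv (fun k : 'I_c.+1 => inord (bump c.+1 k) : 'I_c.+2) t) =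
 vlift (vsimp t) (- t 0 0).
have pE (k : 'I_c.+2) : pushrv (fun k : 'I_c.+1 => inord (bump c.+1 k) : 'I_c.+2) t 0 k =
 if unlift ord_max k is Some l then t 0 l else 0.
 rewrite mxE; case: unliftP => [l ->|->].
 rewrite (big_pred1 l) // => i /=; have iN := ltn_ord i.
 rewrite -val_eqE /= /bump leqNgt iN add0n inordK //; last exact: ltnW.
 by rewrite leqNgt ltn_ord add0n -val_eqE.
 apply: big_pred0 => i; have iN := ltn_ord i.
 by rewrite -val_eqE /= /bump leqNgt iN add0n inordK ?ltn_eqF //; exact: ltnW.
move: (pushrv _ t) pE => p pE.
apply/rowP => j; rewrite !mxE !pE.
have e0 : (0 : 'I_c.+2) = lift ord_max 0 by apply/val_inj.
rewrite e0 liftK; case: (unliftP ord_max j) => [l ->|->].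
 have -> : lift ord0 (lift ord_max l) = lift ord_max (lift ord0 l).
 by apply/val_inj; rewrite /= /bump /=; have := ltn_ord l; lia.
 by rewrite liftK mxE.
have -> : lift ord0 ord_max = ord_max :> 'I_c.+2 by apply/val_inj.
by rewrite unlift_none sub0r.
Qed.

Lemma vsimp_eq0 c (t : 'rV[R]_c.+1) i j : vsimp t = 0 -> t 0 i = t 0 j.
move=> /rowP e; have h k : t 0 k = t 0 0.
 by case: (unliftP ord0 k) => [l ->|->//]; have := e l; rewrite !mxE => /subr0_eq.
by rewrite !h.
Qed.

Lemma simp_eq_gt0 c (t : 'rV[R]_c.+1) : simp R c t -> vsimp t = 0 ->
 forall i, 0 < t 0 i.
move=> [t0 t1] e i; rewrite lt_neqAle t0 andbT eq_sym; apply/eqP => ti.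
suff : \sum_i t 0 i = 0 by rewrite t1 => /eqP; rewrite oner_eq0.
by apply: big1 => j _; rewrite (vsimp_eq0 j i e).
Qed.

Definition evalv c (a : cochain R 'rV[R]_c) : rat :=
 app a (fun t : simp R c => vsimp (set_val t)).
Definition nz c : set 'rV[R]_c := [set v | v != 0].
(** The complement of the closed half-line pointing down. Together with the lower half-space it
    covers the punctured space, and their intersection retracts onto a punctured hyperplane: the
    geometry of the suspension. *)
Definition upper c : set 'rV[R]_c.+1 := [set v | vproj v != 0 \/ 0 < v 0 ord_max].
Definition lowerh c : set 'rV[R]_c.+1 := [set v | v 0 ord_max < 0].

Lemma nz_open c : open (@nz c).
have -> : @nz c = ~` [set 0] by apply/seteqP; split=> v /eqP.
by rewrite openC; apply: accessible_closed_set1; exact: hausdorff_accessible.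
Qed.

Lemma lower_open c : open (@lowerh c).
apply: (@open_comp _ _ (fun v : 'rV[R]_c.+1 => v 0 ord_max) [set x | x < 0]).
 by move=> v _; exact: coord_continuous.
exact: open_lt.
Qed.

Lemma upper_open c : open (@upper c).
have -> : @upper c = (@vproj c @^-1` @nz c) `|` [set v | 0 < v 0 ord_max] by [].
apply: openU.
 by apply: open_comp; [move=> v _; exact: vproj_cts|exact: nz_open].
apply: (@open_comp _ _ (fun v : 'rV[R]_c.+1 => v 0 ord_max) [set x | 0 < x]).
 by move=> v _; exact: coord_continuous.
exact: open_gt.
Qed.

Lemma upper_nz c : @upper c `<=` @nz c.+1.
move=> v uv; apply/eqP => v0; case: uv; rewrite v0.
 by case/eqP; apply/rowP => j; rewrite !mxE.
by rewrite mxE ltxx.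
Qed.

Lemma lower_nz c : @lowerh c `<=` @nz c.+1.
by move=> v lv; apply/eqP => v0; move: lv; rewrite v0 /lowerh /= mxE ltxx. Qed.

Lemma nz_cover c : @nz c.+1 `<=` @lowerh c `|` @upper c.
move=> v nv; case: (eqVneq (vproj v) 0) => [p0|]; last by right; left.
case: (ltgtP (v 0 ord_max) 0) => [|h|m0]; [by left|by right; right|].
by move: nv; rewrite /nz /= -(vlift_proj v) p0 m0 vlift_eq0 !eqxx.
Qed.

(** The suspension isomorphism with its sign: all faces of the simplex lie in [upper] except the one
    omitting the last vertex, which is pushed down to height -1. *)
Lemma evalv_cob c (b : cochain R 'rV[R]_c.+1) :
 coc (@nz c.+1) b -> van (@upper c) b ->
 evalv (cob b) = (-1) ^+ c.+1 *
 app b (fun t : simp R c => vlift (vsimp (set_val t)) (-1)).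
move=> bc bu; rewrite /evalv app_cob; last first.
 by move=> t; apply: continuous_comp; [exact: setv_cts|exact: vsimp_cts].
rewrite big_ord_recr /= big1 ?add0r => [|i _].
 set A := app b _; set B := app b _; suff -> : A = B by [].
 (* The face has last coordinate minus [set_val t 0 0] ([vsimp_face]); the homotopy moves this
    linearly to -1 and leaves the other coordinates alone. *)
 rewrite {}/A {}/B; pose h (t : simp R c) (r : R) := vlift (vsimp (set_val t))
 (- ((1 - r) * set_val t 0 0 + r)).
 have h0 t : h t 0 = vsimp (set_val (simplex_map R (fun k : 'I_c.+1 =>
 inord (bump c.+1 k) : 'I_c.+2) t)).
 by rewrite /= vsimp_face /h subr0 mul1r addr0.
 have h1 t : h t 1 = vlift (vsimp (set_val t)) (-1).
 by rewrite /h subrr mul0r add0r.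
 rewrite -(eq_app _ h0) -(eq_app _ h1); apply/esym.
 apply: (@app_homotopy R _ (@nz c.+1) (@upper c)) => //.
 - move=> t r; have vc : cts_at (t, r) (fun p : simp R c * R => set_val p.1).
 apply: (@continuous_comp _ _ _ fst (set_val : simp R c -> _)).
 exact: cvg_fst.
 exact: setv_cts.
 apply: vlift_cts.
 apply: (@continuous_comp _ _ _ (fun p : simp R c * R => set_val p.1) (@vsimp c)) => //.
 exact: vsimp_cts.
 apply: oppf_cts; apply: addf_cts; last exact: cvg_snd.
 apply: mulf_cts; last exact: coord_cts vc.
 by apply: subf_cts; [exact: cvg_cst|exact: cvg_snd].
 - move=> t r /andP[r0 r1]; rewrite /nz /= /h vlift_eq0; apply/negP => /andP[/eqP e].
 have tS := stdP t.
 have t0 := simp_eq_gt0 tS e 0; rewrite oppr_eq0 gt_eqF //.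
 case: (eqVneq r 1) => [->|r1']; first by rewrite subrr mul0r add0r.
 by rewrite ltr_wpDr // mulr_gt0 // subr_gt0 lt_neqAle r1'.
 - move=> t r i _ ti; left; rewrite vproj_lift; apply/eqP => e.
 have tS := stdP t.
 by have := simp_eq_gt0 tS e i; rewrite ti ltxx.
rewrite [X in _ * X](_ : _ = 0) ?mulr0 //; apply: app_van bu _ => t.
rewrite -[set_val _]/(pushrv (fun k : 'I_c.+1 => inord (bump i k) : 'I_c.+2) (set_val t)).
have : pushrv (fun k : 'I_c.+1 => inord (bump i k) : 'I_c.+2) (set_val t) 0
 (widen_ord (leqnSn _) i) = 0.
 rewrite mxE big1 // => j /eqP/(congr1 val) /=.
 have jn := ltn_ord j; rewrite inordK; last by rewrite ltnS /bump (leq_trans (leq_add (leq_b1 _) (leqnn j))).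
 by move=> e; have := neq_bump i j; rewrite e eqxx.
have : simp R c.+1 (pushrv (fun k : 'I_c.+1 => inord (bump i k) : 'I_c.+2) (set_val t)).
 by apply: pushrv_in; exact: stdP.
move: (pushrv _ _) => p pS pi0.
rewrite /upper /=; case: (eqVneq (vproj (vsimp p)) 0) => [e|]; last by left.
right; rewrite ltNge; apply/negP => le0; suff p0 : p = 0.
 have [_] := pS; rewrite p0; under eq_bigr do rewrite mxE.
 by rewrite big1 // => /eqP; rewrite eq_sym oner_eq0.
have pe k : k != ord_max -> p 0 k = p 0 0.
 move=> km; case: (unliftP ord0 k) => [l kl|->//].
 case: (unliftP ord_max l) => [j jl|lm]; last first.
 by case/eqP: km; rewrite kl lm; apply/val_inj.
 by move/rowP: e => /(_ j); rewrite !mxE -jl -kl => /subr0_eq.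
have p00 : p 0 0 = 0.
 by rewrite -(pe (widen_ord (leqnSn _) i)) // -val_eqE /= ltn_eqF.
have [pge _] := pS.
apply/rowP => k; rewrite mxE.
case: (eqVneq k ord_max) => [->|/pe]; last by rewrite p00.
move: le0; rewrite mxE p00 subr0.
have -> : lift ord0 ord_max = ord_max :> 'I_c.+2 by apply/val_inj.
by move=> le0; apply/eqP; rewrite eq_le le0 pge.
Qed.

End local.
Section local_cohomology.
Context (R : realType).
Lemma rV0_nz (v : 'rV[R]_0) : ~ nz v.
by rewrite /nz /= thinmx0 eqxx. Qed.

(* All maps to a point of the same dimension agree, so the cochain complex is
 Q -> Q -> ... with alternating differentials 0 and 1. *)
Lemma point_cochain (a : cochain R 'rV[R]_0) (s s' : simplex R 'rV[R]_0) :
 sdim s = sdim s' -> a s = a s'.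
case: s s' => [k f] [k' f'] /= e; subst k'; congr (a (Simplex _)).
by apply/continuousEP => t; rewrite (thinmx0 (f t)) (thinmx0 (f' t)).
Qed.

Lemma cst0_cts k : continuous (fun _ : simp R k => 0 : 'rV[R]_0).
exact: cst_continuous. Qed.
Definition pt_simplex k : simplex R 'rV[R]_0 := Simplex (mkcts (@cst0_cts k)).

Lemma alt_sum n : \sum_(i < n) (-1) ^+ i = (odd n)%:R :> rat.
elim: n => [|n ih]; first by rewrite big_ord0.
by rewrite big_ord_recr /= ih -signr_odd; case: (odd n); rewrite /= ?expr1 ?expr0 ?subrr ?add0r.
Qed.

Lemma point_cob (a : cochain R 'rV[R]_0) (s : simplex R 'rV[R]_0) n :
 sdim s = n.+1 -> cob a s = (odd n.+2)%:R * a (pt_simplex n).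
move=> sn; rewrite /cob sn -alt_sum mulr_suml; apply: eq_bigr => i _.
by congr (_ * _); apply: point_cochain.
Qed.

Lemma vsimpv_cts c : continuous (fun t : simp R c => vsimp (set_val t)).
by move=> t; apply: continuous_comp; [exact: setv_cts|exact: vsimp_cts].
Qed.
Lemma vlift_upper c (w : 'rV[R]_c) : nz w -> upper (vlift w (-1)).
by rewrite /nz /upper /= vproj_lift => ?; left. Qed.
Lemma vlift_lower c (w : 'rV[R]_c) : lowerh (vlift w (-1)).
by rewrite /lowerh /= vlift_max oppr_lt0 ltr01. Qed.

Lemma vlift1_cts c : continuous (fun w : 'rV[R]_c => vlift w (-1)).
move=> w; apply: (@vlift_cts R _ c id (fun=> -1)); first exact: cvg_id.
exact: cst_continuous.
Qed.

(* Moving along the half-line: the complement of the closed half-line below the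
 origin is star-shaped. *)
Lemma exact_upper c i (a : cochain R 'rV[R]_c.+1) :
 coc setT a -> van (@nz R c.+1) a -> hdeg i.+1 a ->
 exists b, [/\ van (@upper R c) b, hdeg i b & cob b = a].
move=> ac az ai.
have [b0 b0u b0a] : exists2 b, van (@upper R c) b & cob b = a.
 pose h (v : 'rV[R]_c.+1) (r : R) := (1 - r) *: v + r *: delta_mx 0 ord_max.
 have hc v r : cts_at (v, r) (fun p => h p.1 p.2).
 apply: (@cvgD _ _ _ _ _ (fun p : 'rV[R]_c.+1 * R => (1 - p.2) *: p.1)
 (fun p => p.2 *: delta_mx 0 ord_max)).
 apply: (@cvgZ _ _ _ _ _ (fun p : 'rV[R]_c.+1 * R => 1 - p.2) fst).
 by apply: subf_cts; [exact: cvg_cst|exact: cvg_snd].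
 exact: cvg_fst.
 apply: (@cvgZ _ _ _ _ _ (fun p : 'rV[R]_c.+1 * R => p.2) (fun=> delta_mx 0 ord_max)).
 exact: cvg_snd.
 exact: cvg_cst.
 exists (- prism h a).
 apply: vanN => s us; apply: prism_van az _ => t r /andP[r0 r1].
 have hp v : vproj (h v r) = (1 - r) *: vproj v.
 apply/rowP => j; rewrite !mxE eqxx /= eq_sym (negbTE (neq_lift _ _)).
 by rewrite mulr0 addr0.
 have hm v : h v r 0 ord_max = (1 - r) * v 0 ord_max + r by rewrite !mxE !eqxx mulr1.
 case: (eqVneq r 1) => [re|rn].
 rewrite /nz /=; apply/eqP => /(congr1 (fun w : 'rV[R]_c.+1 => w 0 ord_max)).
 by rewrite hm re subrr mul0r add0r mxE => /eqP; rewrite oner_eq0.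
 have r1' : 0 < 1 - r by rewrite subr_gt0 lt_neqAle rn.
 apply: upper_nz; case: (us t) => hv; [left|right].
 by rewrite hp scaler_eq0 negb_or hv andbT gt_eqF.
 by rewrite hm ltr_pwDl // mulr_gt0.
 apply/funext => s; rewrite linearN -[LHS]/(- cob (prism h a) s).
 have := prismP (A := setT) (fun x r _ => hc x r) a (s := s) (fun _ => I).
 rewrite (prism_van ac) // add0r => ->; rewrite (app_van az) => [|t]; last first.
 rewrite /nz /= /h subrr scale0r add0r scale1r; apply/eqP => /rowP /(_ ord_max).
 by rewrite !mxE !eqxx => /eqP; rewrite oner_eq0.
 rewrite (@eq_app _ _ _ _ (fun t => h (smap s t) 0) (smap s)) => [|t]; last first.
 by rewrite /h subr0 scale1r scale0r addr0.
 by rewrite app_smap sub0r opprK.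
have [bi bu ba] := exact_trunc (U := setT) ai b0u (fun s _ => congr1 (@^~ s) b0a).
by exists (trunc i b0); split=> //; apply/funext => s; rewrite ba.
Qed.

(** Induction on the dimension, lowering the degree as well. A primitive [b] of [a] vanishing on
    [upper] restricts to the hyperplane at height -1 as a cocycle of one dimension and one degree
    less; once that is exact, retraction and excision make [b] exact off the origin. *)
Theorem local_exact c i (a : cochain R 'rV[R]_c) :
 coc setT a -> van (@nz R c) a -> hdeg i a -> (i = c -> evalv a = 0) ->
 exists2 b, van (@nz R c) b & cob b = a.
Proof.
elim: c i a => [|c ih] i a ac az ai a0.
 case: i ai a0 => [|i] ai a0.
 exists 0; first by [].
 apply/funext => s; rewrite linear0 -[LHS]/(0 : rat).
 case: (eqVneq (sdim s) 0%N) => [s0|/eqP s0]; last by rewrite ai.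
 rewrite (point_cochain _ (s' := pt_simplex 0)) // -[LHS]a0 // /evalv.
 by apply: app_simp => t /=; rewrite [RHS]thinmx0.
 (* For odd [i] the differential into degree [i.+1] is the identity, so this is a primitive; for
    even [i] the cocycle condition forces [a] to vanish in that degree. *)
 exists (fun s => (sdim s == i)%:R * a (pt_simplex i.+1)).
 by move=> s /(_ (spt (simp_delta R ord0))) /rV0_nz.
 apply/funext => s; case E: (sdim s) => [|n].
 by rewrite /cob E ai ?E.
 rewrite (point_cob _ E) /=; case: (eqVneq n i) E => [->|ni] E; last first.
 by rewrite mul0r mulr0 ai // E => -[/eqP]; rewrite (negbTE ni).
 rewrite mul1r (point_cochain a (s := s) (s' := pt_simplex i.+1)) ?E //.
 have := ac (pt_simplex i.+2) (fun _ => I); rewrite (point_cob _ (erefl : sdim (pt_simplex i.+2) = i.+2)).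
 by rewrite /=; case: (odd i) => /=; rewrite ?mul0r ?mul1r.
case: i ai a0 => [|i] ai a0.
 (* degree 0: a cocycle vanishing somewhere on a path-connected space *)
 exists (0 : cochain R 'rV[R]_c.+1); first by [].
 suff a_0 s : a s = 0 by apply/funext => s; rewrite linear0 a_0.
 case: (eqVneq (sdim s) 0%N) => [s0|/eqP s0]; last by rewrite ai.
 pose h (v : 'rV[R]_c.+1) (r : R) := (1 - r) *: v + r *: delta_mx 0 ord_max.
 have hc v r : cts_at (v, r) (fun p => h p.1 p.2).
 apply: (@cvgD _ _ _ _ _ (fun p : 'rV[R]_c.+1 * R => (1 - p.2) *: p.1)
 (fun p => p.2 *: delta_mx 0 ord_max)).
 apply: (@cvgZ _ _ _ _ _ (fun p : 'rV[R]_c.+1 * R => 1 - p.2) fst).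
 by apply: subf_cts; [exact: cvg_cst|exact: cvg_snd].
 exact: cvg_fst.
 apply: (@cvgZ _ _ _ _ _ (fun p : 'rV[R]_c.+1 * R => p.2) (fun=> delta_mx 0 ord_max)).
 exact: cvg_snd.
 exact: cvg_cst.
 have := prismP (A := setT) (fun x r _ => hc x r) a (s := s) (fun _ => I).
 rewrite (prism_van ac) // add0r (app_van az) => [|t]; last first.
 rewrite /nz /= /h subrr scale0r add0r scale1r; apply/eqP => /rowP /(_ ord_max).
 by rewrite !mxE !eqxx => /eqP; rewrite oner_eq0.
 rewrite (@eq_app _ _ _ _ (fun t => h (smap s t) 0) (smap s)) => [|t]; last first.
 by rewrite /h subr0 scale1r scale0r addr0.
 rewrite app_smap /cob s0 sub0r => /esym/eqP.
 by rewrite oppr_eq0 => /eqP.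
have [b [bu bi bE]] := exact_upper ac az ai; have ba s : img_in setT s -> cob b s = a s by rewrite bE.
have bz : coc (@nz R c.+1) b by move=> s sz; rewrite ba // az.
pose sg (w : 'rV[R]_c) := vlift w (-1).
have [b1 b1z b1E] : exists2 b1, van (@nz R c) b1 & cob b1 = pb sg b.
 apply: (ih i).
 - apply: (pb_coc (B := @nz R c.+1)) => // x _; first exact: vlift1_cts.
 by apply: lower_nz; exact: vlift_lower.
 - by apply: pb_van bu => x; exact: vlift_upper.
 - exact: pb_hdeg.
 move=> ic; rewrite /evalv pb_app; last exact: vsimpv_cts.
 have := evalv_cob bz bu.
 have -> : cob b = a by apply/funext => s; exact: ba.
 rewrite a0 ?ic // => /esym/eqP; rewrite mulf_eq0 signr_eq0 /= => /eqP //.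
have [b2 b2u b2E] : exists2 b', van (@lowerh R c `&` @upper R c) b' &
 forall s, img_in (@lowerh R c) s -> cob b' s = b s.
 pose h (v : 'rV[R]_c.+1) (r : R) := vlift (vproj v) ((1 - r) * v 0 ord_max - r).
 apply: (@retract_exact R _ _ _ _ (@nz R c) (@vproj R c) sg h b b1) => //.
 - move=> v r _; apply: vlift_cts.
 apply: (@continuous_comp _ _ _ fst (@vproj R c)); first exact: cvg_fst.
 exact: vproj_cts.
 apply: subf_cts; last exact: cvg_snd.
 apply: mulf_cts; first by apply: subf_cts; [exact: cvg_cst|exact: cvg_snd].
 by apply: coord_cts; exact: cvg_fst.
 - by move=> v _; exact: vproj_cts.
 - by move=> v _; rewrite /h !subr0 mul1r vlift_proj.
 - by move=> v _; rewrite /h subrr mul0r sub0r.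
 - move=> v r /andP[r0 r1]; rewrite /lowerh /= /h vlift_max => v0.
 case: (eqVneq r 1) => [->|rn]; first by rewrite subrr mul0r sub0r oppr_lt0 ltr01.
 by rewrite ltr_wnDr ?oppr_le0 // nmulr_llt0 // subr_gt0 lt_neqAle rn.
 - move=> v r /andP[r0 r1] [l0 u0]; have vz : vproj v != 0.
 by case: u0 => // u0; move: l0; rewrite /lowerh /= ltNge (ltW u0).
 split; last by left; rewrite vproj_lift.
 rewrite /lowerh /= /h vlift_max.
 case: (eqVneq r 1) => [->|rn]; first by rewrite subrr mul0r sub0r oppr_lt0 ltr01.
 by rewrite ltr_wnDr ?oppr_le0 // nmulr_llt0 // subr_gt0 lt_neqAle rn.
 - move=> v [l0 [//|u0]]; move: l0; rewrite /lowerh /= ltNge (ltW u0) //.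
 - by apply: van_sub bz => v; exact: lower_nz.
 - by apply: van_sub bu => v [].
 - by move=> s; rewrite b1E.
have [b3 b3u b3E] := excise (@nz_open R c.+1) (@upper_open R c) (@lower_open R c)
 (@upper_nz R c) (@lower_nz R c) (@nz_cover R c) bz bu b2u b2E.
exists (b - cob b3).
 by move=> s sz; rewrite -[LHS]/(b s - cob b3 s) b3E // subrr.
by apply/funext => s; rewrite linearB /= cob_cob subr0 ba.
Qed.

(** The generator is suspended: pulled back to the lower half-space, extended by zero on [upper] to
    the punctured space, then mapped by the coboundary. The sign undoes that of [evalv_cob]. *)
Theorem local_class c : exists a : cochain R 'rV[R]_c,
 [/\ coc setT a, van (@nz R c) a, hdeg c a & evalv a = 1].
Proof.
elim: c => [|c [a [ac az ai a1]]].
 exists (fun s => (sdim s == 0%N)%:R); split.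
 - move=> s _; case E: (sdim s) => [|n]; first by rewrite /cob E.
 rewrite (point_cob _ E); case: n {E} => [|n]; first exact: mul0r.
 exact: mulr0.
 - move=> s sz; by have := rV0_nz (sz (spt (simp_delta R ord0))).
 - by move=> s /eqP/negbTE ->.
 - by rewrite /evalv (app_simp _ (c := mkcts (@vsimpv_cts 0))).
have [b0 [b0z b0u b0E]] : exists b, [/\ coc (@nz R c.+1) b, van (@upper R c) b &
 forall s, img_in (@lowerh R c) s -> b s = pb (@vproj R c) a s].
 apply: (extend (@nz_open R c.+1) (@upper_open R c) (@lower_open R c)
 (@upper_nz R c) (@lower_nz R c) (@nz_cover R c)).
 by apply: pb_coc ac => // x _; exact: vproj_cts.
 apply: pb_van az => x [l0 [//|u0]]; move: l0; rewrite /lowerh /= ltNge (ltW u0) //.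
pose b := trunc c b0.
have bz : coc (@nz R c.+1) b.
 by move=> s sz; rewrite /b cob_trunc /trunc b0z // if_same.
have bu : van (@upper R c) b by exact: van_trunc.
have evE := evalv_cob bz bu.
exists ((-1) ^+ c.+1 *: cob b); split.
- by move=> s _; rewrite linearZ /= cob_cob scaler0.
- by move=> s sz; rewrite -[LHS]/(_ * cob b s) bz // mulr0.
- by apply: hdegZ; apply: hdeg_cob; exact: hdeg_trunc.
have appZ (e : rat) (a' : cochain R 'rV[R]_c.+1) : evalv (e *: a') = e * evalv a'.
 by rewrite /evalv /app; case: pselect => // _; rewrite mulr0.
rewrite appZ evE mulrA -expr2 sqrr_sign mul1r.
have sc : continuous (fun t : simp R c => vlift (vsimp (set_val t)) (-1)).
 move=> t; apply: (@vlift_cts R _ c (fun t => vsimp (set_val t)) (fun=> -1)).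
 exact: vsimpv_cts.
 exact: cst_continuous.
rewrite (@app_simp _ _ _ _ (mkcts sc)) // /b /trunc /= eqxx b0E; last first.
 by move=> t; exact: vlift_lower.
rewrite -a1 /evalv /pb; apply: eq_app => t /=; exact: vproj_lift.
Qed.

End local_cohomology.

(** * Orientation: exchanging vertices and reflecting coordinates *)

Section alternation.
Variable T : eqType.
Implicit Types (u w : seq T) (psi : seq T -> rat).

(** Vanishing on words that miss a letter of [u]: what remains, for words in the vertices of a
    simplex, of vanishing on its proper faces. *)
Definition tface u psi := forall w z, z \in u -> z \notin w -> psi w = 0.

(** In the word with [x] repeated, only omitting one of the two copies of [x] leaves every letter
    present. For closed [psi] this yields antisymmetry under adjacent exchanges. *)
Lemma td_double psi P x y B : uniq (P ++ x :: y :: B) ->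
 tface (P ++ x :: y :: B) psi ->
 td psi (P ++ x :: y :: x :: B) =
 (-1) ^+ size P * (psi (P ++ y :: x :: B) + psi (P ++ x :: y :: B)).
elim: P psi => [|p P ih] psi.
 rewrite expr0 mul1r => /= /and3P[]; rewrite !inE negb_or => /andP[xy xB] yB uB f.
 rewrite (_ : kp x psi (x :: B) = 0); last first.
 by apply: (f _ y); rewrite !inE ?eqxx ?orbT // !negb_or eq_sym xy yB.
 rewrite (_ : td (kp x (kp y (kp x psi))) B = 0) ?subr0 ?sub0r ?opprK //.
 apply: (@td_eq0 _ _ [set z | List.In z B]) => // w sw wB.
 have [z zB zw] : exists2 z, z \in B & z \notin w.
 apply/hasP; rewrite has_predC; apply/negP => /allP BW.
 by have := uniq_leq_size uB BW; rewrite sw ltnn.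
 have zx : z != x by apply: contraNneq xB => <-.
 have zy : z != y by apply: contraNneq yB => <-.
 apply: (f _ z); first by rewrite !inE zB !orbT.
 by rewrite !inE !negb_or zx zy zw.
move=> /= /andP[pP uP] f; rewrite (f _ p) ?inE ?eqxx //; last first.
 by move: pP; rewrite !mem_cat !inE !negb_or => /and4P[-> -> -> ->].
rewrite sub0r exprS mulN1r mulNr ih // => w z zP zw.
apply: (f _ z); first by rewrite inE zP orbT.
by rewrite inE negb_or zw andbT; apply: contraNneq pP => <-.
Qed.

Variables (psi : seq T -> rat) (U : seq T).
Hypothesis psi_td : forall u, td psi u = 0.
Hypothesis psi_U : tface U psi.
Lemma perm_face u : perm_eq u U -> tface u psi.
by move=> /perm_mem uU w z; rewrite uU => /psi_U; apply. Qed.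

Lemma psi_swap P x y B : uniq U -> perm_eq (P ++ x :: y :: B) U ->
 psi (P ++ x :: y :: B) = - psi (P ++ y :: x :: B).
move=> uU pU; have u : uniq (P ++ x :: y :: B) by rewrite (perm_uniq pU).
have := td_double u (perm_face pU); rewrite psi_td => /esym/eqP.
by rewrite mulf_eq0 signr_eq0 /= addrC addr_eq0 => /eqP.
Qed.

Lemma psi_move P A x B : uniq U -> perm_eq (P ++ A ++ x :: B) U ->
 psi (P ++ A ++ x :: B) = (-1) ^+ size A * psi (P ++ x :: A ++ B).
move=> uU; elim: A P => [|a A ih] P pU; first by rewrite mul1r.
have e : P ++ (a :: A) ++ x :: B = (P ++ [:: a]) ++ A ++ x :: B by rewrite -catA.
rewrite e ih -?e // -catA /= psi_swap //; first by rewrite exprS mulN1r mulrN mulNr.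
by apply: perm_trans pU; apply/seq.permP => p; rewrite !count_cat /= !count_cat /=; lia.
Qed.

Lemma psi_transpose P x y A B : uniq U -> perm_eq (P ++ x :: A ++ y :: B) U ->
 psi (P ++ x :: A ++ y :: B) = - psi (P ++ y :: A ++ x :: B).
move=> uU pU; have pU' : perm_eq (P ++ y :: A ++ x :: B) U.
 by apply: perm_trans pU; apply/seq.permP => p; rewrite !count_cat /= !count_cat /=; lia.
have := psi_move (P := P ++ [:: x]) (A := A) (x := y) (B := B) uU; rewrite -!catA /= => -> //.
have := psi_move (P := P ++ [:: y]) (A := A) (x := x) (B := B) uU; rewrite -!catA /= => -> //.
rewrite psi_swap ?mulrN //; apply: perm_trans pU; apply/seq.permP => p.
by rewrite !count_cat /= !count_cat /=; lia.
Qed.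

End alternation.
Section standard_simplex.
Context (R : realType).
Definition vx c (i : 'I_c.+1) : 'rV[R]_c := vsimp (delta_mx 0 i).
Lemma vsimp_linear c : linear (@vsimp R c).
by move=> k x y; apply/rowP => j; rewrite !mxE; ring. Qed.

Lemma comb_vx c p (u : seq 'I_c.+1) (t : 'rV[R]_p.+1) : size u = p.+1 ->
 comb [seq vx i | i <- u] t =
 vsimp (pushrv (fun k : 'I_p.+1 => nth ord0 u k) t).
move=> su; rewrite (_ : [seq vx i | i <- u] = map (@vsimp R c) [seq delta_mx 0 i | i <- u]).
 rewrite comb_linear; last exact: vsimp_linear.
 congr vsimp; rewrite -[RHS]comb_verts comb_push; apply: eq_bigr => k _.
 by rewrite (nth_map ord0) ?su // nth_verts.
by rewrite -map_comp.
Qed.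

Variables (c : nat) (a : cochain R 'rV[R]_c).
Hypotheses (ac : coc setT a) (az : van (@nz R c) a).
Definition psiv (u : seq 'I_c.+1) : rat := evl a id [seq vx i | i <- u].

Lemma cts_id : cts_on (id : 'rV[R]_c -> 'rV[R]_c) setT.
move=> p u _ _ t; apply: (@continuous_comp _ _ _ set_val (@comb R _ p u)).
 exact: setv_cts.
exact: comb_cts.
Qed.

Lemma psiv_td u : td psiv u = 0.
rewrite -[LHS]/(td (fun w => evl a id (map (@vx c) w)) u) -td_map (td_ev _ cts_id) //.
case: (map _ _) => // x w; rewrite /evl /app; case: pselect => // fc.
by apply: ac => t.
Qed.

Lemma psiv_face : tface (enum 'I_c.+1) psiv.
move=> w z _ zw; rewrite /psiv; case: w zw => [//|i w'] zw; set w := i :: w'.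
have sw : size w = (size w').+1 by [].
apply: ev_van az _; rewrite size_map => t tS.
rewrite comb_vx // /nz /=; apply/eqP => e.
have pS := pushrv_in (fun k : 'I_(size w').+1 => nth ord0 w k) tS.
have := simp_eq_gt0 pS e z; rewrite mxE big1 ?ltxx // => k /eqP wk.
by case/negP: zw; rewrite -wk mem_nth // sw.
Qed.

Lemma psiv_enum : psiv (enum 'I_c.+1) = evalv a.
have se : size [seq vx i | i <- enum 'I_c.+1] = c.+1.
 by rewrite size_map size_enum_ord.
rewrite /psiv (ev_size _ _ se).
apply: eq_app => t; rewrite comb_vx ?size_enum_ord //; congr vsimp.
apply/rowP => j; rewrite mxE (big_pred1 j) // => i /=.
by rewrite nth_ord_enum.
Qed.

Definition flipv (j : 'I_c) (v : 'rV[R]_c) : 'rV[R]_c :=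
 \row_i (if i == j then - v 0 i else v 0 i).

Lemma evalv_vperm (x y : 'I_c.+1) : x != y ->
 app a (fun t : simp R c => \row_k (set_val t 0 (tperm x y (lift ord0 k)) - set_val t 0 (tperm x y ord0))) = - evalv a.
move=> xy; pose e := enum 'I_c.+1; have ue : uniq e by exact: enum_uniq.
have [P [A [B [x' [y' [eE tE]]]]]] : exists P A B x' y', e = P ++ x' :: A ++ y' :: B /\ tperm x y = tperm x' y'.
 have [P [Q eE]] : exists P Q, e = P ++ x :: Q by rewrite /e; have := mem_enum 'I_c.+1 x => /splitPr[P Q]; exists P, Q.
 have : y \in P ++ x :: Q by rewrite -eE mem_enum.
 rewrite mem_cat inE eq_sym (negbTE xy) /= => /orP[] yin; move: eE; case/splitPr: yin => A B eE.
 by exists A, B, Q, y, x; split; [rewrite eE -catA|exact: tpermC].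
 by exists P, A, B, x, y.
have pe : psiv [seq tperm x y i | i <- e] = - evalv a.
 rewrite -psiv_enum -/e {2}eE (psi_transpose psiv_td psiv_face) ?opprK -?eE ?enum_uniq //.
 have swid w : x' \notin w -> y' \notin w -> map (tperm x' y') w = w.
 by move=> n0 nj; rewrite map_id_in // => i iw; rewrite tpermD //; [apply: contraNneq n0 => ->|apply: contraNneq nj => ->].
 have cnt z : count_mem z e = 1%N by rewrite count_uniq_mem // mem_enum.
 rewrite tE eE map_cat /= map_cat /= tpermL tpermR !swid //; apply/count_memPn; have := cnt x'; have := cnt y';
 by rewrite eE !count_cat /= !count_cat /= !eqxx; lia.
have se : size [seq vx i | i <- map (tperm x y) e] = c.+1 by rewrite size_map size_map size_enum_ord.
rewrite -pe /psiv (ev_size _ _ se); apply: eq_app => t; rewrite comb_vx; last by rewrite size_map size_enum_ord.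
have pE m : pushrv (fun k : 'I_c.+1 => nth ord0 (map (tperm x y) e) k) (set_val t) 0 m = set_val t 0 (tperm x y m).
 rewrite mxE (big_pred1 (tperm x y m)) // => k /=.
 by rewrite /e (nth_map ord0) ?size_enum_ord // nth_ord_enum -(inj_eq (@perm_inj _ (tperm x y))) tpermK.
by apply/rowP => k; rewrite mxE [RHS]mxE !pE.
Qed.

(** The reflection is joined by straight lines to the exchange of the vertices [ord0] and
    [lift ord0 j], through maps that send no boundary point to the origin; the exchange changes the
    sign by [evalv_vperm]. *)
Lemma evalv_flip j : app a (fun t : simp R c => flipv j (vsimp (set_val t))) = - evalv a.
pose sw (i : 'I_c.+1) := tperm ord0 (lift ord0 j) i; rewrite -(evalv_vperm (neq_lift ord0 j)).
pose L (t : 'rV[R]_c.+1) : 'rV[R]_c := \row_k (t 0 (sw (lift ord0 k)) - t 0 (sw ord0)).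
pose h (t : simp R c) (r : R) := (1 - r) *: L (set_val t) + r *: flipv j (vsimp (set_val t)).
have h0 t : h t 0 = L (set_val t) by rewrite /h subr0 scale1r scale0r addr0.
have h1 t : h t 1 = flipv j (vsimp (set_val t)) by rewrite /h subrr scale0r add0r scale1r.
rewrite -(eq_app _ h0) -(eq_app _ h1).
have LE t i : L t 0 i = t 0 (sw (lift ord0 i)) - t 0 (sw ord0) by rewrite mxE.
apply: (@app_homotopy R _ setT (@nz R c)) => //.
- have vc t r : cts_at (t, r) (fun p : simp R c * R => set_val p.1).
 apply: (@continuous_comp _ _ _ fst (set_val : simp R c -> _)).
 exact: cvg_fst.
 exact: setv_cts.
 move=> t r; apply: mx_cts => i k.
 have -> : (fun p : simp R c * R => h p.1 p.2 i k) = (fun p : simp R c * R =>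
 (1 - p.2) * (set_val p.1 0 (sw (lift ord0 k)) - set_val p.1 0 (sw ord0)) +
 p.2 * ((-1) ^+ (k == j) * (set_val p.1 0 (lift ord0 k) - set_val p.1 0 ord0))).
 apply/funext => p; rewrite (ord1 i) mxE [X in X + _]mxE LE [X in _ + X]mxE.
 rewrite /flipv mxE; congr (_ + _ * _); rewrite mxE.
 by case: (k == j); rewrite ?expr1 ?mulN1r ?expr0 ?mul1r.
 apply: addf_cts; apply: mulf_cts.
 + by apply: subf_cts; [exact: cvg_cst|exact: cvg_snd].
 + by apply: subf_cts; apply: coord_cts; exact: vc.
 + exact: cvg_snd.
 + apply: mulf_cts; first exact: cvg_cst.
 by apply: subf_cts; apply: coord_cts; exact: vc.
- move=> t r i /andP[r0 r1] ti; rewrite /nz /=; apply/eqP => /rowP e.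
 have tS := stdP t.
 have hE k : h t r 0 k = (1 - r) * (set_val t 0 (sw (lift ord0 k)) - set_val t 0 (sw ord0)) +
 r * ((-1) ^+ (k == j) * (set_val t 0 (lift ord0 k) - set_val t 0 ord0)).
 rewrite mxE [X in X + _]mxE LE [X in _ + X]mxE.
 rewrite /flipv mxE; congr (_ + _ * _); rewrite mxE.
 by case: (k == j); rewrite ?expr1 ?mulN1r ?expr0 ?mul1r.
 have ej : set_val t 0 (lift ord0 j) = set_val t 0 ord0.
 have := e j; rewrite hE mxE eqxx expr1 /sw tpermR tpermL => ej.
 apply/eqP; rewrite -subr_eq0 -oppr_eq0; apply/eqP.
 by rewrite -[RHS]ej; ring.
 have ek k : set_val t 0 (lift ord0 k) = set_val t 0 ord0.
 case: (eqVneq k j) => [->//|kj].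
 have := e k; rewrite hE mxE (negbTE kj) expr0 mul1r /sw tpermL tpermD; last first.
 - by rewrite (inj_eq lift_inj) eq_sym.
 - exact: neq_lift.
 rewrite ej => ek; apply/eqP; rewrite -subr_eq0; apply/eqP.
 by rewrite -[RHS]ek; ring.
 have v0 : vsimp (set_val t) = 0.
 by apply/rowP => k; rewrite mxE ek mxE subrr.
 by have := simp_eq_gt0 tS v0 i; rewrite ti ltxx.
Qed.

End standard_simplex.

Lemma evalv_flips (R : realType) c (J : seq 'I_c) (a : cochain R 'rV[R]_c) :
 coc setT a -> van (@nz R c) a ->
 app a (fun t : simp R c => foldr (@flipv R c) (vsimp (set_val t)) J) =
 (-1) ^+ size J * evalv a.
have fc j : continuous (@flipv R c j).
 move=> v; apply: mx_cts => i k.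
 have -> : (fun x => @flipv R c j x i k) = (fun x => if k == j then - x 0 k else x 0 k).
 by apply/funext => x; rewrite mxE.
 case: (k == j); last exact: coord_continuous.
 by apply: oppf_cts; exact: coord_continuous.
elim: J a => [|j J ih] a ac az; first by rewrite mul1r.
have jz v : nz v -> nz (flipv j v).
 rewrite /nz /= => /eqP vz; apply/eqP => e; apply: vz; apply/rowP => i.
 move/rowP: e => /(_ i); rewrite !mxE; case: eqP => // _ /eqP.
 by rewrite oppr_eq0 => /eqP.
have gc : continuous (fun t : simp R c => foldr (@flipv R c) (vsimp (set_val t)) J).
 elim: J {ih} => [|k J ih]; first exact: vsimpv_cts.
 move=> t; apply: (@continuous_comp _ _ _ _ (@flipv R c k)); first exact: ih.
 exact: fc.
have := ih (pb (@flipv R c j) a); rewrite (pb_app _ _ gc) => ->.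
- rewrite /evalv pb_app; last exact: vsimpv_cts.
 by rewrite evalv_flip //= exprS mulN1r mulrN mulNr.
- by apply: (pb_coc (B := setT)) => // v _; exact: fc.
- by apply: pb_van az; exact: jz.
Qed.

(** * Cup products of cochains and graded commutativity *)

Section tuple_cup.
Variable V : Type.
Implicit Types (phi psi chi : seq V -> rat) (u : seq V).
Fixpoint tcup phi psi u : rat :=
 if u is x :: u' then phi [:: x] * psi u + tcup (kp x phi) psi u' else 0.
(** The sign (-1) to the degree; the degree is one less than the size, whence the leading minus. *)
Definition tsign phi u : rat := - (-1) ^+ size u * phi u.

Lemma tcupE phi psi u :
 tcup phi psi u = \sum_(i < size u) phi (take i.+1 u) * psi (drop i u).
elim: u phi => [|x u ih] phi; first by rewrite big_ord0.
by rewrite /= big_ord_recl /= take0 ih.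
Qed.

Lemma eq_tcup phi phi' psi psi' u : phi =1 phi' -> psi =1 psi' ->
 tcup phi psi u = tcup phi' psi' u.
by move=> /funext -> /funext ->. Qed.
Lemma tcupBl phi phi' psi u :
 tcup (phi \- phi') psi u = tcup phi psi u - tcup phi' psi u.
by rewrite !tcupE -sumrB; apply: eq_bigr => i _; rewrite /= mulrBl. Qed.
Lemma tcupZl c phi psi u : tcup (fun w => c * phi w) psi u = c * tcup phi psi u.
by rewrite !tcupE mulr_sumr; apply: eq_bigr => i _; rewrite mulrA. Qed.

(** The Leibniz rule in the augmented complex. The extra term comes from the value on the empty
    tuple, which is 0 for tuples arising from singular cochains. *)
Lemma tcup_td phi psi u : psi [::] = 0 ->
 td (tcup phi psi) u + phi [::] * psi u =
 tcup (td phi) psi u + tcup (tsign phi) (td psi) u.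
move=> psi0; elim: u phi => [|x u ih] phi; first by rewrite /= psi0 mulr0.
rewrite [td _ _]/= [tcup (td phi) _ _]/= [tcup (tsign phi) _ _]/=.
have -> : kp x (tcup phi psi) = (fun w => phi [:: x] * kp x psi w) \- (fun w => - tcup (kp x phi) psi w).
 by apply/funext => w; rewrite /kp /= opprK.
rewrite tdB tdZ (_ : td (fun w => - tcup (kp x phi) psi w) u = - td (tcup (kp x phi) psi) u); last first.
 by rewrite -mulN1r -tdZ; apply: eq_td_all => w; rewrite mulN1r.
have -> : kp x (td phi) = phi \- td (kp x phi) by apply/funext.
have -> : kp x (tsign phi) = (fun w => -1 * tsign (kp x phi) w).
 by apply/funext => w; rewrite /tsign /kp /= exprS; ring.
rewrite tcupBl tcupZl.
have := ih (kp x phi); rewrite {1}/kp => e.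
have -> : td (tcup (kp x phi) psi) u = tcup (td (kp x phi)) psi u +
 tcup (tsign (kp x phi)) (td psi) u - phi [:: x] * psi u by rewrite -e addrK.
by rewrite /tsign /= expr1 /kp; ring.
Qed.

Lemma tcupA phi psi chi u :
 tcup (tcup phi psi) chi u = tcup phi (tcup psi chi) u.
elim: u phi => // x u ih phi; rewrite /= addr0.
have -> : kp x (tcup phi psi) = (fun w => phi [:: x] * kp x psi w) \- (fun w => - tcup (kp x phi) psi w).
 by apply/funext => w; rewrite /kp /= opprK.
rewrite tcupBl tcupZl.
have -> : tcup (fun w => - tcup (kp x phi) psi w) chi u = - tcup (tcup (kp x phi) psi) chi u.
 by rewrite -mulN1r -tcupZl; apply: eq_tcup => // w; rewrite mulN1r.
by rewrite ih; ring.
Qed.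

End tuple_cup.
Section cup_cochains.
Context (R : realType).
Section one_space.
Variable X : topT.
Implicit Types (a b c : cochain R X) (s : simplex R X).
Lemma tin_take V (A : set V) n u : tin A u -> tin A (take n u).
by move=> h; have := h; rewrite -{1}(cat_take_drop n u) => /tin_cat[]. Qed.
Lemma tin_drop V (A : set V) n u : tin A u -> tin A (drop n u).
by move=> h; have := h; rewrite -{1}(cat_take_drop n u) => /tin_cat[]. Qed.

Lemma ev_cupc (W : lmodType R) (g : W -> X) (K : set W) a b u : cts_on g K ->
 tin K u -> evl (cupc a b) g u = tcup (evl a g) (evl b g) u.
case: u => // x u gK Ku; set n := size u.
have su : size (x :: u) = n.+1 by [].
have fc := gK _ _ su Ku.
rewrite (ev_size _ _ su) (@app_simp _ _ _ _ (mkcts fc)) // /cupc [sdim _]/= tcupE su.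
apply: eq_bigr => -[p pn] _; rewrite [nat_of_ord _]/=; congr (_ * _).
 rewrite (@ev_size _ _ _ _ _ _ p); last by rewrite size_takel.
 apply/esym/app_simp => t /=; congr g; rewrite comb_push; apply: eq_bigr => i _.
 have ip := ltn_ord i; congr (_ *: _); rewrite inordK /=; last by apply: leq_trans pn.
 by rewrite -[x :: take _ _]/(take p.+1 (x :: u)) nth_take.
rewrite (@ev_size _ _ _ _ _ _ (n - p)); last by rewrite size_drop su subSn.
apply/esym/app_simp => t /=; congr g; rewrite comb_push; apply: eq_bigr => i _.
have ip := ltn_ord i; congr (_ *: _); rewrite inordK /=; last by rewrite ltnS -leq_subRL.
by rewrite nth_drop.
Qed.

Lemma cupcE a b s :
 cupc a b s = tcup (evl a (ext s)) (evl b (ext s)) (verts R (sdim s)).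
by rewrite -[LHS]ev_verts (ev_cupc _ _ (@cts_ext _ _ s)) //; exact: tin_verts.
Qed.

Lemma cobE a s :
 cob a s = td (evl a (ext s)) (verts R (sdim s)).
by rewrite -[LHS]ev_verts -(td_ev _ (@cts_ext _ _ s)) //; exact: tin_verts.
Qed.

Definition csign a : cochain R X := fun s => (-1) ^+ sdim s * a s.

Lemma ev_csign (W : lmodType R) (g : W -> X) a u : (0 < size u)%N ->
 evl (csign a) g u = tsign (evl a g) u.
case: u => // x u _; rewrite /evl /app /tsign /=; case: pselect => [fc|]; last by rewrite mulr0.
by rewrite /csign /= exprS mulN1r opprK.
Qed.

Lemma eq_tcup_in (V : Type) (A : set V) (phi phi' psi psi' : seq V -> rat) u :
 tin A u -> (forall w, tin A w -> (0 < size w)%N -> phi w = phi' w) ->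
 (forall w, tin A w -> (0 < size w)%N -> psi w = psi' w) ->
 tcup phi psi u = tcup phi' psi' u.
move=> Au e e'; rewrite !tcupE; apply: eq_bigr => -[i iu] _ /=.
rewrite e ?e' //.
- exact: tin_drop.
- by rewrite size_drop subn_gt0.
- exact: tin_take.
- by rewrite size_takel.
Qed.

Lemma cob_cupc a b :
 cob (cupc a b) = cupc (cob a) b + cupc (csign a) (cob b).
apply/funext => s; set u := verts R (sdim s); pose g := ext s.
have Ku : tin (simp R _) u by exact: tin_verts.
rewrite cobE -[RHS]/(cupc (cob a) b s + cupc (csign a) (cob b) s).
rewrite !cupcE -/u -/g.
have -> : td (evl (cupc a b) g) u = td (tcup (evl a g) (evl b g)) u.
 apply: (eq_td Ku) => w _ Kw; exact: ev_cupc (@cts_ext _ _ s) Kw.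
have := tcup_td (evl a g) u (erefl : evl b g [::] = 0).
rewrite mul0r addr0 => ->; congr (_ + _).
 apply: (eq_tcup_in Ku) => // w Kw _; exact: td_ev (@cts_ext _ _ s) Kw.
apply: (eq_tcup_in Ku) => w Kw w0; first by rewrite ev_csign.
exact: td_ev (@cts_ext _ _ s) Kw.
Qed.

Lemma cupcA a b c : cupc (cupc a b) c = cupc a (cupc b c).
apply/funext => s; set u := verts R (sdim s); pose g := ext s.
have Ku : tin (simp R _) u by exact: tin_verts.
rewrite !cupcE -/u -/g.
rewrite (@eq_tcup_in _ (simp R (sdim s)) _ (tcup (evl a g) (evl b g)) _ (evl c g)) //; last first.
 by move=> w Kw _; exact: ev_cupc (@cts_ext _ _ s) Kw.
rewrite tcupA; apply: (eq_tcup_in Ku) => // w Kw _.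
by apply/esym; exact: ev_cupc (@cts_ext _ _ s) Kw.
Qed.

Definition unitc : cochain R X := fun s => (sdim s == 0%N)%:R.

Lemma cup1c a : cupc unitc a = a.
apply/funext => s; rewrite /cupc big_ord_recl /= big1 ?addr0 => [|i _]; last by rewrite mul0r.
rewrite /unitc /= mul1r subn0 -[RHS]app_smap.
apply/esym/app_simp => t /=; congr (smap s _); apply/val_inj/rowP => j /=.
by rewrite mxE (big_pred1 j) // => i /=; rewrite /= inord_val.
Qed.

Lemma unitc_cocycle : cob unitc = 0.
apply/funext => s; rewrite /cob; case: (sdim s) => [|[|n]] //.
 by rewrite big_ord_recl big_ord1 /= expr0 expr1 mul1r mulN1r subrr.
by apply: big1 => i _; rewrite mulr0.
Qed.

Lemma cupcDl a a' b : cupc (a + a') b = cupc a b + cupc a' b.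
apply/funext => s; rewrite -[RHS]/(cupc a b s + cupc a' b s) /cupc -big_split /=.
by apply: eq_bigr => i _; rewrite -mulrDl.
Qed.

Lemma cupcDr a b b' : cupc a (b + b') = cupc a b + cupc a b'.
apply/funext => s; rewrite -[RHS]/(cupc a b s + cupc a b' s) /cupc -big_split /=.
by apply: eq_bigr => i _; rewrite -mulrDr.
Qed.

Lemma cupcZl k a b : cupc (k *: a) b = k *: cupc a b.
apply/funext => s; rewrite -[RHS]/(k * cupc a b s) /cupc mulr_sumr.
by apply: eq_bigr => i _; rewrite -[(k *: a) _]/(k * a _) mulrA.
Qed.

Lemma cupcZr k a b : cupc a (k *: b) = k *: cupc a b.
apply/funext => s; rewrite -[RHS]/(k * cupc a b s) /cupc mulr_sumr.
by apply: eq_bigr => i _; rewrite -[(k *: b) _]/(k * b _) mulrCA.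
Qed.

Lemma hdeg_cupc i j a b : hdeg i a -> hdeg j b -> hdeg (i + j) (cupc a b).
move=> ai bj s sn; apply: big1 => -[p ps] _ /=.
case: (eqVneq p i) => [pi|/eqP pi]; last by rewrite ai // mul0r.
by rewrite bj ?mulr0 //= => h; apply: sn; rewrite -h -pi subnKC // -ltnS.
Qed.

Lemma csign_hdeg i a : hdeg i a -> csign a = (-1) ^+ i *: a.
move=> ai; apply/funext => s; rewrite -[RHS]/((-1) ^+ i * a s) /csign.
by case: (eqVneq (sdim s) i) => [->//|/eqP h]; rewrite ai // !mulr0.
Qed.

Lemma van_cupcl A a b : van A a -> van A (cupc a b).
by move=> h s As; apply: big1 => i _; rewrite h ?mul0r //; exact: img_in_face.
Qed.
Lemma van_cupcr A a b : van A b -> van A (cupc a b).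
by move=> h s As; apply: big1 => i _; rewrite h ?mulr0 //; exact: img_in_face.
Qed.
End one_space.

Lemma pb_cupc (X Y : topT) (f : X -> Y) (A : set X) (a b : cochain R Y)
 (s : simplex R X) : (forall x, A x -> cts_at x f) -> img_in A s ->
 pb f (cupc a b) s = cupc (pb f a) (pb f b) s.
move=> fc As; have sc := cts_comp_img fc As.
rewrite /pb (@app_simp _ _ _ _ (mkcts sc)) // /cupc; apply: eq_bigr => i _.
by congr (_ * _); apply/esym/app_simp.
Qed.

(* Graded commutativity: reversing the order of the vertices exchanges front
 and back faces and is chain homotopic to the identity. *)
Section commutativity.
Variable X : topT.
Implicit Types (a b c : cochain R X) (s : simplex R X).

Definition revc a : cochain R X := fun s =>
 trev (evl a (ext s)) (verts R (sdim s)).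
Definition revhc a : cochain R X := fun s =>
 th (fun phi => phi) (@trev _) (head 0) (evl a (ext s)) (verts R (sdim s)).

Lemma tin_rev V (A : set V) u : tin A u -> tin A (rev u).
elim: u => // x u ih /tin_cons[Ax /ih Au]; rewrite rev_cons -cats1.
by apply/tin_cat; split=> //; apply/tin_cons; split.
Qed.

Lemma revhcP a s : revhc (cob a) s + cob (revhc a) s = a s - revc a s.
have hK q (u : seq 'rV[R]_q.+1) : tin (simp R q) u -> (0 < size u)%N ->
 simp R q (head 0 u) by case: u => // x u /tin_cons[].
have loc q (psi : seq 'rV[R]_q.+1 -> rat) u : tin (simp R q) u ->
 (forall w, tin (simp R q) w -> size w = size u -> psi w = 0) ->
 psi u = 0 /\ trev psi u = 0.
 move=> Ku psi0; split; first exact: psi0.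
 by rewrite /trev psi0 ?mulr0 ?size_rev //; exact: tin_rev.
have rB q (phi psi : seq 'rV[R]_q.+1 -> rat) : trev (phi \- psi) = trev phi \- trev psi.
 by apply/funext => u; rewrite /trev /= mulrBr.
have -> : cob (revhc a) s =
 td (th (fun phi => phi) (@trev _) (head 0) (evl a (ext s))) (verts R (sdim s)).
 apply: (@cob_op R X (fun s => th (fun phi => phi) (@trev _) (head 0) (evl a (ext s)))) => //.
 move=> n theta; set L := pushrv _.
 rewrite (@th_map _ _ _ _ (fun phi => phi) (@trev _) _ _ (head 0) _ L L) //.
 - apply: (@eq_th _ _ _ _ _ (simp R n) (simp R n)) => //.
 + exact: hK.
 + exact: loc.
 + by move=> w Kw; rewrite ev_face.
 + exact: tin_verts.
 - by move=> phi u; rewrite /trev size_map map_rev.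
 - by case.
have -> : revhc (cob a) s =
 th (fun phi => phi) (@trev _) (head 0) (td (evl a (ext s))) (verts R (sdim s)).
 apply: (@eq_th _ _ _ _ _ (simp R (sdim s)) (simp R (sdim s))) => //.
 - exact: hK.
 - exact: loc.
 - by move=> w Kw; rewrite (td_ev _ (@cts_ext _ _ s)).
 - exact: tin_verts.
rewrite th_homotopy //; [by rewrite ev_verts|exact: rB| |].
- by move=> phi u; exact: trev_td.
- by move=> phi; rewrite /trev /= expr0 mul1r.
Qed.

Lemma tcup_rev V (phi psi : seq V -> rat) u : tcup phi psi (rev u) =
 tcup (psi \o @rev V) (phi \o @rev V) u.
rewrite !tcupE size_rev [RHS](reindex_inj rev_ord_inj) /=; apply: eq_bigr => -[i iu] _ /=.
rewrite mulrC take_rev drop_rev; congr (_ * _).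
 by congr (psi (rev (take _ _))); lia.
Qed.

Lemma bin2D k l : 'C(k + l, 2) = ('C(k, 2) + 'C(l, 2) + k * l)%N.
elim: l => [|l ih]; first by rewrite addn0 muln0 !addn0.
by rewrite addnS !binS ih !bin1; lia.
Qed.

(** Reversal exchanges front and back faces. By [bin2D] the signs on the two sides differ by
    (-1)^(ij), which is 1 in even degrees. *)
Lemma revc_cupc i j a b : hdeg i a -> hdeg j b -> ~~ odd i -> ~~ odd j ->
 revc (cupc a b) = cupc (revc b) (revc a).
move=> ai bj oi oj; apply/funext => s; set u := verts R (sdim s); pose g := ext s.
have Ku : tin (simp R _) u by exact: tin_verts.
have rE c w : tin (simp R (sdim s)) w -> evl (revc c) g w = trev (evl c g) w.
 case: w => [|x w] Kw; first by rewrite /trev mulr0.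
 set p := size w; have sw : size (x :: w) = p.+1 by [].
 have fc := @cts_ext _ _ s _ _ sw Kw.
 rewrite (ev_size _ _ sw) (@app_simp _ _ _ _ (mkcts fc)) // /revc /= /trev size_verts sw.
 congr (_ * _).
 rewrite (@ev_size _ _ _ _ _ _ p) ?size_rev ?size_verts //.
 rewrite (@ev_size _ _ _ _ _ _ p) ?size_rev //.
 apply: eq_app => t.
 have Kt : simp R p (comb (rev (verts R p)) (set_val t)).
 apply: convex_simp; rewrite ?size_rev ?size_verts //; last by apply/set_mem; case: t.
 by apply: tin_rev; exact: tin_verts.
 rewrite -[X in ext _ X]/(set_val (spt Kt)) extE /= /g; congr (ext s _).
 rewrite /comb; under eq_bigr do rewrite summxE scaler_suml.
 rewrite exchange_big /=; apply: eq_bigr => k _; have kp := ltn_ord k.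
 rewrite nth_rev ?size_verts // nth_rev ?sw //.
 have lp : (p.+1 - k.+1 < p.+1)%N by lia.
 rewrite (nth_verts R (Ordinal lp)) (bigD1 (Ordinal lp)) //= !mxE !eqxx mulr1.
 rewrite big1 ?addr0 // => l lk; by rewrite !mxE (negbTE lk) mulr0 scale0r.
rewrite cupcE -/u -/g (@eq_tcup_in _ (simp R (sdim s)) _ (trev (evl b g)) _ (trev (evl a g))) //; last first.
- by move=> w Kw _; exact: rE.
- by move=> w Kw _; exact: rE.
rewrite /revc -/u -/g {1}/trev (ev_cupc _ _ (@cts_ext _ _ s)); last exact: tin_rev.
rewrite tcup_rev !tcupE mulr_sumr; apply: eq_bigr => -[p /= pu] _.
rewrite /trev /=; set P := take _ _; set Q := drop _ _.
have sP : size P = p.+1 by rewrite size_takel.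
have sQ : size Q = (size u - p)%N by rewrite size_drop.
have ev0 c k w : hdeg k c -> size w <> k.+1 -> evl c g w = 0.
 move=> ck; case: w => // x w wk; rewrite /evl /app; case: pselect => // fc.
 by apply: ck => /= e; apply: wk; rewrite /= e.
case: (eqVneq p j) => [pj|/eqP pj]; last first.
 by rewrite (ev0 b j) ?size_rev ?sP //; [rewrite !(mul0r, mulr0)|lia].
case: (eqVneq (size Q) i.+1) => [qi|/eqP qi]; last first.
 by rewrite (ev0 a i) ?size_rev //; rewrite !(mul0r, mulr0).
have -> : size u = (i + j).+1 by lia.
rewrite sP qi pj mulrACA -exprD; congr (_ * _).
rewrite -signr_odd -[in RHS]signr_odd; congr (_ ^+ _); congr nat_of_bool.
rewrite !binS !bin1 bin2D !oddD oddM (negbTE oi) (negbTE oj).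
by case: (odd 'C(i, 2)); case: (odd 'C(j, 2)).
Qed.

Lemma revc_cob a : cob (revc a) = revc (cob a).
have e c : revc c = c - revhc (cob c) - cob (revhc c).
 apply/funext => s; have h := revhcP c s.
 rewrite -[RHS]/(c s - revhc (cob c) s - cob (revhc c) s).
 by rewrite -addrA -opprD h opprB addrC subrK.
rewrite [in LHS]e [in RHS]e !linearB /= !cob_cob subr0.
have z : revhc 0 = 0.
 apply/funext => s; apply: (th_eq0 (A := simp R (sdim s)) (B := simp R (sdim s))).
 - by case=> // x u /tin_cons[].
 - move=> psi u Ku psi0; split; first exact: psi0.
 by rewrite /trev psi0 ?mulr0 ?size_rev //; exact: tin_rev.
 - exact: tin_verts.
 by move=> w _ _; case: w => //= x w; rewrite /app; case: pselect.
by rewrite z subr0.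
Qed.

Lemma cupc_comm i j a b : hdeg i a -> hdeg j b -> ~~ odd i -> ~~ odd j ->
 cob a = 0 -> cob b = 0 ->
 exists c, cob c = cupc a b - cupc b a.
move=> ai bj oi oj ac bc.
have revE c : cob c = 0 -> c - revc c = cob (revhc c).
 move=> cc; apply/funext => s; have := revhcP c s.
 rewrite cc (_ : revhc 0 s = 0) ?add0r; first by move/esym.
 apply: (th_eq0 (A := simp R (sdim s)) (B := simp R (sdim s))).
 - by case=> // x u /tin_cons[].
 - move=> psi u Ku psi0; split; first exact: psi0.
 by rewrite /trev psi0 ?mulr0 ?size_rev //; exact: tin_rev.
 - exact: tin_verts.
 by move=> w _ _; case: w => //= x w; rewrite /app; case: pselect.
have abc : cob (cupc a b) = 0.
 have /is_cocycleP := is_cocycle_cupc (introT (is_cocycleP a) ac) (introT (is_cocycleP b) bc).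
 by [].
have ra : cob (revc a) = 0.
 rewrite revc_cob ac; apply/funext => s; rewrite /revc /trev.
 by case: (rev _) => [|x w] /=; rewrite ?mulr0 // /app; case: pselect => *; rewrite mulr0.
(* One homotopy replaces the product by its reversal, which is the product of the reversals in the
   other order; the other two restore the factors [b] and [a] one at a time. *)
exists (revhc (cupc a b) - cupc (revhc b) (revc a) - cupc (csign b) (revhc a)).
rewrite !linearB /= -revE // !cob_cupc -!revE // ra.
have z c : cupc c 0 = 0 :> cochain R X by have := cupcZr 0 c c; rewrite !scale0r.
have z' c : cupc 0 c = 0 :> cochain R X by have := cupcZl 0 c c; rewrite !scale0r.
have sb : cob (csign b) = 0 by rewrite (csign_hdeg bj) linearZ /= bc scaler0.
have ss : csign (csign b) = b.
 by apply/funext => s; rewrite /csign mulrA -expr2 sqrr_sign mul1r.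
rewrite sb ss !z z' addr0 add0r (revc_cupc ai bj oi oj).
have cupcBl x y w : cupc (x - y) w = cupc x w - cupc y w :> cochain R X.
 by rewrite cupcDl -scaleN1r cupcZl scaleN1r.
have cupcBr x y w : cupc w (x - y) = cupc w x - cupc w y :> cochain R X.
 by rewrite cupcDr -scaleN1r cupcZr scaleN1r.
rewrite cupcBl cupcBr.
move: (cupc a b) (cupc (revc b) (revc a)) (cupc b (revc a)) (cupc b a) => x y z1 w.
by rewrite !opprB !subrKA.
Qed.

End commutativity.
End cup_cochains.

(** * Cross products of local classes *)

Section local_product.
Context (R : realType).
Lemma evalvB c (a b : cochain R 'rV[R]_c) : evalv (a - b) = evalv a - evalv b.
exact: appB. Qed.
Lemma evalvZ c k (a : cochain R 'rV[R]_c) : evalv (k *: a) = k * evalv a.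
by rewrite /evalv /app; case: pselect => // _; rewrite mulr0. Qed.
Lemma evalvE c (a : cochain R 'rV[R]_c) :
 evalv a = a (Simplex (mkcts (@vsimpv_cts R c))).
exact: app_simp. Qed.

Lemma evalv_exact c (e : cochain R 'rV[R]_c) : van (@nz R c) e ->
 evalv (cob e) = 0.
move=> ez; rewrite evalvE; case: c e ez => [|c] e ez; rewrite /cob //=.
apply: big1 => i _; rewrite ez ?mulr0 // => t /=.
rewrite /nz /=; apply/eqP => e0.
have tS := stdP (simplex_map R (fun k : 'I_c.+1 => inord (bump i k) : 'I_c.+2) t).
have := simp_eq_gt0 tS e0 i; rewrite mxE big1 ?ltxx // => j /eqP/(congr1 val) /=.
have jn := ltn_ord j; rewrite inordK; last by rewrite ltnS /bump (leq_trans (leq_add (leq_b1 _) (leqnn j))).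
by move=> ei; have := neq_bump i j; rewrite ei eqxx.
Qed.

(** R^(q + p) as a product: [jproj] keeps the first [p] coordinates and [kproj] the last [q]. The
    recursion removes the last coordinate, as the induction of [local_product] does. *)
Fixpoint jproj p q : 'rV[R]_(q + p) -> 'rV[R]_p :=
 if q is q'.+1 then fun v => jproj (vproj v) else id.
Fixpoint kproj p q : 'rV[R]_(q + p) -> 'rV[R]_q :=
 if q is q'.+1 then fun v => vlift (kproj (vproj v)) (v 0 ord_max) else fun=> 0.

Lemma jproj_cts p q : continuous (@jproj p q).
elim: q => [|q ih]; first by move=> v; exact: cvg_id.
by move=> v; apply: (@continuous_comp _ _ _ (@vproj R _) (@jproj p q)); [exact: vproj_cts|exact: ih].
Qed.

Lemma kproj_cts p q : continuous (@kproj p q).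
elim: q => [|q ih]; first exact: cst_continuous.
move=> v; apply: vlift_cts; last exact: coord_continuous.
by apply: (@continuous_comp _ _ _ (@vproj R _) (@kproj p q)); [exact: vproj_cts|exact: ih].
Qed.

Lemma jkproj0 p q (v : 'rV[R]_(q + p)) : jproj v = 0 -> kproj v = 0 -> v = 0.
elim: q v => [|q ih] v //= j0 /eqP; rewrite vlift_eq0 => /andP[/eqP k0 /eqP m0].
by rewrite -(vlift_proj v) m0 (ih _ j0 k0); apply/eqP; rewrite vlift_eq0 !eqxx.
Qed.

Lemma vproj0 c : vproj (0 : 'rV[R]_c.+1) = 0.
by apply/rowP => j; rewrite !mxE. Qed.
Lemma jproj0 p q : @jproj p q 0 = 0.
by elim: q => //= q ih; rewrite vproj0. Qed.
Lemma kproj0 p q : @kproj p q 0 = 0.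
by elim: q => //= q ih; rewrite vproj0 ih mxE; apply/eqP; rewrite vlift_eq0 !eqxx.
Qed.

Lemma pb_comp_cst (X Y Z : topT) (f : X -> Y) (g : Y -> Z) (a : cochain R Z) :
 continuous f -> pb f (pb g a) = pb (g \o f) a.
move=> fc; apply/funext => s; rewrite {1}/pb pb_app //.
by apply: (cts_comp_img (A := setT)) => // x _; exact: fc.
Qed.

(* The cup product of classes vanishing off two subspaces only vanishes on small
 simplices; [z] is its correction to a class vanishing off the intersection. *)
Theorem local_product p q (a : cochain R 'rV[R]_p) (b : cochain R 'rV[R]_q)
 (z e : cochain R 'rV[R]_(q + p)) :
 coc setT a -> van (@nz R p) a -> hdeg p a ->
 coc setT b -> van (@nz R q) b -> hdeg q b ->
 coc setT z -> van (@nz R (q + p)) z ->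
 van [set v | jproj v != 0] e -> van [set v | kproj v != 0] e ->
 z = cupc (pb (@jproj p q) a) (pb (@kproj p q) b) - cob e ->
 evalv z = evalv a * evalv b.
Proof.
move=> ac az ap.
elim: q b z e => [|q ih] b z e bc bz bq zc zz ej ek zE.
 rewrite zE evalvB (evalv_exact ej) subr0 !evalvE /cupc /=.
 rewrite big_ord_recr /= big1 ?add0r => [|i _]; last first.
 rewrite (pb_hdeg _ bq) ?mulr0 //= => /eqP; rewrite subn_eq0 leqNgt ltn_ord //.
 congr (_ * _).
 apply: app_simp => t /=; congr vsimp; apply/rowP => j.
 by rewrite mxE (big_pred1 j) // => i /=; rewrite inord_val.
 set s := face _ _ _; have s0 : sdim s = 0%N by rewrite /= subnn.
 move: s s0 => s s0; rewrite /pb (@app_simp _ _ _ _ (mkcts (@cst0_cts R (sdim s)))) //.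
 by apply: point_cochain; rewrite /= s0.
(* With [b] the coboundary of [beta], the cross product of [a] and [beta] exhibits [z] as a
   coboundary up to sign; restricting to height -1 then lowers [q] by one. *)
have [beta [bu bi bE]] := exact_upper bc bz bq.
have bn : coc (@nz R q.+1) beta by move=> s sz; rewrite bE; exact: bz.
pose sg c (w : 'rV[R]_c) := vlift w (-1).
have sgc c : continuous (sg c) by exact: vlift1_cts.
have sgn c (w : 'rV[R]_c) : nz (sg c w) by apply: lower_nz; exact: vlift_lower.
pose b1 := pb (sg q) beta.
have b1E : evalv b = (-1) ^+ q.+1 * evalv b1.
 rewrite -bE (evalv_cob bn bu) /b1 /evalv pb_app //.
 exact: vsimpv_cts.
pose A := pb (@jproj p q.+1) a; pose B := pb (@kproj p q.+1) beta.
have Ac : cob A = 0.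
 apply/funext => s; apply: (pb_coc (A := setT) (B := setT) _ _ ac) => // v _.
 exact: jproj_cts.
have Ap : hdeg p A by exact: pb_hdeg.
have BE : pb (@kproj p q.+1) b = cob B.
 apply/funext => s; rewrite (@pb_cob _ _ _ _ setT) ?bE // => v _.
 exact: kproj_cts.
have AB : cupc A (cob B) = (-1) ^+ p *: cob (cupc A B).
 rewrite cob_cupc Ac (csign_hdeg Ap) cupcZl scalerDr scalerA -expr2 sqrr_sign scale1r.
 by have := cupcZl 0 A B; rewrite !scale0r => ->; rewrite scaler0 add0r.
pose g := (-1) ^+ p *: cupc A B - e.
have gE : cob g = z by rewrite /g linearB linearZ /= -AB -BE zE.
pose A1 := [set v : 'rV[R]_(q.+1 + p) | jproj v != 0].
pose A2 := [set v : 'rV[R]_(q.+1 + p) | upper (kproj v)].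
have A12 : A1 `|` A2 = @upper R (q + p).
 apply/seteqP; split=> v.
 case=> [j0|[k0|k0]]; [left|left|right].
 - by apply: contraNneq j0 => v0; rewrite /= v0; apply/eqP; exact: jproj0.
 - move: k0; rewrite vproj_lift; apply: contraNneq => ->.
 by apply/eqP; exact: kproj0.
 - by move: k0; rewrite /= vlift_max.
 case=> [v0|v0]; last by right; right; rewrite /= vlift_max.
 case: (eqVneq (jproj (vproj v)) 0) => [j0|]; last by left.
 right; left; rewrite /= vproj_lift; apply: contraNneq v0 => k0.
 by rewrite (jkproj0 j0 k0).
have AA : van A1 A by apply: pb_van az.
have BB : van A2 B by apply: pb_van bu.
(* [g] vanishes on simplices inside [A1] and on simplices inside [A2], but not on all simplices of
   the union [upper]; [f] repairs this, after which the suspension formula applies. *)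
have [f [f1 f2 fE]] : exists f, [/\ van A1 f, van A2 f &
 forall s, img_in (A1 `|` A2) s -> cob f s = g s].
 apply: small_exact.
 - apply: (@open_comp _ _ (@jproj p q.+1) (@nz R p)); last exact: nz_open.
 by move=> v _; exact: jproj_cts.
 - apply: (@open_comp _ _ (@kproj p q.+1) (@upper R q)); last exact: upper_open.
 by move=> v _; exact: kproj_cts.
 - by rewrite gE A12; apply: van_sub zz => v; exact: upper_nz.
 - by apply: vanB => //; apply: vanZ; exact: van_cupcl.
 - apply: vanB; first by apply: vanZ; exact: van_cupcr.
 by apply: van_sub ek => v; exact: upper_nz.
pose g' := g - cob f.
have g'E : cob g' = z by rewrite /g' linearB /= cob_cob subr0.
have g'u : van (@upper R (q + p)) g'.
 by move=> s su; rewrite -[LHS]/(g s - cob f s) fE ?A12 // subrr.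
have g'n : coc (@nz R (q + p).+1) g' by rewrite /coc g'E.
rewrite -g'E (evalv_cob g'n g'u).
pose y := pb (sg (q + p)%N) g'.
have -> : app g' (fun t : simp R (q + p) => vlift (vsimp (set_val t)) (-1)) = evalv y.
 by rewrite /evalv /y pb_app //; exact: vsimpv_cts.
have pbcob c : pb (sg (q + p)%N) (cob c) = cob (pb (sg (q + p)%N) c).
 by apply/funext => s; rewrite (@pb_cob _ _ _ _ setT) // => v _; exact: sgc.
have eE : pb (sg (q + p)%N) e = 0.
 apply/funext => s; apply: (pb_van (A := setT) (B := [set v | kproj v != 0]) _ ek) => // v _ /=.
 by rewrite vproj_lift vlift_eq0 vlift_max oppr_eq0 oner_eq0 andbF.
have pbZ k (c : cochain R _) : pb (sg (q + p)%N) (k *: c) = k *: pb (sg (q + p)%N) c.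
 apply/funext => s; rewrite -[RHS]/(k * pb (sg (q + p)%N) c s) /pb /app.
 by case: pselect => // _; rewrite mulr0.
have yE : y = (-1) ^+ p *: cupc (pb (@jproj p q) a) (pb (@kproj p q) b1) -
 cob (pb (sg (q + p)%N) f).
 rewrite /y /g' pbB pbcob /g pbB pbZ eE subr0; congr (_ *: _ - _).
 have -> : pb (sg (q + p)%N) (cupc A B) = cupc (pb (sg (q + p)%N) A) (pb (sg (q + p)%N) B).
 by apply/funext => s; rewrite (@pb_cupc _ _ _ _ setT) // => v _; exact: sgc.
 have eA : pb (sg (q + p)%N) A = pb (@jproj p q) a.
 rewrite /A (pb_comp_cst (@jproj p q.+1) a (sgc (q + p)%N)).
 by congr (pb _ a); apply/funext => w; rewrite /comp /sg /= vproj_lift.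
 have eB : pb (sg (q + p)%N) B = pb (@kproj p q) b1.
 rewrite /B /b1 (pb_comp_cst (@kproj p q.+1) beta (sgc (q + p)%N)).
 rewrite (pb_comp_cst (sg q) beta (@kproj_cts p q)).
 by congr (pb _ beta); apply/funext => w; rewrite /comp /sg /= vproj_lift vlift_max.
 by rewrite eA eB.
have yE' : (-1) ^+ p *: y = cupc (pb (@jproj p q) a) (pb (@kproj p q) b1) -
 cob ((-1) ^+ p *: pb (sg (q + p)%N) f).
 rewrite yE scalerBr scalerA -expr2 sqrr_sign scale1r.
 by congr (_ - _); apply: esym; exact: linearZ.
have := ih b1 ((-1) ^+ p *: y) ((-1) ^+ p *: pb (sg (q + p)%N) f).
rewrite evalvZ => h.
have {h} yv : (-1) ^+ p * evalv y = evalv a * evalv b1.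
 apply: h => //.
 - by apply: (pb_coc (B := @nz R q.+1)) => // v _; exact: sgc.
 - by apply: pb_van bu => v; exact: vlift_upper.
 - exact: pb_hdeg.
 - move=> s _; rewrite linearZ /= -[LHS]/(_ * _) /y.
 have g'T : coc setT (pb (sg (q + p)%N) g').
 by apply: (pb_coc (B := @nz R (q + p).+1)) => // v _; exact: sgc.
 by rewrite g'T ?mulr0.
 - by apply: vanZ; apply: pb_van g'u => v; exact: vlift_upper.
 - apply: vanZ; apply: (pb_van _ f1) => v; rewrite /A1 /= /sg vproj_lift; exact.
 - apply: vanZ; apply: (pb_van _ f2) => v v0; rewrite /A2 /upper /=; left.
 by rewrite /sg !vproj_lift.
rewrite b1E mulrCA -yv mulrA -exprD; congr (_ * _).
Qed.

End local_product.

(** * Stratified spaces: classes supported on closed unions of cells *)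

Definition cells_of (X : Type) (T : finType) (Om : T -> set X) (Z : {set T}) : set X :=
 [set x | exists2 K, K \in Z & Om K x].

(* A stratification of [X] by cells [Om I] of codimension [cd I] with charts
 [Nb I].  Cells that are not [good] are paired by [mate] (an open cell and a
 closed cell of codimension one more) and contribute nothing, by [rot]. *)
Record strat (R : realType) (X : topT) := Strat {
 cell :> finType;
 Om : cell -> set X;
 Nb : cell -> set X;
 Wb : cell -> set X;
 cd : cell -> nat;
 rk : cell -> nat;
 mate : cell -> cell;
 sl : forall I : cell, 'rV[R]_(cd I) -> X;
 yc : forall I : cell, X -> 'rV[R]_(cd I);
 hh : cell -> X -> R -> X;
 Om_cover : forall x, exists I, Om I x;
 Om_inj : forall I J x, Om I x -> Om J x -> I = J;
 Nb_open : forall I, open (Nb I);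
 Om_Nb : forall I, Om I `<=` Nb I;
 Nb_Wb : forall I, Nb I `<=` Wb I;
 Wb_rk : forall I K x, Wb I x -> Om K x -> [\/ K = I, K = mate I | (rk K < rk I)%N];
 yc_cts : forall I x, Nb I x -> cts_at x (yc I);
 yc_Om : forall I x, Nb I x -> Om I x <-> yc I x = 0;
 sl_cts : forall I, continuous (sl (I := I));
 sl_Nb : forall I w, Nb I (sl (I := I) w);
 yc_sl : forall I w, yc I (sl w) = w;
 hh_cts : forall I x (r : R), Nb I x -> cts_at (x, r) (fun p => hh I p.1 p.2);
 hh0 : forall I x, Nb I x -> hh I x 0 = x;
 hh1 : forall I x, Nb I x -> hh I x 1 = sl (yc I x);
 hh_Nb : forall I x r, 0 <= r <= 1 -> Nb I x -> Nb I (hh I x r);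
 hh_yc : forall I x r, 0 <= r <= 1 -> Nb I x -> yc I (hh I x r) = yc I x;
 mateK : involutive mate;
 rk_mate : forall I, rk (mate I) = rk I;
 cd_mate : forall I, mate I != I ->
 (cd I = (cd (mate I)).+1 \/ cd (mate I) = (cd I).+1);
 mate_open : forall I x, cd (mate I) = (cd I).+1 -> Nb I x -> ~ Om (mate I) x;
 rot : forall I a, cd (mate I) = (cd I).+1 -> coc (Wb I) a ->
 van [set x | Wb I x /\ ~ (Om I x \/ Om (mate I) x)] a ->
 app a (fun t : simp R (cd I) => sl (vsimp (set_val t))) = 0;
 cd_even : forall I, mate I = I -> ~~ odd (cd I);
 cl_cells : forall I K L x y, mate I = I -> closure (Om I) x -> Om K x ->
 L = K \/ L = mate K -> Om L y -> closure (Om I) y;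
 cl_rk : forall I K x, mate I = I -> closure (Om I) x -> Om K x -> K <> I -> (rk I < rk K)%N;
 cl_cd : forall I K x, mate I = I -> mate K = K -> closure (Om I) x -> Om K x ->
 K <> I -> (cd I < cd K)%N }.

Section stratification.
Variables (R : realType) (X : topT) (S : strat R X).
Implicit Types (I K : S) (Z : {set S}) (a b : cochain R X).
Notation cl := (cells_of (Om (s := S))).
Definition slev I a : rat := app a (fun t : simp R (cd I) => sl (vsimp (set_val t))).
Lemma slevE I a : slev I a = evalv (pb (sl (I := I)) a).
by rewrite /evalv pb_app //; exact: vsimpv_cts. Qed.
Lemma slevB I a b : slev I (a - b) = slev I a - slev I b.
exact: appB. Qed.
Lemma slevZ I c a : slev I (c *: a) = c * slev I a.
by rewrite /slev /app; case: pselect => // _; rewrite mulr0. Qed.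

Lemma sl_nz I w : nz w -> (Nb I `&` ~` Om I) (sl (I := I) w).
move=> wz; split; first exact: sl_Nb.
by move/(yc_Om (sl_Nb _)); rewrite yc_sl => w0; move: wz; rewrite /nz /= w0 eqxx.
Qed.

Lemma slev_van I (A : set X) a : van A a -> Nb I `<=` A -> slev I a = 0.
by move=> aA NA; apply: app_van aA _ => t; apply: NA; exact: sl_Nb. Qed.

Lemma slev_exact I (A : set X) b : van A b -> Nb I `&` ~` Om I `<=` A ->
 slev I (cob b) = 0.
move=> bA NA; rewrite slevE.
have -> : pb (sl (I := I)) (cob b) = cob (pb (sl (I := I)) b).
 apply/funext => s; rewrite (@pb_cob _ _ _ _ setT) // => w _.
 exact: sl_cts.
by apply: evalv_exact; apply: pb_van bA => w /sl_nz /NA.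
Qed.

(** The chart retracts onto the slice while keeping the normal coordinate, so the question reduces
    to [local_exact] in dimension [cd I]. *)
Lemma local_cell_exact I i a :
 coc (Nb I) a -> van (Nb I `&` ~` Om I) a -> hdeg i a ->
 (i = cd I -> slev I a = 0) ->
 exists2 b, van (Nb I `&` ~` Om I) b & forall s, img_in (Nb I) s -> cob b s = a s.
move=> aN aV ai a0.
have [b bz bE] : exists2 b, van (@nz R (cd I)) b & cob b = pb (sl (I := I)) a.
 apply: (@local_exact R (cd I) i).
 - by apply: (pb_coc (B := Nb I)) => // w _; [exact: sl_cts|exact: sl_Nb].
 - by apply: pb_van aV => w; exact: sl_nz.
 - exact: pb_hdeg.
 - by move=> /a0; rewrite slevE.
apply: (@retract_exact R _ _ _ _ (@nz R (cd I)) (yc I) (sl (I := I)) (hh I) a b) => //.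
- by move=> x r Nx; exact: hh_cts.
- by move=> x Nx; exact: yc_cts.
- by move=> x; exact: hh0.
- by move=> x; exact: hh1.
- by move=> x r; exact: hh_Nb.
- move=> x r r01 [Nx Ox]; have Nh := hh_Nb r01 Nx; split=> //.
 by move/(yc_Om Nh); rewrite hh_yc // => /(yc_Om Nx).
- by move=> x [Nx Ox]; apply/eqP => y0; apply: Ox; apply/(yc_Om Nx).
- by move=> s; rewrite bE.
Qed.

Lemma local_cell_class I : exists a, [/\ coc (Nb I) a,
 van (Nb I `&` ~` Om I) a, hdeg (cd I) a & slev I a = 1].
have [a [ac az ai a1]] := local_class R (cd I).
exists (pb (yc I) a); split.
- by apply: (pb_coc (B := setT)) => // x Nx; exact: yc_cts.
- apply: pb_van az => x [Nx Ox]; apply/eqP => y0; apply: Ox; exact/(yc_Om Nx).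
- exact: pb_hdeg.
rewrite /slev pb_app.
 by rewrite -a1; apply: eq_app => t; rewrite yc_sl.
by move=> t; apply: (@continuous_comp _ _ _ (fun t : simp R (cd I) => vsimp (set_val t)) (sl (I := I)));
 [exact: vsimpv_cts|exact: sl_cts].
Qed.

Lemma good_piece (U V : set X) I i a : open U -> open V -> V `<=` U -> Nb I `<=` U ->
 U `<=` Nb I `|` V -> Nb I `&` V = Nb I `&` ~` Om I ->
 coc U a -> van V a -> hdeg i a -> (i = cd I -> slev I a = 0) ->
 exists2 b, van V b & forall s, img_in U s -> cob b s = a s.
move=> oU oV VU NU UNV NV aU aV ai a0.
have [b bV bN] : exists2 b, van (Nb I `&` V) b &
 forall s, img_in (Nb I) s -> cob b s = a s.
 rewrite NV; apply: local_cell_exact a0 => //.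
 exact: van_sub aU.
 by rewrite -NV; apply: van_sub aV => x [].
exact: (excise oU oV (@Nb_open _ _ S I) VU NU UNV aU aV bV bN).
Qed.

Lemma class_on (U V : set X) I : open U -> open V -> V `<=` U -> Nb I `<=` U ->
 U `<=` Nb I `|` V -> Nb I `&` V = Nb I `&` ~` Om I ->
 exists a, [/\ coc U a, van V a, hdeg (cd I) a & slev I a = 1].
move=> oU oV VU NU UNV NV; have [t [tN tV ti t1]] := local_cell_class I.
have [a [aU aV aN]] : exists a, [/\ coc U a, van V a &
 forall s, img_in (Nb I) s -> a s = t s].
 by apply: (extend oU oV (@Nb_open _ _ S I)) => //; rewrite NV.
exists (trunc (cd I) a); split.
- by move=> s Us; rewrite cob_trunc /trunc aU // if_same.
- exact: van_trunc.
- exact: hdeg_trunc.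
have sc : continuous (fun t : simp R (cd I) => sl (I := I) (vsimp (set_val t))).
 by move=> t'; apply: (@continuous_comp _ _ _ (fun t : simp R (cd I) => vsimp (set_val t)) (sl (I := I)));
 [exact: vsimpv_cts|exact: sl_cts].
rewrite -t1 /slev !(@app_simp _ _ _ _ (mkcts sc)) // /trunc /= eqxx aN //.
by move=> t' /=; exact: sl_Nb.
Qed.

Lemma coc_cut (U : set X) a : coc U a -> van U (cob (cut U a)).
move=> aU s Us; rewrite -(aU s Us); apply: eq_cob Us => s' Us'.
by rewrite cutE.
Qed.

Lemma hdeg_cut (U : set X) i a : hdeg i a -> hdeg i (cut U a).
by move=> ai s si; rewrite /cut ai // if_same. Qed.

Lemma slev_cut (U : set X) I a : Nb I `<=` U -> slev I (cut U a) = slev I a.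
move=> NU; have sc : continuous (fun t : simp R (cd I) => sl (I := I) (vsimp (set_val t))).
 by move=> t'; apply: (@continuous_comp _ _ _ (fun t : simp R (cd I) => vsimp (set_val t)) (sl (I := I)));
 [exact: vsimpv_cts|exact: sl_cts].
rewrite /slev !(@app_simp _ _ _ _ (mkcts sc)) // cutE // => t /=.
by apply: NU; exact: sl_Nb.
Qed.

(** The recursions over cells replace [a] by [a - cob c], which must again be homogeneous and
    defined on all simplices; cutting and truncating a primitive provides such a [c]. In degree 0
    the hypothesis already makes [a] vanish on [U]. *)
Lemma hom_prim (U V : set X) i a b : V `<=` U -> van V b -> hdeg i a ->
 (forall s, img_in U s -> cob b s = a s) ->
 exists c : cochain R X, [/\ van V c, hdeg i (cob c) &
 forall s, img_in U s -> cob c s = a s].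
move=> VU bV; case: i => [|i] ai bE.
 exists 0; split=> // [|s Us]; rewrite linear0 //.
 case: (eqVneq (sdim s) 0%N) => [s0|/eqP/ai//].
 by rewrite -bE // /cob s0.
exists (cut U (trunc i b)); split.
- by apply: van_cut; apply: van_sub (van_trunc i bV) => x [].
- by apply: hdeg_cob; apply: hdeg_cut; exact: hdeg_trunc.
move=> s Us; rewrite (@eq_cob _ _ U _ (trunc i b)) // => [|s' Us'].
 by rewrite cob_trunc /trunc bE //; case: eqP => [//|/ai ->].
by rewrite cutE.
Qed.

(** The two mates cancel: each alone would contribute one class, in consecutive degrees, and the
    coboundary maps one isomorphically to the other. By [rot] the class of [I] is not the
    restriction of a cocycle on [U], so its coboundary is nonzero on the slice of the mate. *)
Lemma bad_piece (U V : set X) I i a : cd (mate I) = (cd I).+1 ->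
 open U -> open V -> V `<=` U -> Wb I `<=` U -> Nb (mate I) `<=` U ->
 (forall x, U x <-> [\/ V x, Om I x | Om (mate I) x]) ->
 (forall x, V x -> ~ Om I x /\ ~ Om (mate I) x) ->
 coc U a -> van V a -> hdeg i a ->
 exists2 b, van V b & forall s, img_in U s -> cob b s = a s.
move=> cdI oU oV VU WU CU UE VE aU aV ai; set C := mate I.
have NU : Nb I `<=` U by move=> x /Nb_Wb/WU.
pose U1 := V `|` Nb I.
have oU1 : open U1 by apply: openU => //; exact: Nb_open.
have U1U : U1 `<=` U by move=> x [/VU|/NU].
have NV : Nb I `&` V = Nb I `&` ~` Om I.
 apply/seteqP; split=> x [Nx h]; split=> //; first by case: (VE _ h).
 have /UE[//|//|Cx] := NU _ Nx; by case: (mate_open cdI Nx Cx).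
have N1 : U1 `<=` Nb I `|` V by move=> x [|]; [right|left].
have NU1 : Nb I `<=` U1 by move=> x; right.
have VU1 : V `<=` U1 by move=> x; left.
have NC : Nb C `&` U1 = Nb C `&` ~` Om C.
 apply/seteqP; split=> x [Nx h]; split=> //.
 case: h => [/VE[]//|NIx]; exact: mate_open cdI NIx.
 have /UE[Vx|Ix|//] := CU _ Nx; first by left.
 by right; exact: Om_Nb.
have UC : U `<=` Nb C `|` U1.
 move=> x /UE[Vx|Ix|Cx]; [by right; left|by right; right; exact: Om_Nb|].
 by left; exact: Om_Nb.
have rotI c : coc U c -> van V c -> slev I c = 0.
 move=> cU cV; apply: rot cdI _ _; first exact: van_sub cU.
 apply: van_sub cV => x [/WU/UE[//|Ix|Cx] h]; case: h; [by left|by right].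
have [b1 b1V b1E] := good_piece oU1 oV VU1 NU1 N1 NV (van_sub U1U aU) aV ai (fun _ => rotI a aU aV).
have cutV c : van V c -> van V (cut U1 c).
 by move=> cV; apply: van_cut; apply: van_sub cV => x [].
have [f [fV fi fE]] := hom_prim VU1 b1V ai b1E.
pose a1 : cochain R X := a - cob f.
have a1U : coc U a1 by rewrite /coc /a1 linearB /= cob_cob subr0.
have a1U1 : van U1 a1.
 by move=> s Us; rewrite -[LHS]/(a s - cob f s) fE // subrr.
have a1i : hdeg i a1 by exact: hdegB.
suff [b bV bE] : exists2 b, van V b & forall s, img_in U s -> cob b s = a1 s.
 exists (b + f); first exact: vanD.
 move=> s Us; rewrite linearD -[LHS]/(cob b s + cob f s) bE //.
 by rewrite -[X in X + _]/(a s - cob f s) subrK.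
have [mu0|mu] := pselect (i = cd C -> slev C a1 = 0).
 have [b bU1 bE] := good_piece oU oU1 U1U CU UC NC a1U a1U1 a1i mu0.
 by exists b => //; exact: van_sub bU1.
have iI : i = (cd I).+1.
 by apply: contrapT => iI; apply: mu; rewrite /C cdI.
(* Only degree [(cd I).+1] is left. [t] is the class of the cell [I] on [U1]; the coboundary of its
   extension by zero vanishes on [U1], and [nu] is the incidence number of the two cells. *)
have [t [tU1 tV ti t1]] := class_on oU1 oV VU1 NU1 N1 NV.
pose c : cochain R X := cut U1 t; pose nu := slev C (cob c).
have cU1 : van U1 (cob c) by exact: coc_cut.
have ci : hdeg i (cob c).
 by rewrite iI; apply: hdeg_cob; exact: hdeg_cut.
have cc : coc U (cob c) by move=> s _; rewrite cob_cob.
(* Otherwise [c] could be corrected to a cocycle on [U] with value 1 on the slice of [I], against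
   [rot]. *)
have nu0 : nu != 0.
 apply/eqP => nu0.
 have [e eU1 eE] := good_piece oU oU1 U1U CU UC NC cc cU1 ci (fun _ => nu0).
 have := rotI (c - e); rewrite slevB (slev_van eU1) // subr0 /c slev_cut // t1.
 suff h : coc U (c - e) /\ van V (c - e) by case: h => h1 h2 /(_ h1 h2)/eqP; rewrite oner_eq0.
 split.
 move=> s Us; have -> : cob (c - e) = cob c - cob e by rewrite linearB.
 by rewrite -[LHS]/(cob c s - cob e s) eE // subrr.
 by apply: vanB; [exact: cutV|exact: van_sub eU1].
pose a2 : cochain R X := a1 - (slev C a1 / nu) *: cob c.
have a20 : slev C a2 = 0 by rewrite slevB slevZ -/nu divfK // subrr.
have a2U : coc U a2.
 move=> s Us; have -> : cob a2 = cob a1.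
 by rewrite /a2 linearB linearZ /= cob_cob scaler0 subr0.
 exact: a1U.
have a2U1 : van U1 a2 by apply: vanB => //; exact: vanZ.
have a2i : hdeg i a2 by apply: hdegB => //; exact: hdegZ.
have [e eU1 eE] := good_piece oU oU1 U1U CU UC NC a2U a2U1 a2i (fun _ => a20).
exists (e + (slev C a1 / nu) *: c).
 by apply: vanD; [exact: van_sub eU1|apply: vanZ; exact: cutV].
move=> s Us; rewrite linearD linearZ /= -[LHS]/(cob e s + ((slev C a1 / nu) *: cob c) s) eE //.
by rewrite -[X in X + _]/(a1 s - _) subrK.
Qed.

Definition mstable Z := forall I, I \in Z -> mate I \in Z.

Lemma cellsC Z x : (~` cl Z) x <-> exists2 K, K \notin Z & Om K x.
split=> [h|[K KZ Kx] [L LZ Lx]].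
 have [K Kx] := Om_cover S x; exists K => //; apply/negP => KZ.
 by apply: h; exists K.
by case/negP: KZ; rewrite (Om_inj Kx Lx).
Qed.

Lemma cells_sub Z Z' : Z' \subset Z -> ~` cl Z `<=` ~` cl Z'.
by move=> /fintype.subsetP h x hx [K KZ Kx]; apply: hx; exists K => //; exact: h.
Qed.

Lemma Wb_cells Z I : mstable Z -> I \notin Z ->
 (forall K, K \in Z -> (rk I <= rk K)%N) -> Wb I `<=` ~` cl Z.
move=> mZ IZ rZ x Wx [K KZ Kx]; case: (Wb_rk Wx Kx) => [e|e|].
- by rewrite e (negbTE IZ) in KZ.
- by have := mZ _ KZ; rewrite e mateK (negbTE IZ).
by rewrite ltnNge rZ.
Qed.

Lemma remove_open Z I : mstable Z -> open (~` cl Z) -> I \in Z ->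
 (forall K, K \in Z -> (rk I <= rk K)%N) -> open (~` cl (Z :\ I :\ mate I)%SET).
move=> mZ oZ IZ rZ; set Z1 := (_ :\ _)%SET.
have mZ1 : mstable Z1.
 move=> K; rewrite !inE => /and3P[K1 K2 KZ].
 rewrite (inj_eq (can_inj (@mateK _ _ S))) K2 mZ // andbT /=.
 by rewrite -(inj_eq (can_inj (@mateK _ _ S))) mateK in K1.
have rZ1 K : K \in Z1 -> (rk I <= rk K)%N.
 by rewrite !inE => /and3P[_ _ /rZ].
have -> : ~` cl Z1 = ~` cl Z `|` (Nb I `|` Nb (mate I)).
 apply/seteqP; split=> x.
 move=> /cellsC[K KZ1 Kx].
 have [KZ|KZ] := boolP (K \in Z); last by left; apply/cellsC; exists K.
 move: KZ1; rewrite !inE KZ andbT negb_and !negbK => /orP[]/eqP e; right;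
 by [right; rewrite -e; exact: Om_Nb|left; rewrite -e; exact: Om_Nb].
 case=> [h [K KZ Kx]|[|] /Nb_Wb].
 - by apply: h; exists K => //; move: KZ; rewrite !inE => /and3P[].
 - by apply: Wb_cells => //; rewrite !inE eqxx ?andbF.
 - apply: Wb_cells => //; first by rewrite !inE eqxx.
 by move=> K /rZ1; rewrite rk_mate.
by apply: openU => //; apply: openU; exact: Nb_open.
Qed.

Lemma remove_cells Z I x : mstable Z -> I \in Z ->
 (~` cl (Z :\ I :\ mate I)%SET) x <-> [\/ (~` cl Z) x, Om I x | Om (mate I) x].
move=> mZ IZ; split=> [/cellsC[K KZ1 Kx]|].
 have [KZ|KZ] := boolP (K \in Z); last by apply: Or31; apply/cellsC; exists K.
 move: KZ1; rewrite !inE KZ andbT negb_and !negbK => /orP[]/eqP e.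
 by apply: Or33; rewrite -e.
 by apply: Or32; rewrite -e.
case=> [h|Ix|Ix]; apply/cellsC.
- by have /cellsC[K KZ Kx] := h; exists K => //; rewrite !inE (negbTE KZ) !andbF.
- by exists I; rewrite // !inE eqxx andbF.
- by exists (mate I); rewrite // !inE eqxx.
Qed.

Lemma piece Z I i a : mstable Z -> open (~` cl Z) -> I \in Z ->
 (forall K, K \in Z -> (rk I <= rk K)%N) ->
 coc (~` cl (Z :\ I :\ mate I)%SET) a -> van (~` cl Z) a -> hdeg i a ->
 (mate I = I -> i = cd I -> slev I a = 0) ->
 exists2 b, van (~` cl Z) b &
 forall s, img_in (~` cl (Z :\ I :\ mate I)%SET) s -> cob b s = a s.
move=> mZ oZ IZ rZ aU aV ai a0; set Z1 := (_ :\ _ :\ _)%SET in aU *.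
have oU := remove_open mZ oZ IZ rZ; have UE x := remove_cells x mZ IZ.
have VU : ~` cl Z `<=` ~` cl Z1 by move=> x h; apply/UE; exact: Or31.
have mZ1 : mstable Z1.
 move=> K; rewrite !inE => /and3P[K1 K2 KZ].
 rewrite (inj_eq (can_inj (@mateK _ _ S))) K2 mZ // andbT /=.
 by rewrite -(inj_eq (can_inj (@mateK _ _ S))) mateK in K1.
have rZ1 K : K \in Z1 -> (rk I <= rk K)%N by rewrite !inE => /and3P[_ _ /rZ].
have WU : Wb I `<=` ~` cl Z1 by apply: Wb_cells => //; rewrite !inE eqxx ?andbF.
have WU' : Wb (mate I) `<=` ~` cl Z1.
 by apply: Wb_cells => //; [rewrite !inE eqxx|move=> K /rZ1; rewrite rk_mate].
have VE x : (~` cl Z) x -> ~ Om I x /\ ~ Om (mate I) x.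
 by move=> /cellsC[K KZ Kx]; split=> h; case/negP: KZ; rewrite (Om_inj Kx h) // mZ.
have NU (J : S) : Wb J `<=` ~` cl Z1 -> Nb J `<=` ~` cl Z1 by move=> h x /Nb_Wb/h.
have [mI|mI] := eqVneq (mate I) I.
 refine (good_piece oU oZ VU (NU _ WU) _ _ aU aV ai (a0 mI)).
 move=> x /UE; rewrite mI => -[|/Om_Nb|/Om_Nb]; by [right|left|left].
 apply/seteqP; split=> x [Nx h]; split=> //; first by case: (VE _ h).
 by have /UE := NU _ WU _ Nx; rewrite mI => -[].
have [|] := cd_mate mI => cdI; last first.
 exact: (bad_piece cdI oU oZ VU WU (NU _ WU') UE VE aU aV ai).
have cdI' : cd (mate (mate I)) = (cd (mate I)).+1 by rewrite mateK.
apply: (bad_piece cdI' oU oZ VU WU' _ _ _ aU aV ai); rewrite mateK //.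
- exact: NU.
- move=> x; rewrite UE; split=> -[h|h|h]; by [apply: Or31|apply: Or32|apply: Or33].
- by move=> x /VE[].
Qed.

Lemma cl_set0 : ~` cl finset.set0 = setT.
by apply/seteqP; split=> // x _ [K]; rewrite inE. Qed.
Lemma min_rk Z : Z != finset.set0 -> exists2 I, I \in Z & forall K, K \in Z -> (rk I <= rk K)%N.
by move=> /set0Pn[I0 I0Z]; case: (arg_minnP (rk (s := S)) I0Z) => I IZ h; exists I.
Qed.

Lemma remove_stable Z I : mstable Z -> mstable (Z :\ I :\ mate I)%SET.
move=> mZ K; rewrite !inE => /and3P[K1 K2 KZ].
rewrite (inj_eq (can_inj (@mateK _ _ S))) K2 mZ // andbT /=.
by rewrite -(inj_eq (can_inj (@mateK _ _ S))) mateK in K1.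
Qed.

(** Cells leave [Z] by increasing rank, which keeps the complements open. A good cell obstructs only
    in the degree equal to its codimension, excluded by hypothesis, and a pair of mates never
    obstructs. *)
Theorem strat_exact Z Z' i a : mstable Z -> mstable Z' -> open (~` cl Z) ->
 Z' \subset Z -> (forall I K, I \in Z -> I \notin Z' -> K \in Z' -> (rk I <= rk K)%N) ->
 (forall I, I \in Z -> I \notin Z' -> mate I = I -> cd I <> i) ->
 coc (~` cl Z') a -> van (~` cl Z) a -> hdeg i a ->
 exists2 b, van (~` cl Z) b & forall s, img_in (~` cl Z') s -> cob b s = a s.
Proof.
move=> mZ mZ' oZ ZZ' rZ gZ; have [n] := ubnP #|(Z :\: Z')%SET|.
elim: n => // n ih in Z mZ oZ ZZ' rZ gZ a *; rewrite ltnS => sn aU aV ai.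
have [ZE|/min_rk[I]] := eqVneq (Z :\: Z')%SET finset.set0.
 exists 0; first by [].
 move=> s Us; rewrite linear0 aV // => t; apply: contra_not (Us t) => -[K KZ Kx].
 exists K => //; apply/negPn/negP => KZ'.
 by have : K \in (Z :\: Z')%SET by [rewrite inE KZ' KZ]; rewrite ZE inE.
rewrite inE => /andP[IZ' IZ] Imin.
have rI K : K \in Z -> (rk I <= rk K)%N.
 by move=> KZ; have [KZ'|KZ'] := boolP (K \in Z'); [exact: rZ|apply: Imin; rewrite inE KZ' KZ].
set Z1 := (Z :\ I :\ mate I)%SET.
have Z1Z' : Z' \subset Z1.
 apply/fintype.subsetP => K KZ'; rewrite !inE (fintype.subsetP ZZ' _ KZ') andbT.
 apply/andP; split; apply/eqP => e; last by rewrite -e KZ' in IZ'.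
 by have := mZ' _ KZ'; rewrite e mateK (negbTE IZ').
have aU1 : coc (~` cl Z1) a by apply: van_sub aU; exact: cells_sub.
have oU1 := remove_open mZ oZ IZ rI.
have [b bV bE] := piece mZ oZ IZ rI aU1 aV ai (fun mI e => False_ind _ (gZ I IZ IZ' mI (esym e))).
have VU1 : ~` cl Z `<=` ~` cl Z1 by apply: cells_sub; apply: fintype.subset_trans (subsetDl _ _) (subsetDl _ _).
have [c [cV ci cE]] := hom_prim VU1 bV ai bE.
have [|||||||b' b'V b'E] := ih Z1 _ oU1 Z1Z' _ _ (a - cob c) _.
- exact: remove_stable.
- by move=> J K; rewrite !inE => /and3P[_ _ JZ]; exact: rZ.
- by move=> J; rewrite !inE => /and3P[_ _ JZ]; exact: gZ.
- apply: leq_trans sn; apply: proper_card; apply/properP; split.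
 by apply: finset.setSD; apply: fintype.subset_trans (subsetDl _ _) (subsetDl _ _).
 by exists I; rewrite !inE ?IZ ?IZ' ?eqxx ?andbF.
- by move=> s Us; rewrite linearB /= cob_cob subr0 aU.
- by move=> s Us; rewrite -[LHS]/(a s - cob c s) cE // subrr.
- exact: hdegB.
exists (b' + c); first by apply: vanD => //; apply: van_sub b'V.
by move=> s Us; rewrite linearD -[LHS]/(cob b' s + cob c s) b'E // -[X in X + _]/(a s - cob c s) subrK.
Qed.

Definition cl_set I : {set S} := [set K | `[< exists2 x, closure (Om I) x & Om K x >]]%SET.
Lemma Om_sl I : Om I (sl (I := I) 0).
by apply/(yc_Om (sl_Nb _)); rewrite yc_sl. Qed.

Lemma cl_setE I : mate I = I -> cl (cl_set I) = closure (Om I).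
move=> mI; apply/seteqP; split=> x.
 by case=> K; rewrite inE => /asboolP[y Iy Ky] Kx; exact: (cl_cells mI Iy Ky (or_introl erefl) Kx).
by move=> Ix; have [K Kx] := Om_cover S x; exists K => //; rewrite inE; apply/asboolP; exists x.
Qed.

Lemma cl_set_open I : mate I = I -> open (~` cl (cl_set I)).
by move=> mI; rewrite cl_setE //; apply: closed_openC; exact: closed_closure. Qed.

Lemma cl_set_stable I : mate I = I -> mstable (cl_set I).
move=> mI K; rewrite inE => /asboolP[x Ix Kx]; rewrite inE; apply/asboolP.
exists (sl (I := mate K) 0); last by exact: Om_sl.
by apply: (cl_cells mI Ix Kx (or_intror erefl)); exact: Om_sl.
Qed.

Lemma cl_set_id I : I \in cl_set I.
by rewrite inE; apply/asboolP; exists (sl (I := I) 0); [apply: subset_closure|]; exact: Om_sl.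
Qed.
Lemma cl_set_rk I K : mate I = I -> K \in cl_set I -> K != I -> (rk I < rk K)%N.
by move=> mI; rewrite inE => /asboolP[x Ix Kx] /eqP; exact: cl_rk Kx.
Qed.

(** The chart of [I] meets only cells of rank at most that of [I], whereas [K] is the only cell of
    least rank in its closure. *)
Lemma Nb_closure I K : mate I = I -> mate K = K -> (rk I <= rk K)%N -> K != I ->
 Nb I `<=` ~` closure (Om K).
move=> mI mK rIK KI x Nx; rewrite -cl_setE // => -[L LK Lx].
have LI : (rk L <= rk I)%N.
 by have [->|->|/ltnW//] := Wb_rk (Nb_Wb Nx) Lx; rewrite ?mI.
have [LK'|LK'] := eqVneq L K.
 subst L; have [e|e|] := Wb_rk (Nb_Wb Nx) Lx; last by rewrite ltnNge rIK.
 by rewrite e eqxx in KI.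
 by rewrite e mI eqxx in KI.
by have := cl_set_rk mK LK LK'; rewrite ltnNge (leq_trans LI).
Qed.

Lemma good_cd_neq I K i : mate I = I -> mate K = K -> i = (cd I).+1 -> cd K <> i.
by move=> /cd_even iI /cd_even iK -> e; move: iK; rewrite e /= iI. Qed.

(** The local generator extends over the chart of [I] and the complement of the closure.
    Obstructions to going further lie in degree [(cd I).+1], which is odd, while the good cells have
    even codimension. *)
Lemma schubert_exists I : mate I = I -> exists a, [/\ cob a = 0,
 van (~` closure (Om I)) a, hdeg (cd I) a & slev I a = 1].
move=> mI; set Z := cl_set I; set Z1 := (Z :\ I :\ mate I)%SET.
have mZ : mstable Z by exact: cl_set_stable.
have oZ : open (~` cl Z) by exact: cl_set_open.
have IZ : I \in Z by exact: cl_set_id.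
have rZ K : K \in Z -> (rk I <= rk K)%N.
 by have [->//|KI KZ] := eqVneq K I; apply: ltnW; exact: cl_set_rk.
have oU := remove_open mZ oZ IZ rZ; have UE x := remove_cells x mZ IZ.
have mZ1 : mstable Z1 by exact: remove_stable.
have VU : ~` cl Z `<=` ~` cl Z1 by move=> x h; apply/UE; exact: Or31.
have NU : Nb I `<=` ~` cl Z1.
 apply: (subset_trans (@Nb_Wb _ _ S I)); apply: Wb_cells => //; first by rewrite !inE eqxx ?andbF.
 by move=> K; rewrite in_setD1 => /andP[_]; rewrite in_setD1 => /andP[_ /rZ].
have [a [aU aV ai a1]] : exists a, [/\ coc (~` cl Z1) a, van (~` cl Z) a, hdeg (cd I) a & slev I a = 1].
 apply: class_on => //.
 by move=> x /UE; rewrite mI => -[|/Om_Nb|/Om_Nb]; by [right|left|left].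
 apply/seteqP; split=> x [Nx h]; split=> //.
 by move=> Ix; case: h; exists I.
 by have /UE := NU _ Nx; rewrite mI => -[].
pose a' := cut (~` cl Z1) a.
have [b bU bE] : exists2 b, van (~` cl Z1) b &
 forall s, img_in (~` cl finset.set0) s -> cob b s = cob a' s.
 apply: (@strat_exact Z1 finset.set0 (cd I).+1) => //.
 - by move=> K; rewrite inE.
 - by rewrite finset.sub0set.
 - by move=> ? K _ _; rewrite inE.
 - by move=> K _ _ mK; exact: good_cd_neq mI mK erefl.
 - by move=> s _; rewrite cob_cob.
 - exact: coc_cut.
 - by apply: hdeg_cob; exact: hdeg_cut.
exists (a' - trunc (cd I) b); split.
- apply/funext => s; rewrite linearB -[LHS]/(cob a' s - cob (trunc (cd I) b) s).
 rewrite cob_trunc /trunc bE ?cl_set0 //.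
 by case: eqP => [_|/(hdeg_cob (hdeg_cut _ ai)) ->]; rewrite subrr.
- rewrite -cl_setE //; apply: vanB.
 by apply: van_cut; apply: van_sub aV => x [].
 by apply: van_trunc; exact: van_sub bU.
- by apply: hdegB; [exact: hdeg_cut|exact: hdeg_trunc].
- by rewrite slevB slev_cut // a1 (slev_van (van_trunc (cd I) bU)) // subr0.
Qed.

Variable sc : S -> cochain R X.
Hypothesis scP : forall I, mate I = I -> [/\ cob (sc I) = 0,
 van (~` closure (Om I)) (sc I), hdeg (cd I) (sc I) & slev I (sc I) = 1].

Lemma closure_cells Z K : open (~` cl Z) -> K \in Z -> ~` cl Z `<=` ~` closure (Om K).
move=> oZ KZ; apply: subsetC; have cZ : closed (cl Z) by rewrite -[cl Z]setCK; exact: open_closedC.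
have /closure_id -> := cZ; apply: closureS => x Kx; by exists K.
Qed.

(** A pair of least rank is peeled off: at a good cell of codimension [i] the value on the slice is
    cancelled by a multiple of its Schubert cocycle, and what remains can be moved to a smaller
    union of cells. *)
Lemma schubert_span Z i a : mstable Z -> open (~` cl Z) -> cob a = 0 ->
 van (~` cl Z) a -> hdeg i a ->
 exists2 lam : S -> rat, (forall K, lam K != 0 -> [/\ K \in Z, mate K = K & cd K = i]) &
 exists2 b, van (~` cl Z) b & cob b = a - \sum_K lam K *: sc K.
have [n] := ubnP #|Z|; elim: n => // n ih in Z a *; rewrite ltnS => Zn mZ oZ ca aZ ai.
have [ZE|/min_rk[I IZ rI]] := eqVneq Z finset.set0.
 exists (fun=> 0); first by move=> K; rewrite eqxx.
 exists 0; first by [].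
 rewrite big1 ?subr0 => [|K _]; last by rewrite scale0r.
 by rewrite linear0; apply/funext => s; rewrite aZ // ZE cl_set0.
set Z1 := (Z :\ I :\ mate I)%SET.
have cardZ1 : (#|Z1| < n)%N.
 apply: leq_trans Zn; apply: proper_card; apply/properP; split.
 exact: fintype.subset_trans (subsetDl _ _) (subsetDl _ _).
 by exists I; rewrite // !inE eqxx andbF.
have oU1 := remove_open mZ oZ IZ rI; have mZ1 := remove_stable (I := I) mZ.
have VU1 : ~` cl Z `<=` ~` cl Z1 by apply: cells_sub; apply: fintype.subset_trans (subsetDl _ _) (subsetDl _ _).
have [c cI c0] : exists2 c : rat, (c != 0 -> mate I = I /\ cd I = i) &
 (mate I = I -> i = cd I -> slev I (a - c *: sc I) = 0).
 have [mI|mI] := eqVneq (mate I) I; last first.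
 by exists 0; [rewrite eqxx|move=> e; rewrite e eqxx in mI].
 have [iI|iI] := eqVneq (cd I) i; last first.
 by exists 0; [rewrite eqxx|move=> _ e; rewrite e eqxx in iI].
 exists (slev I a) => // _ _; have [_ _ _ s1] := scP mI.
 by rewrite slevB slevZ s1 mulr1 subrr.
pose a1 : cochain R X := a - c *: sc I.
have cs : cob (c *: sc I) = 0.
 rewrite linearZ /=; have [->|/cI[mI _]] := eqVneq c 0; first by rewrite scale0r.
 by have [-> _ _ _] := scP mI; rewrite scaler0.
have ca1 : cob a1 = 0 by rewrite /a1 linearB /= ca cs subrr.
have a1Z : van (~` cl Z) a1.
 apply: vanB => //; have [->|/cI[mI _]] := eqVneq c 0; first by rewrite scale0r.
 by apply: vanZ; have [_ h _ _] := scP mI; apply: van_sub h; exact: closure_cells.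
have a1i : hdeg i a1.
 apply: hdegB => //; have [->|/cI[mI <-]] := eqVneq c 0; first by move=> s _; rewrite scale0r.
 by apply: hdegZ; have [] := scP mI.
have [b bZ bE] : exists2 b, van (~` cl Z) b &
 forall s, img_in (~` cl Z1) s -> cob b s = a1 s.
 by apply: (piece mZ oZ IZ rI _ a1Z a1i c0) => s _; rewrite ca1.
have [e [eZ ei eE]] := hom_prim VU1 bZ a1i bE.
have [||||||lam lamP [b' b'Z b'E]] := ih Z1 (a1 - cob e) => //.
- by rewrite linearB /= ca1 cob_cob subrr.
- by move=> s Us; rewrite -[LHS]/(a1 s - cob e s) eE // subrr.
- exact: hdegB.
have lamZ K : lam K != 0 -> [/\ K \in Z, mate K = K & cd K = i].
 by move=> /lamP[]; rewrite !inE => /and3P[].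
have lamI : lam I = 0.
 by apply/eqP/negPn/negP => /lamP[]; rewrite !inE eqxx andbF.
exists (fun K => if K == I then c else lam K).
 by move=> K; case: (eqVneq K I) => [-> /cI[]|_ /lamZ].
exists (b' + e); first by apply: vanD => //; exact: van_sub b'Z.
have -> : \sum_K (if K == I then c else lam K) *: sc K = c *: sc I + \sum_K lam K *: sc K.
 rewrite (bigD1 I) //= eqxx [in RHS](bigD1 I) //= lamI scale0r add0r; congr (_ + _).
 by apply: eq_bigr => K /negbTE ->.
by rewrite linearD /= b'E [LHS]addrAC subrK opprD addrA.
Qed.

(** On the slice of a cell of least rank with nonzero coefficient no other term contributes. A
    relation makes this coefficient the value of a coboundary; by parity its primitive can be chosen
    to vanish off the cell in the chart, and [slev_exact] gives 0. *)
Lemma schubert_free (lam : S -> rat) b :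
 (forall K, mate K != K -> lam K = 0) -> cob b = \sum_K lam K *: sc K ->
 forall K, lam K = 0.
move=> lamg bE K1; apply/eqP/negPn/negP => lam1.
have [K0 lam0 Kmin] : exists2 K0, lam K0 != 0 & forall K, lam K != 0 -> (rk K0 <= rk K)%N.
 by case: (arg_minnP (P := fun K => lam K != 0) (rk (s := S)) lam1) => K h1 h2; exists K.
have good K : lam K != 0 -> mate K = K by move=> h; apply/eqP/negPn/negP => /lamg/eqP; rewrite (negbTE h).
have m0 := good _ lam0; set i := cd K0.
pose a : cochain R X := \sum_K (if cd K == i then lam K else 0) *: sc K.
have aE : a = trunc i (cob b).
 rewrite bE; apply/funext => s; rewrite /trunc /a !fct_sumE.
 case: eqVneq => si; last first.
 apply: big1 => K _; rewrite -[LHS]/(_ * sc K s).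
 case: eqVneq => [Ki|_]; last by rewrite mul0r.
 have [->|/good mK] := eqVneq (lam K) 0; first by rewrite mul0r.
 by have [_ _ h _] := scP mK; rewrite h ?mulr0 // Ki; apply/eqP.
 apply: eq_bigr => K _; rewrite -[LHS]/(_ * sc K s) -[RHS]/(lam K * sc K s).
 case: eqVneq => [//|Ki]; rewrite mul0r.
 have [->|/good mK] := eqVneq (lam K) 0; first by rewrite mul0r.
 by have [_ _ h _] := scP mK; rewrite h ?mulr0 // si => /esym/eqP; rewrite (negbTE Ki).
have aE0 : slev K0 a = lam K0.
 have slev_sum : slev K0 a = \sum_K (if cd K == i then lam K else 0) * slev K0 (sc K).
 rewrite /slev /app; case: pselect => [h|_]; last by rewrite big1 // => K _; rewrite mulr0.
 by rewrite /a fct_sumE.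
 rewrite slev_sum (bigD1 K0) //= eqxx; have [_ _ _ ->] := scP m0; rewrite mulr1 big1 ?addr0 // => K KK0.
 have [->|lK] := eqVneq (lam K) 0; first by case: eqP; rewrite mul0r.
 have [_ h _ _] := scP (good _ lK); rewrite (slev_van h) ?mulr0 //.
 by apply: Nb_closure => //; [exact: good|exact: Kmin].
pose Zr := [set K : S | (rk K0 <= rk K)%N]%SET.
have mZr : mstable Zr by move=> K; rewrite !inE rk_mate.
have NZ : Nb K0 `&` ~` Om K0 `<=` ~` cl Zr.
 move=> x [Nx Ox] [K]; rewrite inE => rK Kx; have [e|e|] := Wb_rk (Nb_Wb Nx) Kx.
 - by rewrite e in Kx.
 - by rewrite e m0 in Kx.
 - by rewrite ltnNge rK.
have clT : ~` cl [set: S]%SET = set0.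
 apply/seteqP; split=> // x h; apply: h; have [K Kx] := Om_cover S x; by exists K; rewrite ?inE.
have aZr : van (~` cl Zr) a.
 move=> s Us; rewrite /a fct_sumE big1 // => K _; rewrite -[LHS]/(_ * sc K s).
 have [->|lK] := eqVneq (lam K) 0; first by case: eqP; rewrite mul0r.
 have [_ h _ _] := scP (good _ lK); rewrite h ?mulr0 // => t Kt; apply: (Us t).
 have [L Lt] := Om_cover S (smap s t); exists L => //; rewrite inE.
 have [->|LK] := eqVneq L K; first exact: Kmin.
 by apply: leq_trans (Kmin _ lK) _; apply/ltnW; apply: (cl_rk (good _ lK) Kt Lt); exact/eqP.
have ipos : (0 < i)%N.
 rewrite lt0n; apply/eqP => i0; have a0 : a = 0.
 by rewrite aE i0; apply/funext => s; rewrite /trunc /cob; case: (sdim s) => //= ?; rewrite if_same.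
 by move: lam0; rewrite -aE0 a0 -(scale0r 0) slevZ mul0r eqxx.
have cb : a = cob (trunc i.-1 b).
 rewrite aE cob_trunc; apply/funext => s; rewrite /trunc.
 have := ipos.
 by move=> /prednK ->.
have [|||||||||e eV eE] := @strat_exact [set: S]%SET Zr i.-1 (trunc i.-1 b).
- by move=> K; rewrite !inE.
- by [].
- by rewrite clT; exact: open0.
- exact: finset.subsetT.
- by move=> I K _; rewrite !inE -ltnNge => /ltnW h1; exact: leq_trans.
- move=> I _ _ mI e; have := cd_even mI; have := cd_even m0; rewrite -/i e => i1 i2.
 by case: (i) ipos i1 i2 => //= k _ /negPf ->.
- by rewrite /coc -cb.
- by rewrite clT => s /(_ (spt (simp_delta R ord0))).
- exact: hdeg_trunc.
pose b' : cochain R X := trunc i.-1 b - cob (cut (~` cl Zr) e).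
have ab : a = cob b' by rewrite /b' linearB /= cob_cob subr0.
have := aE0; rewrite ab (slev_exact _ NZ) => [l0|]; first by move: lam0; rewrite -l0 eqxx.
move=> s Us; rewrite -[LHS]/(trunc i.-1 b s - cob (cut (~` cl Zr) e) s).
rewrite (@eq_cob _ _ (~` cl Zr) _ e) // ?eE ?subrr // => s' Us'.
by rewrite cutE.
Qed.

End stratification.

(** * Frames, flags and Schubert cells *)

Section frames.
Variables (F : fieldType) (M : nat).
Implicit Types (A : pred 'I_M) (g h : 'M[F]_M).

Lemma row_spanP A g v :
 reflect (exists2 c : 'rV[F]_M, (forall l, ~~ A l -> c 0 l = 0) & v = c *m g)
 (v \in row_span A g).
have sE (c : 'rV[F]_M) : (forall l, ~~ A l -> c 0 l = 0) -> c *m g = \sum_(l | A l) c 0 l *: row l g.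
 move=> c0; rewrite mulmx_sum_row [LHS](bigID A) /= [X in _ + X]big1 ?addr0 // => l /c0 ->.
 by rewrite scale0r.
apply: (iffP idP) => [|[c c0 ->]]; last first.
 rewrite sE //; apply: memv_suml => l Al; apply: memvZ; apply: memv_span.
 by apply/mapP; exists l => //; rewrite mem_enum.
have seqP (s : seq 'I_M) : {subset s <= A} -> v \in <<[seq row l g | l <- s]>>%VS ->
 exists2 c : 'rV[F]_M, (forall l, ~~ A l -> c 0 l = 0) & v = c *m g.
 elim: s v => [|l s ih] w sA; first by rewrite span_nil memv0 => /eqP->; exists 0; rewrite ?mul0mx // => l; rewrite mxE.
 rewrite /= span_cons => /memv_addP[u /vlineP[k ->] [w' w's ->]].
 have [c c0 ->] := ih _ (fun x xs => sA x (mem_behead (s := l :: s) xs)) w's.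
 exists (k *: delta_mx 0 l + c); last by rewrite mulmxDl -scalemxAl -rowE.
 move=> d Ad; rewrite !mxE c0 // addr0 eqxx /=; case: eqP => [dl|]; last by rewrite mulr0.
 by move: Ad; rewrite dl; have /negbF := sA l (mem_head _ _); rewrite -topredE /= => ->.
by apply: seqP => l; rewrite mem_enum.
Qed.

Lemma row_mem_span A g l : A l -> row l g \in row_span A g.
by move=> Al; apply: memv_span; apply/mapP; exists l => //; rewrite mem_enum. Qed.

Lemma dim_row_span A g : g \in unitmx -> \dim (row_span A g) = #|A|.
move=> gu; suff : free [seq row l g | l in A].
 by rewrite /free => /eqP; rewrite size_map -cardE.
apply: (@catr_free _ _ [seq row l g | l in predC A]); rewrite -map_cat.
have pe : perm_eq (enum (predC A) ++ enum A) (enum 'I_M).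
 by rewrite perm_catC; apply: uniq_perm; rewrite ?cat_uniq ?enum_uniq ?andbT //=;
 [apply/hasPn => x; rewrite !mem_enum|move=> x; rewrite mem_cat !mem_enum; case: (boolP (x \in A)) => //;
 rewrite !inE => ->].
rewrite (perm_free (perm_map _ pe)) /free size_map size_enum_ord.
have -> : <<[seq row l g | l <- enum 'I_M]>>%VS = fullv.
 apply/eqP; rewrite eqEsubv subvf /=; apply/subvP => v _.
 have -> : v = \sum_l (v *m invmx g) 0 l *: row l g by rewrite -mulmx_sum_row mulmxKV.
 apply: memv_suml => l _; apply: memvZ; apply: memv_span; apply: map_f; exact: mem_enum.
by rewrite dimvf /dim /= mul1n.
Qed.

Lemma row_span_mul A g h : row_span A (g *m h) = (linfun (mulmxr h) @: row_span A g)%VS.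
rewrite /row_span limg_span -map_comp; congr (<<_>>%VS); apply: eq_map => l /=.
by rewrite lfunE /= row_mul.
Qed.

Lemma eq_row_span A A' g : A =1 A' -> row_span A g = row_span A' g.
by move=> AA'; rewrite /row_span /image_mem (@eq_enum _ A A') // => x; rewrite -!topredE /= AA'. Qed.

Lemma row_span_perm A g (s : 'S_M) : row_span [pred l | A (s l)] (row_perm s g) = row_span A g.
apply/vspaceP => v; apply/row_spanP/row_spanP => -[c c0 ->].
 exists (c *m perm_mx s) => [l Al|]; last by rewrite -mulmxA row_permE.
 have -> : c *m perm_mx s = col_perm s^-1 c by rewrite col_permE invgK.
 by rewrite mxE; apply: c0; rewrite /= permKV.
exists (c *m perm_mx s^-1) => [l Al|]; last by rewrite row_permE mulmxA -[_ *m _ *m perm_mx s]mulmxA -perm_mxM mulVg perm_mx1 mulmx1.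
by rewrite -col_permE mxE; apply: c0.
Qed.

End frames.
Section flags.
Variables (F : numFieldType) (m : nat) (e : 'I_m -> nat) (M : nat).
Implicit Types (I K : osp e M) (V : flag F e M) (g h : 'M[F]_M).
Lemma osp_card I j : #|[pred c | I c == j]| = e j.
by case: I => I /= /forallP/(_ j)/eqP. Qed.

Lemma card_le_sum (L : 'I_M -> 'I_m) (i : 'I_m) :
 #|[pred l | (L l <= i)%N]| = (\sum_(j < m | j <= i) #|[pred c | L c == j]|)%N.
rewrite -sum1_card (partition_big L (fun j : 'I_m => (j <= i)%N)) //=.
apply: eq_bigr => j ji; rewrite -sum1_card; apply: eq_bigl => l; rewrite !inE.
by case: eqP => [->|]; rewrite ?ji ?andbF.
Qed.

Lemma osp_flag_dim I (i : 'I_m) : #|[pred l | (I l <= i)%N]| = flag_dim e i.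
by rewrite card_le_sum; apply: eq_bigr => j _; rewrite osp_card. Qed.
(** The flag whose i-th space is spanned by the rows of [g] with label at most [i]. Singular
    matrices are replaced by the identity, so that the function is total. *)
Definition fr_fun I g : {ffun 'I_m -> {vspace 'rV[F]_M}} :=
 [ffun i : 'I_m => row_span [pred l | (I l <= i)%N] (if g \in unitmx then g else 1%:M)].

Lemma fr_subproof I g : is_flag e (fr_fun I g).
have gu : (if g \in unitmx then g else 1%:M) \in unitmx.
 by case: ifP => // _; exact: unitmx1.
apply/andP; split; apply/forallP => i; first by rewrite ffunE dim_row_span // osp_flag_dim.
apply/forallP => j; apply/implyP => ij; rewrite !ffunE; apply: sub_span => v /mapP[l].
rewrite mem_enum inE => li ->; apply: map_f; rewrite mem_enum inE; exact: leq_trans ij.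
Qed.

Definition fr I g : flag F e M := Flag (fr_subproof I g).
Lemma frE I g i : g \in unitmx -> fr I g i = row_span [pred l | (I l <= i)%N] g.
by move=> gu; rewrite ffunE gu. Qed.
Lemma flagP V V' : (forall i, V i = V' i) -> V = V'.
by move=> h; apply: val_inj; apply/ffunP. Qed.
Lemma flag_dimE V i : \dim (V i) = flag_dim e i.
by case: V => V /= /andP[/forallP/(_ i)/eqP]. Qed.
Lemma flag_sub V (i j : 'I_m) : (i <= j)%N -> (V i <= V j)%VS.
by case: V => V /= /andP[_ /forallP/(_ i)/forallP/(_ j)/implyP]. Qed.
Definition act_fun V h : {ffun 'I_m -> {vspace 'rV[F]_M}} :=
 [ffun i : 'I_m => (linfun (mulmxr (if h \in unitmx then h else 1%:M)) @: V i)%VS].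

Lemma act_subproof V h : is_flag e (act_fun V h).
have gu : (if h \in unitmx then h else 1%:M) \in unitmx.
 by case: ifP => // _; exact: unitmx1.
apply/andP; split; apply/forallP => i; last first.
 apply/forallP => j; apply/implyP => ij; rewrite !ffunE; apply: limgS; exact: flag_sub.
rewrite ffunE limg_dim_eq ?flag_dimE //; apply/eqP; rewrite -subv0; apply/subvP => v.
rewrite memv_cap memv_ker memv0 lfunE /= => /andP[_ /eqP v0].
by rewrite -[v](mulmxK gu) v0 mul0mx.
Qed.

Definition actf V h : flag F e M := Flag (act_subproof V h).

Lemma act_fr I g h : g \in unitmx -> h \in unitmx -> actf (fr I g) h = fr I (g *m h).
move=> gu hu; apply: flagP => i; rewrite frE ?unitmx_mul ?gu // ffunE hu frE //.
by rewrite row_span_mul.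
Qed.

(** [l] is a pivot of the i-th space: the last nonzero coordinate of one of its vectors. Cells are
    described by their pivots. *)
Definition lead V i (l : 'I_M) :=
 `[< exists v, [/\ v \in V i, v 0 l != 0 & forall d : 'I_M, (l < d)%N -> v 0 d = 0] >].

Lemma leadP V i l :
 reflect (exists v, [/\ v \in V i, v 0 l = 1 & forall d : 'I_M, (l < d)%N -> v 0 d = 0]) (lead V i l).
rewrite /lead; apply: (iffP (asboolP _)) => [[v [vV vl vd]]|[v [vV vl vd]]].
 exists ((v 0 l)^-1 *: v); split; first exact: memvZ.
 by rewrite mxE mulVf.
 by move=> d ld; rewrite mxE (vd _ ld) mulr0.
by exists v; rewrite vl oner_neq0.
Qed.

Lemma std_spaceP k (v : 'rV[F]_M) :
 reflect (forall d : 'I_M, (k <= d)%N -> v 0 d = 0) (v \in std_space F M k).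
apply: (iffP (row_spanP _ _ _)) => [[c c0 ->] d kd|v0].
 by rewrite mulmx1 c0 //= -leqNgt.
by exists v; rewrite ?mulmx1 // => l /=; rewrite -leqNgt; exact: v0.
Qed.

(** Induction on [k]: on the intersection with the next standard space, the new coordinate has rank
    1 or 0 according to whether it is a pivot, and its kernel is the previous intersection. *)
Lemma dim_lead V i k : (k <= M)%N ->
 \dim (V i :&: std_space F M k) = #|[pred l : 'I_M | lead V i l && (l < k)%N]|.
elim: k => [|k ih] kM.
 rewrite eq_card0 => [|l]; last by rewrite inE ltn0 andbF.
 apply/eqP; rewrite dimv_eq0 -subv0; apply/subvP => v; rewrite memv_cap memv0 => /andP[_ /std_spaceP v0].
 by apply/eqP/rowP => j; rewrite v0 // mxE.
pose l := Ordinal kM.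
pose f : 'Hom('rV[F]_M, 'rV[F]_1) := linfun (mulmxr (delta_mx l 0)).
have fE v : f v = (v 0 l)%:M.
 rewrite lfunE /=; apply/rowP => j; rewrite (ord1 j) !mxE eqxx mulr1n (bigD1 l) //= mxE !eqxx mulr1 big1 ?addr0 // => d dl.
 by rewrite mxE (negbTE dl) mulr0.
have f0 v : (f v == 0) = (v 0 l == 0).
 rewrite fE; apply/eqP/eqP => [/rowP/(_ 0)|->]; last by apply/rowP => j; rewrite !mxE mul0rn.
 by rewrite !mxE mulr1n.
rewrite -(limg_ker_dim f (V i :&: std_space F M k.+1)%VS).
have -> : ((V i :&: std_space F M k.+1) :&: lker f)%VS = (V i :&: std_space F M k)%VS.
 apply/vspaceP => v; rewrite !memv_cap -andbA; congr (_ && _); rewrite memv_ker f0.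
 apply/andP/std_spaceP => [[/std_spaceP h /eqP vl] d|h].
 by rewrite leq_eqVlt => /orP[/eqP kd|/h//]; rewrite -vl; congr (v 0 _); exact: val_inj.
 by split; [apply/std_spaceP => d /ltnW/h|rewrite h].
rewrite ih ?(ltnW kM) //.
have -> : \dim (f @: (V i :&: std_space F M k.+1)) = lead V i l.
 case: leadP => [[v [vV vl vd]]|nl].
 have fv : (1%:M : 'rV[F]_1) \in (f @: (V i :&: std_space F M k.+1))%VS.
 by rewrite -vl -fE memv_img // memv_cap vV; apply/std_spaceP => d; exact: vd.
 apply/eqP; rewrite eqn_leq (leq_trans (dimvS (subvf _))) ?dimvf //=.
 rewrite lt0n dimv_eq0; apply/eqP => h; move: fv; rewrite h memv0 => /eqP/rowP/(_ 0).
 by rewrite !mxE => /eqP; rewrite oner_eq0.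
 apply/eqP; rewrite dimv_eq0 -subv0; apply/subvP => w /memv_imgP[v].
 rewrite memv_cap => /andP[vV /std_spaceP vd] ->; rewrite memv0 f0.
 apply/negPn/negP => vl; apply: nl; apply/leadP/asboolP; exists v; split=> // d; exact: vd.
rewrite -[in RHS]sum1_card (bigID (pred1 l)) /= [RHS]addnC; congr (_ + _)%N.
 rewrite -sum1_card; apply: eq_bigl => d; rewrite !inE /= -andbA; congr (_ && _).
 by rewrite ltnS ltn_neqAle andbC.
case: (boolP (lead V i l)) => nl.
 rewrite (big_pred1 l) // => d; rewrite !inE /=; case: eqP => [->|]; rewrite ?andbF // nl ltnS leqnn //.
by rewrite big_pred0 // => d; rewrite !inE /=; case: eqP => [->|]; rewrite ?andbF // (negbTE nl).
Qed.

Lemma lead_mono V (i j : 'I_m) l : (i <= j)%N -> lead V i l -> lead V j l.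
move=> ij /leadP[v [vV vl vd]]; apply/leadP; exists v; split=> //.
by have /subvP := flag_sub V ij; apply.
Qed.

Definition lower g := forall l d : 'I_M, (l < d)%N -> g l d = 0.

Lemma lead_fr I g i l : g \in unitmx -> lower g -> lead (fr I g) i l = (I l <= i)%N.
move=> gu gl; have gd d : g d d != 0.
 have : is_trig_mx g by apply/is_trig_mxP => a b; exact: gl.
 move=> /det_trig dE; move: gu; rewrite unitmxE unitfE dE.
 by move=> /prodf_neq0/(_ d isT).
apply/leadP/idP => [[v []]|li].
 rewrite frE // => /row_spanP[c c0 vE] vl vd; apply/negPn/negP => li.
 have cl0 : c 0 l = 0 by apply: c0.
 have cd0 k : forall d : 'I_M, (l < d)%N -> (M - d <= k)%N -> c 0 d = 0.
 elim: k => [|k ih] d ld; first by rewrite leqn0 subn_eq0 leqNgt ltn_ord.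
 move=> dk; have := vd d ld; rewrite vE mxE (bigD1 d) //= big1 ?addr0 => [|j jd].
 by move=> /eqP; rewrite mulf_eq0 (negbTE (gd d)) orbF => /eqP.
 case: (ltngtP j d) => jd'; first by rewrite gl ?mulr0.
 by rewrite ih ?mul0r //; [exact: ltn_trans jd'|have := ltn_ord j; lia].
 by move: jd; rewrite (val_inj jd') eqxx.
 move: vl; rewrite vE mxE big1 => [/esym/eqP|d _]; first by rewrite oner_eq0.
 case: (ltngtP d l) => dl; first by rewrite gl ?mulr0.
 by rewrite (cd0 _ d dl (leqnn _)) mul0r.
 by rewrite (val_inj dl) cl0 mul0r.
exists ((g l l)^-1 *: row l g); split.
- by rewrite memvZ // frE // row_mem_span.
- by rewrite !mxE mulVf.
- by move=> d ld; rewrite !mxE (gl _ _ ld) mulr0.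
Qed.

(** The rank table jumps from [k] to [k.+1] exactly at the pivots, so the table and the pivots
    determine each other. *)
Lemma cell_lead I V : schubert_cell I V <-> forall i l, lead V i l = (I l <= i)%N.
split=> h i k; last first.
 by move=> kM; rewrite dim_lead //; apply: eq_card => l; rewrite !inE h.
have := h i k (ltnW (ltn_ord k)); have := h i k.+1 (ltn_ord k); rewrite !dim_lead ?(ltnW (ltn_ord k)) //.
have cS (P : pred 'I_M) : #|[pred l : 'I_M | P l && (l < k.+1)%N]| = (P k + #|[pred l : 'I_M | P l && (l < k)%N]|)%N.
 rewrite (cardD1 k) !inE ltnSn andbT; congr (_ + _)%N; apply: eq_card => l; rewrite !inE.
 by rewrite [(l < k)%N]ltn_neqAle ltnS andbCA.
by rewrite (cS (lead V i)) (cS (fun l => I l <= i)%N) => + h2; rewrite h2 => /addIn; case: lead; case: leqP.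
Qed.

Lemma frame_lead I V : (forall (i : 'I_m) l, (I l <= i)%N -> lead V i l) ->
 exists g, [/\ g \in unitmx, lower g, (forall l, g l l = 1) & V = fr I g].
move=> h; have /choice[v vP] : forall l, exists v, [/\ v \in V (I l), v 0 l = 1 & forall d : 'I_M, (l < d)%N -> v 0 d = 0].
 by move=> l; apply/leadP; exact: h.
pose g := \matrix_l v l.
have gE l d : g l d = v l 0 d by rewrite mxE.
have gl : lower g by move=> l d ld; rewrite gE; have [_ _ ->] := vP l.
have g1 l : g l l = 1 by rewrite gE; have [_ -> _] := vP l.
have gu : g \in unitmx.
 rewrite unitmxE det_trig; last by apply/is_trig_mxP => a b; exact: gl.
 by rewrite big1 ?unitr1.
exists g; split=> //; apply: flagP => i; apply/esym/eqP; rewrite eqEdim flag_dimE (frE I i gu) dim_row_span // osp_flag_dim leqnn andbT.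
apply/span_subvP => w /mapP[l]; rewrite mem_enum inE => li ->.
rewrite rowK; have [vV _ _] := vP l; by have /subvP := flag_sub V li; apply.
Qed.

Lemma cellP I V : schubert_cell I V <->
 exists g, [/\ g \in unitmx, lower g & V = fr I g].
split=> [/cell_lead h|[g [gu gl ->]]].
 have [|g [gu gl _ ->]] := @frame_lead I V; first by move=> i l; rewrite h.
 by exists g.
by apply/cell_lead => i l; rewrite lead_fr.
Qed.

Lemma cell_inj I K V : schubert_cell I V -> schubert_cell K V -> I = K.
move=> /cell_lead hI /cell_lead hK; apply: val_inj; apply/ffunP => l /=.
apply: val_inj; apply/eqP; rewrite eqn_leq.
by have := hI (K l) l; have := hK (I l) l; rewrite hI hK !leqnn => <- <-.
Qed.

Lemma eq_partial_sums (a b : 'I_m -> nat) :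
 (forall i : 'I_m, \sum_(j < m | j <= i) a j = \sum_(j < m | j <= i) b j)%N -> a =1 b.
move=> h; suff ih k : forall i : 'I_m, (i < k)%N -> a i = b i by move=> i; exact: (ih i.+1).
elim: k => // k ih i ik; have := h i; rewrite !(bigD1 (P := fun j : 'I_m => (j <= i)%N) i) //=.
rewrite [X in (_ + X)%N](eq_bigr b) => [/addIn//|j /andP[ji jn]]; apply: ih.
by apply: (@leq_trans i) => //; rewrite ltn_neqAle ji andbT.
Qed.

Hypothesis sum_e : (\sum_i e i)%N = M.

Lemma flag_top V (i : 'I_m) : (forall j : 'I_m, (j <= i)%N) -> V i = fullv.
move=> im; apply/eqP; rewrite eqEdim subvf dimvf flag_dimE /dim /= mul1n -[X in (X <= _)%N]sum_e /flag_dim.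
by rewrite [X in (_ <= X)%N](eq_bigl xpredT) // => j; exact: im.
Qed.

(** The label of [l] is the first member of the flag that has a pivot at [l]; pivots persist in
    later members, and counting them shows that the blocks have the right sizes. *)
Lemma cell_cover V : exists I, schubert_cell I V.
have ex l : exists i : 'I_m, lead V i l.
 have [m0|m0] := posnP m; first by have := ltn_ord l; rewrite -[X in (_ < X)%N]sum_e big1 // => i _; have := ltn_ord i; rewrite [X in (_ < X)%N]m0.
 have lt : (m.-1 < m)%N by rewrite prednK.
 exists (Ordinal lt); apply/leadP; exists (delta_mx 0 l); split.
 - by rewrite flag_top ?memvf // => j /=; rewrite -ltnS prednK.
 - by rewrite mxE !eqxx.
 - move=> d ld; rewrite mxE eqxx /=; case: (d =P l) => // dl.
 by rewrite dl ltnn in ld.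
have /choice[K KP] : forall l, exists i : 'I_m, lead V i l /\ forall j, lead V j l -> (i <= j)%N.
 by move=> l; have [i0 il0] := ex l; case: (arg_minnP (P := fun i => lead V i l) (fun i : 'I_m => i : nat) il0) => i h1 h2; exists i.
have leadK i l : lead V i l = (K l <= i)%N.
 apply/idP/idP; first by have [_] := KP l; apply.
 by move=> Ki; apply: (lead_mono Ki); have [] := KP l.
have osp_K : [forall j, #|[pred c | [ffun l => K l] c == j]| == e j].
 apply/forallP => j; rewrite (eq_card (B := [pred c | K c == j])) => [|c]; last by rewrite !inE ffunE.
 apply/eqP; apply: (eq_partial_sums (a := fun j => #|[pred c | K c == j]|)) => {}j.
 rewrite -card_le_sum -/(flag_dim e j) -(flag_dimE V j).
 have -> : V j = (V j :&: std_space F M M)%VS.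
 apply/vspaceP => v; rewrite memv_cap; case: (v \in V j) => //=.
 by apply/esym/std_spaceP => d; rewrite leqNgt ltn_ord.
 by rewrite dim_lead //; apply: eq_card => l; rewrite !inE ltn_ord andbT leadK.
by exists (Osp osp_K); apply/cell_lead => i l; rewrite leadK /= ffunE.
Qed.

Lemma osp_perm I K : exists s : 'S_M, forall l, I (s l) = K l.
have : perm_eq [tuple K l | l < M] [tuple I l | l < M].
 apply/allP => j _ /=; apply/eqP; rewrite !count_map.
 have cE (J : osp e M) : count (preim (fun l => J l) (pred1 j)) (enum 'I_M) = e j.
 by rewrite -(osp_card J j) cardE -size_filter enumT.
 by rewrite -!enumT !cE.
move=> /tuple_permP[p pE]; exists p => l.
by have := congr1 (fun s => nth (I l) s l) pE; rewrite -!tnth_nth !tnth_mktuple.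
Qed.

Lemma fr_perm I K g (s : 'S_M) : (forall l, I (s l) = K l) -> g \in unitmx ->
 fr I g = fr K (row_perm s g).
move=> sE gu; have pu : row_perm s g \in unitmx by rewrite row_permE unitmx_mul unitmx_perm.
apply: flagP => i; rewrite !frE // -[LHS](row_span_perm _ _ s); apply: eq_row_span => l /=.
by rewrite sE.
Qed.

Lemma fr_surj I V : exists2 g, g \in unitmx & V = fr I g.
have [K /cellP[g [gu _ ->]]] := cell_cover V; have [s sE] := osp_perm K I.
exists (row_perm s g); last exact: fr_perm.
by rewrite row_permE unitmx_mul unitmx_perm.
Qed.

End flags.

(** * Charts around the coordinate flags *)

Section charts.
Variables (F : numFieldType) (m : nat) (e : 'I_m -> nat) (M : nat).
Implicit Types (I K : osp e M) (V : flag F e M) (g h p A B : 'M[F]_M).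

Lemma fr_sub I V g : g \in unitmx -> (forall l, row l g \in V (I l)) -> V = fr I g.
move=> gu h; apply: flagP => i; apply/esym/eqP.
rewrite eqEdim flag_dimE (frE I i gu) dim_row_span // osp_flag_dim leqnn andbT.
apply/span_subvP => w /mapP[l]; rewrite mem_enum inE => li ->.
by have /subvP := flag_sub V li; apply; exact: h.
Qed.

(** The stabiliser of the coordinate flag of [I] under change of frame: two frames span the same
    flag exactly when they differ by such a matrix ([fr_parab]). *)
Definition parab I p := forall l k : 'I_M, (I l < I k)%N -> p l k = 0.

Lemma fr_parab I g g' : g \in unitmx -> g' \in unitmx ->
 fr I g = fr I g' <-> parab I (g *m invmx g').
move=> gu g'u; split=> [E l k lk|pp].
 have : row l g \in fr I g' (I l) by rewrite -E frE // row_mem_span /=.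
 rewrite frE // => /row_spanP[c c0 gE].
 have -> : (g *m invmx g') l k = (row l g *m invmx g') 0 k by rewrite -row_mul [RHS]mxE.
 by rewrite gE mulmxK // c0 //= -ltnNge.
apply/esym; rewrite [RHS](_ : _ = fr I g') //.
apply/esym; apply: fr_sub => // l; rewrite frE //; apply/row_spanP.
exists (row l (g *m invmx g')) => [k /=|]; first by rewrite -ltnNge mxE; exact: pp.
by rewrite -row_mul mulmxKV.
Qed.

(** The matrices 1 + A form the unipotent group opposite to [parab I], so the chart below is a
    translate of the big cell. *)
Definition ntype I A := forall l d : 'I_M, (I d <= I l)%N -> A l d = 0.

Lemma unitmx_inj g : (forall v : 'rV[F]_M, v *m g = 0 -> v = 0) -> g \in unitmx.
move=> h; rewrite -row_free_unit -kermx_eq0; apply/eqP/row_matrixP => i.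
by rewrite row0; apply: h; rewrite -row_mul mulmx_ker row0.
Qed.

Lemma ntype_unit I A : ntype I A -> 1%:M + A \in unitmx.
move=> nA; apply: unitmx_inj => v v0; apply/rowP => d; rewrite mxE.
have [k] := ubnP (I d); elim: k d => // k ih d dk.
have := congr1 (fun w : 'rV[F]_M => w 0 d) v0; rewrite mulmxDr mulmx1 !mxE big1 ?addr0 // => l _.
case: (leqP (I d) (I l)) => dl; first by rewrite nA ?mulr0.
by rewrite ih ?mul0r //; exact: leq_trans dl _.
Qed.

Definition dI I (i : 'I_m) : 'M[F]_M := \matrix_(l, d) ((l == d) && (I l <= i)%N)%:R.

Lemma dI_mull I i p l d : (dI I i *m p) l d = if (I l <= i)%N then p l d else 0.
rewrite mxE (bigD1 l) //= big1 ?addr0 => [|k kl]; last by rewrite mxE eq_sym (negbTE kl) mul0r.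
by rewrite mxE eqxx; case: ifP; rewrite ?mul1r ?mul0r.
Qed.

Lemma dI_mulr I i p l d : (p *m dI I i) l d = if (I d <= i)%N then p l d else 0.
rewrite mxE (bigD1 d) //= big1 ?addr0 => [|k kl]; last by rewrite mxE (negbTE kl) mulr0.
by rewrite mxE eqxx; case: ifP; rewrite ?mulr1 ?mulr0.
Qed.

(** The diagonal block of labels at most [i], completed by the identity to a matrix of full size.
    Invertibility of all these blocks is the open condition defining the chart. *)
Definition blk I (i : 'I_m) g : 'M[F]_M :=
 \matrix_(l, d) if (I l <= i)%N then (if (I d <= i)%N then g l d else 0) else (l == d)%:R.

Lemma blkE I i g : blk I i g = dI I i *m g *m dI I i + (1%:M - dI I i).
apply/matrixP => l d; rewrite mxE mxE dI_mulr dI_mull !mxE.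
case: (leqP (I l) i) => li; case: (leqP (I d) i) => di; rewrite ?andbT ?andbF ?subrr ?addr0 ?add0r ?subr0 //.
Qed.

Lemma blkM I i p h : parab I p -> blk I i (p *m h) = blk I i p *m blk I i h.
move=> pp; apply/matrixP => l d; rewrite !mxE.
case: (leqP (I l) i) => li; last first.
 rewrite (bigD1 l) //= big1 => [|k kl]; last by rewrite mxE leqNgt li /= eq_sym (negbTE kl) mul0r.
 by rewrite !mxE leqNgt li /= eqxx mul1r addr0.
case: (leqP (I d) i) => di; last first.
 apply/esym; apply: big1 => k _; rewrite !mxE li.
 case: (leqP (I k) i) => ki; last by rewrite mul0r.
 by rewrite leqNgt di mulr0.
apply: eq_bigr => k _; rewrite !mxE li di; case: (leqP (I k) i) => ki //.
by rewrite mul0r pp ?mul0r //; exact: leq_ltn_trans ki.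
Qed.

Lemma blk1 I i : blk I i 1%:M = 1%:M.
apply/matrixP => l d; rewrite !mxE; case: leqP => // li; case: leqP => // di.
by case: eqP => // ld; rewrite -ld ltnNge li in di.
Qed.

Lemma blk_ntype I i A : ntype I A -> blk I i (1%:M + A) \in unitmx.
move=> nA; pose B := dI I i *m A *m dI I i.
have -> : blk I i (1%:M + A) = 1%:M + B.
 apply/matrixP => l d; rewrite [RHS]mxE /B dI_mulr dI_mull !mxE.
 case: (leqP (I l) i) => li; case: (leqP (I d) i) => di; rewrite ?addr0 //.
 by case: eqP => // ld; rewrite -ld ltnNge li in di.
by apply: (ntype_unit (I := I)) => l d dl; rewrite /B dI_mulr dI_mull nA ?if_same.
Qed.

(** The normal form of a frame: row [l] is the vector of the space of index [I l] whose coordinates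
    with labels at most [I l] are those of the basis vector of index [l]. The explicit formula makes
    the chart coordinates continuous. *)
Definition gmat I g : 'M[F]_M :=
 \matrix_(l, d) (invmx (blk I (I l) g) *m (dI I (I l) *m g)) l d.
Definition regular I g := forall i, blk I i g \in unitmx.

Lemma regular_chart I A p : ntype I A -> p \in unitmx -> parab I p ->
 regular I (p *m (1%:M + A)) /\ gmat I (p *m (1%:M + A)) = 1%:M + A.
move=> nA pu pp; have bp i : blk I i p \in unitmx.
 have := blkM i (invmx p) pp; rewrite mulmxV // blk1 => /esym/mulmx1_unit[].
 by [].
have bu i : blk I i (p *m (1%:M + A)) \in unitmx.
 by rewrite blkM // unitmx_mul bp blk_ntype.
split=> //; apply/matrixP => l d; rewrite mxE; set i := I l.
have key : blk I i p *m (dI I i *m (1%:M + A)) = dI I i *m (p *m (1%:M + A)).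
 apply/matrixP => a b; rewrite !dI_mull mxE.
 case: (leqP (I a) i) => ai; last first.
 apply: big1 => k _; rewrite dI_mull; case: (leqP (I k) i) => ki; rewrite ?mulr0 // mxE leqNgt ai /=.
 by case: eqP => [ak|]; rewrite ?mul0r //; move: ai; rewrite ak ltnNge ki.
 rewrite [RHS]mxE; apply: eq_bigr => k _; rewrite dI_mull mxE ai.
 case: (leqP (I k) i) => ki //; first by rewrite mulr0 pp ?mul0r //; exact: leq_ltn_trans ki.
pose B := blk I i (1%:M + A); have Bu : B \in unitmx by exact: blk_ntype.
have -> : invmx (blk I i (p *m (1%:M + A))) *m (dI I i *m (p *m (1%:M + A))) =
 invmx B *m (dI I i *m (1%:M + A)).
 have -> : dI I i *m (p *m (1%:M + A)) = blk I i (p *m (1%:M + A)) *m (invmx B *m (dI I i *m (1%:M + A))).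
 by rewrite blkM // -mulmxA mulKVmx.
 by rewrite mulKmx.
have rB : row l B = row l 1%:M.
 apply/rowP => k; rewrite !mxE leqnn; case: (leqP (I k) (I l)) => kl.
 by rewrite nA ?addr0.
 by case: eqP => // lk; rewrite lk ltnn in kl.
have -> : (invmx B *m (dI I i *m (1%:M + A))) l d = (row l (invmx B) *m (dI I i *m (1%:M + A))) 0 d.
 by rewrite -row_mul [RHS]mxE.
have -> : row l (invmx B) = row l 1%:M.
 by rewrite -[LHS]mul1mx -[invmx B in LHS]mul1mx row_mul -rB -row_mul mulmxV // mul1mx.
by rewrite -row_mul mul1mx [LHS]mxE dI_mull leqnn.
Qed.

Lemma regularP I g : g \in unitmx -> regular I g ->
 exists A, [/\ ntype I A, gmat I g = 1%:M + A & fr I g = fr I (1%:M + A)].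
move=> gu rg; pose A := gmat I g - 1%:M; have gE : gmat I g = 1%:M + A by rewrite addrC subrK.
have nA : ntype I A.
 move=> l d dl; rewrite !mxE; set i := I l; pose B := blk I i g.
 have : (invmx B *m (dI I i *m g *m dI I i)) l d = (l == d)%:R.
 have -> : dI I i *m g *m dI I i = B - (1%:M - dI I i) by rewrite /B blkE addrK.
 rewrite mulmxBr mulVmx; last exact: rg.
 have E2 : (invmx B *m (1%:M - dI I i)) l d = 0.
 by rewrite mulmxBr mulmx1 mxE [X in _ + X]mxE dI_mulr dl subrr.
 by rewrite mxE [X in _ + X]mxE E2 subr0 mxE.
 rewrite mulmxA dI_mulr dl mxE => ->.
 by rewrite subrr.
exists A; split=> //; rewrite -gE; apply/esym.
apply/esym; apply: fr_sub => [|l]; first by rewrite gE; exact: (ntype_unit nA).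
rewrite frE //; apply/row_spanP; set i := I l.
exists (row l (invmx (blk I i g) *m dI I i)) => [k /= ki|].
 by rewrite mxE dI_mulr (negbTE ki).
by rewrite -row_mul -mulmxA; apply/rowP => d; rewrite !mxE.
Qed.

Definition chart I : set (flag F e M) := [set V | exists2 A, ntype I A & V = fr I (1%:M + A)].
Definition coordA I V : 'M[F]_M := xget 0 [set A | ntype I A /\ V = fr I (1%:M + A)].
Lemma coordAP I V : chart I V -> ntype I (coordA I V) /\ V = fr I (1%:M + coordA I V).
by move=> [A nA VA]; rewrite /coordA; case: xgetP => [B _ //|/(_ A)[]]. Qed.

Lemma chart_regular I g : g \in unitmx -> chart I (fr I g) ->
 regular I g /\ gmat I g = 1%:M + coordA I (fr I g).
move=> gu /coordAP[]; set A := coordA _ _ => nA E.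
have Au := ntype_unit nA; have /fr_parab pp := E.
rewrite -[g](mulmxKV Au); apply: regular_chart => //; last exact: pp.
by rewrite unitmx_mul gu unitmx_inv.
Qed.

Lemma reg_chart I g : g \in unitmx -> regular I g -> chart I (fr I g).
by move=> gu /(regularP gu)[A [nA _ E]]; exists A. Qed.
Lemma chart_fr I A : ntype I A -> chart I (fr I (1%:M + A)).
by exists A. Qed.

Lemma coordA_fr I A : ntype I A -> coordA I (fr I (1%:M + A)) = A.
move=> nA; have [_ gE] := chart_regular (ntype_unit nA) (chart_fr nA).
have pp1 : parab I 1%:M by move=> l k lk; rewrite mxE; case: eqP => // E; rewrite E ltnn in lk.
have := (regular_chart nA (unitmx1 F M) pp1).2; rewrite mul1mx gE => /addrI.
by [].
Qed.

Lemma lowerM g h : lower g -> lower h -> lower (g *m h).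
move=> gl hl l d ld; rewrite mxE big1 // => k _.
by case: (ltnP l k) => lk; [rewrite gl ?mul0r|rewrite hl ?mulr0 //; exact: leq_ltn_trans ld].
Qed.

Lemma lower_det g : lower g -> \det g = \prod_l g l l.
by move=> gl; apply: det_trig; apply/is_trig_mxP => a b; exact: gl. Qed.
Lemma lower_unit g : lower g -> g \in unitmx = [forall l, g l l != 0].
move=> gl; rewrite unitmxE unitfE lower_det //; apply/prodf_neq0/forallP => [h l|h l _]; exact: h.
Qed.

Lemma lowerV g : g \in unitmx -> lower g -> lower (invmx g).
move=> gu gl l d; have [k] := ubnP (l : nat); elim: k l => // k ih l lk ld.
have := congr1 (fun w : 'M[F]_M => w l d) (mulmxV gu); rewrite !mxE (bigD1 l) //= big1 ?addr0.
 case: eqP => [E|_]; first by rewrite E ltnn in ld.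
 move=> /eqP; rewrite mulf_eq0 => /orP[|/eqP//].
 by move: gu; rewrite lower_unit // => /forallP/(_ l)/negPf ->.
move=> j jl; case: (ltnP l j) => lj; first by rewrite gl ?mul0r.
have lj' : (j < l)%N by rewrite ltn_neqAle lj andbT.
by rewrite ih ?mulr0 //; [exact: leq_trans lj' _|exact: ltn_trans ld].
Qed.

(** A frame of the cell can be taken lower triangular with unit diagonal; its blocks are then lower
    triangular, and so is its normal form. *)
Lemma cell_chart I V : schubert_cell I V <->
 chart I V /\ (forall l d : 'I_M, (l < d)%N -> coordA I V l d = 0).
split=> [/cell_lead h|[/coordAP[nA VA] A0]]; last first.
 apply/cellP; exists (1%:M + coordA I V); split=> //; first exact: (ntype_unit nA).
 move=> l d ld; rewrite !mxE A0 // addr0; case: eqP => // E; by rewrite E ltnn in ld.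
have [|g [gu gl g1 VE]] := @frame_lead _ _ _ _ I V; first by move=> i l; rewrite h.
have bl i : lower (blk I i g).
 move=> l d ld; rewrite mxE; case: ifP => _; first by rewrite gl // if_same.
 by case: eqP => // E; rewrite E ltnn in ld.
have rg : regular I g.
 move=> i; rewrite lower_unit //; apply/forallP => l; rewrite mxE.
 by rewrite eqxx g1; case: ifP => [->|_]; rewrite ?oner_neq0 /=.
have ch := reg_chart gu rg; have [_ gE] := chart_regular gu ch.
rewrite VE; split=> // l d ld; have := congr1 (fun w : 'M[F]_M => w l d) gE.
rewrite mxE lowerM //; first rewrite [RHS]mxE [X in _ = X + _]mxE.
- by case: eqP => [E|_]; [rewrite E ltnn in ld|rewrite add0r => <-].
- exact: lowerV.
- by move=> a b ab; rewrite dI_mull gl ?if_same.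
Qed.

Definition rI I (i : 'I_m) (k : nat) : nat := #|[pred l : 'I_M | (I l <= i)%N && (l < k)%N]|.

(** Forgetting the coordinates of label larger than [i] is injective on the i-th space of a flag in
    the chart, and sends its intersection with a standard space into a coordinate subspace whose
    dimension is the entry for [I]. *)
Lemma chart_rank I K V : chart I V -> schubert_cell K V ->
 forall i k, (k <= M)%N -> (rI K i k <= rI I i k)%N.
move=> [A nA VA] KV i k kM; rewrite /rI -KV //; set W := (V i :&: _)%VS.
pose f : 'Hom('rV[F]_M, 'rV[F]_M) := linfun (mulmxr (dI I i)).
have fE v d : f v 0 d = if (I d <= i)%N then v 0 d else 0.
 rewrite lfunE /= mxE (bigD1 d) //= big1 ?addr0 => [|l ld]; last by rewrite mxE (negbTE ld) mulr0.
 by rewrite mxE eqxx; case: ifP; rewrite ?mulr1 ?mulr0.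
have ker0 : (W :&: lker f = 0)%VS.
 apply/eqP; rewrite -subv0; apply/subvP => v; rewrite !memv_cap memv_ker memv0.
 case/andP => /andP[]; rewrite VA frE ?(ntype_unit nA) // => /row_spanP[c c0 vE] _ /eqP f0.
 suff -> : v = 0 by [].
 suff c00 : c = 0 by rewrite vE c00 mul0mx.
 apply/rowP => d; rewrite mxE; have [n] := ubnP (I d); elim: n d => // n ih d dn.
 case: (leqP (I d) i) => di; last by rewrite c0 //= -ltnNge.
 have := fE v d; rewrite f0 di mxE vE mulmxDr mulmx1 !mxE big1 ?addr0 // => l _.
 case: (leqP (I d) (I l)) => dl; first by rewrite nA ?mulr0.
 by rewrite ih ?mul0r //; exact: leq_trans dl _.
rewrite -(limg_dim_eq ker0) -(dim_row_span [pred l : 'I_M | (I l <= i)%N && (l < k)%N] (unitmx1 F M)).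
apply: dimvS; apply/subvP => w /memv_imgP[v]; rewrite memv_cap => /andP[_ /std_spaceP vk] ->.
apply/row_spanP; exists (f v); last by rewrite mulmx1.
move=> d /=; rewrite negb_and fE -leqNgt; case: ifP => // _ /= kd; exact: vk.
Qed.

End charts.

(** * Continuity on matrices and on flags *)

Section matrix_topology.
Variables (F : numFieldType) (T : topT).

Lemma mulmx_cts (m n p : nat) (f : T -> 'M[F]_(m, n)) (g : T -> 'M[F]_(n, p)) t :
 cts_at t f -> cts_at t g -> cts_at t (fun x => f x *m g x).
move=> fc gc; apply: mx_cts => i j.
have -> : (fun x => (f x *m g x) i j) = (fun x => \sum_k (f x i k * g x k j : F^o)).
 by apply/funext => x; rewrite mxE.
apply: cvg_big => [|k _]; first exact: add_continuous.
by apply: mulf_cts; exact: coord_cts.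
Qed.

Lemma det_cts n (f : T -> 'M[F]_n) t : cts_at t f ->
 cts_at t (fun x => \det (f x) : F^o).
move=> fc; rewrite /determinant.
have h (s : 'S_n) : cts_at t (fun x => (-1) ^+ s * \prod_i f x i (s i) : F^o).
 apply: mulf_cts; first exact: cstf_cts.
 by apply: (@cvg_big F^o) => [|i _]; [exact: mul_continuous|exact: coord_cts].
by apply: (@cvg_big F^o) => [|s _]; [exact: add_continuous|exact: h].
Qed.

Lemma unit_near n (f : T -> 'M[F]_n) t : cts_at t f -> f t \in unitmx ->
 \forall x \near t, f x \in unitmx.
move=> fc; rewrite unitmxE unitfE => ft.
have hN : nbhs (\det (f t) : F^o) (fun y : F^o => y != 0).
 apply/nbhs_ballP; exists `|\det (f t)|; first by rewrite /= normr_gt0.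
 move=> y; rewrite -ball_normE /= => h; apply/eqP => y0; by rewrite y0 subr0 ltxx in h.
have hN' : nbhs t (fun x => \det (f x) != 0) := det_cts fc hN.
by apply: filterS hN' => x; rewrite unitmxE unitfE.
Qed.

Lemma invmx_cts n (f : T -> 'M[F]_n) t : cts_at t f -> f t \in unitmx ->
 cts_at t (fun x => invmx (f x)).
move=> fc fu; have nu := unit_near fc fu.
have : cts_at t (fun x => (\det (f x))^-1 *: \adj (f x)).
 apply: mx_cts => i j.
 have -> : (fun x => ((\det (f x))^-1 *: \adj (f x)) i j) =
 (fun x => (\det (f x))^-1 * (((-1) ^+ (j + i)) * \det (row' j (col' i (f x))))).
 by apply/funext => x; rewrite !mxE.
 apply: mulf_cts.
 apply: (@cvgV F T (nbhs t) _ (fun x => \det (f x) : F^o)); last exact: det_cts.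
 by move: fu; rewrite unitmxE unitfE.
 apply: mulf_cts; first exact: cstf_cts.
 apply: det_cts; apply: mx_cts => a b.
 have -> : (fun x => (row' j (col' i (f x))) a b) = (fun x => f x (lift j a) (lift i b)).
 by apply/funext => x; rewrite !mxE.
 exact: coord_cts.
move=> h A; rewrite {1}/invmx fu => /h; apply: filterS2 nu => x xu.
by rewrite /invmx /= xu.
Qed.

End matrix_topology.

Section flag_topology.
Variables (F : numFieldType) (m : nat) (e : 'I_m -> nat) (M : nat).
Implicit Types (I K : osp e M) (V : flag F e M) (g h p A B : 'M[F]_M).
Hypothesis sum_e : (\sum_i e i)%N = M.

Lemma flag_dim_mono (i j : 'I_m) : (i <= j)%N -> (flag_dim e i <= flag_dim e j)%N.
move=> ij; rewrite /flag_dim [X in (_ <= X)%N](bigID (fun k : 'I_m => (k <= i)%N)) /=.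
rewrite (eq_bigl (fun k : 'I_m => (k <= j)%N && (k <= i)%N)) ?leq_addr // => k.
by case: (leqP k i) => ki; rewrite ?andbF // (leq_trans ki ij).
Qed.

(** The partition into consecutive intervals; its frames are those by which the topology of the flag
    manifold is defined, and other labellings reduce to it by a row permutation. *)
Lemma std_osp : exists I : osp e M, forall l (i : 'I_m), (I l <= i)%N = (l < flag_dim e i)%N.
have fl (i : 'I_m) : (flag_dim e i <= M)%N.
 by rewrite -[X in (_ <= X)%N]sum_e [X in (_ <= X)%N](bigID (fun k : 'I_m => (k <= i)%N)) leq_addr.
have /choice[K KP] : forall l : 'I_M, exists i : 'I_m, (l < flag_dim e i)%N /\ forall j : 'I_m, (l < flag_dim e j)%N -> (i <= j)%N.
 move=> l; have [i0 il0] : exists i : 'I_m, (l < flag_dim e i)%N.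
 have [m0|m0] := posnP m; first by have := ltn_ord l; rewrite -[X in (_ < X)%N]sum_e big1 // => i _; have := ltn_ord i; rewrite [X in (_ < X)%N]m0.
 have lt : (m.-1 < m)%N by rewrite prednK.
 exists (Ordinal lt); rewrite /flag_dim (eq_bigl xpredT) ?sum_e // => j /=.
 by rewrite -ltnS prednK ?ltn_ord.
 by case: (arg_minnP (P := fun i : 'I_m => (l < flag_dim e i)%N) (fun i : 'I_m => i : nat) il0) => i h1 h2; exists i.
have KE l (i : 'I_m) : (K l <= i)%N = (l < flag_dim e i)%N.
 apply/idP/idP; last by have [_] := KP l; apply.
 by move=> Ki; apply: leq_trans (flag_dim_mono Ki); have [] := KP l.
have osp_K : [forall j, #|[pred c | [ffun l => K l] c == j]| == e j].
 apply/forallP => j; rewrite (eq_card (B := [pred c | K c == j])) => [|c]; last by rewrite !inE ffunE.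
 apply/eqP; apply: (eq_partial_sums (a := fun j => #|[pred c | K c == j]|)) => {}j.
 rewrite -card_le_sum -/(flag_dim e j).
 rewrite (eq_card (B := [pred l : 'I_M | (l < flag_dim e j)%N])) => [|l]; last by rewrite !inE KE.
 rewrite -sum1_card; transitivity (\sum_(l < M | l < flag_dim e j) 1)%N; first exact: eq_bigl.
 by rewrite (big_ord_narrow (fl j)) /= sum1_card card_ord.
by exists (Osp osp_K) => l i; rewrite /= ffunE KE.
Qed.

Lemma std_frame : exists I : osp e M, forall V g, g \in unitmx ->
 (forall i, V i = row_span [pred l : 'I_M | (l < flag_dim e i)%N] g) <-> V = fr I g.
have [I IE] := std_osp; exists I => V g gu; split=> [h|-> i].
 by apply: flagP => i; rewrite h frE //; apply: eq_row_span => l /=; rewrite IE.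
by rewrite frE //; apply: eq_row_span => l /=; rewrite IE.
Qed.

Lemma row_perm_cts (T : topT) (s : 'S_M) (f : T -> 'M[F]_M) t :
 cts_at t f -> cts_at t (fun x => row_perm s (f x)).
move=> fc; apply: mx_cts => i j.
have -> : (fun x => row_perm s (f x) i j) = (fun x => f x (s i) j) by apply/funext => x; rewrite mxE.
exact: coord_cts.
Qed.

Lemma fr_cts I (T : topT) (f : T -> 'M[F]_M) t :
 cts_at t f -> f t \in unitmx -> cts_at t (fun x => fr I (f x)).
move=> fc fu; have [K KE] := std_frame; have [s sE] := osp_perm I K.
have nu := unit_near fc fu; move=> O; rewrite nbhsE => -[W [[U oU UW] Wt] WO].
have fE x : f x \in unitmx -> W (fr I (f x)) <-> U (row_perm s (f x)).
 move=> xu; have pu : row_perm s (f x) \in unitmx by rewrite row_permE unitmx_mul unitmx_perm.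
 by apply: UW => //; apply/KE => //; exact: fr_perm.
have : nbhs (row_perm s (f t)) U by apply: open_nbhs_nbhs; split=> //; apply/fE.
move=> /(row_perm_cts (s := s) fc); apply: filterS2 nu => x xu Ux.
by apply: WO; apply/fE.
Qed.

Lemma open_flag I (O : set (flag F e M)) :
 (forall g, g \in unitmx -> O (fr I g) -> \forall h \near g, O (fr I h)) -> open O.
move=> OP; have [K KE] := std_frame; have [s sE] := osp_perm K I.
pose U := [set g : 'M[F]_M | g \in unitmx /\ O (fr K g)].
exists U; last by move=> g V gu /KE-/(_ gu) ->; split=> [Og|[]].
rewrite openE => g [gu Og]; rewrite /interior /=.
have pu h : h \in unitmx -> row_perm s h \in unitmx by move=> hu; rewrite row_permE unitmx_mul unitmx_perm.
have := OP (row_perm s g) (pu _ gu); rewrite -(fr_perm (I := K)) // => /(_ Og) nO.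
have cid : cts_at g (fun x : 'M[F]_M => x) by move=> A.
have /(_ _ nO) := row_perm_cts (s := s) cid; apply: filterS2 (unit_near cid gu) => h hu Oh.
by split=> //; rewrite (fr_perm sE).
Qed.

(** The topology is a quotient of the invertible matrices, so continuity is tested on the formula in
    terms of a frame. *)
Lemma flag_fun_cts I (Y : topT) (N : set (flag F e M)) (f : flag F e M -> Y) (phi : 'M[F]_M -> Y) :
 open N -> (forall g, g \in unitmx -> N (fr I g) -> f (fr I g) = phi g) ->
 (forall g, g \in unitmx -> N (fr I g) -> cts_at g phi) ->
 forall V, N V -> cts_at V f.
move=> oN fE fc V NV W; rewrite nbhsE => -[W' [oW' W'V] W'W].
have : open (N `&` f @^-1` W').
 apply: (open_flag (I := I)) => g gu [Ng Wg].
 have cid : cts_at g (fun x : 'M[F]_M => x) by move=> A.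
 have Nn : \forall h \near g, N (fr I h).
 by apply: (fr_cts (I := I) cid gu); apply: open_nbhs_nbhs.
 have Wn : \forall h \near g, W' (phi h).
 by apply: (fc g gu Ng); apply: open_nbhs_nbhs; split=> //; rewrite -fE.
 near=> h; have hu : h \in unitmx by near: h; exact: unit_near cid gu.
 have Nh : N (fr I h) by near: h.
 by split=> //; rewrite /= fE //; near: h.
move=> oNW; have : nbhs V (N `&` f @^-1` W') by apply: open_nbhs_nbhs; split.
by apply: filterS => x [_ /W'W].
Unshelve. all: by end_near. Qed.

Lemma blk_cts (T : topT) I i (f : T -> 'M[F]_M) t :
 cts_at t f -> cts_at t (fun x => blk I i (f x)).
move=> fc; apply: mx_cts => l d.
have -> : (fun x => blk I i (f x) l d) = (fun x => if (I l <= i)%N then (if (I d <= i)%N then f x l d else 0) else (l == d)%:R).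
 by apply/funext => x; rewrite mxE.
case: (I l <= i)%N; last exact: cstf_cts.
by case: (I d <= i)%N; [exact: coord_cts|exact: cstf_cts].
Qed.

Lemma gmat_cts I g : regular I g -> cts_at g (gmat I).
move=> rg; have cid : cts_at g (fun x : 'M[F]_M => x) by move=> A.
apply: mx_cts => l d.
have -> : (fun x => gmat I x l d) = (fun x => (invmx (blk I (I l) x) *m (dI F I (I l) *m x)) l d).
 by apply/funext => x; rewrite mxE.
apply: coord_cts; apply: mulmx_cts; first by apply: invmx_cts; [exact: blk_cts|exact: rg].
apply: mulmx_cts => //; exact: cst_continuous.
Qed.

Lemma chart_open I : open (chart (F := F) I).
apply: (open_flag (I := I)) => g gu /(chart_regular gu)[rg _].
have cid : cts_at g (fun x : 'M[F]_M => x) by move=> A.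
near=> h; apply: reg_chart; first by near: h; exact: unit_near cid gu.
near: h; apply: (@filter_forall _ _ (fun i h => blk I i h \in unitmx) (nbhs g) _) => i.
by apply: (@unit_near F _ _ (fun x => blk I i x) g); [exact: blk_cts|exact: rg].
Unshelve. all: by end_near. Qed.

Lemma coordA_cts I V : chart I V -> cts_at V (coordA (F := F) I).
apply: (flag_fun_cts (I := I) (phi := fun g => gmat I g - 1%:M)); first exact: chart_open.
 by move=> g gu /(chart_regular gu)[_ ->]; rewrite addrC addKr.
move=> g gu /(chart_regular gu)[rg _]; apply: mx_cts => l d.
have -> : (fun x => (gmat I x - 1%:M) l d) = (fun x => gmat I x l d - (1%:M : 'M[F]_M) l d).
 by apply/funext => x; rewrite !mxE.
by apply: subf_cts; [apply: coord_cts; exact: gmat_cts|exact: cstf_cts].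
Qed.

Lemma act_cts V h : h \in unitmx ->
 cts_at (V, h) (fun q : flag F e M * 'M[F]_M => actf q.1 q.2).
move=> hu; have [I VI] := cell_cover sum_e V; have /cell_chart[NV _] := VI.
pose phi (q : flag F e M * 'M[F]_M) := fr I ((1%:M + coordA I q.1) *m q.2).
have nE : \forall q \near (V, h), actf q.1 q.2 = phi q.
 exists (chart I, [set h : 'M[F]_M | h \in unitmx]) => /=.
 split; first by apply: open_nbhs_nbhs; split=> //; exact: chart_open.
 by apply: (@unit_near F _ _ (fun x : 'M[F]_M => x) h) => // A.
 move=> [V' h'] /= [/coordAP[nA VE] h'u]; rewrite {1}VE act_fr //; exact: (ntype_unit nA).
have pc : cts_at (V, h) phi.
 apply: fr_cts.
 apply: mulmx_cts; last by apply: cvg_snd.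
 apply: mx_cts => l d.
 have -> : (fun x : flag F e M * 'M[F]_M => (1%:M + coordA I x.1) l d) = (fun x => (1%:M : 'M[F]_M) l d + coordA I x.1 l d).
 by apply/funext => x; rewrite !mxE.
 apply: addf_cts; first exact: cstf_cts.
 apply: coord_cts; apply: (@continuous_comp _ _ _ fst (coordA I)); first by apply: cvg_fst.
 exact: coordA_cts.
 by rewrite unitmx_mul hu andbT; have [nA _] := coordAP NV; exact: (ntype_unit nA).
move=> O /=; have -> : actf V h = phi (V, h) by exact: (nbhs_singleton nE).
move=> /pc; apply: filterS2 nE => q E Oq; change (O (actf q.1 q.2)); by rewrite E.
Qed.

End flag_topology.

(** * Normal coordinates, real and complex *)

Section normal_entries.
Variables (F : fieldType) (m : nat) (e : 'I_m -> nat) (M : nat) (I : osp e M).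

Lemma mem_np (p : 'I_M * 'I_M) :
 (p \in normal_pairs I) = (p.1 < p.2)%N && (I p.1 < I p.2)%N.
rewrite mem_filter andb_idr // => _.
by apply/allpairsPdep; exists p.1, p.2; rewrite !mem_enum; case: p.
Qed.

Lemma uniq_np : uniq (normal_pairs I).
apply: filter_uniq; apply: allpairs_uniq; rewrite ?enum_uniq //.
by move=> [a b] [c d] _ _.
Qed.

Lemma sum_normal (y : nat -> F) l d :
 (\sum_(j < codim I) y j *: normal_basis F j) l d =
 if (l, d) \in normal_pairs I then y (index (l, d) (normal_pairs I)) else 0.
have tE j : tnth (in_tuple (normal_pairs I)) j = nth (l, d) (normal_pairs I) j by rewrite (tnth_nth (l, d)).
rewrite summxE; case: ifP => ld.
 have lt : (index (l, d) (normal_pairs I) < codim I)%N by rewrite index_mem.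
 rewrite (bigD1 (Ordinal lt)) //= big1 ?addr0 => [|j jn].
 by rewrite /normal_basis mxE tE nth_index // mxE !eqxx mulr1.
 rewrite /normal_basis mxE tE mxE; case: eqP => [E1|]; last by rewrite mulr0.
 case: eqP => [E2|]; last by rewrite mulr0.
 have pj : nth (l, d) (normal_pairs I) j = (l, d) by rewrite [LHS]surjective_pairing -E1 -E2.
 by case/negP: jn; apply/eqP/val_inj; rewrite /= -[in RHS]pj index_uniq ?uniq_np // ltn_ord.
apply: big1 => j _; rewrite /normal_basis mxE tE mxE; case: eqP => [E1|]; last by rewrite mulr0.
case: eqP => [E2|]; last by rewrite mulr0.
have pj : nth (l, d) (normal_pairs I) j = (l, d) by rewrite [LHS]surjective_pairing -E1 -E2.
by move: ld; rewrite -{1}pj mem_nth // ltn_ord.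
Qed.

End normal_entries.
(** A row vector as a sequence extended by zero, the form in which [real_normal] and
    [complex_normal] expect their coordinates. *)
Definition wx (R : realType) k (w : 'rV[R]_k) (j : nat) : R :=
 if insub j is Some i then w 0 i else 0.
Lemma wxE (R : realType) k (w : 'rV[R]_k) (j : 'I_k) : wx w j = w 0 j.
by rewrite /wx; case: insubP => [i _ ij|]; [congr (w 0 _); exact: val_inj|rewrite ltn_ord]. Qed.

Lemma wx_cts (R : realType) k j : continuous (fun w : 'rV[R]_k => wx w j : R^o).
rewrite /wx; case: insub => [i|]; last by move=> w; exact: cstf_cts.
exact: coord_continuous.
Qed.

(* Real coordinates on the normal space: [nrm] is [real_normal] or
 [complex_normal], and [nco] reads off the coordinates of a matrix. *)
Record ncoords (R : realType) (F : numFieldType) (m : nat) (e : 'I_m -> nat) (M : nat) := NCoords {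
 ncd : osp e M -> nat;
 nrm : forall I : osp e M, 'rV[R]_(ncd I) -> 'M[F]_M;
 nco : forall I : osp e M, 'M[F]_M -> 'rV[R]_(ncd I);
 emb : R -> F;
 emb0 : emb 0 = 0;
 emb1 : emb 1 = 1;
 emb_cts : continuous (emb : R^o -> F^o);
 nrm_cts : forall I, continuous (nrm (I := I));
 nco_cts : forall I, continuous (nco I);
 nrmK : forall I w, nco I (nrm (I := I) w) = w;
 nrm0 : forall I, nrm (I := I) 0 = 0;
 nrm_out : forall (I : osp e M) w (l d : 'I_M), ~~ ((l < d)%N && (I l < I d)%N) -> nrm (I := I) w l d = 0;
 nrm_nco : forall (I : osp e M) A (l d : 'I_M), (l < d)%N && (I l < I d)%N -> nrm (nco I A) l d = A l d }.

Section chart_fields.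
Variables (R : realType) (F : numFieldType) (m : nat) (e : 'I_m -> nat) (M : nat).
Variable C : ncoords R F e M.
Hypothesis sum_e : (\sum_i e i)%N = M.
Implicit Types (I K : osp e M) (V : flag F e M).

Definition slice I (w : 'rV[R]_(ncd C I)) : flag F e M := fr I (1%:M + nrm w).
Definition ycoord I V : 'rV[R]_(ncd C I) := nco C I (coordA I V).
(** In the chart the entries above the diagonal are normal to the cell and the others run along it;
    only the latter are contracted. *)
Definition tscale (r : R) (A : 'M[F]_M) : 'M[F]_M :=
 \matrix_(l, d) if (l < d)%N then A l d else emb C (1 - r) * A l d.
Definition hretr I V (r : R) : flag F e M := fr I (1%:M + tscale r (coordA I V)).

Lemma ntype_nrm I w : ntype I (nrm (n := C) (I := I) w).
by move=> l d dl; apply: nrm_out; rewrite [(I l < _)%N]ltnNge dl andbF. Qed.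
Lemma ntype_tscale I r A : ntype I A -> ntype I (tscale r A).
by move=> nA l d dl; rewrite mxE nA // mulr0 if_same. Qed.

Lemma nco0 I (A : 'M[F]_M) : (forall l d : 'I_M, (l < d)%N -> (I l < I d)%N -> A l d = 0) -> nco C I A = 0.
move=> A0; rewrite -[LHS]nrmK; suff -> : nrm (nco C I A) = nrm (n := C) (I := I) 0 by rewrite nrmK.
apply/matrixP => l d; rewrite nrm0 mxE; case: (boolP ((l < d)%N && (I l < I d)%N)) => [ld|]; last exact: nrm_out.
by rewrite nrm_nco //; apply: A0; case/andP: ld.
Qed.

Lemma nco_eq I (A B : 'M[F]_M) : (forall l d : 'I_M, (l < d)%N -> (I l < I d)%N -> A l d = B l d) -> nco C I A = nco C I B.
move=> AB; rewrite -[LHS]nrmK -[RHS]nrmK; congr nco; apply/matrixP => l d.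
case: (boolP ((l < d)%N && (I l < I d)%N)) => [ld|ld]; last by rewrite !nrm_out.
by rewrite !nrm_nco //; apply: AB; case/andP: ld.
Qed.

Lemma cell_ycoord I V : chart I V -> schubert_cell I V <-> ycoord I V = 0.
move=> NV; have [nA VE] := coordAP NV; split=> [/cell_chart[_ A0]|y0].
 by apply: nco0 => l d ld _; exact: A0.
apply/cell_chart; split=> // l d ld; case: (leqP (I d) (I l)) => dl; first exact: nA.
have := nrm_nco C (I := I) (coordA I V) (l := l) (d := d); rewrite ld dl => /(_ isT) <-.
by rewrite -/(ycoord I V) y0 nrm0 mxE.
Qed.

Lemma slice_cts I : continuous (@slice I).
move=> w; apply: (@fr_cts F m e M sum_e I _ (fun w => 1%:M + nrm w) w); last first.
 by apply: (ntype_unit (I := I)); exact: ntype_nrm.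
apply: mx_cts => l d.
have -> : (fun x : 'rV[R]_(ncd C I) => (1%:M + nrm x) l d) = (fun x => (1%:M : 'M[F]_M) l d + nrm x l d).
 by apply/funext => x; rewrite mxE.
by apply: addf_cts; [exact: cstf_cts|apply: coord_cts; exact: nrm_cts].
Qed.

Lemma slice_chart I w : chart I (@slice I w).
by apply: chart_fr; exact: ntype_nrm. Qed.
Lemma ycoord_slice I w : ycoord I (@slice I w) = w.
by rewrite /ycoord coordA_fr ?nrmK //; exact: ntype_nrm. Qed.

Lemma ycoord_cts I V : chart I V -> cts_at V (ycoord I).
move=> NV; apply: (@continuous_comp _ _ _ (coordA I) (nco C I)); first exact: coordA_cts.
exact: nco_cts.
Qed.

Lemma hretr_cts I V r : chart I V -> cts_at (V, r) (fun p => hretr I p.1 p.2).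
move=> NV; have cA : cts_at (V, r) (fun p : flag F e M * R => coordA I p.1).
 by apply: (@continuous_comp _ _ _ fst (coordA I)); [exact: cvg_fst|exact: coordA_cts].
apply: (fr_cts sum_e); last first.
 by apply: (ntype_unit (I := I)); apply: ntype_tscale; have [] := coordAP NV.
apply: mx_cts => l d.
have -> : (fun x : flag F e M * R => (1%:M + tscale x.2 (coordA I x.1)) l d) =
 (fun x => (1%:M : 'M[F]_M) l d + (if (l < d)%N then coordA I x.1 l d else emb C (1 - x.2) * coordA I x.1 l d)).
 by apply/funext => x; rewrite [in RHS]mxE !mxE.
apply: addf_cts; first exact: cstf_cts.
case: (l < d)%N; first exact: coord_cts.
apply: mulf_cts; last exact: coord_cts.
apply: (@continuous_comp _ _ _ (fun x : flag F e M * R => (1 - x.2 : R^o)) (emb C : R^o -> F^o)); last exact: emb_cts.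
by apply: subf_cts; [exact: cstf_cts|exact: cvg_snd].
Qed.

Lemma hretr0 I V : chart I V -> hretr I V 0 = V.
move=> NV; have [nA VE] := coordAP NV; rewrite [RHS]VE /hretr; congr (fr I (_ + _)).
by apply/matrixP => l d; rewrite mxE subr0 emb1 mul1r if_same.
Qed.

Lemma hretr1 I V : chart I V -> hretr I V 1 = slice (ycoord I V).
move=> NV; have [nA VE] := coordAP NV; rewrite /hretr /slice; congr (fr I (_ + _)).
apply/matrixP => l d; rewrite mxE subrr emb0 mul0r.
case: (boolP ((l < d)%N && (I l < I d)%N)) => [ld|ld]; first by rewrite nrm_nco //; case/andP: ld => ->.
rewrite nrm_out //; move: ld; rewrite negb_and; case: ifP => //= _; rewrite -leqNgt; exact: nA.
Qed.

Lemma hretr_chart I V r : chart I V -> chart I (hretr I V r).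
by move=> /coordAP[nA _]; apply: chart_fr; exact: ntype_tscale. Qed.

Lemma hretr_ycoord I V r : chart I V -> ycoord I (hretr I V r) = ycoord I V.
move=> /coordAP[nA _]; rewrite /ycoord coordA_fr; last exact: ntype_tscale.
by apply: nco_eq => l d ld _; rewrite mxE ld.
Qed.

End chart_fields.
Section real_coords.
Variables (R : realType) (m : nat) (e : 'I_m -> nat) (M : nat).
Implicit Types (I : osp e M).
Definition pairn I (j : 'I_(codim I)) : 'I_M * 'I_M := tnth (in_tuple (normal_pairs I)) j.
Lemma pairn_mem I j : ((pairn (I := I) j).1 < (pairn j).2)%N && (I (pairn j).1 < I (pairn j).2)%N.
by rewrite -mem_np mem_tnth. Qed.
Lemma index_pairn I j : index (pairn (I := I) j) (normal_pairs I) = j.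
rewrite /pairn (tnth_nth (pairn j)) index_uniq ?uniq_np //; exact: ltn_ord.
Qed.

Lemma pairn_index I (l d : 'I_M) (h : (l < d)%N && (I l < I d)%N) : exists j, pairn (I := I) j = (l, d).
have lt : (index (l, d) (normal_pairs I) < codim I)%N by rewrite index_mem mem_np.
by exists (Ordinal lt); rewrite /pairn (tnth_nth (l, d)) /= nth_index // mem_np.
Qed.

Definition rnrm I (w : 'rV[R]_(codim I)) : 'M[R]_M := real_normal I (wx w).
Definition rnco I (A : 'M[R]_M) : 'rV[R]_(codim I) := \row_j A (pairn j).1 (pairn j).2.
Lemma rnrmE I w l d : @rnrm I w l d = if (l, d) \in normal_pairs I then wx w (index (l, d) (normal_pairs I)) else 0.
exact: sum_normal. Qed.

Lemma rnrm_nco I A (l d : 'I_M) : (l < d)%N && (I l < I d)%N -> rnrm (rnco I A) l d = A l d.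
move=> ld; rewrite rnrmE mem_np ld; have [j jE] := pairn_index ld.
by rewrite -jE index_pairn wxE mxE jE.
Qed.

Lemma rnrmK I w : rnco I (@rnrm I w) = w.
apply/rowP => j; rewrite mxE rnrmE -surjective_pairing mem_np pairn_mem index_pairn.
exact: wxE.
Qed.

Definition real_nc : ncoords R R e M.
apply: (@NCoords R R m e M (@codim m e M) rnrm rnco id) => //.
- by move=> x A.
- move=> I w; apply: (@mx_cts R _ _ _ (@rnrm I) w) => l d.
 have -> : (fun x => @rnrm I x l d) = (fun x => if (l, d) \in normal_pairs I then wx x (index (l, d) (normal_pairs I)) else 0).
 by apply/funext => x; exact: rnrmE.
 by case: ((l, d) \in _); [exact: wx_cts|exact: cstf_cts].
- move=> I A; apply: (@mx_cts R _ _ _ (@rnco I) A) => i j.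
 have -> : (fun x => @rnco I x i j) = (fun x => x (pairn j).1 (pairn j).2).
 by apply/funext => x; rewrite (ord1 i) mxE.
 exact: coord_continuous.
- exact: rnrmK.
- by move=> I; apply/matrixP => l d; rewrite rnrmE mxE; case: ifP => // _; rewrite /wx; case: insub => // i; rewrite mxE.
- by move=> I w l d; rewrite rnrmE mem_np => /negbTE ->.
- exact: rnrm_nco.
Defined.

End real_coords.
Section complex_coords.
Variables (R : realType).
Definition Cx : numFieldType := R[i].

Lemma Cx_cts (T : topT) (f : T -> Cx) t :
 cts_at t (fun x => complex.Re (f x) : R^o) -> cts_at t (fun x => complex.Im (f x) : R^o) ->
 cts_at t f.
move=> fr fi P /nbhs_ballP[e e0 h].
have e1 : 0 < complex.Re e by move: e0; rewrite /= ltcE => /andP[].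
have eE : e = (complex.Re e)%:C%C.
 by move: e0; rewrite /= ltcE => /andP[/eqP i0 _]; case: (e) i0 => a b /= ->.
have n1 : \forall x \near t, `|complex.Re (f t) - complex.Re (f x)| < complex.Re e / 2.
 have hN : nbhs (complex.Re (f t) : R^o) (fun y : R^o => `|complex.Re (f t) - y| < complex.Re e / 2).
 apply/nbhs_ballP; exists (complex.Re e / 2) => /=; first by rewrite divr_gt0.
 by move=> y; rewrite -ball_normE.
 exact: (fr _ hN).
have n2 : \forall x \near t, `|complex.Im (f t) - complex.Im (f x)| < complex.Re e / 2.
 have hN : nbhs (complex.Im (f t) : R^o) (fun y : R^o => `|complex.Im (f t) - y| < complex.Re e / 2).
 apply/nbhs_ballP; exists (complex.Re e / 2) => /=; first by rewrite divr_gt0.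
 by move=> y; rewrite -ball_normE.
 exact: (fi _ hN).
apply: filterS2 n1 n2 => x x1 x2; apply: h; rewrite -(@ball_normE Cx Cx^o) /=.
rewrite eE; case: (f t) (f x) x1 x2 => a b [c d] /= x1 x2.
rewrite normc_def /= ltcR -(ger0_norm (ltW e1)) -sqrtr_sqr ltr_sqrt; last by rewrite exprn_gt0.
have : `|a - c| ^+ 2 < (complex.Re e / 2) ^+ 2 by rewrite ltr_pXn2r // nnegrE // divr_ge0 // ltW.
have : `|b - d| ^+ 2 < (complex.Re e / 2) ^+ 2 by rewrite ltr_pXn2r // nnegrE // divr_ge0 // ltW.
rewrite !real_normK ?num_real //; have := e1; nra.
Qed.

Lemma Re_cts : continuous (fun z : Cx => complex.Re z : R^o).
move=> z P /nbhs_ballP[r /= r0 h].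
have rC : (0 : Cx) < r%:C%C by rewrite ltcR.
have nz := @nbhsx_ballx Cx Cx^o z _ rC.
apply: filterS nz => y; rewrite -(@ball_normE Cx Cx^o) /= => zy; apply: h; rewrite -ball_normE /=.
rewrite -ltcR; apply: le_lt_trans zy; apply: le_trans (normc_ge_Re (z - y)).
by case: (z) (y) => a b [c d] /=.
Qed.

Lemma Im_cts : continuous (fun z : Cx => complex.Im z : R^o).
have -> : (fun z : Cx => complex.Im z : R^o) = (fun z : Cx => complex.Re (- ('i%C : R[i]) * z) : R^o).
 by apply/funext => -[a b] /=; rewrite oppr0 mul0r mulN1r sub0r opprK.
move=> z; apply: (@continuous_comp _ _ _ (fun z : Cx => (- ('i%C : R[i]) * z : Cx)) (fun z : Cx => complex.Re z : R^o)); last exact: Re_cts.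
by apply: (@mulf_cts Cx); [exact: cstf_cts|move=> ?].
Qed.

Variables (m : nat) (e : 'I_m -> nat) (M : nat).
Implicit Types (I : osp e M).

Definition cnrm I (w : 'rV[R]_((codim I).*2)) : 'M[Cx]_M := complex_normal I (wx w).
Definition cnco I (A : 'M[Cx]_M) : 'rV[R]_((codim I).*2) :=
 \row_j (if odd j then complex.Im (A (pairn (half_ord j)).1 (pairn (half_ord j)).2)
 else complex.Re (A (pairn (half_ord j)).1 (pairn (half_ord j)).2)).

Lemma cnrmE I w (l d : 'I_M) : @cnrm I w l d = if (l, d) \in normal_pairs I then
 (wx w (index (l, d) (normal_pairs I)).*2 +i* wx w (index (l, d) (normal_pairs I)).*2.+1)%C else 0.
exact: (sum_normal (F := Cx) I (fun j => (wx w j.*2 +i* wx w j.*2.+1)%C)). Qed.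
Lemma wx_index k (w : 'rV[R]_k) (i : nat) (lt : (i < k)%N) : wx w i = w 0 (Ordinal lt).
exact: (wxE w (Ordinal lt)). Qed.

Lemma cnrm_nco I A (l d : 'I_M) : (l < d)%N && (I l < I d)%N -> cnrm (cnco I A) l d = A l d.
move=> ld; rewrite cnrmE mem_np ld; have [j jE] := pairn_index ld.
rewrite -jE index_pairn.
have l0 : (j.*2 < (codim I).*2)%N by rewrite ltn_double ltn_ord.
have l1 : (j.*2.+1 < (codim I).*2)%N by rewrite ltn_Sdouble ltn_ord.
rewrite (wx_index _ l0) (wx_index _ l1) !mxE /= odd_double /=.
have -> : half_ord (Ordinal l0) = j by apply: val_inj; rewrite /= doubleK.
have -> : half_ord (Ordinal l1) = j by apply: val_inj; rewrite /= uphalf_double.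
by rewrite jE /=; case: (A l d).
Qed.

Lemma cnrmK I w : cnco I (@cnrm I w) = w.
apply/rowP => j; rewrite mxE cnrmE -surjective_pairing mem_np pairn_mem index_pairn /=.
rewrite -[RHS]wxE; case: (odd j) (odd_double_half j) => /= E; congr (wx w _); exact: E.
Qed.

Definition cplx_nc : ncoords R Cx e M.
apply: (@NCoords R Cx m e M (fun I => (@codim m e M I).*2) cnrm cnco (real_complex R)) => //.
- by move=> x; apply: Cx_cts => /=; [move=> A|exact: cst_continuous].
- move=> I w; apply: (@mx_cts Cx _ _ _ (@cnrm I) w) => l d.
 have -> : (fun x => @cnrm I x l d) = (fun x => if (l, d) \in normal_pairs I then
 (wx x (index (l, d) (normal_pairs I)).*2 +i* wx x (index (l, d) (normal_pairs I)).*2.+1)%C else 0).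
 by apply/funext => x; exact: cnrmE.
 case: ((l, d) \in _); last exact: cstf_cts.
 by apply: Cx_cts; exact: wx_cts.
- move=> I A; apply: (@mx_cts R _ _ _ (@cnco I) A) => i j.
 have -> : (fun x => @cnco I x i j) = (fun x => if odd j then complex.Im (x (pairn (half_ord j)).1 (pairn (half_ord j)).2)
 else complex.Re (x (pairn (half_ord j)).1 (pairn (half_ord j)).2)).
 by apply/funext => x; rewrite (ord1 i) mxE.
 have cA : cts_at A (fun x : 'M[Cx]_M => x (pairn (half_ord j)).1 (pairn (half_ord j)).2).
 exact: coord_continuous.
 case: (odd j); [apply: (continuous_comp cA); exact: Im_cts|apply: (continuous_comp cA); exact: Re_cts].
- exact: cnrmK.
- move=> I; apply/matrixP => l d; rewrite cnrmE mxE; case: ifP => // _; rewrite /wx.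
 by do 2!(case: insub => [?|]; rewrite ?mxE).
- by move=> I w l d; rewrite cnrmE mem_np => /negbTE ->.
- exact: cnrm_nco.
Defined.

End complex_coords.

(** * Rank functions and codimension *)

Section osp_order.
Variables (m : nat) (e : 'I_m -> nat) (M : nat).
Implicit Types (I K L : osp e M).

Lemma osp_comp_subproof I (s : 'S_M) : [forall j, #|[pred c | [ffun l => I (s l)] c == j]| == e j].
apply/forallP => j; rewrite -(osp_card I j) -!sum1_card [X in _ == X](reindex_inj (@perm_inj _ s)) /=.
by apply/eqP; apply: eq_bigl => l; rewrite !inE ffunE.
Qed.

Definition osp_comp I s : osp e M := Osp (osp_comp_subproof I s).
Lemma osp_compE I s l : osp_comp I s l = I (s l).
by rewrite /= ffunE. Qed.
Lemma ospP I K : (forall l, I l = K l) -> I = K.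
by move=> h; apply: val_inj; apply/ffunP. Qed.

Lemma rIE I i k : rI I i k = (\sum_l ((I l <= i) && (l < k)))%N.
rewrite /rI -sum1_card big_mkcond /=; apply: eq_bigr => l _; rewrite !inE.
by case: (_ && _).
Qed.

Lemma rIS I i (k : 'I_M) : rI I i k.+1 = (rI I i k + (I k <= i))%N.
rewrite !rIE (bigD1 k) //= [in RHS](bigD1 k) //= ltnSn ltnn andbT andbF addnC add0n; congr (_ + _)%N.
by apply: eq_bigr => l lk; rewrite ltnS [(l <= k)%N]leq_eqVlt [l == k :> nat](negbTE lk).
Qed.

Lemma rI_inj I K : (forall i k, (k <= M)%N -> rI I i k = rI K i k) -> I = K.
move=> h; have hl (l : 'I_M) (i : 'I_m) : (I l <= i)%N = (K l <= i)%N.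
 have := h i l.+1 (ltn_ord l); rewrite !rIS h; last exact: ltnW.
 by move=> /addnI; case: (I l <= i)%N; case: (K l <= i)%N.
by apply: ospP => l; apply: val_inj; apply/eqP; rewrite eqn_leq hl leqnn -hl leqnn.
Qed.

(** A linear extension of the order by rank functions; it ranks the cells of the complex
    stratification. *)
Definition rsum I := (\sum_(i < m) \sum_(k < M.+1) rI I i k)%N.

Lemma rsum_lt I K : (forall i k, (k <= M)%N -> rI K i k <= rI I i k)%N -> K <> I ->
 (rsum K < rsum I)%N.
move=> h KI; have aux (a b x y : nat) : (a <= b -> x <= y -> a + x == b + y -> b <= a)%N by lia.
rewrite ltn_neqAle; have le i (k : 'I_M.+1) : (rI K i k <= rI I i k)%N by apply: h; rewrite -ltnS.
have le2 (i : 'I_m) : (\sum_(k < M.+1) rI K i k <= \sum_(k < M.+1) rI I i k)%N by apply: leq_sum.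
rewrite leq_sum ?andbT //; apply/eqP => E; apply: KI; apply: rI_inj => i k kM.
have E1 : (\sum_(k < M.+1) rI K i k = \sum_(k < M.+1) rI I i k)%N.
 apply/eqP; rewrite eqn_leq le2 /=; move/eqP: E; rewrite /rsum (bigD1 i) //= [in X in _ == X](bigD1 i) //=.
 by apply: aux (le2 i) _; apply: leq_sum => j _; exact: le2.
have kM' : (k < M.+1)%N by []; apply/eqP; rewrite eqn_leq h //=.
move/eqP: E1; rewrite (bigD1 (Ordinal kM')) //= [in X in _ == X](bigD1 (Ordinal kM')) //=.
by apply: aux (h i k kM) _; apply: leq_sum => j _; exact: le.
Qed.

Definition gI I (p q : 'I_M) : nat := (p < q)%N && (I p < I q)%N.

Lemma codimE I : codim I = (\sum_p \sum_q gI I p q)%N.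
rewrite /codim /normal_pairs size_filter -sum1_count big_mkcond /= big_allpairs_dep /=.
rewrite big_enum /=; apply: eq_bigr => p _; rewrite big_enum /=.
by apply: eq_bigr => q _; rewrite /gI; case: (_ && _).
Qed.

Lemma sum_split2 (c d : 'I_M) (g : 'I_M -> 'I_M -> nat) : c != d ->
 (\sum_p \sum_q g p q = \sum_(p | (p != c) && (p != d)) \sum_(q | (q != c) && (q != d)) g p q
 + \sum_(p | (p != c) && (p != d)) (g p c + g p d + g c p + g d p)
 + (g c c + g c d + g d c + g d d))%N.
move=> cd; have s2 (f : 'I_M -> nat) : (\sum_p f p = f c + f d + \sum_(p | (p != c) && (p != d)) f p)%N.
 by rewrite (bigD1 c) //= (bigD1 d) 1?eq_sym //= addnA.
rewrite s2 !s2 !big_split /= (eq_bigr _ (fun p _ => s2 (g p))) !big_split /=.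
lia.
Qed.

Lemma codim_swap I (c d : 'I_M) : (c < d)%N -> (I d < I c)%N ->
 (codim I < codim (osp_comp I (tperm c d)))%N.
have aux (x y p ix iy ip : nat) : (x < y -> iy < ix -> p != x -> p != y ->
 ((p < x) && (ip < ix)) + ((p < y) && (ip < iy)) + ((x < p) && (ix < ip)) + ((y < p) && (iy < ip)) <=
 ((p < x) && (ip < iy)) + ((p < y) && (ip < ix)) + ((x < p) && (iy < ip)) + ((y < p) && (ix < ip)))%N.
 move=> xy yx; case: (ltngtP p x) => // px _; case: (ltngtP p y) => // py _ /=; rewrite ?andbT ?andbF /=.
 - lia.
 - lia.
 - case: (ltnP ip ix) => ?; case: (ltnP ip iy) => ?; case: (ltnP ix ip) => ?; case: (ltnP iy ip) => ? /=; lia.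
 - lia.
move=> cd dc; have ncd : c != d by rewrite -val_eqE /= neq_ltn cd.
have Kc : osp_comp I (tperm c d) c = I d by rewrite osp_compE tpermL.
have Kd : osp_comp I (tperm c d) d = I c by rewrite osp_compE tpermR.
have Ke p : (p != c) && (p != d) -> osp_comp I (tperm c d) p = I p.
 by case/andP => pc pd; rewrite osp_compE tpermD // eq_sym.
set K := osp_comp _ _ in Kc Kd Ke *; rewrite !codimE !(sum_split2 _ ncd).
have -> : (\sum_(p | (p != c) && (p != d)) \sum_(q | (q != c) && (q != d)) gI I p q =
 \sum_(p | (p != c) && (p != d)) \sum_(q | (q != c) && (q != d)) gI K p q)%N.
 by apply: eq_bigr => p /Ke pE; apply: eq_bigr => q /Ke qE; rewrite /gI pE qE.
have l1 : (\sum_(p | (p != c) && (p != d)) (gI I p c + gI I p d + gI I c p + gI I d p) <=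
 \sum_(p | (p != c) && (p != d)) (gI K p c + gI K p d + gI K c p + gI K d p))%N.
 by apply: leq_sum => p pE; rewrite /gI Kc Kd Ke //; case/andP: pE => pc pd; exact: aux.
have l2 : (gI I c c + gI I c d + gI I d c + gI I d d < gI K c c + gI K c d + gI K d c + gI K d d)%N.
 rewrite /gI !Kc !Kd !ltnn cd dc /= [(d < c)%N]ltnNge (ltnW cd) /= [(I c < I d)%N]ltnNge (ltnW dc) //.
have addlt (S a b x y : nat) : (a <= b -> x < y -> S + a + x < S + b + y)%N by lia.
exact: addlt.
Qed.

Lemma rI_swap I (c d : 'I_M) i k : (c < d)%N ->
 (rI (osp_comp I (tperm c d)) i k + ((I c <= i) && (c < k)) + ((I d <= i) && (d < k)) =
 rI I i k + ((I d <= i) && (c < k)) + ((I c <= i) && (d < k)))%N.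
move=> cd; have ncd : c != d by rewrite -val_eqE /= neq_ltn cd.
rewrite !rIE (bigD1 c) //= (bigD1 d) 1?eq_sym //= ffunE tpermL ffunE tpermR.
rewrite [in RHS](bigD1 c) //= [in RHS](bigD1 d) 1?eq_sym //=.
rewrite (eq_bigr (fun l => ((I l <= i) && (l < k) : nat))%N); last first.
 by move=> p /andP[pc pd]; rewrite ffunE tpermD // eq_sym.
move: (\sum_(l | (l != c) && (l != d)) ((I l <= i) && (l < k)))%N => S; lia.
Qed.

(** A Bruhat order argument: as long as [K] differs from [L], exchanging two suitable labels of [K]
    raises the codimension and keeps the rank function below that of [L]. *)
Lemma codim_lt K L : (forall i k, (k <= M)%N -> rI K i k <= rI L i k)%N -> K <> L ->
 (codim K < codim L)%N.
have [n] := ubnP (rsum L - rsum K)%N; elim: n K => // n ih K; rewrite ltnS => Kn h KL.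
have [c Kc cmin] : exists2 c, K c != L c & forall l : 'I_M, (l < c)%N -> K l = L l.
 have [c0 Kc0] : exists c, K c != L c.
 by apply/existsP; rewrite -negb_forall; apply/negP => /forallP E; apply: KL; apply: ospP => l; apply/eqP/E.
 case: (arg_minnP (P := fun c => K c != L c) (fun c : 'I_M => c : nat) Kc0) => c h1 h2; exists c => // l lc.
 by apply/eqP/negPn/negP => /h2; rewrite leqNgt lc.
have pre i : rI K i c = rI L i c.
 rewrite !rIE; apply: eq_bigr => l _; case: (ltnP l c) => lc; rewrite ?andbF //.
 by rewrite cmin.
have Lc : (L c < K c)%N.
 have nKc : (L c : nat) != K c by rewrite eq_sym (inj_eq val_inj).
 rewrite ltn_neqAle nKc /=; have := h (K c) c.+1 (ltn_ord c).
 by rewrite !rIS pre leqnn leq_add2l; case: (L c <= K c)%N.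
set a := L c in Lc *.
(* [c] is the first place where the labels differ, and [d] will be the first later place whose label
   lies between [L c] and [K c], the upper bound excluded; such a place exists because both
   partitions use the label [L c] equally often. *)
pose Q (d : 'I_M) := (c < d)%N && (a <= K d)%N && (K d < K c)%N.
have [d0 Qd0] : exists d, Q d.
 have [d [cd da]] : exists d : 'I_M, (c < d)%N /\ K d = a.
 apply: contrapT => nd; have : (#|[pred l | K l == a]| < #|[pred l | L l == a]|)%N.
 apply: proper_card; apply/properP; split.
 apply/fintype.subsetP => l; rewrite !inE => /eqP la; case: (ltngtP l c) => lc.
 - by rewrite -cmin // la.
 - by case: nd; exists l.
 - by rewrite (val_inj lc) eqxx.
 by exists c; rewrite !inE ?eqxx // -(inj_eq val_inj) /= neq_ltn Lc orbT.
 by rewrite !osp_card ltnn.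
 by exists d; rewrite /Q cd da leqnn Lc.
case: (arg_minnP (P := Q) (fun d : 'I_M => d : nat) Qd0) => d /andP[/andP[cd ad] dc] dmin.
have mid (l : 'I_M) : (c < l)%N -> (l < d)%N -> (a <= K l)%N -> (K c <= K l)%N.
 move=> cl ld al; rewrite leqNgt; apply/negP => lc; have := dmin l; rewrite /Q cl al lc => /(_ isT).
 by rewrite leqNgt ld.
set K' := osp_comp K (tperm c d).
have KK' i k : (rI K i k <= rI K' i k)%N.
 have := rI_swap K i k cd; rewrite -/K'; case: (leqP (K c) i) => ci; case: (leqP (K d) i) => di; case: (ltnP c k) => ck; case: (ltnP d k) => dk /=; lia.
have K'L i k : (k <= M)%N -> (rI K' i k <= rI L i k)%N.
 move=> kM; have E := rI_swap K i k cd; rewrite -/K' in E; have hik := h i k kM.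
 (* The entries that the exchange raises. There [K] has no label from [a] to [i] at the positions
    from [c] up to [k], by the choice of [d], whereas [L] has one at [c]. *)
 have main : (K d <= i)%N -> (i < K c)%N -> (c < k)%N -> (k <= d)%N -> (rI K i k < rI L i k)%N.
 move=> di ic ck kd.
 have sp (J : osp e M) : rI J i k = (\sum_l ((J l < a) && (l < k)) + \sum_l [&& a <= J l, J l <= i & l < k])%N.
 rewrite rIE -big_split; apply: eq_bigr => l _ /=; have := leq_trans ad di.
 by case: (ltnP (J l) a) => ?; case: (leqP (J l) i) => ?; case: (l < k)%N => /=; lia.
 rewrite !sp -addnS leq_add //.
 have [a0|a0] := posnP a; first by rewrite big1 // => l _; rewrite a0 ltn0.
 have am : (a.-1 < m)%N by apply: leq_ltn_trans (ltn_ord a); exact: leq_pred.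
 have sE (J : osp e M) : (\sum_l ((J l < a) && (l < k)) = rI J (Ordinal am) k)%N.
 rewrite rIE; apply: eq_bigr => l _; congr (nat_of_bool (_ && _)).
 by rewrite /= -[in LHS](prednK a0) ltnS.
 by rewrite !sE; exact: h.
 rewrite (bigD1 c) //= [X in (_ < X)%N](bigD1 c) //= -/a leqnn ck (leq_trans ad di) [(K c <= i)%N]leqNgt ic /= andbF add0n add1n ltnS.
 apply: leq_sum => l lc; case: (ltngtP l c) => lc'.
 - by rewrite cmin.
 - case: (boolP [&& a <= K l, K l <= i & l < k]%N) => // /and3P[al li lk].
 by have := mid l lc' (leq_trans lk kd) al; rewrite leqNgt (leq_ltn_trans li ic).
 - by move: lc; rewrite (val_inj lc') eqxx.
 move: main E hik; case: (leqP (K c) i) => ci; case: (leqP (K d) i) => di; case: (ltnP c k) => ck; case: (ltnP d k) => dk /=; try lia.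
have cK' := codim_swap cd dc; rewrite -/K' in cK'.
have [K'L'|/eqP K'L'] := eqVneq K' L; first by rewrite -K'L'.
apply: (leq_trans cK'); apply/ltnW; apply: ih => //.
have K'K : (rsum K < rsum K')%N.
 by apply: rsum_lt => // E; move: cK'; rewrite E ltnn.
have := rsum_lt K'L K'L'; lia.
Qed.

End osp_order.

(** * Closures of cells *)

Section closures.
Variables (F : numFieldType) (m : nat) (e : 'I_m -> nat) (M : nat).
Hypothesis sum_e : (\sum_i e i)%N = M.
Implicit Types (I K L : osp e M) (V : flag F e M).

Lemma closure_rank I K V : closure (schubert_cell I) V -> schubert_cell K V ->
 forall i k, (k <= M)%N -> (rI I i k <= rI K i k)%N.
move=> IV KV i k kM; have /cell_chart[NV _] := KV.
have [|W [IW NW]] := IV (chart K).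
 by apply: open_nbhs_nbhs; split=> //; exact: chart_open.
exact: (chart_rank NW IW).
Qed.

Lemma act_mul V (g h : 'M[F]_M) : g \in unitmx -> h \in unitmx -> actf (actf V g) h = actf V (g *m h).
move=> gu hu; have [I /cellP[f [fu _ ->]]] := cell_cover sum_e V.
by rewrite !act_fr ?unitmx_mul ?fu ?gu // mulmxA.
Qed.

Lemma act1 V : actf V 1%:M = V.
have [I /cellP[f [fu _ ->]]] := cell_cover sum_e V.
by rewrite act_fr ?unitmx1 // mulmx1.
Qed.

Lemma act_cts1 (g : 'M[F]_M) : g \in unitmx -> continuous (fun V : flag F e M => actf V g).
move=> gu V; apply: (@continuous_comp _ _ _ (fun V : flag F e M => (V, g)) (fun q => actf q.1 q.2)).
 by apply: pair_cts; [move=> A|exact: cst_continuous].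
exact: act_cts.
Qed.

Lemma closure_act (A B : set (flag F e M)) (g : 'M[F]_M) V : g \in unitmx ->
 (forall W, A W -> B (actf W g)) -> closure A V -> closure B (actf V g).
move=> gu AB AV P /(act_cts1 gu)/AV[W [AW PW]].
by exists (actf W g); split=> //; exact: AB.
Qed.

Lemma cell_act_lower I (g : 'M[F]_M) V : g \in unitmx -> lower g ->
 schubert_cell I V -> schubert_cell I (actf V g).
move=> gu gl /cellP[f [fu fl ->]]; apply/cellP; exists (f *m g); split.
- by rewrite unitmx_mul fu.
- exact: lowerM.
- exact: act_fr.
Qed.

Lemma cell_transitive I (V W : flag F e M) : schubert_cell I V -> schubert_cell I W ->
 exists g, [/\ g \in unitmx, lower g & W = actf V g].
move=> /cellP[f [fu fl ->]] /cellP[g [gu gl ->]].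
exists (invmx f *m g); split; first by rewrite unitmx_mul unitmx_inv fu.
 by apply: lowerM => //; exact: lowerV.
by rewrite act_fr ?unitmx_mul ?unitmx_inv ?fu // mulKVmx.
Qed.

(** Cells are the orbits of the lower triangular group, which acts by homeomorphisms, so a closure
    is a union of cells. *)
Lemma clos_cells I K (V W : flag F e M) : closure (schubert_cell I) V -> schubert_cell K V ->
 schubert_cell K W -> closure (schubert_cell I) W.
move=> IV KV KW; have [g [gu gl ->]] := cell_transitive KV KW.
by apply: closure_act IV => // U; exact: cell_act_lower.
Qed.

End closures.
Section cplx_strat.
Variables (R : realType) (m : nat) (e : 'I_m -> nat) (M : nat).
Hypothesis sum_e : (\sum_i e i)%N = M.

(** Real codimensions are twice the complex ones, hence even: every cell is good and is its own
    mate. *)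
Definition cplx_strat : strat R (flag (Cx R) e M).
apply: (@Strat R (flag (Cx R) e M) (osp e M) (@schubert_cell (Cx R) m e M) (@chart (Cx R) m e M)
 (@chart (Cx R) m e M) (ncd (cplx_nc R e M)) (@rsum m e M) id
 (@slice R (Cx R) m e M (cplx_nc R e M)) (@ycoord R (Cx R) m e M (cplx_nc R e M))
 (@hretr R (Cx R) m e M (cplx_nc R e M))).
- exact: cell_cover.
- exact: cell_inj.
- by move=> I; exact: chart_open.
- by move=> I V /cell_chart[].
- by move=> ?.
- move=> I K V NV KV; have [->|/eqP KI] := eqVneq K I; first exact: Or31.
 by apply: Or33; apply: rsum_lt KI => i k; exact: chart_rank KV i k.
- by move=> I V; exact: ycoord_cts.
- by move=> I V; exact: cell_ycoord.
- by move=> I; exact: slice_cts.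
- by move=> I w; exact: slice_chart.
- by move=> I w; exact: ycoord_slice.
- by move=> I V r; exact: hretr_cts.
- by move=> I V; exact: hretr0.
- by move=> I V; exact: hretr1.
- by move=> I V r _; exact: hretr_chart.
- by move=> I V r _; exact: hretr_ycoord.
- by [].
- by [].
- by move=> I; rewrite eqxx.
- by move=> I V /n_Sn.
- by move=> I a /n_Sn.
- by move=> I _; rewrite /= odd_double.
- move=> I K L V W _ IV KV LK LW; apply: (clos_cells sum_e IV KV).
 by case: LK LW => ->.
- move=> I K V _ IV KV KI; apply: rsum_lt; first exact: (closure_rank sum_e IV KV).
 by move=> E; apply: KI.
- move=> I K V _ _ IV KV KI; rewrite /= ltn_double; apply: codim_lt; first exact: (closure_rank sum_e IV KV).
 by move=> E; apply: KI.
Defined.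

End cplx_strat.

(** * Pairing of the cells that are not doubled *)

Section blocks.
Variables (m : nat) (d : 'I_m -> nat) (n : nat).
Notation e := (fun i => (d i).*2).
Implicit Types (I K : osp e n.*2) (c : 'I_n).

Lemma o0_subproof c : (c.*2 < n.*2)%N. Proof. by rewrite ltn_double. Qed.
Lemma o1_subproof c : (c.*2.+1 < n.*2)%N. Proof. by rewrite ltn_Sdouble. Qed.
Definition o0 c : 'I_n.*2 := Ordinal (o0_subproof c).
Definition o1 c : 'I_n.*2 := Ordinal (o1_subproof c).

Lemma half_o0 c : half_ord (o0 c) = c.
by apply: val_inj; rewrite /= doubleK. Qed.
Lemma half_o1 c : half_ord (o1 c) = c.
by apply: val_inj; rewrite /= uphalf_double. Qed.

Lemma half_ordP (l : 'I_n.*2) : l = o0 (half_ord l) \/ l = o1 (half_ord l).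
have := odd_double_half l; case: (odd l) => E; [right|left]; apply: val_inj => /=; by rewrite -[LHS]E.
Qed.
Lemma o01_neq c : o0 c != o1 c.
by rewrite -val_eqE /= neq_ltn ltnSn. Qed.

Lemma half_eq (l : 'I_n.*2) c : (half_ord l == c) = (l == o0 c) || (l == o1 c).
apply/eqP/orP => [<-|[]/eqP->]; rewrite ?half_o0 ?half_o1 //.
by have [E|E] := half_ordP l; [left|right]; rewrite -E.
Qed.

Lemma sum_blocks (f : 'I_n.*2 -> nat) : (\sum_l f l = \sum_c (f (o0 c) + f (o1 c)))%N.
rewrite (partition_big (@half_ord n) xpredT) //=; apply: eq_bigr => c _.
rewrite (bigD1 (o0 c)) ?half_o0 //= (bigD1 (o1 c)) ?half_o1 ?eqxx //=; last by rewrite eq_sym o01_neq.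
rewrite big_pred0 ?addn0 // => l; rewrite half_eq; do 2!case: eqP => //=.
Qed.

Definition swp c : 'S_n.*2 := tperm (o0 c) (o1 c).
Definition dbl I c := I (o0 c) == I (o1 c).
Definition first_bad I c := ~~ dbl I c && [forall c' : 'I_n, (c' < c)%N ==> dbl I c'].
Definition fb I := [pick c | first_bad I c].
(** Exchanges the two labels of the first block that carries different ones. Exchanges do not change
    which blocks are doubled, so this is an involution whose fixed points are the doubled
    partitions. *)
Definition rmate I := if fb I is Some c then osp_comp I (swp c) else I.

Lemma swp0 I c : osp_comp I (swp c) (o0 c) = I (o1 c).
by rewrite osp_compE tpermL. Qed.
Lemma swp1 I c : osp_comp I (swp c) (o1 c) = I (o0 c).
by rewrite osp_compE tpermR. Qed.
Lemma swpD I c l : half_ord l != c -> osp_comp I (swp c) l = I l.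
by rewrite half_eq negb_or => /andP[l0 l1]; rewrite osp_compE tpermD // eq_sym. Qed.

Lemma swp_dbl I c c' : dbl (osp_comp I (swp c)) c' = dbl I c'.
rewrite /dbl; have [->|cc] := eqVneq c' c; first by rewrite swp0 swp1 eq_sym.
by rewrite !swpD ?half_o0 ?half_o1.
Qed.

Lemma eq_fb I K : (forall c, dbl I c = dbl K c) -> fb I = fb K.
by move=> h; apply: eq_pick => c; rewrite /first_bad h; congr (_ && _); apply: eq_forallb => c'; rewrite h.
Qed.
Lemma osp_comp_swpK I c : osp_comp (osp_comp I (swp c)) (swp c) = I.
by apply: ospP => l; rewrite !osp_compE tpermK. Qed.
Lemma fb_rmate I : fb (rmate I) = fb I.
by apply: eq_fb => c'; rewrite /rmate; case: fb => // c; rewrite swp_dbl. Qed.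
Lemma rmateK : involutive rmate.
by move=> I; rewrite {1}/rmate fb_rmate /rmate; case: fb => // c; rewrite osp_comp_swpK. Qed.

Lemma fbP I : fb I = None -> forall c, dbl I c.
rewrite /fb; case: pickP => // h _ c; have [k] := ubnP (c : nat); elim: k c => // k ih c ck.
have := h c; rewrite /first_bad => /negbT; rewrite negb_and negbK => /orP[//|/negP[]].
by apply/forallP => c'; apply/implyP => c'c; apply: ih; exact: leq_trans c'c _.
Qed.

Lemma fb_Some I c : fb I = Some c -> ~~ dbl I c /\ forall c' : 'I_n, (c' < c)%N -> dbl I c'.
rewrite /fb; case: pickP => // c0 /andP[h1 /forallP h2] [<-]; split=> // c' c'c.
by have := h2 c'; rewrite c'c.
Qed.

Lemma rmate_fix I : rmate I = I <-> fb I = None.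
rewrite /rmate; case E: fb => [c|]; split=> // h.
by have [/negP[]] := fb_Some E; rewrite /dbl -[in X in X == _]h swp0.
Qed.

Lemma double_good (J : osp d n) : rmate (double_osp J) = double_osp J.
by apply/rmate_fix; case E: fb => [c|//]; have [/negP[]] := fb_Some E; rewrite /dbl /= !ffunE half_o0 half_o1.
Qed.

Lemma good_double I : rmate I = I -> exists J : osp d n, I = double_osp J.
move=> /rmate_fix/fbP h; have osp_J : [forall j, #|[pred c | [ffun c => I (o0 c)] c == j]| == d j].
 apply/forallP => j; have := osp_card I j; rewrite -!sum1_card big_mkcond sum_blocks.
 rewrite (eq_bigr (fun c => (I (o0 c) == j).*2)); last first.
 by move=> c _; rewrite !inE -(eqP (h c)) addnn; case: eqP.
 rewrite -(big_morph double doubleD double0) => /double_inj <-.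
 by rewrite [X in X == _]big_mkcond; apply/eqP/eq_bigr => c _; rewrite !inE ffunE; case: eqP.
exists (Osp osp_J); apply: ospP => l; rewrite /= !ffunE /=.
by have [{1}->|{1}->] := half_ordP l; rewrite // (eqP (h _)).
Qed.

(* two labels determine, up to order, and are determined by, their counting function *)
Lemma two_labels (x y x' y' : 'I_m) :
 (forall i : 'I_m, (x <= i) + (y <= i) = (x' <= i) + (y' <= i))%N ->
 (x' = x /\ y' = y) \/ (x' = y /\ y' = x).
move=> h; have := h x; have := h y; have := h x'; have := h y'; rewrite !leqnn.
move=> h1 h2 h3 h4; suff : ((x' : nat) = x /\ (y' : nat) = y) \/ ((x' : nat) = y /\ (y' : nat) = x).
 by case=> -[/val_inj -> /val_inj ->]; [left|right].
clear h; move: h1 h2 h3 h4; move: (x : nat) (y : nat) (x' : nat) (y' : nat) => {}x {}y {}x' {}y'; lia.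
Qed.

Lemma block_labels I K c : (forall i, rI I i c.*2 = rI K i c.*2 /\ rI I i c.+1.*2 = rI K i c.+1.*2) ->
 (K (o0 c) = I (o0 c) /\ K (o1 c) = I (o1 c)) \/ (K (o0 c) = I (o1 c) /\ K (o1 c) = I (o0 c)).
move=> h; apply: two_labels => i; have [h0 h1] := h i.
have E (J : osp e n.*2) : rI J i c.+1.*2 = (rI J i c.*2 + ((J (o0 c) <= i) + (J (o1 c) <= i)))%N.
 by rewrite doubleS (rIS J i (o1 c)) /= (rIS J i (o0 c)) addnA.
by move: h1; rewrite !E h0 => /addnI.
Qed.

Lemma block_cells I K c : (forall i k, (k <= n.*2)%N -> k != c.*2.+1 -> rI I i k = rI K i k) ->
 K = I \/ K = osp_comp I (swp c).
move=> h; have off l : half_ord l != c -> K l = I l.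
 rewrite half_eq negb_or -!val_eqE /= => /andP[l0 l1].
 have hl (i : 'I_m) : (K l <= i)%N = (I l <= i)%N.
 have E := rIS I i l; have E' := rIS K i l.
 by move: E'; rewrite -!h ?ltn_ord ?(ltnW (ltn_ord l)) // ?E ?eqSS // => /addnI; case: (K l <= i)%N; case: (I l <= i)%N.
 by apply: val_inj; apply/eqP; rewrite eqn_leq hl leqnn -hl leqnn.
have [|[E0 E1]|[E0 E1]] := @block_labels I K c.
- move=> i; split; apply: h; rewrite ?leq_double ?(ltnW (ltn_ord c)) ?ltn_ord //.
 by rewrite neq_ltn ltnSn.
 by rewrite doubleS neq_ltn ltnSn orbT.
- left; apply: ospP => l; have [lc|/off//] := eqVneq (half_ord l) c.
 by move/eqP: lc; rewrite half_eq => /orP[]/eqP->.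
- right; apply: ospP => l; have [lc|lc] := eqVneq (half_ord l) c; last by rewrite swpD // off.
 by move/eqP: lc; rewrite half_eq => /orP[]/eqP->; rewrite ?swp0 ?swp1.
Qed.

Definition evens I := (\sum_(p : 'I_m * 'I_n.+1) rI I p.1 p.2.*2)%N.
Definition odds I := (\sum_(p : 'I_m * 'I_n | Some p.2 != fb I) rI I p.1 p.2.*2.+1)%N.
(** A lexicographic rank. [evens] uses the cuts between blocks, which an exchange inside a block
    cannot change; [odds] uses the cuts inside blocks, leaving out that of the first bad block so
    that mates have equal rank. The factor exceeds every value of [odds]. *)
Definition rrk I := ((m * n * n.*2).+1 * evens I + odds I)%N.

Lemma sum_le_or (T : finType) (P : pred T) (f g : T -> nat) : (forall x, P x -> f x <= g x)%N ->
 (\sum_(x | P x) f x < \sum_(x | P x) g x)%N \/ forall x, P x -> f x = g x.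
move=> h; have := @leqif_sum _ P (fun x => f x == g x) f g (fun x Px => leqif_eq (h x Px)).
move=> [le E]; case: (boolP (\sum_(x | P x) f x == \sum_(x | P x) g x)%N) => [|ne]; last by left; rewrite ltn_neqAle ne.
by rewrite E => /forallP hE; right=> x Px; have := hE x; rewrite Px => /eqP.
Qed.

Lemma odds_lt I : (odds I < (m * n * n.*2).+1)%N.
rewrite ltnS; apply: (@leq_trans (\sum_(p : 'I_m * 'I_n) n.*2)).
 apply: (@leq_trans (\sum_(p : 'I_m * 'I_n | Some p.2 != fb I) n.*2)).
 by apply: leq_sum => p _; rewrite /rI -[X in (_ <= X)%N]card_ord max_card.
 by rewrite [X in (_ <= X)%N](bigID (fun p : 'I_m * 'I_n => Some p.2 != fb I)) leq_addr.
by rewrite sum_nat_const card_prod !card_ord.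
Qed.

Lemma rrk_lt_evens I K : (evens K < evens I)%N -> (rrk K < rrk I)%N.
move=> h; rewrite /rrk; have := odds_lt K; move: (odds K) (odds I) (m * n * n.*2)%N (evens K) (evens I) h => a b N x y; nia.
Qed.

Lemma evens_cmp I K : (forall i (c : nat), (c <= n)%N -> rI K i c.*2 <= rI I i c.*2)%N ->
 (rrk K < rrk I)%N \/ (forall i (c : nat), (c <= n)%N -> rI K i c.*2 = rI I i c.*2).
move=> h; have [|lt|E] := @sum_le_or _ xpredT (fun p : 'I_m * 'I_n.+1 => rI K p.1 p.2.*2) (fun p => rI I p.1 p.2.*2).
- by move=> [i c] _; exact: (h i c (ltn_ord c)).
- by left; exact: rrk_lt_evens.
- by right=> i c cn; have cn' : (c < n.+1)%N by []; exact: (E (i, Ordinal cn') isT).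
Qed.

Lemma evens_dbl I K : (forall i (c : nat), (c <= n)%N -> rI K i c.*2 = rI I i c.*2) -> forall c, dbl I c = dbl K c.
move=> E c; have [|[E0 E1]|[E0 E1]] := @block_labels I K c; rewrite /dbl ?E0 ?E1 //.
 by move=> i; split; apply/esym/E; rewrite ?ltn_ord // ltnW.
Qed.

Lemma good_cmp I K : fb I = None \/ fb K = None -> K <> I ->
 (forall i k, (k <= n.*2)%N -> rI K i k <= rI I i k)%N -> (rrk K < rrk I)%N.
move=> g KI h; have [|//|E] := @evens_cmp I K; first by move=> i c cn; apply: h; rewrite leq_double.
have dE := evens_dbl E; have h1 : forall c, dbl I c.
 by case: g => /fbP // h1 c; rewrite dE.
case: KI; apply: ospP => l; set c := half_ord l.
have [|E'|E'] := @block_labels I K c; first by move=> i; split; apply/esym/E; rewrite ?ltn_ord // ltnW.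
 by case: E' => E0 E1; have [->|->] := half_ordP l.
by case: E' => E0 E1; have [->|->] := half_ordP l; rewrite -/c ?E0 ?E1 (eqP (h1 c)).
Qed.

(** Nothing is assumed at the cut through block [c]; equality at all other cuts determines the
    labels outside [c] and, up to order, the two labels in [c]. *)
Lemma bad_cmp I K c : fb I = Some c ->
 (forall i k, (k <= n.*2)%N -> k != c.*2.+1 -> rI K i k <= rI I i k)%N ->
 [\/ K = I, K = rmate I | (rrk K < rrk I)%N].
move=> Ic h; have [|lt|E] := @evens_cmp I K; last 2 first.
- exact: Or33.
- have fE : fb K = fb I by apply: eq_fb => c'; rewrite (evens_dbl E).
 have ek : evens K = evens I by apply: eq_bigr => -[i c'] _; exact: (E i c' (ltn_ord c')).
 have [|lt|Eo] := @sum_le_or _ (fun p : 'I_m * 'I_n => Some p.2 != fb I) (fun p => rI K p.1 p.2.*2.+1) (fun p => rI I p.1 p.2.*2.+1).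
 + move=> [i c'] /= nc; apply: h; first exact: o0_subproof.
 by apply: contraNneq nc => -[/double_inj/val_inj ->]; rewrite Ic.
 + by apply: Or33; rewrite /rrk ek /odds fE ltn_add2l.
 have [||] := @block_cells I K c; last 2 first.
 + exact: Or31.
 + by move=> ->; apply: Or32; rewrite /rmate Ic.
 move=> i k kn kc; have [l [lE|lE]] : exists l : nat, k = l.*2 \/ k = l.*2.+1.
 by exists k./2; have := odd_double_half k; case: (odd k) => /= E'; [right|left]; rewrite -[LHS]E'.
 by rewrite lE E // -leq_double -lE.
 have ln : (l < n)%N by rewrite -ltn_double; move: kn; rewrite lE.
 apply/esym; rewrite lE; apply: (Eo (i, Ordinal ln)) => /=; rewrite Ic.
 by apply: contraNneq kc => -[E']; rewrite lE -E'.
move=> i c' c'n; apply: h; rewrite ?leq_double //.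
by apply/eqP => E'; have := odd_double c'; rewrite E' /= odd_double.
Qed.

Lemma rrk_mate I : rrk (rmate I) = rrk I.
rewrite /rrk /evens /odds fb_rmate /rmate; case E: fb => [c|//].
have rE i k : k != c.*2.+1 -> rI (osp_comp I (swp c)) i k = rI I i k.
 move=> kc; have cc : (o0 c < o1 c)%N by [].
 have := rI_swap I (c := o0 c) (d := o1 c) i k cc; rewrite -/(swp c) /=.
 have -> : (c.*2.+1 < k)%N = (c.*2 < k)%N by rewrite [RHS]leq_eqVlt eq_sym (negbTE kc).
 lia.
congr (_ * _ + _)%N; apply: eq_bigr => -[i c'] /= nc; rewrite rE //.
 by apply/eqP => E'; have := odd_double c'; rewrite E' /= odd_double.
by apply: contraNneq nc => -[/double_inj/val_inj ->].
Qed.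

Lemma codim_adj I c : (I (o1 c) < I (o0 c))%N -> codim (osp_comp I (swp c)) = (codim I).+1.
move=> yx; have K0 := swp0 I c; have K1 := swp1 I c.
have Ke p : (p != o0 c) && (p != o1 c) -> osp_comp I (swp c) p = I p.
 by rewrite -negb_or -half_eq; exact: swpD.
set K := osp_comp _ _ in K0 K1 Ke *; rewrite !codimE !(sum_split2 _ (o01_neq c)).
have -> : (\sum_(p | (p != o0 c) && (p != o1 c)) \sum_(q | (q != o0 c) && (q != o1 c)) gI K p q =
 \sum_(p | (p != o0 c) && (p != o1 c)) \sum_(q | (q != o0 c) && (q != o1 c)) gI I p q)%N.
 by apply: eq_bigr => p /Ke pE; apply: eq_bigr => q /Ke qE; rewrite /gI pE qE.
have -> : (\sum_(p | (p != o0 c) && (p != o1 c)) (gI K p (o0 c) + gI K p (o1 c) + gI K (o0 c) p + gI K (o1 c) p) =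
 \sum_(p | (p != o0 c) && (p != o1 c)) (gI I p (o0 c) + gI I p (o1 c) + gI I (o0 c) p + gI I (o1 c) p))%N.
 apply: eq_bigr => p pE; rewrite /gI K0 K1 Ke //=; case/andP: pE; rewrite -!val_eqE /= => p0 p1.
 have -> : (p < c.*2.+1)%N = (p < c.*2)%N by rewrite ltnS leq_eqVlt (negbTE p0).
 have -> : (c.*2 < p)%N = (c.*2.+1 < p)%N by rewrite leq_eqVlt eq_sym (negbTE p1).
 lia.
rewrite /gI !K0 !K1 /= !ltnn ltnSn yx /= [(c.*2.+1 < c.*2)%N]ltnNge leqnSn /= [(I (o0 c) < I (o1 c))%N]ltnNge (ltnW yx) /=.
lia.
Qed.

Lemma rcd_mate I : rmate I != I -> codim I = (codim (rmate I)).+1 \/ codim (rmate I) = (codim I).+1.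
move=> /eqP mI; case E: (fb I) => [c|]; last by case: mI; apply/rmate_fix.
have [nd _] := fb_Some E; rewrite /rmate E.
have [lt|gt|eq] := ltngtP (I (o0 c)) (I (o1 c)).
- by left; have := @codim_adj (osp_comp I (swp c)) c; rewrite osp_comp_swpK swp0 swp1 => /(_ lt).
- by right; exact: codim_adj.
- by move: nd; rewrite /dbl -val_eqE /= eq eqxx.
Qed.

Lemma mate_descent I c : fb I = Some c -> codim (rmate I) = (codim I).+1 -> (I (o1 c) < I (o0 c))%N.
move=> E; rewrite /rmate E => h; have [nd _] := fb_Some E.
have [lt|gt|eq] := ltngtP (I (o0 c)) (I (o1 c)) => //.
- have := @codim_adj (osp_comp I (swp c)) c; rewrite osp_comp_swpK swp0 swp1 h => /(_ lt); lia.
- by move: nd; rewrite /dbl -val_eqE /= eq eqxx.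
Qed.

Definition inblk c (l : 'I_n.*2) := half_ord l == c.

(** Blocks before [c] are doubled and contribute evenly. A later position forms normal pairs with
    both, one or none of the positions of [c], and contributes oddly exactly when its label lies
    between the two labels of [c]; such labels are counted modulo 2 by [t]. *)
Lemma flip_parity I c : fb I = Some c -> (I (o1 c) < I (o0 c))%N ->
 odd (\sum_p \sum_q gI I p q * (inblk c p (+) inblk c q))%N.
move=> E yx; have [nd bd] := fb_Some E; set x := I (o0 c) in yx *; set y := I (o1 c) in yx *.
pose s q := (gI I (o0 c) q + gI I (o1 c) q + gI I q (o0 c) + gI I q (o1 c))%N.
pose t q : nat := (y < I q)%N && (I q <= x)%N.
have in0 : inblk c (o0 c) by rewrite /inblk half_o0.
have in1 : inblk c (o1 c) by rewrite /inblk half_o1.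
have oE p : (p != o0 c) && (p != o1 c) -> inblk c p = false.
 by rewrite -negb_or -half_eq => /negbTE.
have -> : (\sum_p \sum_q gI I p q * (inblk c p (+) inblk c q) = \sum_(c' | c' != c) (s (o0 c') + s (o1 c')))%N.
 rewrite (sum_split2 _ (o01_neq c)) in0 in1 /= !muln0 !addn0 big1 ?add0n; last first.
 by move=> p /oE ->; apply: big1 => q /oE ->; rewrite muln0.
 rewrite (eq_bigr s); last by move=> p /oE ->; rewrite /= !muln1 /s; lia.
 rewrite big_mkcond sum_blocks [RHS]big_mkcond; apply: eq_bigr => c' _.
 rewrite -!negb_or -!half_eq half_o0 half_o1; by case: eqP.
(* Every label occurs an even number of times, so the labels above [y] and up to [x] are even in
   number; block [c] accounts for exactly one of them. *)
have Teven : ~~ odd (\sum_q t q).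
 have -> : (\sum_q t q = \sum_(j < m | (y < j)%N && (j <= x)%N) (d j).*2)%N.
 rewrite (eq_bigr (fun q => if (y < I q)%N && (I q <= x)%N then 1 else 0)%N); last by move=> q _; rewrite /t; case: (_ && _).
 rewrite -big_mkcond (partition_big (fun q => I q) (fun j : 'I_m => (y < j)%N && (j <= x)%N)) //=.
 apply: eq_bigr => j yj; rewrite -(osp_card I j) -sum1_card; apply: eq_bigl => q; rewrite !inE.
 by case: eqP => [->|]; rewrite ?yj ?andbF.
 by rewrite -(big_morph double doubleD double0) odd_double.
have t0 : t (o0 c) = 1%N by rewrite /t -/x yx leqnn.
have t1 : t (o1 c) = 0%N by rewrite /t -/y ltnn.
rewrite sum_blocks (bigD1 c) //= t0 t1 addn0 add1n /= negbK in Teven.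
have : odd (\sum_(c' | c' != c) (s (o0 c') + s (o1 c')) + \sum_(c' | c' != c) (t (o0 c') + t (o1 c'))) = false.
 rewrite -big_split /=; apply: (big_ind (fun k => odd k = false)) => // [a b|c' c'c].
 by rewrite oddD => -> ->.
 rewrite /s /t /gI -/x -/y /=; case: (ltngtP c' c) => cc; last by move: c'c; rewrite (val_inj cc) eqxx.
 have := bd c' cc; rewrite /dbl => /eqP ->.
 have -> : (c.*2 < c'.*2)%N = false by apply/negbTE; rewrite -leqNgt leq_double ltnW.
 have -> : (c.*2.+1 < c'.*2)%N = false by apply/negbTE; lia.
 have -> : (c.*2 < c'.*2.+1)%N = false by apply/negbTE; lia.
 have -> : (c.*2.+1 < c'.*2.+1)%N = false by apply/negbTE; lia.
 have -> : (c'.*2.+1 < c.*2)%N by lia.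
 have -> : (c'.*2.+1 < c.*2.+1)%N by lia.
 have -> : (c'.*2 < c.*2)%N by lia.
 have -> : (c'.*2 < c.*2.+1)%N by lia.
 by rewrite /= !add0n !addnn -doubleD odd_double.
 have -> : (c'.*2 < c.*2)%N = false by apply/negbTE; lia.
 have -> : (c'.*2 < c.*2.+1)%N = false by apply/negbTE; lia.
 have -> : (c'.*2.+1 < c.*2)%N = false by apply/negbTE; lia.
 have -> : (c'.*2.+1 < c.*2.+1)%N = false by apply/negbTE; lia.
 have -> : (c.*2 < c'.*2)%N by lia.
 have -> : (c.*2.+1 < c'.*2)%N by lia.
 have -> : (c.*2 < c'.*2.+1)%N by lia.
 have -> : (c.*2.+1 < c'.*2.+1)%N by lia.
 rewrite /= !addn0; move: (I (o0 c') : nat) (I (o1 c') : nat) (x : nat) (y : nat) yx => a b u v yx'.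
 by case: (ltnP u a) => ?; case: (ltnP v a) => ?; case: (ltnP u b) => ?; case: (ltnP v b) => ?; case: (leqP a u) => ?; case: (leqP b u) => ? //=; lia.
by rewrite oddD Teven; case: (odd _).
Qed.

End blocks.

(** * The rotation argument and the real stratification *)

Section real_strat.
Variables (R : realType) (m : nat) (d : 'I_m -> nat) (n : nat).
Notation e := (fun i => (d i).*2).
Hypothesis sum_e : (\sum_i e i)%N = n.*2.
Notation X := (flag R e n.*2).
Notation C := (real_nc R e n.*2).
Implicit Types (I K : osp e n.*2) (c : 'I_n) (V W : X) (g : 'M[R]_n.*2).

Definition block_mx_at c g := g \in unitmx /\
 forall l l', ~~ (inblk c l && inblk c l') -> g l l' = (l == l')%:R.

(** A matrix acting inside block [c] preserves every standard space except the one that cuts the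
    block in two. *)
Lemma block_rank c g V I K : block_mx_at c g -> schubert_cell I V -> schubert_cell K (actf V g) ->
 forall i k, (k <= n.*2)%N -> k != c.*2.+1 -> rI I i k = rI K i k.
move=> [gu gb] VI WK i k kn kc; rewrite /rI -(VI i k kn) -(WK i k kn).
pose f : 'Hom('rV[R]_n.*2, 'rV[R]_n.*2) := linfun (mulmxr g).
have fE v : f v = v *m g by rewrite lfunE.
have finj : injective f by move=> u v; rewrite !fE => /(congr1 (mulmxr (invmx g))) /=; rewrite !mulmxK.
have kf : lker f == 0%VS by apply/lker0P.
have Ek : (f @: std_space R n.*2 k)%VS = std_space R n.*2 k.
 apply/eqP; rewrite eqEdim limg_dim_eq ?leqnn ?andbT; last by rewrite (eqP kf) capv0.
 apply/subvP => w /memv_imgP[v /std_spaceP vk ->]; apply/std_spaceP => l kl; rewrite fE mxE.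
 apply: big1 => l' _; case: (ltnP l' k) => l'k; last by rewrite vk ?mul0r.
 rewrite gb ?mulr0 //.
 by case: eqP => [E|]; rewrite ?mulr0 // -E leqNgt l'k in kl *.
 apply/negP => /andP[]; rewrite /inblk !half_eq -!val_eqE /=.
 by move: kc l'k kl; lia.
have VE : actf V g i = (f @: V i)%VS by rewrite ffunE gu.
rewrite VE -[in RHS]Ek; have -> : (f @: V i :&: f @: std_space R n.*2 k = f @: (V i :&: std_space R n.*2 k))%VS.
 apply/vspaceP => w; rewrite memv_cap; apply/andP/memv_imgP => [[/memv_imgP[v vV ->] /memv_imgP[u uE /finj uv]]|[v]].
 by exists v => //; rewrite memv_cap vV uv.
 by rewrite memv_cap => /andP[vV vE] ->; split; apply: memv_img.
by rewrite limg_dim_eq // (eqP kf) capv0.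
Qed.

Lemma block_cells_act c g V I K : block_mx_at c g -> schubert_cell I V -> schubert_cell K (actf V g) ->
 K = I \/ K = osp_comp I (swp c).
by move=> gb VI WK; apply: block_cells; exact: (block_rank gb VI WK). Qed.
(** The chart swept out by the matrices of the first bad block. It contains the whole rotation of
    the slice, and apart from [I] and its mate it still meets only cells of smaller rank. *)
Definition rWb I : set X := [set V | if fb I is Some c then
 exists g W, [/\ block_mx_at c g, chart I W & V = actf W g] else chart I V].
Lemma block1 c : block_mx_at c 1%:M.
by split=> [|l l' _]; [exact: unitmx1|rewrite mxE]. Qed.

Lemma chart_rWb I : chart I `<=` rWb I.
move=> V NV; rewrite /rWb /=; case: fb => // c; exists 1%:M, V; split=> //; first exact: block1.
by rewrite (act1 sum_e).
Qed.

Lemma rWb_rk I K V : rWb I V -> schubert_cell K V -> [\/ K = I, K = rmate I | (rrk K < rrk I)%N].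
rewrite /rWb /=; case E: fb => [c|] => [[g [W [gb NW ->]]]|NV] KV; last first.
 have [->|/eqP KI] := eqVneq K I; first exact: Or31.
 by apply: Or33; apply: good_cmp => //; [left|exact: chart_rank KV].
have [L LW] := cell_cover sum_e W; apply: (bad_cmp E) => i k kn kc.
by rewrite -(block_rank gb LW KV) //; exact: (chart_rank NW LW).
Qed.

(* the rotation [[a, b], [-b, a]] of the plane of e_2c, e_2c+1 *)
Definition rotm c (a b : R) : 'M[R]_n.*2 := \matrix_(l, l')
 if inblk c l && inblk c l' then (if l == l' then a else if l == o0 c then b else - b) else (l == l')%:R.

Lemma mul_rotm c a b (v : 'rV[R]_n.*2) l : (v *m rotm c a b) 0 l =
 if l == o0 c then v 0 (o0 c) * a - v 0 (o1 c) * b else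
 if l == o1 c then v 0 (o0 c) * b + v 0 (o1 c) * a else v 0 l.
have n10 : (o1 c == o0 c) = false by rewrite eq_sym (negbTE (o01_neq c)).
have in0 : inblk c (o0 c) by rewrite /inblk half_o0.
have in1 : inblk c (o1 c) by rewrite /inblk half_o1.
rewrite mxE; case: (boolP (inblk c l)) => lc; last first.
 have := lc; rewrite /inblk half_eq negb_or => /andP[/negbTE -> /negbTE ->].
 rewrite (bigD1 l) //= big1 ?addr0 => [|k kl]; rewrite mxE (negbTE lc) andbF ?eqxx ?mulr1 //.
 by rewrite (negbTE kl) mulr0.
rewrite (bigD1 (o0 c)) //= (bigD1 (o1 c)) 1?eq_sym ?o01_neq //= big1 ?addr0; last first.
 move=> k; rewrite -negb_or -half_eq => kc; rewrite mxE /inblk (negbTE kc) /=.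
 by case: eqP => [E|]; rewrite ?mulr0 //; move: kc; rewrite E; move: lc; rewrite /inblk => ->.
rewrite !mxE in0 in1 lc /=; move: lc; rewrite /inblk half_eq => /orP[]/eqP ->.
 by rewrite !eqxx n10 mulrN.
by rewrite !eqxx (negbTE (o01_neq c)).
Qed.

Lemma rotm_block c a b : a ^+ 2 + b ^+ 2 != 0 -> block_mx_at c (rotm c a b).
move=> ab; split=> [|l l' /negbTE ll']; last by rewrite mxE ll'.
apply: unitmx_inj => v v0; have h l := congr1 (fun w : 'rV[R]_n.*2 => w 0 l) v0.
have n10 : (o1 c == o0 c) = false by rewrite eq_sym (negbTE (o01_neq c)).
have := h (o0 c); have := h (o1 c); rewrite !mul_rotm !eqxx n10 !mxE => h1 h0.
have z0 : v 0 (o0 c) * (a ^+ 2 + b ^+ 2) = 0.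
 transitivity ((v 0 (o0 c) * a - v 0 (o1 c) * b) * a + (v 0 (o0 c) * b + v 0 (o1 c) * a) * b); first by ring.
 by rewrite h0 h1 !mul0r addr0.
have z1 : v 0 (o1 c) * (a ^+ 2 + b ^+ 2) = 0.
 transitivity ((v 0 (o0 c) * b + v 0 (o1 c) * a) * a - (v 0 (o0 c) * a - v 0 (o1 c) * b) * b); first by ring.
 by rewrite h0 h1 !mul0r subr0.
apply/rowP => l; rewrite mxE; case: (eqVneq l (o0 c)) => [->|l0].
 by move/eqP: z0; rewrite mulf_eq0 (negbTE ab) orbF => /eqP.
case: (eqVneq l (o1 c)) => [->|l1].
 by move/eqP: z1; rewrite mulf_eq0 (negbTE ab) orbF => /eqP.
by have := h l; rewrite mul_rotm (negbTE l0) (negbTE l1) mxE.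
Qed.

Definition sgn c (l : 'I_n.*2) : R := if inblk c l then -1 else 1.

Lemma rotmN1 c (A : 'M[R]_n.*2) l l' : (A *m rotm c (-1) 0) l l' = A l l' * sgn c l'.
have -> : (A *m rotm c (-1) 0) l l' = (row l A *m rotm c (-1) 0) 0 l' by rewrite -row_mul [RHS]mxE.
rewrite mul_rotm !mxE /sgn /inblk half_eq !mulr0 subr0 add0r.
by do 2!case: eqVneq => [->|_]; rewrite ?mulr1.
Qed.

Lemma foldr_flipv k (J : seq 'I_k) (v : 'rV[R]_k) i : uniq J ->
 (foldr (@flipv R k) v J) 0 i = if i \in J then - v 0 i else v 0 i.
elim: J => //= j J ih /andP[jJ uJ]; rewrite mxE ih // in_cons.
by case: (eqVneq i j) => [->|//]; rewrite (negbTE jJ).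
Qed.

Definition flips I c := [seq j <- enum 'I_(codim I) | inblk c (pairn j).1 (+) inblk c (pairn j).2].

Lemma size_flips I c : size (flips I c) = (\sum_p \sum_q gI I p q * (inblk c p (+) inblk c q))%N.
rewrite size_filter -sum1_count big_enum_cond /=.
transitivity (\sum_(p <- normal_pairs I | inblk c p.1 (+) inblk c p.2) 1)%N.
 by rewrite -[normal_pairs I in RHS](in_tupleE) big_tuple.
rewrite /normal_pairs big_filter_cond big_mkcond big_allpairs_dep /= big_enum /=.
apply: eq_bigr => p _; rewrite big_enum /=; apply: eq_bigr => q _.
by rewrite /gI; case: (_ (+) _); case: (p < q)%N; case: (I p < I q)%N.
Qed.

(** The rotation by pi is -1 on the plane of the block. Multiplying the frame on the left by the
    same signs does not change the flag, and together they negate the entries with exactly one index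
    in the block. *)
Lemma slice_rot I c (w : 'rV[R]_(codim I)) : actf (slice (C := C) w) (rotm c (-1) 0) =
 slice (C := C) (foldr (@flipv R _) w (flips I c)).
have ru : rotm c (-1) 0 \in unitmx.
 by have [] := @rotm_block c (-1) 0 _; rewrite // expr0n addr0 sqrrN expr1n oner_neq0.
have nu := ntype_unit (ntype_nrm (C := C) w); have nu' := ntype_unit (ntype_nrm (C := C) (foldr (@flipv R _) w (flips I c))).
rewrite /slice act_fr //; apply/fr_parab => //; first by rewrite unitmx_mul nu.
pose D : 'M[R]_n.*2 := diag_mx (\row_l sgn c l).
suff -> : (1%:M + nrm (n := C) w) *m rotm c (-1) 0 = D *m (1%:M + nrm (n := C) (I := I) (foldr (@flipv R _) w (flips I c))).
 rewrite mulmxK // => l k lk; rewrite !mxE; case: eqP => [E|]; last by rewrite mulr0n.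
 by rewrite E ltnn in lk.
apply/matrixP => l l'; rewrite rotmN1 mul_diag_mx !mxE [LHS]mulrDl [RHS]mulrDr.
congr (_ + _); first by case: eqP => [->|]; rewrite ?mul0r ?mulr0 // mul1r mulr1.
rewrite /= !rnrmE; case: ifP => ll'; last by rewrite mul0r mulr0.
rewrite mem_np in ll'; have [j jE] := pairn_index ll'.
rewrite -jE index_pairn !wxE foldr_flipv; last by rewrite filter_uniq ?enum_uniq.
rewrite /flips mem_filter mem_enum andbT jE /=.
by rewrite /sgn; case: (inblk c l); case: (inblk c l') => /=; rewrite ?mulrN1 ?mulN1r ?mulr1 ?mul1r ?opprK.
Qed.

(** Rotating the slice about block [c] keeps its boundary off both mates. After half a turn the
    slice comes back reflected in an odd number of coordinates, so its value equals its opposite,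
    hence is 0 over the rationals. *)
Lemma rrot I a : codim (rmate I) = (codim I).+1 -> coc (rWb I) a ->
 van [set x | rWb I x /\ ~ (schubert_cell I x \/ schubert_cell (rmate I) x)] a ->
 app a (fun t : simp R (codim I) => slice (C := C) (I := I) (vsimp (set_val t))) = 0.
move=> cdI aW aV; case E: (fb I) => [c|]; last by move: cdI; rewrite (rmate_fix I).2 // => /n_Sn.
have yx := mate_descent E cdI.
(* A parabola from (1, 0) to (-1, 0) that avoids the origin; a rotation up to scale serves as well,
   as invertibility is what counts. *)
pose la (r : R) := 1 - 2 * r; pose mu (r : R) := 4 * r * (1 - r).
have lm r : la r ^+ 2 + mu r ^+ 2 != 0.
 rewrite paddr_eq0 ?sqr_ge0 // !sqrf_eq0 /la /mu; apply/negP => /andP[/eqP h1 /eqP h2].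
 have r2 : r = 1 / 2 by lra.
 by move: h2; rewrite r2; lra.
pose h (t : simp R (codim I)) (r : R) : X := actf (slice (C := C) (I := I) (vsimp (set_val t))) (rotm c (la r) (mu r)).
have sc : continuous (fun t : simp R (codim I) => slice (C := C) (I := I) (vsimp (set_val t))).
 by move=> t; apply: (@continuous_comp _ _ _ (fun t : simp R (codim I) => vsimp (set_val t)) (slice (C := C) (I := I)));
 [exact: vsimpv_cts|exact: slice_cts].
have hom : app a (h^~ 1) = app a (h^~ 0).
 apply: (app_homotopy (U := rWb I) (V := [set x | rWb I x /\ ~ (schubert_cell I x \/ schubert_cell (rmate I) x)])) => //.
 - move=> t r; apply: (@continuous_comp _ _ _ (fun p : simp R (codim I) * R => (slice (C := C) (I := I) (vsimp (set_val p.1)), rotm c (la p.2) (mu p.2))) (fun q => actf q.1 q.2)); last first.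
 by apply: (act_cts sum_e); have [] := rotm_block c (lm r).
 apply: pair_cts.
 by apply: (@continuous_comp _ _ _ fst (fun t : simp R (codim I) => slice (C := C) (I := I) (vsimp (set_val t)))); [exact: cvg_fst|exact: sc].
 have c2 : cts_at (t, r) (fun p : simp R (codim I) * R => p.2 : R^o) by exact: cvg_snd.
 apply: mx_cts => l l'.
 have -> : (fun p : simp R (codim I) * R => rotm c (la p.2) (mu p.2) l l') = (fun p =>
 if inblk c l && inblk c l' then (if l == l' then la p.2 else if l == o0 c then mu p.2 else - mu p.2) else (l == l')%:R).
 by apply/funext => p; rewrite mxE.
 have cl : cts_at (t, r) (fun p : simp R (codim I) * R => la p.2 : R^o).
 by apply: subf_cts; [exact: cstf_cts|apply: mulf_cts => //; exact: cstf_cts].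
 have cm : cts_at (t, r) (fun p : simp R (codim I) * R => mu p.2 : R^o).
 apply: mulf_cts; first by apply: mulf_cts => //; exact: cstf_cts.
 by apply: subf_cts => //; exact: cstf_cts.
 case: (_ && _); last exact: cstf_cts.
 case: (_ == _) => //; case: (_ == _) => //; exact: oppf_cts.
 - move=> t r _; rewrite /rWb /= E; exists (rotm c (la r) (mu r)), (slice (C := C) (I := I) (vsimp (set_val t))).
 by split=> //; [exact: rotm_block|exact: slice_chart].
 - move=> t r i _ ti; split.
 rewrite /rWb /= E; exists (rotm c (la r) (mu r)), (slice (C := C) (I := I) (vsimp (set_val t))).
 by split=> //; [exact: rotm_block|exact: slice_chart].
 have wz : vsimp (set_val t) != 0.
 apply/eqP => w0; have [t0 t1] := stdP t.
 have tE j : set_val t 0 j = set_val t 0 0.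
 case: (unliftP ord0 j) => [j' ->|-> //]; have := congr1 (fun w : 'rV[R]_(codim I) => w 0 j') w0.
 by rewrite !mxE => /eqP; rewrite subr_eq0 => /eqP.
 move: t1; rewrite (eq_bigr (fun=> 0)) => [|j _]; last by rewrite tE -(tE i) ti.
 by rewrite big1 // => /esym/eqP; rewrite oner_eq0.
 have rb := rotm_block c (lm r).
 have [K KW] := cell_cover sum_e (slice (C := C) (I := I) (vsimp (set_val t))).
 have nI : K <> I.
 move=> KI; move: KW; rewrite KI => /(cell_ycoord C (slice_chart _)).
 by rewrite ycoord_slice => /eqP; rewrite (negbTE wz).
 have KWc i' k : (k <= n.*2)%N -> (rI K i' k <= rI I i' k)%N.
 exact: (chart_rank (slice_chart (C := C) _) KW).
 have nM : K <> rmate I.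
 move=> KM; have := KWc (I (o1 c)) c.*2.+1 (ltnW (o1_subproof c)).
 rewrite KM /rmate E (rIS _ _ (o0 c)) (rIS _ _ (o0 c)) swp0 leqnn [(I (o0 c) <= _)%N]leqNgt yx /=.
 have := rI_swap I (I (o1 c)) c.*2 (c := o0 c) (d := o1 c) (ltnSn _).
 rewrite -/(swp c) /= ltnn [(c.*2.+1 < _)%N]ltnNge leqnSn /= !andbF; lia.
 have rE : rmate I = osp_comp I (swp c) by rewrite /rmate E.
 case=> LW; have [LE|LE] := block_cells_act rb KW LW.
 + by rewrite LE in nI.
 + by apply: nM; rewrite rE LE osp_comp_swpK.
 + by rewrite LE in nM.
 + by apply: nI; move: LE; rewrite rE => /(congr1 (fun J => osp_comp J (swp c))); rewrite !osp_comp_swpK.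
have h0E : app a (h^~ 0) = app a (fun t : simp R (codim I) => slice (C := C) (I := I) (vsimp (set_val t))).
 apply: eq_app => t; rewrite /h /la /mu mulr0 subr0 mulr0 mul0r.
 have -> : rotm c 1 0 = 1%:M.
 by apply/matrixP => l l'; rewrite !mxE; case: (_ && _); rewrite // oppr0; case: (l == l') => //; case: ifP.
 exact: (act1 sum_e).
have pc : coc setT (pb (slice (C := C) (I := I)) a).
 by apply: (pb_coc (B := rWb I)) => // w _; [exact: slice_cts|apply: chart_rWb; exact: slice_chart].
have pz : van (@nz R (codim I)) (pb (slice (C := C) (I := I)) a).
 apply: pb_van aV => w wz; split; first by apply: chart_rWb; exact: slice_chart.
 case=> [/(cell_ycoord C (slice_chart _))|MW].
 by rewrite ycoord_slice => /eqP; rewrite (negbTE wz).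
 have := chart_rank (slice_chart (C := C) w) MW (I (o1 c)) (ltnW (o1_subproof c)).
 rewrite /rmate E (rIS _ _ (o0 c)) (rIS _ _ (o0 c)) swp0 leqnn [(I (o0 c) <= _)%N]leqNgt yx /=.
 have := rI_swap I (I (o1 c)) c.*2 (c := o0 c) (d := o1 c) (ltnSn _).
 rewrite -/(swp c) /= ltnn [(c.*2.+1 < _)%N]ltnNge leqnSn /= !andbF; lia.
have fc : continuous (fun t : simp R (codim I) => foldr (@flipv R _) (vsimp (set_val t)) (flips I c)).
 elim: (flips I c) => [|j J ih] /=; first exact: vsimpv_cts.
 move=> t; apply: (@continuous_comp _ _ _ (fun t : simp R (codim I) => foldr (@flipv R _) (vsimp (set_val t)) J) (@flipv R _ j)); first exact: ih.
 apply: mx_cts => i k; set v := foldr _ _ _.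
 have -> : (fun x => @flipv R (codim I) j x i k) = (fun x => if k == j then - x 0 k else x 0 k).
 by apply/funext => x; rewrite mxE.
 by case: (k == j); [apply: oppf_cts; exact: coord_continuous|exact: coord_continuous].
have h1E : app a (h^~ 1) = - app a (fun t : simp R (codim I) => slice (C := C) (I := I) (vsimp (set_val t))).
 have ev := evalv_flips (flips I c) pc pz.
 rewrite size_flips (pb_app _ _ fc) in ev.
 rewrite -signr_odd (flip_parity E yx) expr1 mulN1r /evalv pb_app in ev; last exact: vsimpv_cts.
 rewrite -ev; apply: eq_app => t; rewrite /h /la /mu subrr mulr0 -slice_rot; congr (actf _ (rotm c _ _)).
 lra.
move: hom; rewrite h0E h1E; set z := app _ _ => /eqP; rewrite eq_sym -addr_eq0 -mulr2n mulrn_eq0 /= => /eqP.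
by [].
Qed.

Lemma rmate_open I V : codim (rmate I) = (codim I).+1 -> chart I V -> ~ schubert_cell (rmate I) V.
move=> cdI NV MV; case E: (fb I) => [c|]; last by move: cdI; rewrite (rmate_fix I).2 // => /n_Sn.
have yx := mate_descent E cdI.
have := chart_rank NV MV (I (o1 c)) (ltnW (o1_subproof c)).
rewrite /rmate E (rIS _ _ (o0 c)) (rIS _ _ (o0 c)) swp0 leqnn [(I (o0 c) <= _)%N]leqNgt yx /=.
have := rI_swap I (I (o1 c)) c.*2 (c := o0 c) (d := o1 c) (ltnSn _).
rewrite -/(swp c) /= ltnn [(c.*2.+1 < _)%N]ltnNge leqnSn /= !andbF; lia.
Qed.

(** Between two doubled blocks the four pairs of positions are normal all together or not at all. *)
Lemma good_codim_even I : rmate I = I -> ~~ odd (codim I).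
move=> /rmate_fix/fbP h; rewrite codimE sum_blocks; apply: (big_ind (fun k => ~~ odd k)) => // [a b|c _].
 by rewrite oddD => /negbTE -> /negbTE ->.
rewrite !sum_blocks -big_split; apply: (big_ind (fun k => ~~ odd k)) => // [a b|c' _].
 by rewrite oddD => /negbTE -> /negbTE ->.
rewrite /gI -(eqP (h c)) -(eqP (h c')) /=.
have [->|cc] := eqVneq c c'; first by rewrite !ltnn /= ?andbF.
have ne : (c : nat) != c' by rewrite (inj_eq val_inj).
have -> : (c.*2 < c'.*2)%N = (c < c')%N by rewrite ltn_double.
have -> : (c.*2 < c'.*2.+1)%N = (c < c')%N by rewrite ltnS leq_double leq_eqVlt (negbTE ne).
have -> : (c.*2.+1 < c'.*2)%N = (c < c')%N by rewrite ltn_Sdouble.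
have -> : (c.*2.+1 < c'.*2.+1)%N = (c < c')%N by rewrite ltnS ltn_double.
by rewrite addnn odd_double.
Qed.

Lemma swap_mx_block c : block_mx_at c (perm_mx (swp c)).
split=> [|l l' ll']; first exact: unitmx_perm.
rewrite !mxE; have [lc|lc] := boolP (inblk c l).
 rewrite lc /= in ll'; have l'l : (l == l') = false by apply/negP => /eqP E; rewrite -E lc in ll'.
 rewrite l'l; case: eqP => // E; move: ll'; rewrite -E; move: lc; rewrite /inblk !half_eq.
 by move=> /orP[]/eqP->; rewrite ?tpermL ?tpermR ?eqxx ?orbT.
by move: lc; rewrite /inblk half_eq negb_or => /andP[l0 l1]; rewrite tpermD // eq_sym.
Qed.

(** The permutation matrix of the block maps the doubled cell to itself, hence also its closure, and
    carries the coordinate flag of [K] to that of [K] with the block exchanged. *)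
Lemma closure_block I c K V W : rmate I = I -> closure (schubert_cell I) V -> schubert_cell K V ->
 schubert_cell (osp_comp K (swp c)) W -> closure (schubert_cell I) W.
move=> mI IV KV KW; have [gu _] := swap_mx_block c.
have IA (U : X) : schubert_cell I U -> schubert_cell I (actf U (perm_mx (swp c))).
 move=> IU; have [L LU] := cell_cover sum_e (actf U (perm_mx (swp c))).
 have [<-//|LE] := block_cells_act (swap_mx_block c) IU LU.
 have -> // : I = L; rewrite LE; apply: ospP => l; move/rmate_fix/fbP: mI => /(_ c)/eqP dI.
 have [lc|/swpD->//] := eqVneq (half_ord l) c.
 by move/eqP: lc; rewrite half_eq => /orP[]/eqP->; rewrite ?swp0 ?swp1.
have h0 := clos_cells sum_e IV KV (W := fr K 1%:M).
have h1 : schubert_cell K (fr K (1%:M : 'M[R]_n.*2)).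
 apply/cellP; exists 1%:M; split=> //; first exact: unitmx1.
 by move=> l l' ll'; rewrite mxE; case: eqP => // E; rewrite E ltnn in ll'.
have h2 := closure_act sum_e gu IA (h0 h1).
apply: (clos_cells sum_e h2 _ KW).
have -> : actf (fr K (1%:M : 'M[R]_n.*2)) (perm_mx (swp c)) = fr (osp_comp K (swp c)) 1%:M.
 rewrite act_fr ?unitmx1 // mul1mx; rewrite (fr_perm (K := osp_comp K (swp c)) (s := swp c)) //.
 by rewrite row_permE -perm_mxM tperm2 perm_mx1.
 by move=> l; rewrite osp_compE.
apply/cellP; exists 1%:M; split=> //; first exact: unitmx1.
by move=> l l' ll'; rewrite mxE; case: eqP => // E; rewrite E ltnn in ll'.
Qed.

Definition real_strat : strat R X.
apply: (@Strat R X (osp e n.*2) (@schubert_cell R m e n.*2) (@chart R m e n.*2)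
 rWb (@codim m e n.*2) (@rrk m d n) (@rmate m d n)
 (@slice R R m e n.*2 C) (@ycoord R R m e n.*2 C) (@hretr R R m e n.*2 C)).
- exact: cell_cover.
- exact: cell_inj.
- by move=> I; exact: chart_open.
- by move=> I V /cell_chart[].
- exact: chart_rWb.
- exact: rWb_rk.
- by move=> I V; apply: (@ycoord_cts R R m e n.*2 C sum_e).
- by move=> I V NV; apply: (@cell_ycoord R R m e n.*2 C I V NV).
- by move=> I; apply: (@slice_cts R R m e n.*2 C sum_e I).
- by move=> I w; apply: (@slice_chart R R m e n.*2 C I w).
- by move=> I w; apply: (@ycoord_slice R R m e n.*2 C I w).
- by move=> I V r NV; apply: (@hretr_cts R R m e n.*2 C sum_e I V r NV).
- by move=> I V NV; apply: (@hretr0 R R m e n.*2 C I V NV).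
- by move=> I V NV; apply: (@hretr1 R R m e n.*2 C I V NV).
- by move=> I V r _ NV; apply: (@hretr_chart R R m e n.*2 C I V r NV).
- by move=> I V r _ NV; apply: (@hretr_ycoord R R m e n.*2 C I V r NV).
- exact: rmateK.
- exact: rrk_mate.
- exact: rcd_mate.
- exact: rmate_open.
- exact: rrot.
- exact: good_codim_even.
- move=> I K L V W mI IV KV LK; case: LK => ->; first exact: (clos_cells sum_e IV KV).
 rewrite /rmate; case: fb => [c|]; last exact: (clos_cells sum_e IV KV).
 exact: closure_block IV KV.
- move=> I K V mI IV KV KI; apply: good_cmp; first by right; apply/rmate_fix.
 by move=> E; apply: KI.
 exact: (closure_rank sum_e IV KV).
- move=> I K V _ _ IV KV KI; apply: codim_lt; first exact: (closure_rank sum_e IV KV).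
 by move=> E; apply: KI.
Defined.

End real_strat.

(** * Functions on permutations and divided differences *)

Section count_pairs.
Variable n : nat.
Definition asc_pairs (f : 'I_n -> nat) : nat := (\sum_(p : 'I_n) \sum_(q : 'I_n) ((p < q) && (f p < f q)))%N.

Lemma asc_pairs_adj (a b : 'I_n) (f : 'I_n -> nat) : b = a.+1 :> nat -> (f b < f a)%N ->
 asc_pairs (fun p => f (tperm a b p)) = (asc_pairs f).+1.
move=> ba fba; have ab : a != b by rewrite -val_eqE /= ba neq_ltn ltnSn.
pose g (p q : 'I_n) : nat := (p < q)%N && (f (tperm a b p) < f (tperm a b q))%N.
pose h (p q : 'I_n) : nat := (p < q)%N && (f p < f q)%N.
have Ke p : (p != a) && (p != b) -> tperm a b p = p.
 by case/andP => pa pb; rewrite tpermD // eq_sym.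
rewrite -[LHS]/(\sum_p \sum_q g p q)%N -[asc_pairs f]/(\sum_p \sum_q h p q)%N !(sum_split2 _ ab).
have -> : (\sum_(p | (p != a) && (p != b)) \sum_(q | (q != a) && (q != b)) g p q =
 \sum_(p | (p != a) && (p != b)) \sum_(q | (q != a) && (q != b)) h p q)%N.
 by apply: eq_bigr => p /Ke pE; apply: eq_bigr => q /Ke qE; rewrite /g pE qE.
have -> : (\sum_(p | (p != a) && (p != b)) (g p a + g p b + g a p + g b p) =
 \sum_(p | (p != a) && (p != b)) (h p a + h p b + h a p + h b p))%N.
 apply: eq_bigr => p pE; rewrite /g /h tpermL tpermR Ke //=; case/andP: pE; rewrite -!val_eqE /= ba => p0 p1.
 have -> : (p < a.+1)%N = (p < a)%N by rewrite ltnS leq_eqVlt (negbTE p0).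
 have -> : (a < p)%N = (a.+1 < p)%N by rewrite leq_eqVlt eq_sym (negbTE p1).
 lia.
rewrite /g /h !tpermL !tpermR ba !ltnn ltnSn fba /= [(a.+1 < a)%N]ltnNge leqnSn /= [(f a < f b)%N]ltnNge (ltnW fba) /=.
lia.
Qed.

Lemma asc_pairs_perm (w : 'S_n) : asc_pairs (fun p => w p) = asc_pairs (fun p => w^-1%g p).
rewrite /asc_pairs (reindex_inj (@perm_inj _ w^-1%g)) /=; apply: eq_bigr => p _.
rewrite (reindex_inj (@perm_inj _ w^-1%g)) /=; apply: eq_bigr => q _.
by rewrite !permKV andbC.
Qed.

End count_pairs.
Section schubert_algebra.
Variable n : nat.
Implicit Types (w u v : 'S_n) (i j : 'I_n.-1).

Lemma lo_subproof j : (j < n)%N. Proof. by have := ltn_ord j; lia. Qed.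
Lemma hi_subproof j : (j.+1 < n)%N. Proof. by have := ltn_ord j; lia. Qed.
Definition lo j : 'I_n := Ordinal (lo_subproof j).
Definition hi j : 'I_n := Ordinal (hi_subproof j).
Definition sj j : 'S_n := tperm (lo j) (hi j).
(** The label [hi j] occurs before the label [lo j]; right multiplication by [sj j] exchanges these
    two labels. *)
Definition desc j w : bool := (w^-1 (hi j) < w^-1 (lo j))%g%N.
(** Pairs in increasing order, that is the length of [w] times the longest element: the degree of
    the class of [w]. The unit is therefore the class of [wtop]. *)
Definition wlen w : nat := asc_pairs (fun p => w p).
Definition wtop : 'S_n := perm (@rev_ord_inj n).

Lemma wtopE c : (wtop c : nat) = (n - c.+1)%N.
by rewrite permE. Qed.
Lemma wtopK : (wtop * wtop = 1)%g.
by apply/permP => c; rewrite permM !permE rev_ordK. Qed.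
Lemma wtopV : (wtop^-1 = wtop)%g.
by apply: (mulgI wtop); rewrite mulgV wtopK. Qed.
Lemma sjK j : (sj j * sj j = 1)%g. Proof. exact: tperm2. Qed.
Lemma invM_sj w j c : ((w * sj j)^-1 c = w^-1 (sj j c))%g.
by rewrite invMg permM tpermV. Qed.
Lemma lohi j : lo j != hi j.
by rewrite -val_eqE /= neq_ltn ltnSn. Qed.

Lemma desc_mul w j : desc j (w * sj j)%g = ~~ desc j w.
rewrite /desc !invM_sj tpermL tpermR -leqNgt [in RHS]leq_eqVlt.
by rewrite (inj_eq (@ord_inj n)) (inj_eq perm_inj) (negbTE (lohi j)).
Qed.

Lemma wlen_mul w j : desc j w -> wlen (w * sj j)%g = (wlen w).+1.
move=> dw; rewrite /wlen (asc_pairs_perm (w * sj j)%g) (asc_pairs_perm w) -(asc_pairs_adj (a := lo j) (b := hi j)) //.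
by apply: eq_bigr => p _; apply: eq_bigr => q _; rewrite !invM_sj.
Qed.

Lemma desc_wtop j : desc j wtop.
by rewrite /desc wtopV !permE /=; have := ltn_ord j; lia. Qed.

Lemma desc_all w : (forall j, desc j w) -> w = wtop.
move=> h; suff E : (w^-1 = wtop)%g by rewrite -[w]invgK E wtopV.
have lt (c d : 'I_n) : (c < d)%N -> (w^-1 d < w^-1 c)%g%N.
 move=> cd; have [k dE] : exists k, d = (c + k).+1 :> nat by exists (d - c).-1; lia.
 elim: k d dE {cd} => [|k ih] d dE.
 have cn : (c < n.-1)%N by have := ltn_ord d; rewrite dE; lia.
 have := h (Ordinal cn); rewrite /desc.
 have -> : lo (Ordinal cn) = c by apply: val_inj.
 by have -> : hi (Ordinal cn) = d by apply: val_inj; rewrite /= dE addn0.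
 have cn : (c + k.+1 < n.-1)%N by have := ltn_ord d; rewrite dE; lia.
 have := h (Ordinal cn); rewrite /desc.
 have -> : hi (Ordinal cn) = d by apply: val_inj; rewrite /= dE.
 move=> h1; apply: ltn_trans h1 (ih _ _); by rewrite /= addnS.
apply/permP => c; apply: val_inj; rewrite [RHS]wtopE /=.
have mono (f : 'I_n -> 'I_n) : (forall c d : 'I_n, (c < d)%N -> (f d < f c)%N) -> forall c : 'I_n, (f c <= n - c.+1)%N.
 move=> fm c'; elim: (c' : nat) {-2}c' (erefl (c' : nat)) => [|k ih] d dE.
 by rewrite dE; have := ltn_ord (f d); lia.
 have kn : (k < n)%N by have := ltn_ord d; lia.
 have := ih (Ordinal kn) erefl; have := fm (Ordinal kn) d; rewrite /= dE ltnSn => /(_ isT); lia.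
have h1 := mono _ lt c.
have mono2 k : forall d : 'I_n, n = (d + k.+1)%N -> (k <= w^-1%g d)%N.
 elim: k => // k ih d dE; have dn : (d.+1 < n)%N by rewrite [X in (_ < X)%N]dE; lia.
 have := ih (Ordinal dn); have := lt d (Ordinal dn); rewrite /= ltnSn => /(_ isT) h2.
 move=> h3; apply: leq_ltn_trans h2; apply: h3 => /=; move: dE; lia.
have h2 : (n - c.+1 <= w^-1 c)%g%N by apply: mono2; have := ltn_ord c; lia.
by apply/eqP; rewrite eqn_leq h1 h2.
Qed.

Lemma wlen0 w : wlen w = 0%N -> w = wtop.
move=> w0; apply: desc_all => j; apply/negPn/negP => dj.
have := wlen_mul (w := (w * sj j)%g) (j := j); rewrite desc_mul dj => /(_ isT).
by rewrite -mulgA sjK mulg1 w0.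
Qed.

Lemma wlen_top : wlen wtop = 0%N.
rewrite /wlen /asc_pairs big1 // => p _; apply: big1 => q _; rewrite !permE /=.
by have := ltn_ord p; have := ltn_ord q; case: ltnP => //= pq; lia.
Qed.

Notation A := {ffun 'S_n -> rat^o}.
Implicit Types (a b r s : A).

Definition ew w : A := [ffun u => (u == w)%:R].
(** The divided difference in the Schubert basis: it sends the class of [w] to that of [w * sj j]
    when this lowers the degree, and to 0 otherwise ([dj_ew]). *)
Definition dj j a : A := [ffun w => if desc j w then a (w * sj j)%g else 0].
(** The span of the classes pulled back along the projection that forgets the j-th member of the
    flag. *)
Definition inR j a : Prop := forall w, ~~ desc j w -> a w = 0.
Definition hom k a : Prop := forall w, wlen w <> k -> a w = 0.
Definition xj j : A := ew (wtop * sj j)%g.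

Lemma ffE a : a = \sum_w a w *: ew w.
apply/ffunP => u; rewrite sum_ffunE (bigD1 u) //= big1 ?addr0 => [|v vu].
 by rewrite !ffunE eqxx [RHS]mulr1.
by rewrite !ffunE eq_sym (negbTE vu) [LHS]mulr0.
Qed.

Lemma dj_lin j : linear (dj j).
by move=> k a b; apply/ffunP => w; rewrite !ffunE; case: ifP => // _; rewrite [k *: 0]mulr0 addr0.
Qed.
HB.instance Definition _ j := GRing.isLinear.Build rat A A _ (dj j) (dj_lin j).

Lemma dj_ew j w : dj j (ew w) = if desc j w then 0 else ew (w * sj j)%g.
have eqE u : (u * sj j == w)%g = (u == w * sj j)%g.
 by apply/eqP/eqP => [<-|->]; rewrite -mulgA sjK mulg1.
apply/ffunP => u; rewrite !ffunE eqE; case: eqVneq => [->|ne].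
 by rewrite desc_mul; case: (desc j w); rewrite !ffunE ?eqxx.
by case: (desc j w); case: (desc j u); rewrite !ffunE ?(negbTE ne).
Qed.

Lemma dj_R j a : inR j (dj j a).
by move=> w dw; rewrite ffunE (negbTE dw). Qed.
Lemma dj_inR j a : inR j a -> dj j a = 0.
by move=> h; apply/ffunP => w; rewrite !ffunE; case: ifP => // dw; rewrite h // desc_mul dw. Qed.
Lemma inRD j a b : inR j a -> inR j b -> inR j (a + b).
by move=> ha hb w dw; rewrite ffunE ha ?hb ?addr0. Qed.
Lemma hom_ew w : hom (wlen w) (ew w).
by move=> u du; rewrite ffunE; case: eqP => // E; rewrite E in du. Qed.
Lemma hom_dj k j a : hom k.+1 a -> hom k (dj j a).
by move=> h w wk; rewrite ffunE; case: ifP => // dw; apply: h; rewrite wlen_mul // => -[]. Qed.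
Lemma hom0_dj j a : hom 0 a -> dj j a = 0.
by move=> h; apply/ffunP => w; rewrite !ffunE; case: ifP => // dw; apply: h; rewrite wlen_mul. Qed.
Lemma homB k a b : hom k a -> hom k b -> hom k (a - b).
by move=> ha hb w wk; rewrite !ffunE ha ?hb ?subr0. Qed.
Lemma hom_xj j : hom 1 (xj j).
by have := @hom_ew (wtop * sj j)%g; rewrite wlen_mul ?wlen_top ?desc_wtop. Qed.

(** A permutation other than [wtop] has some [j] that is not a descent, and then its coefficient is
    a coefficient of [dj j a]. *)
Lemma dj_eq0 k a : hom k.+1 a -> (forall j, dj j a = 0) -> a = 0.
move=> ha h; apply/ffunP => w; rewrite !ffunE.
have [E|/eqP nw] := eqVneq w wtop; first by rewrite E; apply: ha; rewrite wlen_top.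
have [j dj'] : exists j, ~~ desc j w.
 by apply: contrapT => h'; apply: nw; apply: desc_all => j; apply/negPn/negP => dj'; apply: h'; exists j.
have := congr1 (fun b : A => b (w * sj j)%g) (h j); rewrite !ffunE desc_mul dj' /= -mulgA sjK mulg1.
by [].
Qed.

Lemma dj_xj i j : dj i (xj j) = if i == j then ew wtop else 0.
rewrite dj_ew; case: eqVneq => [->|ij].
 by rewrite desc_mul desc_wtop /= -mulgA sjK mulg1.
have -> // : desc i (wtop * sj j)%g.
rewrite /desc !invM_sj wtopV !wtopE.
have ij' : (i : nat) != j by rewrite (inj_eq val_inj).
have h1 : (sj j (hi i) : nat) = (if i.+1 == j then j.+1 else i.+1).
 case: ifP => E; last by rewrite tpermD // -val_eqE /=; lia.
 by have -> : hi i = lo j by [apply: val_inj; rewrite /= (eqP E)]; rewrite tpermL.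
have h2 : (sj j (lo i) : nat) = (if (i : nat) == j.+1 then j : nat else i : nat).
 case: ifP => E; last by rewrite tpermD // -val_eqE /=; lia.
 by have -> : lo i = hi j by [apply: val_inj; rewrite /= (eqP E)]; rewrite tpermR.
rewrite h1 h2; have := ltn_ord i; have := ltn_ord j; case: ifP; case: ifP; lia.
Qed.

Lemma sj_far i j c : (i.+1 < j)%N || (j.+1 < i)%N -> (c == lo i) || (c == hi i) -> sj j c = c.
by move=> ij ci; rewrite tpermD // -val_eqE /=; move: ci; rewrite -!val_eqE /= => /orP[]/eqP ->; lia.
Qed.

Lemma dj_far i j a : (i.+1 < j)%N || (j.+1 < i)%N -> dj i (dj j a) = dj j (dj i a).
move=> ij; have ji : (j.+1 < i)%N || (i.+1 < j)%N by rewrite orbC.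
apply/ffunP => w; rewrite !ffunE /desc !invM_sj.
rewrite !(sj_far ij) ?eqxx ?orbT // !(sj_far ji) ?eqxx ?orbT //.
have -> : (w * sj i * sj j = w * sj j * sj i)%g.
 rewrite -!mulgA; congr (_ * _)%g; rewrite conjgC /sj tpermJ -!/(sj _).
 by rewrite !(sj_far ij) ?eqxx ?orbT.
by do 2!case: ifP.
Qed.

Lemma dj_braid i j a : (j : nat) = i.+1 -> dj i (dj j (dj i a)) = dj j (dj i (dj j a)).
move=> ij; have E : lo j = hi i by apply: val_inj.
have l1 : sj i (hi j) = hi j by rewrite tpermD // -val_eqE /=; lia.
have l2 : sj j (lo i) = lo i by rewrite tpermD // -val_eqE /=; lia.
have l3 : sj i (hi i) = lo i by rewrite tpermR.
have l4 : sj i (lo i) = hi i by rewrite tpermL.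
have l5 : sj j (hi i) = hi j by rewrite -E tpermL.
have l6 : sj j (hi j) = hi i by rewrite -E tpermR.
have sE : (sj i * sj j * sj i = sj j * sj i * sj j)%g.
 have cE (x y : 'I_n.-1) : (sj x * sj y * sj x = tperm (sj x (lo y)) (sj x (hi y)))%g.
 by rewrite -tpermJ conjgE tpermV mulgA.
 by rewrite !cE l1 E l3 l2 l5.
have sE' w : (w * sj i * sj j * sj i = w * sj j * sj i * sj j)%g.
 by rewrite -!mulgA; congr (_ * _)%g; rewrite !mulgA.
apply/ffunP => w; rewrite !ffunE /desc !invM_sj E !(l1, l2, l3, l4, l5, l6) sE'.
set P0 := (w^-1 (lo i))%g; set P1 := (w^-1 (hi i))%g; set P2 := (w^-1 (hi j))%g.
case: (ltnP P1 P0) => h1; case: (ltnP P2 P1) => h2; case: (ltnP P2 P0) => h3 //; lia.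
Qed.

Section products.
Variable mul : A -> A -> A.
Notation "a ** b" := (mul a b) (at level 40).
Hypothesis mulc : forall a b, a ** b = b ** a.
Hypothesis mula : forall a b r, a ** (b ** r) = (a ** b) ** r.
Hypothesis mulDl' : forall a b r, (a + b) ** r = a ** r + b ** r.
Hypothesis mulZl' : forall (k : rat) a b, (k *: a) ** b = k *: (a ** b).
Hypothesis mul1 : forall a, ew wtop ** a = a.
Hypothesis mul_hom : forall k l a b, hom k a -> hom l b -> hom (k + l) (a ** b).
Hypothesis mul_R : forall j a b, inR j a -> inR j b -> inR j (a ** b).
Hypothesis mul_x : forall j v, desc j v -> inR j (xj j ** ew v - ew (v * sj j)%g).

Lemma mulDr' a b r : r ** (a + b) = r ** a + r ** b.
by rewrite mulc mulDl' mulc [b ** r]mulc. Qed.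
Lemma mulZr' (k : rat) a b : a ** (k *: b) = k *: (a ** b).
by rewrite mulc mulZl' mulc. Qed.
Lemma mul0l a : 0 ** a = 0. Proof. by have := mulZl' 0 0 a; rewrite !scale0r. Qed.
Lemma mul0r' a : a ** 0 = 0. Proof. by rewrite mulc mul0l. Qed.
Lemma mulBl' a b r : (a - b) ** r = a ** r - b ** r.
by rewrite mulDl' -scaleN1r mulZl' scaleN1r. Qed.
Lemma mul_suml (I : Type) (t : seq I) (f : I -> A) b : (\sum_(k <- t) f k) ** b = \sum_(k <- t) (f k ** b).
by elim/big_rec2: _ => [|k x y _ <-]; [exact: mul0l|exact: mulDl']. Qed.
Lemma mul_sumr (I : Type) (t : seq I) (f : I -> A) b : b ** (\sum_(k <- t) f k) = \sum_(k <- t) (b ** f k).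
by rewrite mulc mul_suml; apply: eq_bigr => k _; exact: mulc. Qed.

Lemma dj_mul_x j r : inR j r -> dj j (xj j ** r) = r.
move=> rR; rewrite {1}[r]ffE mul_sumr linear_sum [RHS]ffE; apply: eq_bigr => v _.
rewrite mulZr' linearZ /=; case: (boolP (desc j v)) => dv; last by rewrite rR // !scale0r.
congr (_ *: _); have /dj_inR := mul_x dv; rewrite linearB /= dj_ew desc_mul dv /= -mulgA sjK mulg1.
by move/eqP; rewrite subr_eq0 => /eqP.
Qed.

(** As for a projective line bundle, every element is r + x s with r and s pulled back, x being the
    divisor class and s its divided difference. *)
Lemma x_decomp j a : inR j (a - xj j ** dj j a).
move=> w dw; have := dj_mul_x (@dj_R j a) => /(congr1 (fun b : A => b (w * sj j)%g)).
rewrite !ffunE desc_mul dw /= -mulgA sjK mulg1 => ->.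
by rewrite subrr.
Qed.

Definition qj j := dj j (xj j ** xj j).
(** The simple root: if x is the fundamental weight, [qj j] is the sum of x and its reflection, so 2
    x minus it is the root, and [sigmaj j] is the reflection. *)
Definition alphaj j : A := 2 *: xj j - qj j.
Definition sigmaj j a : A := a - alphaj j ** dj j a.

(** Both factors are written as r + x s, and x squared as p + x q; the pulled-back elements form a
    subring killed by [dj j], on which multiplication by x is inverted by [dj j]. *)
Lemma leibniz j a b : dj j (a ** b) = dj j a ** b + sigmaj j a ** dj j b.
set s := dj j a; set s' := dj j b; pose r := a - xj j ** s; pose r' := b - xj j ** s'.
have sR : inR j s by exact: dj_R. have s'R : inR j s' by exact: dj_R.
have rR : inR j r by exact: x_decomp. have r'R : inR j r' by exact: x_decomp.
have aE : a = r + xj j ** s by rewrite subrK.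
have bE : b = r' + xj j ** s' by rewrite subrK.
pose p := xj j ** xj j - xj j ** qj j; have pR : inR j p by exact: x_decomp.
have xxE : xj j ** xj j = p + xj j ** qj j by rewrite subrK.
have qR : inR j (qj j) by exact: dj_R.
clearbody r r' p.
have abE : a ** b = r ** r' + p ** (s ** s') + xj j ** (r ** s' + s ** r' + qj j ** (s ** s')).
 rewrite {1}aE {1}bE mulDl' !mulDr' -!addrA; congr (_ + _).
 have -> : (xj j ** s) ** (xj j ** s') = p ** (s ** s') + xj j ** (qj j ** (s ** s')).
 have e1 : (xj j ** s) ** xj j = (xj j ** xj j) ** s by rewrite -mula [s ** xj j]mulc mula.
 by rewrite mula e1 xxE !mulDl' -!mula.
 have -> : r ** (xj j ** s') = xj j ** (r ** s') by rewrite mula [r ** xj j]mulc -mula.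
 have -> : (xj j ** s) ** r' = xj j ** (s ** r') by rewrite mula.
 by rewrite [RHS]addrCA; congr (_ + _); rewrite addrCA.
rewrite abE linearD /= [dj j (_ + _)]dj_inR ?add0r; last by apply: inRD; apply: mul_R => //; exact: mul_R.
rewrite dj_mul_x; last by apply: inRD; [apply: inRD|]; repeat apply: mul_R => //.
have aux (X Y Z T : A) : Z + T + Y = T + X + (Z + X - (X + X - Y)).
 by apply/ffunP => w; rewrite !ffunE; ring.
have R1 : s ** b = s ** r' + xj j ** (s ** s').
 by rewrite {1}bE mulDr'; congr (_ + _); rewrite mula [s ** _]mulc mula.
have R2 : a ** s' = r ** s' + xj j ** (s ** s').
 by rewrite {1}aE mulDl'; congr (_ + _); rewrite mula.
have R3 : (alphaj j ** s) ** s' = xj j ** (s ** s') + xj j ** (s ** s') - qj j ** (s ** s').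
 by rewrite -mula /alphaj mulBl' mulZl' scaler_nat mulr2n.
by rewrite /sigmaj -/s mulBl' R1 R2 R3.
Qed.

Lemma mul_dj0 j a b : dj j a = 0 -> dj j (a ** b) = a ** dj j b.
by move=> a0; rewrite leibniz a0 mul0l add0r /sigmaj a0 mul0r' subr0. Qed.
Lemma qj_hom j : hom 1 (qj j).
by apply: hom_dj; apply: (mul_hom (k := 1) (l := 1)); exact: hom_xj. Qed.

Lemma cartan_far i j : (i.+1 < j)%N || (j.+1 < i)%N -> dj i (qj j) = 0.
move=> ij; have nij : (i == j) = false by apply/negbTE; rewrite -val_eqE /=; lia.
have x0 : dj i (xj j) = 0 by rewrite dj_xj nij.
by rewrite /qj dj_far // (mul_dj0 _ x0) x0 mul0r' linear0.
Qed.

(** The braid relation applied to the product of [xj i] with the class of [wtop * sj i * sj j]: one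
    side evaluates to the unit, the other to [dj j (qj i)]. *)
Lemma cartan_near i j : ((i : nat) == j.+1) || ((j : nat) == i.+1) -> dj j (qj i) = ew wtop.
move=> ij; have nji : (j == i) = false by apply/negbTE; rewrite -val_eqE /=; lia.
have nij : (i == j) = false by rewrite eq_sym.
have braid a : dj i (dj j (dj i a)) = dj j (dj i (dj j a)).
 by case/orP: ij => /eqP ij; [rewrite -(dj_braid _ ij)|rewrite (dj_braid _ ij)].
set u := (wtop * sj i)%g; pose y := ew (u * sj j)%g.
have du : desc j u.
 have : dj j (xj i) = 0 by rewrite dj_xj nji.
 rewrite dj_ew; case: ifP => // _ /(congr1 (fun b : A => b (u * sj j)%g)).
 by rewrite !ffunE eqxx => /eqP; rewrite oner_eq0.
have yj : dj j y = xj i by rewrite dj_ew desc_mul du /= -mulgA sjK mulg1.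
have yi : dj i y = 0.
 rewrite dj_ew; have -> // : desc i (u * sj j)%g.
 rewrite /u /desc !invM_sj wtopV !wtopE.
 have h1 : (sj i (sj j (hi i)) : nat) = (if (j : nat) == i.+1 then j.+1 else i : nat).
 case: ifP => ij'.
 have -> : hi i = lo j by apply: val_inj; rewrite /= (eqP ij').
 by rewrite [sj j _]tpermL tpermD // -val_eqE /=; lia.
 have -> : sj j (hi i) = hi i by rewrite tpermD // -val_eqE /=; lia.
 by rewrite tpermR.
 have h2 : (sj i (sj j (lo i)) : nat) = (if (j : nat) == i.+1 then i.+1 else j : nat).
 case: ifP => ij'.
 have -> : sj j (lo i) = lo i by rewrite tpermD // -val_eqE /=; lia.
 by rewrite tpermL.
 have -> : lo i = hi j by apply: val_inj => /=; lia.
 by rewrite [sj j _]tpermR tpermD // -val_eqE /=; lia.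
 by rewrite h1 h2; have := ltn_ord i; have := ltn_ord j; case: ifP; lia.
have := braid (xj i ** y); rewrite leibniz yi mul0r' addr0 dj_xj eqxx mul1 yj dj_xj eqxx.
by rewrite (mul_dj0 _ _) ?dj_xj ?nji // yj => ->.
Qed.

End products.

Section uniqueness.
Variables mul mul' : A -> A -> A.
Hypothesis mulc : forall a b, mul a b = mul b a.
Hypothesis mula : forall a b r, mul a (mul b r) = mul (mul a b) r.
Hypothesis mulDl : forall a b r, mul (a + b) r = mul a r + mul b r.
Hypothesis mulZl : forall (k : rat) a b, mul (k *: a) b = k *: (mul a b).
Hypothesis mul1 : forall a, mul (ew wtop) a = a.
Hypothesis mul_hom : forall k l a b, hom k a -> hom l b -> hom (k + l) (mul a b).
Hypothesis mul_R : forall j a b, inR j a -> inR j b -> inR j (mul a b).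
Hypothesis mul_x : forall j v, desc j v -> inR j (mul (xj j) (ew v) - ew (v * sj j)%g).
Hypothesis mulc' : forall a b, mul' a b = mul' b a.
Hypothesis mula' : forall a b r, mul' a (mul' b r) = mul' (mul' a b) r.
Hypothesis mulDl'' : forall a b r, mul' (a + b) r = mul' a r + mul' b r.
Hypothesis mulZl'' : forall (k : rat) a b, mul' (k *: a) b = k *: (mul' a b).
Hypothesis mul1'' : forall a, mul' (ew wtop) a = a.
Hypothesis mul_hom' : forall k l a b, hom k a -> hom l b -> hom (k + l) (mul' a b).
Hypothesis mul_R' : forall j a b, inR j a -> inR j b -> inR j (mul' a b).
Hypothesis mul_x' : forall j v, desc j v -> inR j (mul' (xj j) (ew v) - ew (v * sj j)%g).

(** The difference has degree one, so it suffices that all its divided differences vanish; those of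
    [qj j] are 0 for i = j and for far i, and the unit for neighbours. *)
Lemma alphaj_unique j : alphaj mul j = alphaj mul' j.
rewrite /alphaj; congr (_ - _); apply/eqP; rewrite -subr_eq0; apply/eqP.
apply: (dj_eq0 (k := 0)); first by apply: homB; exact: qj_hom.
move=> i; rewrite linearB /=; have [->|ij] := eqVneq i j.
 by rewrite /qj !(dj_inR (@dj_R _ _)) subrr.
have ij' : (i : nat) != j by rewrite (inj_eq val_inj).
have [far|near] := boolP ((i.+1 < j)%N || (j.+1 < i)%N).
 by rewrite !cartan_far // subrr.
by rewrite !cartan_near ?subrr //; lia.
Qed.

(** Induction on the degree: the Leibniz rule expresses each divided difference of a product through
    products of smaller total degree and the common class [alphaj], and [dj_eq0] concludes. *)
Lemma mul_unique_hom k : forall p q a b, (p + q = k)%N -> hom p a -> hom q b -> mul a b = mul' a b.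
have [N] := ubnP k; elim: N k => // N ih k; rewrite ltnS => kN p q a b pq pa qb.
case: k kN pq => [|k] kN pq.
 have -> : a = a wtop *: ew wtop.
 apply/ffunP => w; rewrite !ffunE; have [->|wn] := eqVneq w wtop; first by rewrite [RHS]mulr1.
 rewrite [RHS]mulr0 pa // => w0; move: wn; rewrite (@wlen0 w) ?eqxx // w0; lia.
 by rewrite mulZl mulZl'' mul1 mul1''.
apply/eqP; rewrite -subr_eq0; apply/eqP; apply: (dj_eq0 (k := k)).
 by rewrite -pq; apply: homB; [exact: mul_hom|exact: mul_hom'].
move=> j; rewrite linearB /= (leibniz mulc) // (leibniz mulc') // /sigmaj -alphaj_unique.
set s := dj j a; set s' := dj j b.
have E1 : mul s b = mul' s b.
 case: p pa pq => [|p] pa pq; first by rewrite /s (hom0_dj _ pa) (mul0l mulZl) (mul0l mulZl'').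
 by apply: (ih k kN p q) => //; [lia|exact: hom_dj].
have E2 : mul a s' = mul' a s'.
 case: q qb pq => [|q] qb pq; first by rewrite /s' (hom0_dj _ qb) (mul0r' mulc mulZl) (mul0r' mulc' mulZl'').
 by apply: (ih k kN p q) => //; [lia|exact: hom_dj].
have E3 : mul (mul (alphaj mul j) s) s' = mul' (mul' (alphaj mul j) s) s'.
 rewrite -mula -mula'.
 case: p pa pq => [|p] pa pq.
 by rewrite /s (hom0_dj _ pa) (mul0l mulZl) (mul0l mulZl'') (mul0r' mulc mulZl) (mul0r' mulc' mulZl'').
 case: q qb pq => [|q] qb pq.
 by rewrite /s' (hom0_dj _ qb) !(mul0r' mulc mulZl) !(mul0r' mulc' mulZl'').
 have sp : hom p s by exact: hom_dj. have s'q : hom q s' by exact: hom_dj.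
 have <- : mul s s' = mul' s s' by case: k kN pq ih => [|k] kN pq ih; [lia|apply: (ih k _ p q) => //; lia].
 apply: (ih k kN 1%N (p + q)%N) => //; [lia| |exact: mul_hom].
 apply: homB; last exact: qj_hom.
 by move=> w wk; rewrite ffunE hom_xj // [_ *: _]mulr0.
by rewrite (mulBl' mulDl mulZl) (mulBl' mulDl'' mulZl'') E1 E2 E3 subrr.
Qed.

Theorem mul_unique a b : mul a b = mul' a b.
Proof.
rewrite [a]ffE [b]ffE !(mul_suml _ _) //; apply: eq_bigr => u _.
rewrite !(mul_sumr _ _) //; apply: eq_bigr => v _.
rewrite !mulZl !mulZl'' !(mulZr' _ _) //; congr (_ *: (_ *: _)).
exact: (mul_unique_hom erefl (@hom_ew u) (@hom_ew v)).
Qed.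

End uniqueness.
End schubert_algebra.

(** * Forgetting members of a flag *)

Section coarse.
Variables (F : numFieldType) (m m' : nat) (e : 'I_m -> nat) (e' : 'I_m' -> nat) (M : nat).
Variable phi : 'I_m -> 'I_m'.
Hypothesis phi_mono : forall i j : 'I_m, (i <= j)%N -> (phi i <= phi j)%N.
Hypothesis sum_e : (\sum_i e i)%N = M.
Hypothesis sum_e' : (\sum_i e' i)%N = M.
Hypothesis phi_e : forall j, e' j = (\sum_(i | phi i == j) e i)%N.
Implicit Types (I K : osp e M) (V : flag F e M) (g : 'M[F]_M).

Lemma osp_map_subproof I : [forall j, #|[pred c | [ffun l => phi (I l)] c == j]| == e' j].
apply/forallP => j; rewrite phi_e -sum1_card (partition_big (fun l => I l) (fun i => phi i == j)) /=.
 apply/eqP/eq_bigr => i /eqP ij; rewrite -(osp_card I i) -sum1_card; apply: eq_bigl => l.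
 by rewrite !inE ffunE; case: (I l =P i) => [->|]; rewrite ?ij ?eqxx ?andbF.
by move=> l; rewrite inE ffunE.
Qed.

Definition osp_map I : osp e' M := Osp (osp_map_subproof I).
Lemma osp_mapE I l : osp_map I l = phi (I l).
by rewrite /= ffunE. Qed.
Lemma osp_map_comp I (s : 'S_M) : osp_map (osp_comp I s) = osp_comp (osp_map I) s.
by apply: ospP => l; rewrite osp_mapE !osp_compE osp_mapE. Qed.

(** It identifies each entry of a coarse rank table with an entry of the fine one, or with 0. *)
Lemma phi_down (j : 'I_m') : (forall i, (phi i <= j)%N = false) \/
 exists i0 : 'I_m, forall i, (phi i <= j)%N = (i <= i0)%N.
have [/existsP[i1 h1]|h] := boolP [exists i, (phi i <= j)%N]; last first.
 by left=> i; apply/negbTE; apply: contraNN h => hi; apply/existsP; exists i.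
right; case: (arg_maxnP (P := fun i => (phi i <= j)%N) (fun i : 'I_m => i : nat) h1) => i0 h0 hm.
exists i0 => i; apply/idP/idP; first exact: hm.
by move=> /phi_mono h; apply: leq_trans h0.
Qed.

Lemma rI_osp_map I K : (forall i k, (k <= M)%N -> rI I i k <= rI K i k)%N ->
 forall j k, (k <= M)%N -> (rI (osp_map I) j k <= rI (osp_map K) j k)%N.
move=> h j k kM; have E J : rI (osp_map J) j k = (\sum_l ((phi (J l) <= j) && (l < k)))%N.
 by rewrite rIE; apply: eq_bigr => l _; rewrite osp_mapE.
rewrite !E; have [f0|[i0 fE]] := phi_down j.
 by rewrite big1 // => l _; rewrite f0.
have := h i0 k kM; rewrite !rIE; under eq_bigr do rewrite -fE.
by under [X in (_ <= X)%N -> _]eq_bigr do rewrite -fE.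
Qed.

Lemma parab_map I g : parab I g -> parab (osp_map I) g.
move=> h l k; rewrite !osp_mapE => lk; apply: h; rewrite ltnNge; apply/negP => /phi_mono.
by rewrite leqNgt lk.
Qed.

Lemma fr_map I g g' : g \in unitmx -> g' \in unitmx -> fr I g = fr I g' ->
 fr (osp_map I) g = fr (osp_map I) g'.
by move=> gu g'u /fr_parab h; apply/fr_parab => //; apply: parab_map; exact: h. Qed.
(** The same frame with labels merged by the monotone map [phi]. A frame is chosen arbitrarily; the
    result does not depend on it, by [coarse_fr]. *)
Definition coarse V : flag F e' M :=
 let I := proj1_sig (cid (cell_cover sum_e V)) in
 let g := proj1_sig (cid2 (fr_surj sum_e I V)) in fr (osp_map I) g.

Lemma coarse_fr I g : g \in unitmx -> coarse (fr I g) = fr (osp_map I) g.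
move=> gu; rewrite /coarse; set J := proj1_sig (cid _); case: (cid2 _) => h hu /= E.
have [s sE] := osp_perm I J; have pu : row_perm s g \in unitmx by rewrite row_permE unitmx_mul unitmx_perm.
rewrite (@fr_perm F m' e' M (osp_map I) (osp_map J) g s) //; last by move=> l; rewrite [LHS]osp_mapE [RHS]osp_mapE; congr phi; exact: sE.
by apply: fr_map => //; rewrite -E; exact: fr_perm.
Qed.

Lemma coarse_cts : continuous coarse.
move=> V; have [I VI] := cell_cover sum_e V.
apply: (flag_fun_cts sum_e (I := I) (N := setT) (phi := fun g => fr (osp_map I) g)) => //.
- exact: openT.
- by move=> g gu _; exact: coarse_fr.
- by move=> g gu _; apply: (@fr_cts F m' e' M sum_e' (osp_map I) _ (fun x : 'M[F]_M => x) g) => // A.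
Qed.

Lemma coarse_cell I V : schubert_cell I V -> schubert_cell (osp_map I) (coarse V).
by move=> /cellP[g [gu gl ->]]; apply/cellP; exists g; split=> //; exact: coarse_fr. Qed.

Lemma codim_osp_map I : (codim (osp_map I) <= codim I)%N.
rewrite !codimE; apply: leq_sum => p _; apply: leq_sum => q _; rewrite /gI !osp_mapE.
case: (p < q)%N => //=; case: (ltnP (phi (I p)) (phi (I q))) => // h; rewrite (_ : (I p < I q)%N) //.
by rewrite ltnNge; apply/negP => /phi_mono; rewrite leqNgt h.
Qed.

End coarse.

Lemma cell_fr1 (F : numFieldType) m (e : 'I_m -> nat) M (I : osp e M) :
 schubert_cell I (fr I (1%:M : 'M[F]_M)).
apply/cellP; exists 1%:M; split=> //; first exact: unitmx1.
by move=> l l' ll'; rewrite mxE; case: eqP => // E; rewrite E ltnn in ll'.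
Qed.

(** * Lifting partitions to permutations *)

Section lifts.
Variable n : nat.
Notation d1 := (fun _ : 'I_n => 1%N).

Lemma operm_subproof (w : 'S_n) : [forall j, #|[pred c | [ffun l => w l] c == j]| == d1 j].
apply/forallP => j; rewrite -(card1 (w^-1 j)%g); apply/eqP/eq_card => c; rewrite !inE ffunE.
by rewrite -(inj_eq (@perm_inj _ w^-1)) permK.
Qed.

Definition operm (w : 'S_n) : osp d1 n := Osp (operm_subproof w).
Lemma opermE w c : operm w c = w c.
by rewrite /= ffunE. Qed.

Lemma operm_surj (I : osp d1 n) : exists w, I = operm w.
have inj : injective (fun c => I c).
 move=> c c' E; have /card_le1_eqP h : (#|[pred c0 | I c0 == I c]| <= 1)%N by rewrite osp_card.
 by apply: h; rewrite !inE ?E eqxx.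
by exists (perm inj); apply: ospP => c; rewrite opermE permE.
Qed.

Lemma operm_inj : injective operm.
by move=> w w' E; apply/permP => c; rewrite -!opermE E. Qed.

Lemma perm_rank (w : 'S_n) c : (w c : nat) = (\sum_c' (w c' < w c))%N.
rewrite (reindex_inj (@perm_inj _ w^-1%g)) /=.
rewrite (eq_bigr (fun i : 'I_n => if (i < w c)%N then 1 else 0)%N); last first.
 by move=> i _; rewrite permKV; case: (_ < _)%N.
by rewrite -big_mkcond /= (big_ord_narrow (ltnW (ltn_ord (w c)))) sum1_card card_ord.
Qed.

Lemma eq_perm_order (w w' : 'S_n) :
 (forall c c' : 'I_n, (c < c')%N -> (w c < w c')%N = (w' c < w' c')%N) -> w = w'.
move=> h; apply/permP => c; apply: val_inj; rewrite [LHS]perm_rank [RHS]perm_rank; apply: eq_bigr => c' _.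
case: (ltngtP c' c) => cc; last by rewrite (val_inj cc) !ltnn.
 by rewrite h.
have gt (v : 'S_n) : (v c' < v c)%N = ~~ (v c < v c')%N.
 rewrite -leqNgt [in RHS]leq_eqVlt; case: eqP => // /val_inj/perm_inj E.
 by rewrite E ltnn in cc.
by rewrite !gt h.
Qed.

Variables (m : nat) (d : 'I_m -> nat) (phi : osp d n).
Hypothesis phi_mono : forall i j : 'I_n, (i <= j)%N -> (phi i <= phi j)%N.
(** The open cell of the fibre over the cell of [K]: labels with the same image occur in decreasing
    order, so no new normal pair appears and the codimension is that of [K]. *)
Definition lift_of (K : 'I_n -> 'I_m) (w : 'S_n) : Prop :=
 (forall c, phi (w c) = K c) /\ (forall c c' : 'I_n, (c < c')%N -> K c = K c' -> (w c' < w c)%N).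

Lemma lift_order K w (c c' : 'I_n) : lift_of K w -> (c < c')%N -> (w c < w c')%N = (K c < K c')%N.
move=> [h1 h2] cc; apply/idP/idP => [lt|].
 rewrite ltn_neqAle -!h1 phi_mono ?(ltnW lt) // andbT; apply/negP => /eqP/val_inj E.
 by have := h2 c c' cc; rewrite -!h1 => /(_ E); rewrite ltnNge (ltnW lt).
by move=> lt; rewrite ltnNge; apply/negP => /phi_mono; rewrite !h1 leqNgt lt.
Qed.

Lemma lift_unique K w w' : lift_of K w -> lift_of K w' -> w = w'.
by move=> h h'; apply: eq_perm_order => c c' cc; rewrite (lift_order h) // (lift_order h'). Qed.

(** A permutation over [K] of least codimension works: an increasing pair inside a fibre could be
    exchanged, which would lower the codimension. *)
Lemma lift_exists (K : osp d n) : exists w, lift_of K w.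
have [s0 h0] := osp_perm phi K.
have P0 : [forall c, phi (s0 c) == K c] by apply/forallP => c; rewrite h0.
case: (arg_minnP (P := fun w : 'S_n => [forall c, phi (w c) == K c]) (fun w => codim (operm w)) P0) => w /forallP h1 hm.
have {}h1 c : phi (w c) = K c by apply/eqP/h1.
exists w; split=> // c c' cc Kcc; rewrite ltnNge leq_eqVlt negb_or; apply/andP; split.
 by apply/negP => /eqP/val_inj/perm_inj E; rewrite E ltnn in cc.
apply/negP => lt; have := hm (tperm c c' * w)%g; case: forallP => [_ /(_ isT)|]; last first.
 case=> x; rewrite permM h1; case: tpermP => [->|->|//]; by rewrite Kcc.
rewrite leqNgt => /negP; apply.
have := @codim_swap _ _ _ (operm (tperm c c' * w)) c c' cc.
rewrite !opermE !permM tpermL tpermR => /(_ lt).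
suff -> : osp_comp (operm (tperm c c' * w)) (tperm c c') = operm w by [].
by apply: ospP => x; rewrite osp_compE !opermE permM tpermK.
Qed.

End lifts.

(** * The common framework for the real and the complex case *)

Definition cohom (R : realType) (X : topT) (a b : cochain R X) :=
 exists c, cob c = a - b.
Definition ev (R : realType) (X : topT) k (h : (nat -> R) -> X) (a : cochain R X) : rat :=
 app a (fun t : simp R k => h (fun j => set_val t 0 (inord j.+1) - set_val t 0 0)).
Section normal_lists.
Variables (R : realType) (F : numFieldType) (n M : nat) (gb : 'I_M -> 'I_n) (kap : R -> R -> 'I_M -> F).
(** Normal directions by position and block: each pair stands for two consecutive real coordinates,
    the real and imaginary parts of an entry or its two columns in a doubled block. *)
Definition pl m (d : 'I_m -> nat) (w : osp d n) : seq ('I_M * 'I_n) :=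
 [seq p : 'I_M * 'I_n <- [seq (l, c) | l <- enum 'I_M, c <- enum 'I_n] |
 (gb p.1 < p.2)%N && (w (gb p.1) < w p.2)%N].
(** The normal matrix with coordinates listed along [s]. The list is a parameter because slices are
    later compared for different orders of the same pairs. *)
Definition nl (s : seq ('I_M * 'I_n)) (x : nat -> R) : 'M[F]_M :=
 \matrix_(l, d) if (l, gb d) \in s
 then kap (x (index (l, gb d) s).*2) (x (index (l, gb d) s).*2.+1) d else 0.

Lemma mem_pl m (d : 'I_m -> nat) (w : osp d n) l c :
 ((l, c) \in pl w) = (gb l < c)%N && (w (gb l) < w c)%N.
rewrite mem_filter andb_idr // => _.
by apply/allpairsPdep; exists l, c; rewrite !mem_enum.
Qed.

Lemma uniq_pl m (d : 'I_m -> nat) (w : osp d n) : uniq (pl w).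
apply: filter_uniq; apply: allpairs_uniq; rewrite ?enum_uniq //.
by move=> [a b] [c d'] _ _.
Qed.

End normal_lists.

(* Flags of F^M, for the two cases F = R, M = 2n and F = C, M = n, with the facts
 on Schubert cocycles on which the determination of the products rests.  The
 positions 'I_gM form n blocks, [gb l] is the block of l and [gD w] is the
 ordered set partition with label w c on the block c. *)
Record geo (R : realType) (n : nat) := Geo {
 gF : numFieldType;
 gM : nat;
 gb : 'I_gM -> 'I_n;
 gs : 'S_n -> 'S_gM;
 gem : nat -> nat;
 gbeta : nat;
 ggam : nat;
 kap : R -> R -> 'I_gM -> gF;
 gbsw : 'S_gM -> Prop;
 gD : forall m (d : 'I_m -> nat), osp d n -> osp (fun i => gem (d i)) gM;
 gmate : forall m (d : 'I_m -> nat), osp (fun i => gem (d i)) gM -> osp (fun i => gem (d i)) gM;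
 gsc : forall m (d : 'I_m -> nat), osp d n -> cochain R (flag gF (fun i => gem (d i)) gM);
 gb_mono : forall l l' : 'I_gM, (gb l < gb l')%N -> (l < l')%N;
 gb_card : forall c, #|[pred l | gb l == c]| = gbeta;
 gbeta_gt0 : (0 < gbeta)%N;
 ggam_gt0 : (0 < ggam)%N;
 gsE : forall s l, gb (gs s l) = s (gb l);
 gs1 : gs 1 = 1%g;
 gsM : forall s t, gs (s * t) = (gs s * gs t)%g;
 gem0 : gem 0 = 0%N;
 gemD : forall a b, gem (a + b) = (gem a + gem b)%N;
 gemn : gem n = gM;
 gDE : forall m d w l, @gD m d w l = w (gb l);
 kap0 : forall l, kap 0 0 l = 0;
 kap_cts : forall (T : topT) (f g : T -> R^o) t l, cts_at t f ->
 cts_at t g -> cts_at t (fun x => kap (f x) (g x) l : gF^o);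
 kap_sep : forall a b c, (forall l, gb l = c -> kap a b l = 0) -> a = 0 /\ b = 0;
 kap_gs : forall a b s l, kap a b (gs s l) = kap a b l;
 gpath : forall p q : 'I_n, exists gam : R -> 'M[gF]_gM, [/\ continuous gam,
 forall t, gam t \in unitmx, gam 0 = 1%:M & gam 1 = perm_mx (gs (tperm p q))];
 gmate_D : forall m d w, gmate (@gD m d w) = gD w;
 gmate_sw : forall m d I, exists2 s, gbsw s & @gmate m d I = osp_comp I s;
 gbsw_gb : forall s l, gbsw s -> gb (s l) = gb l;
 gclosure_sw : forall m d (w : osp d n) (K : osp (fun i => gem (d i)) gM) s
 (V W : flag gF (fun i => gem (d i)) gM), (\sum_(i < m) d i)%N = n ->
 gbsw s -> closure (@schubert_cell gF _ _ _ (gD w)) V -> schubert_cell K V -> schubert_cell (osp_comp K s) W ->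
 closure (schubert_cell (gD w)) W;
 gcodim : forall m d (w : osp d n), codim (@gD m d w) = (ggam * size (pl gb w))%N;
 gscP : forall m d (w : osp d n), (\sum_(i < m) d i)%N = n ->
 [/\ cob (gsc w) = 0, van (~` closure (schubert_cell (gD w))) (gsc w),
 hdeg (size (pl gb w)).*2 (gsc w) &
 ev (size (pl gb w)).*2 (fun x => fr (gD w) (1%:M + nl gb kap (pl gb w) x)) (gsc w) = 1];
 gspan : forall m d (Z : {set osp (fun i => gem (d i)) gM}) i a, (\sum_(i < m) d i)%N = n ->
 (forall I, I \in Z -> @gmate m d I \in Z) ->
 open (~` cells_of (@schubert_cell gF _ _ _) Z) -> cob a = 0 ->
 van (~` cells_of (@schubert_cell gF _ _ _) Z) a -> hdeg i a ->
 exists2 lam : osp d n -> rat, (forall w, lam w != 0 -> gD w \in Z /\ (size (pl gb w)).*2 = i) &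
 exists2 b, van (~` cells_of (@schubert_cell gF _ _ _) Z) b &
 cob b = a - \sum_w lam w *: gsc w;
 gfree : forall m d (lam : osp d n -> rat), (\sum_(i < m) d i)%N = n ->
 cohom (\sum_w lam w *: gsc w) 0 -> forall w, lam w = 0;
 gexact : forall m d (w : osp d n) b, (\sum_(i < m) d i)%N = n ->
 van (@chart gF _ _ _ (gD w) `&` ~` schubert_cell (gD w)) b ->
 ev (size (pl gb w)).*2 (fun x => fr (gD w) (1%:M + nl gb kap (pl gb w) x)) (cob b) = 0 }.

Arguments gsc {R n} g0 {m d} w.

(** * Cohomologous cochains and pullbacks *)

Section cohomologous.
Variables (R : realType) (X : topT).
Implicit Types (a b c : cochain R X).

Lemma cohom_refl a : cohom a a.
by exists 0; rewrite linear0 subrr. Qed.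
Lemma cohom_sym a b : cohom a b -> cohom b a.
by move=> [c cE]; exists (- c); rewrite linearN /= cE opprB. Qed.
Lemma cohom_trans a b c : cohom a b -> cohom b c -> cohom a c.
move=> [x xE] [y yE]; exists (x + y); rewrite linearD /= xE yE.
by rewrite addrA subrK.
Qed.
Lemma cohomD a b a' b' : cohom a a' -> cohom b b' -> cohom (a + b) (a' + b').
by move=> [x xE] [y yE]; exists (x + y); rewrite linearD /= xE yE opprD addrACA. Qed.
Lemma cohomZ k a b : cohom a b -> cohom (k *: a) (k *: b).
by move=> [x xE]; exists (k *: x); rewrite linearZ /= xE scalerBr. Qed.
Lemma cohom_sum (I : Type) (r : seq I) (P : pred I) (f g : I -> cochain R X) :
 (forall i, P i -> cohom (f i) (g i)) -> cohom (\sum_(i <- r | P i) f i) (\sum_(i <- r | P i) g i).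
by move=> h; elim/big_rec2: _ => [|i x y Pi]; [exact: cohom_refl|move=> ?; apply: cohomD => //; exact: h]. Qed.

Lemma cocycle_cupc a b : cob a = 0 -> cob b = 0 -> cob (cupc a b) = 0.
move=> a0 b0; apply/is_cocycleP; apply: is_cocycle_cupc; exact/is_cocycleP.
Qed.

Lemma cupc0l b : cupc (0 : cochain R X) b = 0.
by rewrite -(scale0r (0 : cochain R X)) cupcZl scale0r. Qed.
Lemma cupc0r b : cupc b (0 : cochain R X) = 0.
by rewrite -(scale0r (0 : cochain R X)) cupcZr scale0r. Qed.

Lemma cohom_cupl a a' b : cob b = 0 -> cohom a a' -> cohom (cupc a b) (cupc a' b).
move=> b0 [c cE]; exists (cupc c b); rewrite cob_cupc cE b0 cupc0r addr0.
by rewrite -[- a']scaleN1r cupcDl cupcZl scaleN1r.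
Qed.

Lemma cohom_cupr i a b b' : hdeg i a -> cob a = 0 -> cohom b b' -> cohom (cupc a b) (cupc a b').
move=> ai a0 [c cE]; exists ((-1) ^+ i *: cupc a c).
rewrite linearZ /= cob_cupc a0 cupc0l add0r (csign_hdeg ai) cupcZl scalerA -exprD addnn.
by rewrite -signr_odd odd_double scale1r cE -[- b']scaleN1r cupcDr cupcZr scaleN1r.
Qed.

Lemma ev_sub k h a b : ev k h (a - b) = ev k h a - ev k h b.
exact: appB. Qed.
Lemma ev_scale k h (q : rat) a : ev k h (q *: a) = q * ev k h a.
by rewrite /ev /app; case: pselect => // _; rewrite mulr0. Qed.

End cohomologous.
Section pullbacks.
Variables (R : realType) (X Y : topT) (f : X -> Y).
Hypothesis fc : continuous f.
Lemma pb_cobE (a : cochain R Y) : cob (pb f a) = pb f (cob a).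
by apply/funext => s; rewrite (@pb_cob _ _ _ _ setT) // => x _; exact: fc. Qed.

Lemma pbD (a b : cochain R Y) : pb f (a + b) = pb f a + pb f b.
apply/funext => s; rewrite -[RHS]/(pb f a s + pb f b s) /pb /app.
by case: pselect => // _; rewrite addr0.
Qed.

Lemma pbZ k (a : cochain R Y) : pb f (k *: a) = k *: pb f a.
apply/funext => s; rewrite -[RHS]/(k * pb f a s) /pb /app.
by case: pselect => // _; rewrite mulr0.
Qed.

Lemma pb0 : pb f (0 : cochain R Y) = 0.
by rewrite -(scale0r (0 : cochain R Y)) pbZ scale0r. Qed.
Lemma pb_sum (I : Type) (r : seq I) (P : pred I) (g : I -> cochain R Y) :
 pb f (\sum_(i <- r | P i) g i) = \sum_(i <- r | P i) pb f (g i).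
by elim/big_rec2: _ => [|i x y _ <-]; [exact: pb0|exact: pbD]. Qed.
Lemma pb_cohom (a b : cochain R Y) : cohom a b -> cohom (pb f a) (pb f b).
by move=> [c cE]; exists (pb f c); rewrite pb_cobE cE pbB. Qed.
Lemma pb_cupcE (a b : cochain R Y) : pb f (cupc a b) = cupc (pb f a) (pb f b).
by apply/funext => s; rewrite (@pb_cupc _ _ _ _ setT) // => x _; exact: fc. Qed.
End pullbacks.

(** * Pulling Schubert classes back to complete flags *)

Section geo_theory.
Variables (R : realType) (n : nat) (G : geo R n).
Notation F := (gF G).
Notation M := (gM G).
Notation em d := (fun i => gem G (d i)).
Notation PL := (pl (@gb _ _ G)).
Notation NL := (nl (@gb _ _ G) (@kap _ _ G)).
Notation d1 := (fun _ : 'I_n => 1%N).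

Definition evS m (d : 'I_m -> nat) (w : osp d n) a : rat :=
 ev (size (PL w)).*2 (fun x => fr (gD G w) (1%:M + NL (PL w) x)) a.
Lemma gem_sum (I : finType) (P : pred I) (f : I -> nat) :
 gem G (\sum_(i | P i) f i) = (\sum_(i | P i) gem G (f i))%N.
by apply: big_morph; [exact: gemD|exact: gem0]. Qed.
Lemma sum_em m (d : 'I_m -> nat) : (\sum_i d i)%N = n -> (\sum_i em d i)%N = M.
by move=> E; rewrite -(gem_sum xpredT) E gemn. Qed.
Lemma sum_d1 : (\sum_(i < n) 1)%N = n.
by rewrite sum1_card card_ord. Qed.
Lemma gb_surj c : exists l : 'I_M, gb l = c.
have := gbeta_gt0 G; rewrite -(gb_card G c) => /card_gt0P[l]; rewrite inE => /eqP; by exists l.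
Qed.
Lemma gD_inj m (d : 'I_m -> nat) : injective (gD G (d := d)).
by move=> w w' E; apply: ospP => c; have [l <-] := gb_surj c; rewrite -!gDE E. Qed.

Lemma size_pl_operm (w : 'S_n) : size (PL (operm w)) = (gbeta G * wlen w)%N.
rewrite size_filter -sum1_count big_mkcond big_allpairs_dep /= big_enum /=.
rewrite (partition_big (@gb _ _ G) xpredT) //= /wlen /asc_pairs big_distrr /=.
apply: eq_bigr => c _; rewrite -[in RHS](@gb_card _ _ G c) -sum_nat_const; apply: eq_bigr => l /eqP ->.
rewrite big_enum /=; apply: eq_bigr => c' _; rewrite !ffunE.
by case: (_ && _).
Qed.

Section lifting.
Variables (m : nat) (d : 'I_m -> nat) (phi : osp d n).
Hypothesis sum_d : (\sum_i d i)%N = n.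
Hypothesis phi_mono : forall i j : 'I_n, (i <= j)%N -> (phi i <= phi j)%N.

Lemma phi_em j : gem G (d j) = (\sum_(i | phi i == j) gem G 1)%N.
by rewrite -(osp_card phi j) -sum1_card gem_sum; apply: eq_bigl => i; rewrite inE. Qed.
Definition pmap := @coarse F n m (em d1) (em d) M (fun i => phi i) (sum_em sum_d1) phi_em.
Notation om := (@osp_map n m (em d1) (em d) M (fun i => phi i) phi_em).
Lemma pmap_cts : continuous pmap.
by move=> V; apply: (@coarse_cts F n m (em d1) (em d) M (fun i => phi i) phi_mono (sum_em sum_d1) (sum_em sum_d) phi_em V). Qed.
Lemma pmap_fr I g : g \in unitmx -> pmap (fr I g) = fr (om I) g.
exact: coarse_fr. Qed.

Lemma pl_lift (K : osp d n) w : lift_of phi K w -> PL (operm w) = PL K.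
move=> h; apply: eq_filter => -[l c] /=; case: (ltnP (gb l) c) => //= lc.
by rewrite !opermE (lift_order phi_mono h).
Qed.

Lemma om_lift (K : osp d n) w : lift_of phi K w -> om (gD G (operm w)) = gD G K.
by move=> [h _]; apply: ospP => l; rewrite osp_mapE !gDE opermE h. Qed.
Lemma rI_eq e' (I K : osp e' M) : (forall (i : 'I_m) k, (k <= M)%N -> (rI I i k <= rI K i k)%N) ->
 (forall i k, (k <= M)%N -> (rI K i k <= rI I i k)%N) -> I = K.
by move=> h h'; apply: rI_inj => i k kM; apply/eqP; rewrite eqn_leq h ?h'. Qed.
(** The cells that make up the preimage of a Schubert variety ([upZ_cells]). *)
Definition upZ (K : osp d n) : {set osp (em d1) M} :=
 [set I | `[< exists2 V, closure (@schubert_cell F _ _ _ (gD G K)) V & schubert_cell (om I) V >]]%SET.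

Lemma upZ_cells (K : osp d n) : cells_of (@schubert_cell F _ _ _) (upZ K) =
 pmap @^-1` closure (@schubert_cell F _ _ _ (gD G K)).
apply/seteqP; split=> V; last first.
 move=> KV; have [I IV] := cell_cover (sum_em sum_d1) V; exists I => //; rewrite inE; apply/asboolP.
 by exists (pmap V) => //; exact: coarse_cell.
case=> I; rewrite inE => /asboolP[W KW IW] IV.
by apply: (clos_cells (sum_em sum_d) KW IW); exact: coarse_cell.
Qed.

Lemma upZ_open (K : osp d n) : open (~` cells_of (@schubert_cell F _ _ _) (upZ K)).
rewrite upZ_cells (_ : ~` _ = pmap @^-1` (~` closure (@schubert_cell F _ _ _ (gD G K)))) //; apply: open_comp; first by move=> V _; exact: pmap_cts.
by apply: closed_openC; exact: closed_closure.
Qed.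

Lemma upZ_mate (K : osp d n) I : I \in upZ K -> gmate I \in upZ K.
rewrite inE => /asboolP[V KV IV]; rewrite inE; apply/asboolP.
have [s sw ->] := gmate_sw I; exists (fr (om (osp_comp I s)) 1%:M); last exact: cell_fr1.
apply: (gclosure_sw sum_d sw KV IV); rewrite osp_map_comp; exact: cell_fr1.
Qed.

Lemma upZ_rank (K : osp d n) I : I \in upZ K -> forall i k, (k <= M)%N -> (rI (gD G K) i k <= rI (om I) i k)%N.
by rewrite inE => /asboolP[V KV IV]; exact: (closure_rank (sum_em sum_d) KV IV). Qed.

(** Since [phi] is monotone, normal pairs for [K] are normal for [u]; if there are no others, labels
    in a fibre decrease. *)
Lemma size_pl_map (u : 'S_n) (K : osp d n) : (forall c, phi (u c) = K c) ->
 (size (PL K) <= size (PL (operm u)))%N /\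
 (size (PL K) = size (PL (operm u)) -> lift_of phi K u).
move=> uK; have sub : {subset PL K <= PL (operm u)}.
 move=> [l c]; rewrite !mem_pl !opermE => /andP[-> /=]; rewrite -!uK => lt.
 by rewrite ltnNge; apply/negP => /phi_mono; rewrite leqNgt lt.
split=> [|sz]; first exact: uniq_leq_size (uniq_pl _ _) sub.
have [|_ eqm] := uniq_min_size (uniq_pl _ _) sub; first by rewrite sz.
split=> // c c' cc Kcc; rewrite ltnNge leq_eqVlt negb_or; apply/andP; split.
 by apply/negP => /eqP/val_inj/perm_inj E; rewrite E ltnn in cc.
have [l lc] := gb_surj c; have := eqm (l, c'); rewrite !mem_pl !opermE lc cc /= Kcc ltnn => <-.
by [].
Qed.

Lemma om_perm (u : 'S_n) : exists2 K : osp d n, (forall c, phi (u c) = K c) & om (gD G (operm u)) = gD G K.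
exists (osp_comp phi u); first by move=> c; rewrite osp_compE.
by apply: ospP => l; rewrite osp_mapE !gDE opermE osp_compE.
Qed.

(** The pullback is supported on the preimage of the Schubert variety, where only the cell of the
    lift has the right codimension; the coefficient is read on its slice. *)
Theorem pull_lift (K : osp d n) w : lift_of phi K w -> cohom (pb pmap (gsc G K)) (gsc G (operm w)).
Proof.
move=> h; have [scK vK hK eK] := gscP G K sum_d.
have cK : cob (pb pmap (gsc G K)) = 0 by rewrite (pb_cobE pmap_cts) scK (pb0 _).
have vanK : van (~` cells_of (@schubert_cell F _ _ _) (upZ K)) (pb pmap (gsc G K)).
 by rewrite upZ_cells; apply: pb_van vK => V.
have [lam lamP [b bZ bE]] := gspan sum_d1 (@upZ_mate K) (upZ_open K) cK vanK (pb_hdeg _ hK).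
(* Codimension grows strictly along a closure, so a cell of this codimension lies over [K] itself,
   and is then the lift. *)
have lam0 v : v != operm w -> lam v = 0.
 move=> vw; apply/eqP/negPn/negP => /lamP[vZ /double_inj sz].
 have [u uE] := operm_surj v; rewrite {}uE in vw vZ sz.
 have [L uL omL] := om_perm u; have [le eq] := size_pl_map uL.
 have r := upZ_rank vZ; rewrite omL in r.
 have LK : L = K.
 apply: contrapT => LK; have := codim_lt r; rewrite !gcodim => /(_ _).
 have nE : gD G K <> gD G L by move=> /gD_inj E; apply: LK.
 by move=> /(_ nE); rewrite ltn_pmul2l ?ggam_gt0 // ltnNge -sz le.
 subst L; have /(lift_unique phi_mono h) E := eq (esym sz).
 by rewrite E eqxx in vw.
have sE : \sum_v lam v *: gsc G v = lam (operm w) *: gsc G (operm w).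
 by rewrite (bigD1 (operm w)) //= big1 ?addr0 // => v vw; rewrite lam0 // scale0r.
rewrite sE in bE; suff l1 : lam (operm w) = 1 by exists b; rewrite bE l1 scale1r.
have [_ _ _ ew] := gscP G (operm w) sum_d1.
have := gexact (w := operm w) sum_d1 (b := b); rewrite bE ev_sub ev_scale ew mulr1.
(* The lift has the same list of normal pairs as [K] and the projection keeps the frame, so it
   carries one slice to the other. *)
have -> : ev (size (PL (operm w))).*2 (fun x => fr (gD G (operm w)) (1%:M + NL (PL (operm w)) x)) (pb pmap (gsc G K)) = 1.
 have nlu v m' (d' : 'I_m' -> nat) (K' : osp d' n) x : v = PL K' -> 1%:M + NL v x \in unitmx.
 move=> ->; apply: (ntype_unit (I := gD G K')) => l c; rewrite !gDE mxE mem_pl => cl.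
 by rewrite [(_ < K' (gb c))%N]ltnNge cl andbF.
 rewrite (pl_lift h) /ev pb_app.
 rewrite -eK; apply: eq_app => t; rewrite pmap_fr ?(om_lift h) //; exact: nlu.
 move=> t; apply: (@fr_cts F n (em d1) M (sum_em sum_d1) (gD G (operm w)) _ (fun t : simp R (size (PL K)).*2 =>
 1%:M + NL (PL K) (fun j => set_val t 0 (inord j.+1) - set_val t 0 0)) t); last exact: nlu.
 apply: mx_cts => l c.
 have -> : (fun t : simp R (size (PL K)).*2 => (1%:M + NL (PL K) (fun j => set_val t 0 (inord j.+1) - set_val t 0 0)) l c) =
 (fun t => (1%:M : 'M[F]_M) l c + (if (l, gb c) \in PL K then kap (set_val t 0 (inord (index (l, gb c) (PL K)).*2.+1) - set_val t 0 0)
 (set_val t 0 (inord (index (l, gb c) (PL K)).*2.+2) - set_val t 0 0) c else 0)).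
 by apply/funext => t'; rewrite !mxE.
 apply: addf_cts; first exact: cstf_cts.
 case: (_ \in _); last exact: cstf_cts.
 have cc j : cts_at t (fun t : simp R (size (PL K)).*2 => set_val t 0 j : R^o).
 by apply: coord_cts; exact: setv_cts.
 by apply: kap_cts; apply: subf_cts; exact: cc.
move=> e0; apply/eqP; rewrite -subr_eq0 -oppr_eq0 opprB e0 // => s sU.
apply: bZ => t; have [cV nV] := sU t => -[I IZ IV].
have r1 := chart_rank cV IV; have r2 := upZ_rank IZ.
have omE : om I = gD G K.
 apply: rI_eq r2; rewrite -(om_lift h); exact: (rI_osp_map phi_mono phi_em r1).
have [E|/eqP NE] := eqVneq I (gD G (operm w)); first by rewrite E in IV.
have := codim_lt r1 NE; rewrite ltnNge gcodim (pl_lift h) -gcodim -omE => /negP; apply.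
exact: codim_osp_map.
Qed.

End lifting.
End geo_theory.

(** * The product on functions on permutations *)

Section geo_products.
Variables (R : realType) (n : nat) (G : geo R n).
Notation F := (gF G).
Notation M := (gM G).
Notation em d := (fun i => gem G (d i)).
Notation PL := (pl (@gb _ _ G)).
Notation d1 := (fun _ : 'I_n => 1%N).
Notation A := {ffun 'S_n -> rat^o}.
Notation SC w := (gsc G (operm w)).
Notation Xf := (flag F (em d1) M).
Implicit Types (u v w : 'S_n) (a b r : A).

Definition ecl a : cochain R Xf := \sum_w a w *: SC w.
Lemma scP w : [/\ cob (SC w) = 0, hdeg (gbeta G * wlen w).*2 (SC w) & evS (operm w) (SC w) = 1].
by have [h1 _ h2 h3] := gscP G (operm w) (sum_d1 n); split=> //; rewrite -size_pl_operm. Qed.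

Lemma ecl_sum a b k : ecl (k *: a + b) = k *: ecl a + ecl b.
rewrite /ecl scaler_sumr -big_split /=; apply: eq_bigr => w _.
by rewrite !ffunE scalerDl scalerA.
Qed.

Lemma eclD a b : ecl (a + b) = ecl a + ecl b.
by have := ecl_sum a b 1; rewrite !scale1r. Qed.
Lemma ecl0 : ecl 0 = 0.
by rewrite /ecl big1 // => w _; rewrite ffunE scale0r. Qed.
Lemma eclZ k a : ecl (k *: a) = k *: ecl a.
by have := ecl_sum a 0 k; rewrite ecl0 !addr0. Qed.
Lemma ecl_suml (I : Type) (s : seq I) (f : I -> A) : ecl (\sum_(i <- s) f i) = \sum_(i <- s) ecl (f i).
by elim/big_rec2: _ => [|i x y _ <-]; [exact: ecl0|exact: eclD]. Qed.
Lemma ecl_ew w : ecl (ew w) = SC w.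
rewrite /ecl (bigD1 w) //= big1 ?addr0 => [|v vw]; rewrite ffunE ?eqxx ?scale1r //.
by rewrite (negbTE vw) scale0r.
Qed.

Lemma ecl_cocycle a : cob (ecl a) = 0.
by rewrite linear_sum big1 // => w _; rewrite linearZ /=; have [-> _ _] := scP w; rewrite scaler0. Qed.

Lemma sum_osp (f : osp d1 n -> cochain R Xf) : \sum_v f v = \sum_w f (operm w).
have /choice[unop unopK] : forall v : osp d1 n, exists w, operm w = v.
 by move=> v; have [w ->] := operm_surj v; exists w.
rewrite (reindex (@operm n)) //; exists unop => v _; last exact: unopK.
by apply: operm_inj; rewrite unopK.
Qed.

Lemma ecl_inj a b : cohom (ecl a) (ecl b) -> a = b.
move=> h; have /choice[unop unopK] : forall v : osp d1 n, exists w, operm w = v.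
 by move=> v; have [w ->] := operm_surj v; exists w.
have uo w : unop (operm w) = w by apply: operm_inj; rewrite unopK.
apply/ffunP => w; apply/eqP; rewrite -subr_eq0; apply/eqP.
have := @gfree R n G n d1 (fun v : osp d1 n => a (unop v) - b (unop v)) (sum_d1 n) _ (operm w).
rewrite uo; apply; rewrite sum_osp; case: h => c cE; exists c; rewrite cE subr0 /ecl -sumrB.
by apply: eq_bigr => v _; rewrite uo scalerBl.
Qed.

Lemma mateT m (d : 'I_m -> nat) : forall I, I \in [set: osp (em d) M]%SET -> gmate I \in [set: osp (em d) M]%SET.
by move=> I _; rewrite inE. Qed.

Lemma cells_setT m (d : 'I_m -> nat) : (\sum_i d i)%N = n ->
 ~` cells_of (@schubert_cell F m (em d) M) [set: osp (em d) M]%SET = set0.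
move=> sd; apply/seteqP; split=> // x h; apply: h.
by have [K Kx] := cell_cover (sum_em G sd) x; exists K; rewrite ?inE.
Qed.

Lemma van_set0 (X : topT) (a : cochain R X) : van set0 a.
by move=> s /(_ (spt (simp_delta R ord0))). Qed.

Lemma span_all m (d : 'I_m -> nat) i (a : cochain R (flag F (em d) M)) : (\sum_i d i)%N = n -> cob a = 0 -> hdeg i a ->
 exists2 lam : osp d n -> rat, (forall w : osp d n, lam w != 0 -> (size (PL w)).*2 = i) &
 cohom a (\sum_(w : osp d n) lam w *: gsc G w).
move=> sd ca ai; have [||lam lamP [b _ bE]] := @gspan R n G m d [set: osp (em d) M]%SET i a sd (@mateT m d) _ ca _ ai.
- by rewrite cells_setT //; exact: open0.
- by rewrite cells_setT //; exact: van_set0.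
by exists lam; [move=> w /lamP[]|exists b].
Qed.

Lemma span_full i (a : cochain R Xf) : cob a = 0 -> hdeg i a ->
 exists2 f : A, (forall w, f w != 0 -> (gbeta G * wlen w).*2 = i) & cohom a (ecl f).
move=> ca ai; have [lam lamP h] := span_all (sum_d1 n) ca ai.
exists [ffun w => lam (operm w)]; first by move=> w; rewrite ffunE => /lamP; rewrite size_pl_operm.
apply: cohom_trans h _; rewrite sum_osp /ecl.
by apply: cohom_sum => w _; rewrite ffunE; exact: cohom_refl.
Qed.

(** The product of two Schubert cocycles is a homogeneous cocycle, so [span_full] expands it in
    classes of the one possible length. *)
Lemma mstr_exists u v : exists f : A, (forall w, f w != 0 -> wlen w = (wlen u + wlen v)%N) /\
 cohom (cupc (SC u) (SC v)) (ecl f).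
have [cu hu _] := scP u; have [cv hv _] := scP v.
have [f fP h] := span_full (cocycle_cupc cu cv) (hdeg_cupc hu hv).
exists f; split=> // w /fP; rewrite -doubleD -mulnDr => /double_inj/eqP.
by rewrite eqn_pmul2l ?gbeta_gt0 // => /eqP.
Qed.

Definition mstr u v : A := proj1_sig (cid (mstr_exists u v)).
Lemma mstr_len u v w : mstr u v w != 0 -> wlen w = (wlen u + wlen v)%N.
by rewrite /mstr; case: (cid _) => f [h _] /=; exact: h. Qed.
Lemma mstr_cup u v : cohom (cupc (SC u) (SC v)) (ecl (mstr u v)).
by rewrite /mstr; case: (cid _) => f []. Qed.
Definition mulG a b : A := \sum_u \sum_v (a u * b v) *: mstr u v.

Lemma mulG_ew u v : mulG (ew u) (ew v) = mstr u v.
rewrite /mulG (bigD1 u) //= [X in _ + X]big1 ?addr0 => [|u' uu]; last first.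
 by apply: big1 => v' _; rewrite ffunE (negbTE uu) mul0r scale0r.
rewrite (bigD1 v) //= big1 ?addr0 => [|v' vv]; last by rewrite [ew v v']ffunE (negbTE vv) mulr0 scale0r.
by rewrite !ffunE !eqxx mulr1 scale1r.
Qed.

Lemma cupc_suml (I : Type) (s : seq I) (f : I -> cochain R Xf) x : cupc (\sum_(i <- s) f i) x = \sum_(i <- s) cupc (f i) x.
by elim/big_rec2: _ => [|i y z _ <-]; [exact: cupc0l|exact: cupcDl]. Qed.
Lemma cupc_sumr (I : Type) (s : seq I) (f : I -> cochain R Xf) x : cupc x (\sum_(i <- s) f i) = \sum_(i <- s) cupc x (f i).
by elim/big_rec2: _ => [|i y z _ <-]; [exact: cupc0r|exact: cupcDr]. Qed.

Lemma cup_ecl a b : cupc (ecl a) (ecl b) = \sum_u \sum_v (a u * b v) *: cupc (SC u) (SC v).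
rewrite /ecl cupc_suml; apply: eq_bigr => u _; rewrite cupc_sumr; apply: eq_bigr => v _.
by rewrite cupcZl cupcZr scalerA.
Qed.

Lemma mulG_cup a b : cohom (cupc (ecl a) (ecl b)) (ecl (mulG a b)).
rewrite cup_ecl /mulG ecl_suml; apply: cohom_sum => u _; rewrite ecl_suml; apply: cohom_sum => v _.
by rewrite eclZ; apply: cohomZ; exact: mstr_cup.
Qed.

Lemma cohom_cupr_ecl a (x y : cochain R Xf) : cohom x y -> cohom (cupc (ecl a) x) (cupc (ecl a) y).
move=> h; rewrite /ecl !cupc_suml; apply: cohom_sum => w _; rewrite !cupcZl; apply: cohomZ.
by have [cw hw _] := scP w; exact: cohom_cupr hw cw h.
Qed.

(** All degrees are doubles, hence even, so graded commutativity brings in no sign. *)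
Lemma mulG_c a b : mulG a b = mulG b a.
apply: ecl_inj; apply: cohom_trans (cohom_sym (mulG_cup a b)) _.
apply: cohom_trans (mulG_cup b a); rewrite !cup_ecl exchange_big.
apply: cohom_sum => v _; apply: cohom_sum => u _; rewrite mulrC; apply: cohomZ.
have [cu hu _] := scP u; have [cv hv _] := scP v.
by apply: (cupc_comm hu hv); rewrite ?odd_double.
Qed.

Lemma mulG_a a b r : mulG a (mulG b r) = mulG (mulG a b) r.
apply: ecl_inj; apply: cohom_trans (cohom_sym (mulG_cup _ _)) _.
apply: cohom_trans (cohom_cupr_ecl _ (cohom_sym (mulG_cup b r))) _.
rewrite -cupcA; apply: cohom_trans (cohom_cupl _ (mulG_cup a b)) _; first exact: ecl_cocycle.
exact: mulG_cup.
Qed.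

Lemma mulG_Dl a b r : mulG (a + b) r = mulG a r + mulG b r.
rewrite /mulG -big_split /=; apply: eq_bigr => u _; rewrite -big_split /=; apply: eq_bigr => v _.
by rewrite ffunE mulrDl scalerDl.
Qed.

Lemma mulG_Zl (k : rat) a b : mulG (k *: a) b = k *: mulG a b.
rewrite /mulG scaler_sumr; apply: eq_bigr => u _; rewrite scaler_sumr; apply: eq_bigr => v _.
by rewrite ffunE scalerA mulrA.
Qed.

Lemma mulG_hom k l a b : hom k a -> hom l b -> hom (k + l) (mulG a b).
move=> ha hb w wk; rewrite sum_ffunE big1 // => u _; rewrite sum_ffunE big1 // => v _; rewrite ffunE.
have [uk|/eqP uk] := eqVneq (wlen u) k; last by rewrite ha // mul0r scale0r.
have [vl|/eqP vl] := eqVneq (wlen v) l; last by rewrite hb // mulr0 scale0r.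
have [->|/mstr_len E] := eqVneq (mstr u v w) 0; first by rewrite [_ *: _]mulr0.
by case: wk; rewrite E uk vl.
Qed.

(** In degree 0 only [wtop] can occur; its coefficient is found by evaluating on the 0-simplex that
    is the slice. *)
Lemma unit_ecl : cohom (@unitc R Xf) (SC (wtop n)).
have h0 : hdeg 0 (@unitc R Xf) by move=> s /eqP/negbTE; rewrite /unitc; case: (sdim s).
have [f fP h] := span_full (@unitc_cocycle R Xf) h0.
have fE : ecl f = f (wtop n) *: SC (wtop n).
 rewrite /ecl (bigD1 (wtop n)) //= big1 ?addr0 // => w wn.
 have [->|/fP/eqP] := eqVneq (f w) 0; first by rewrite scale0r.
 rewrite double_eq0 muln_eq0 => /orP[/eqP b0|/eqP/wlen0 E]; last by rewrite E eqxx in wn.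
 by have := gbeta_gt0 G; rewrite b0.
rewrite fE in h; suff f1 : f (wtop n) = 1 by rewrite f1 scale1r in h.
case: h => c cE; have [_ _] := scP (wtop n); rewrite /evS size_pl_operm wlen_top muln0.
set H := (fun x => fr _ _) => e1; have := congr1 (ev 0 H) cE; rewrite ev_sub ev_scale.
rewrite /ev in e1 *; rewrite e1 mulr1; move: e1; rewrite /app; case: pselect => [cts _|_ /esym/eqP]; last by rewrite oner_eq0.
rewrite /cob /unitc /= => /esym/eqP; rewrite subr_eq0 => /eqP <-.
by [].
Qed.

Lemma mulG_1 a : mulG (ew (wtop n)) a = a.
apply: ecl_inj; apply: cohom_trans (cohom_sym (mulG_cup _ _)) _; rewrite ecl_ew.
have := cohom_cupl (ecl_cocycle a) (cohom_sym unit_ecl); rewrite cup1c.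
by [].
Qed.

Section lifted.
Variables (m : nat) (d : 'I_m -> nat) (phi : osp d n).
Hypothesis sum_d : (\sum_i d i)%N = n.
Hypothesis phi_mono : forall i j : 'I_n, (i <= j)%N -> (phi i <= phi j)%N.

Definition liftw (K : osp d n) : 'S_n := proj1_sig (cid (lift_exists phi K)).
Lemma liftwP (K : osp d n) : lift_of phi K (liftw K).
by rewrite /liftw; case: (cid _). Qed.
Lemma liftw_inj : injective liftw.
move=> K K' E; apply: ospP => c; have [<- _] := liftwP K; have [<- _] := liftwP K'; by rewrite E.
Qed.

(** Pulling back preserves cup products and takes Schubert classes to those of their lifts, so
    structure constants of partial flags are structure constants on permutations. *)
Lemma prod_lift (K L : osp d n) (c : osp d n -> rat) :
 cohom (cupc (gsc G K) (gsc G L)) (\sum_N c N *: gsc G N) ->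
 mstr (liftw K) (liftw L) = \sum_N c N *: ew (liftw N).
move=> h; apply: ecl_inj; apply: cohom_trans (cohom_sym (mstr_cup _ _)) _.
have pc := @pmap_cts R n G m d phi sum_d phi_mono.
have pK := pull_lift G sum_d phi_mono (liftwP K); have pL := pull_lift G sum_d phi_mono (liftwP L).
have [cK hK _] := scP (liftw K); have [cL hL _] := scP (liftw L).
have [cK' _ _ _] := gscP G K sum_d; have [cL' _ _ _] := gscP G L sum_d.
have cpL : cob (pb (@pmap R n G m d phi) (gsc G L)) = 0 by rewrite (pb_cobE pc) cL' (pb0 _).
apply: cohom_trans (cohom_cupr hK cK (cohom_sym pL)) _.
apply: cohom_trans (cohom_cupl cpL (cohom_sym pK)) _.
rewrite -(pb_cupcE pc); apply: cohom_trans (pb_cohom pc h) _.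
rewrite pb_sum ecl_suml; apply: cohom_sum => N _; rewrite pbZ eclZ ecl_ew; apply: cohomZ.
exact: (pull_lift G sum_d phi_mono (liftwP N)).
Qed.

Lemma prod_lift_exists (K L : osp d n) : exists c : osp d n -> rat,
 cohom (cupc (gsc G K) (gsc G L)) (\sum_N c N *: gsc G N).
have [cK _ hK _] := gscP G K sum_d; have [cL _ hL _] := gscP G L sum_d.
have [lam _ h] := span_all sum_d (cocycle_cupc cK cL) (hdeg_cupc hK hL).
by exists lam.
Qed.

End lifted.
Section adjacent.
Variable j : 'I_n.-1.

Lemma phij_subproof (i : 'I_n) : ((if (i <= j)%N then i : nat else i.-1) < n.-1)%N.
by have := ltn_ord i; have := ltn_ord j; case: (leqP i j); lia. Qed.
(** The label map of the projection that forgets the j-th member: it merges [lo j] and [hi j]. *)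
Definition phij_fun (i : 'I_n) : 'I_n.-1 := Ordinal (phij_subproof i).
Definition dj_dim (k : 'I_n.-1) : nat := #|[pred i | phij_fun i == k]|.
Lemma phij_osp_subproof : [forall k, #|[pred c | [ffun i => phij_fun i] c == k]| == dj_dim k].
by apply/forallP => k; apply/eqP/eq_card => c; rewrite !inE ffunE. Qed.
Definition phij : osp dj_dim n := Osp phij_osp_subproof.

Lemma phijE i : phij i = phij_fun i. Proof. by rewrite /= ffunE. Qed.

Lemma sum_dj : (\sum_k dj_dim k)%N = n.
rewrite -[RHS]card_ord -sum1_card (partition_big phij_fun xpredT) //=.
by apply: eq_bigr => k _; rewrite /dj_dim -sum1_card; apply: eq_bigl => i; rewrite inE.
Qed.

Lemma phij_mono (i i' : 'I_n) : (i <= i')%N -> (phij i <= phij i')%N.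
by rewrite !phijE /=; case: (leqP i j); case: (leqP i' j); lia. Qed.
Lemma phij_eq (i i' : 'I_n) : phij i = phij i' -> (i < i')%N -> i = lo j /\ i' = hi j.
rewrite !phijE => /(congr1 val) /= E lt; split; apply: val_inj => /=; move: E lt; case: (leqP i j); case: (leqP i' j); lia.
Qed.
Lemma phij_lohi : phij (lo j) = phij (hi j).
by rewrite !phijE; apply: val_inj; rewrite /= leqnn ltnn. Qed.

(** Identifies [inR j] with the span of the classes pulled back along this projection. *)
Lemma desc_lift w : desc j w <-> lift_of phij (osp_comp phij w) w.
split=> [dw|[_ h]].
 split=> [c|c c' cc]; first by rewrite osp_compE.
 rewrite !osp_compE => E; rewrite ltnNge leq_eqVlt negb_or; apply/andP; split.
 by apply/negP => /eqP/val_inj/perm_inj E'; rewrite E' ltnn in cc.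
 apply/negP => /(phij_eq E)[l0 h0]; move: dw; rewrite /desc -l0 -h0 !permK.
 by rewrite ltnNge (ltnW cc).
rewrite /desc ltnNge leq_eqVlt negb_or; apply/andP; split.
 by apply/negP => /eqP/val_inj/perm_inj/eqP; rewrite (negbTE (lohi j)).
apply/negP => lt; have := h _ _ lt; rewrite !osp_compE !permKV phij_lohi => /(_ erefl) /=.
by rewrite ltnNge leqnSn.
Qed.

(** A product of pulled-back classes is the pullback of a product downstairs, hence a combination of
    classes of lifts. *)
Lemma mulG_R a b : inR j a -> inR j b -> inR j (mulG a b).
move=> ha hb w dw; rewrite sum_ffunE big1 // => u _; rewrite sum_ffunE big1 // => v _; rewrite ffunE.
have [/desc_lift lu|nu] := boolP (desc j u); last by rewrite ha // mul0r scale0r.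
have [/desc_lift lv|nv] := boolP (desc j v); last by rewrite hb // mulr0 scale0r.
have [c cE] := prod_lift_exists sum_dj (osp_comp phij u) (osp_comp phij v).
have := prod_lift sum_dj phij_mono cE.
rewrite (lift_unique phij_mono (liftwP phij _) lu) (lift_unique phij_mono (liftwP phij _) lv) => ->.
rewrite sum_ffunE big1 ?[_ *: _]mulr0 // => N _; rewrite !ffunE.
case: eqP => [wN|_]; last by rewrite [_ *: _]mulr0.
case/negP: dw; apply/desc_lift; have lN := liftwP phij N; rewrite -wN in lN.
split=> [c'|c' c'' cc]; first by rewrite osp_compE.
by have [h1 h2] := lN; rewrite !osp_compE !h1; exact: h2.
Qed.

End adjacent.
End geo_products.

(** * Normal slices and independence of the order of coordinates *)

Section transpositions.
Context (R : realType).
Definition colp c (s : 'S_c) (v : 'rV[R]_c) : 'rV[R]_c := \row_j v 0 (s j).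

Lemma colp_cts c (s : 'S_c) : continuous (colp s).
move=> v; apply: mx_cts => i j.
rewrite (_ : (fun x => colp s x i j) = fun x : 'rV[R]_c => x 0 (s j)); first exact: coord_continuous.
by apply/funext => x; rewrite mxE.
Qed.

Lemma evalv_tperm c (i j : 'I_c) (a : cochain R 'rV[R]_c) : i != j -> coc setT a -> van (@nz R c) a ->
 app a (fun t : simp R c => colp (tperm i j) (vsimp (set_val t))) = - evalv a.
move=> ij ac az; have lij : lift ord0 i != lift ord0 j by rewrite (inj_eq lift_inj).
rewrite -(evalv_vperm ac az lij); apply: eq_app => t; apply/rowP => k; rewrite !mxE -(inj_tperm _ _ _ lift_inj).
by rewrite (tpermD (x := lift ord0 i)) // eq_sym neq_lift.
Qed.
Lemma wx_eq0 c (y : 'rV[R]_c) : (forall i, (i < c)%N -> wx y i = 0) -> y = 0.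
by move=> h; apply/rowP => k; rewrite mxE -wxE h. Qed.

Lemma wx_vproj c (y : 'rV[R]_c.+1) i : (i < c)%N -> wx (vproj y) i = wx y i.
move=> ic; rewrite -[i in LHS]/(val (Ordinal ic)) wxE mxE -[LHS]wxE; congr wx => /=.
by rewrite /bump leqNgt ic.
Qed.

Lemma wx_vlift c (w : 'rV[R]_c) (z : R) i : (i < c)%N -> wx (vlift w z) i = wx w i.
by move=> ic; rewrite -wx_vproj // vproj_lift. Qed.
Lemma wx_jproj p q (y : 'rV[R]_(q + p)) i : (i < p)%N -> wx (jproj y) i = wx y i.
elim: q y => //= q ih y ip; rewrite ih // wx_vproj //; exact: leq_trans ip (leq_addl _ _).
Qed.

Lemma wx_kproj p q (y : 'rV[R]_(q + p)) i : (i < q)%N -> wx (kproj y) i = wx y (p + i).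
elim: q y => //= q ih y; rewrite ltnS leq_eqVlt => /orP[/eqP ->|iq].
 rewrite -[q in LHS]/(val (@ord_max q)) wxE vlift_max -wxE /=; congr wx; by rewrite addnC.
by rewrite wx_vlift // ih // wx_vproj // addnC ltn_add2r.
Qed.

Lemma evE (X : topT) k (h : (nat -> R) -> X) (a : cochain R X) :
 (forall x y, (forall i, (i < k)%N -> x i = y i) -> h x = h y) ->
 ev k h a = app a (fun t : simp R k => h (wx (vsimp (set_val t)))).
move=> hx; apply: eq_app => t; apply: hx => i ik; rewrite -[i in RHS]/(val (Ordinal ik)) wxE mxE.
by congr (set_val t 0 _ - _); apply: val_inj; rewrite /= inordK.
Qed.

Lemma colp_step c (i j : 'I_c) (r : 'S_c) (q : rat) (b : cochain R 'rV[R]_c) : i != j ->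
 (forall b' : cochain R 'rV[R]_c, coc setT b' -> van (@nz R c) b' ->
 app b' (fun t : simp R c => colp r (vsimp (set_val t))) = q * evalv b') ->
 coc setT b -> van (@nz R c) b ->
 app b (fun t : simp R c => colp (tperm i j * r)%g (vsimp (set_val t))) = - q * evalv b.
move=> ij h bc bz; pose b' := pb (colp (tperm i j)) b.
have b'c : coc setT b' by apply: pb_coc bc => // u _; exact: colp_cts.
have b'z : van (@nz R c) b'.
 apply: pb_van bz => u; rewrite /nz /= => /eqP uz; apply/eqP => e; apply: uz; apply/rowP => k.
 by move/rowP: e => /(_ (tperm i j k)); rewrite !mxE tpermK.
have -> : app b (fun t : simp R c => colp (tperm i j * r)%g (vsimp (set_val t))) =
 app b' (fun t : simp R c => colp r (vsimp (set_val t))).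
 rewrite pb_app; last by move=> t; apply: (@continuous_comp _ _ _ (fun t : simp R _ => vsimp (set_val t)) (colp r)); [exact: vsimpv_cts|exact: colp_cts].
 by apply: eq_app => t; apply/rowP => k; rewrite !mxE permM.
rewrite h // /evalv pb_app; last exact: vsimpv_cts.
by rewrite (evalv_tperm ij bc bz) mulrN mulNr.
Qed.

(** Exchanging two pairs of coordinates is a product of two transpositions, so permuting pairs
    preserves the orientation. *)
Lemma evalv_double k (b : cochain R 'rV[R]_(k.*2)) (bc : coc setT b) (bz : van (@nz R k.*2) b) (s : 'S_k) :
 exists2 r : 'S_(k.*2),
 forall a : 'I_k, (forall i : 'I_(k.*2), i = a.*2 :> nat -> r i = (s a).*2 :> nat) /\
 (forall i : 'I_(k.*2), i = a.*2.+1 :> nat -> r i = (s a).*2.+1 :> nat) &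
 app b (fun t : simp R k.*2 => colp r (vsimp (set_val t))) = evalv b.
have h0 (a : 'I_k) : (a.*2 < k.*2)%N by rewrite ltn_double.
have h1 (a : 'I_k) : (a.*2.+1 < k.*2)%N by rewrite -doubleS leq_double.
pose d0 a := Ordinal (h0 a); pose d1 a := Ordinal (h1 a).
suff [r rE rb] : exists2 r : 'S_(k.*2), forall a, r (d0 a) = d0 (s a) /\ r (d1 a) = d1 (s a) &
 forall b, coc setT b -> van (@nz R k.*2) b ->
 app b (fun t : simp R k.*2 => colp r (vsimp (set_val t))) = 1 * evalv b.
 exists r; last by rewrite rb // mul1r.
 move=> a; have [e0 e1] := rE a; split=> i ia.
 by rewrite (_ : i = d0 a) ?e0 //; exact: val_inj.
 by rewrite (_ : i = d1 a) ?e1 //; exact: val_inj.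
have [ts -> ] := prod_tpermP s; elim: ts => [|t ts ih] /= => [_|/andP[dt /ih[r rE rb]]].
 exists 1%g => [a|b' b'c b'z]; first by rewrite big_nil !perm1.
 by rewrite mul1r; apply: eq_app => t; apply/rowP => i; rewrite mxE perm1.
have inj0 : injective d0 by move=> a a' /(congr1 val) /= /double_inj/val_inj.
have inj1 : injective d1 by move=> a a' /(congr1 val) /= [/double_inj/val_inj].
have d01 a a' : d0 a != d1 a' by apply/eqP => /(congr1 val) /= E; have := congr1 odd E; rewrite /= !odd_double.
exists (tperm (d0 t.1) (d0 t.2) * (tperm (d1 t.1) (d1 t.2) * r))%g; last first.
 move=> b' b'c b'z; rewrite (@colp_step _ _ _ _ (-1)) ?opprK ?(inj_eq inj0) // => b2 b2c b2z.
 by rewrite (@colp_step _ _ _ _ 1) ?(inj_eq inj1).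
move=> a; rewrite big_cons !permM; split.
 have -> : tperm (d0 t.1) (d0 t.2) (d0 a) = d0 (tperm t.1 t.2 a).
 by case: (tpermP t.1 t.2 a) => [->|->|/eqP n1 /eqP n2]; rewrite ?tpermL ?tpermR // tpermD // (inj_eq inj0) eq_sym.
 have nd y : d1 y != d0 (tperm t.1 t.2 a) by rewrite eq_sym d01.
 by rewrite (tpermD (nd _) (nd _)); exact: (rE _).1.
rewrite (tpermD (x := d0 t.1)) //.
have -> : tperm (d1 t.1) (d1 t.2) (d1 a) = d1 (tperm t.1 t.2 a).
 by case: (tpermP t.1 t.2 a) => [->|->|/eqP n1 /eqP n2]; rewrite ?tpermL ?tpermR // tpermD // (inj_eq inj1) eq_sym.
by rewrite (rE _).2.
Qed.

End transpositions.

Section slices.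
Variables (R : realType) (n : nat) (G : geo R n).
Notation F := (gF G).
Notation M := (gM G).
Notation em d := (fun i => gem G (d i)).
Notation PL := (pl (@gb _ _ G)).
Notation NL := (nl (@gb _ _ G) (@kap _ _ G)).
Implicit Types (L : seq ('I_M * 'I_n)) (x : nat -> R).

Lemma nl_ext L x y : (forall i, (i < (size L).*2)%N -> x i = y i) -> NL L x = NL L y.
move=> e; apply/matrixP => l d; rewrite !mxE; case: ifP => // h; have := h; rewrite -index_mem => h'.
by rewrite !e ?ltn_double // -doubleS leq_double.
Qed.

Lemma nl_eq0 L x : uniq L -> (forall l d, NL L x l d = 0) -> forall i, (i < (size L).*2)%N -> x i = 0.
move=> uL h i iL; have iL2 : (i./2 < size L)%N by lia.
have [l0 _] : exists l0 : 'I_M * 'I_n, true by move: iL2; case: (L) => // p; exists p.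
set p := nth l0 L i./2; have pL : p \in L by exact: mem_nth.
have ip : index p L = i./2 by exact: index_uniq.
have : forall l, gb (g0 := G) l = p.2 -> kap (g0 := G) (x (i./2).*2) (x (i./2).*2.+1) l = 0.
 by move=> l lp; have := h p.1 l; rewrite mxE lp -surjective_pairing pL ip.
move=> /kap_sep[x0' x1]; rewrite -(odd_double_half i); case: (odd i) => //=.
Qed.

Lemma nl_wx0 c L : NL L (wx (0 : 'rV[R]_c)) = 0.
have c0 i : wx (0 : 'rV[R]_c) i = 0 by rewrite /wx; case: insubP => // k _ _; rewrite mxE.
by apply/matrixP => l d; rewrite !mxE !c0 kap0; case: ifP.
Qed.

Lemma nl_cts (T : topT) L (f : T -> nat -> R) t :
 (forall i, cts_at t (fun t => f t i : R^o)) -> cts_at t (fun t => NL L (f t)).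
move=> fc; apply: mx_cts => l d.
rewrite (_ : (fun t => NL L (f t) l d) = fun t => if (l, gb d) \in L
 then kap (f t (index (l, gb d) L).*2) (f t (index (l, gb d) L).*2.+1) d else 0); last by apply/funext => t'; rewrite mxE.
case: ((l, gb d) \in L); last exact: cstf_cts.
by apply: kap_cts; exact: fc.
Qed.

Lemma nl_cat L L' x : (forall p, p \in L -> p \notin L') ->
 NL (L ++ L') x = NL L x + NL L' (fun i => x ((size L).*2 + i)%N).
move=> dL; apply/matrixP => l d; rewrite !mxE mem_cat index_cat.
case: (boolP ((l, gb d) \in L)) => [h|_] /=; first by rewrite (negbTE (dL _ h)) addr0.
by rewrite add0r doubleD addnS.
Qed.

Lemma nl_pl m (d : 'I_m -> nat) (K : osp d n) x l c : NL (PL K) x l c != 0 ->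
 (gb l < gb c)%N /\ (K (gb l) < K (gb c))%N.
by rewrite mxE mem_pl; case: andP => //; rewrite eqxx. Qed.
Definition slc m (d : 'I_m -> nat) (K : osp d n) c (y : 'rV[R]_c) : flag F (em d) M :=
 fr (gD G K) (1%:M + NL (PL K) (wx y)).
Lemma slc_ntype m (d : 'I_m -> nat) (K : osp d n) x : ntype (gD G K) (NL (PL K) x).
by move=> l c cl; apply/eqP/negPn/negP => /nl_pl[_]; rewrite ltnNge -!gDE cl. Qed.

Lemma slc_cts m (d : 'I_m -> nat) (K : osp d n) c : (\sum_i d i)%N = n -> continuous (@slc m d K c).
move=> sd y; apply: (@fr_cts F m (em d) M (sum_em G sd) (gD G K) _ (fun y : 'rV[R]_c => 1%:M + NL (PL K) (wx y))).
 apply: mx_cts => l k.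
 rewrite (_ : (fun y => (1%:M + NL (PL K) (wx y)) l k) = fun y => (1%:M : 'M[F]_M) l k + NL (PL K) (wx y) l k); last by apply/funext => y'; rewrite mxE.
 apply: addf_cts; first exact: cstf_cts.
 by apply: coord_cts; apply: nl_cts => i; exact: wx_cts.
exact: (ntype_unit (@slc_ntype _ _ _ _)).
Qed.

(** The chart bounds the rank function of a point from above, the closure from below; a point of the
    slice in the closure thus lies in the cell, where the normal coordinates vanish. *)
Lemma slc_off m (d : 'I_m -> nat) (K : osp d n) x : (\sum_i d i)%N = n ->
 closure (@schubert_cell F m (em d) M (gD G K)) (fr (gD G K) (1%:M + NL (PL K) x)) ->
 forall i, (i < (size (PL K)).*2)%N -> x i = 0.
move=> sd cl; have nt := @slc_ntype m d K x.
have [L LV] := cell_cover (sum_em G sd) (fr (gD G K) (1%:M + NL (PL K) x)).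
have LK : L = gD G K.
 by apply: rI_eq => i k kM; [exact: (chart_rank (chart_fr nt) LV)|exact: (closure_rank (sum_em G sd) cl LV)].
rewrite {}LK in LV; have [_ A0] := (cell_chart _ _).1 LV; rewrite coordA_fr // in A0.
apply: nl_eq0 (uniq_pl _ _) _ => l c; apply/eqP/negPn/negP => h; have [lt _] := nl_pl h.
by move/eqP: h; apply; apply: A0; exact: gb_mono.
Qed.

Lemma slc_eval m (d : 'I_m -> nat) (K : osp d n) (a : cochain R (flag F (em d) M)) : (\sum_i d i)%N = n ->
 evalv (pb (@slc m d K (size (PL K)).*2) a) = evS K a.
move=> sd; rewrite /evalv pb_app; last exact: vsimpv_cts.
 rewrite /evS evE // => x y e; congr (fr _ (_ + _)); exact: nl_ext.
Qed.

Lemma slc_cocycle m (d : 'I_m -> nat) (K : osp d n) (a : cochain R (flag F (em d) M)) c : (\sum_i d i)%N = n ->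
 cob a = 0 -> coc setT (pb (@slc m d K c) a).
by move=> sd a0 s _; rewrite (pb_cobE (@slc_cts _ _ _ _ sd)) a0 (pb0 _). Qed.

Lemma slc_van m (d : 'I_m -> nat) (K : osp d n) : (\sum_i d i)%N = n ->
 van (@nz R (size (PL K)).*2) (pb (@slc m d K (size (PL K)).*2) (gsc G K)).
move=> sd; have [_ va _ _] := gscP G K sd; apply: pb_van va => y; rewrite /nz /= => /eqP y0 cl; apply: y0.
by apply: wx_eq0; exact: (slc_off sd cl).
Qed.

(** Reordering the list permutes the real coordinates in pairs, which does not affect the value, by
    [evalv_double]. *)
Lemma ev_perm m (e : 'I_m -> nat) (I : osp e M) L L' (a : cochain R (flag F e M)) :
 (\sum_i e i)%N = M -> uniq L -> perm_eq L L' -> cob a = 0 ->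
 (forall x, 1%:M + NL L x \in unitmx) ->
 van (@nz R (size L).*2) (pb (fun y : 'rV_((size L).*2) => fr I (1%:M + NL L (wx y))) a) ->
 ev (size L).*2 (fun x => fr I (1%:M + NL L x)) a = ev (size L').*2 (fun x => fr I (1%:M + NL L' x)) a.
move=> se uL; rewrite perm_sym => LL a0 Lu bz; set S := (fun y => _) in bz; have sL := perm_size LL.
have Sc : continuous S.
 move=> y; apply: (@fr_cts F m e M se I _ (fun y : 'rV[R]_((size L).*2) => 1%:M + NL L (wx y))) => //.
 apply: mx_cts => l k.
 rewrite (_ : (fun y => (1%:M + NL L (wx y)) l k) = fun y => (1%:M : 'M[F]_M) l k + NL L (wx y) l k); last by apply/funext => y'; rewrite mxE.
 apply: addf_cts; first exact: cstf_cts.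
 by apply: coord_cts; apply: nl_cts => i; exact: wx_cts.
have bc : coc setT (pb S a) by move=> s _; rewrite (pb_cobE Sc) a0 (pb0 _).
have /tuple_permP[p pE] : perm_eq L' (in_tuple L) by [].
have [r r0 r1] := evalv_double bc bz p^-1.
rewrite sL !evE; last 2 first.
- by move=> x y xy; congr (fr _ (_ + _)); apply: nl_ext; rewrite ?sL.
- by move=> x y xy; congr (fr _ (_ + _)); apply: nl_ext; rewrite ?sL.
rewrite -[LHS]/(app a (fun t => S (vsimp (set_val t)))) -pb_app; last exact: vsimpv_cts.
rewrite -/(evalv (pb S a)) -r1 pb_app; last first.
 by move=> t; apply: (@continuous_comp _ _ _ (fun t : simp R _ => vsimp (set_val t)) (colp r)); [exact: vsimpv_cts|exact: colp_cts].
apply: eq_app => t; rewrite /S; congr (fr _ (_ + _)); apply/matrixP => l c; rewrite !mxE (perm_mem LL).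
case: ifP => q; last reflexivity.
set u := vsimp _; have k0 : (index (l, gb c) L < size L)%N by rewrite index_mem.
pose k := Ordinal k0.
have kE : tnth (in_tuple L) k = (l, gb c) by rewrite (tnth_nth (l, gb c)) /= nth_index.
have -> : index (l, gb c) L' = (p^-1)%g k.
 have uL' : uniq L' by rewrite (perm_uniq LL).
 have kn : ((p^-1)%g k < size L')%N by rewrite sL ltn_ord.
 have <- : nth (l, gb c) L' ((p^-1)%g k) = (l, gb c).
 by rewrite pE -tnth_nth tnth_mktuple permKV kE.
 by rewrite index_uniq.
have [e0 e1] := r0 k.
have k2 : (k.*2 < (size L).*2)%N by rewrite ltn_double.
have k3 : (k.*2.+1 < (size L).*2)%N by rewrite -doubleS leq_double.
have -> : wx (colp r u) (index (l, gb c) L).*2 = wx u ((p^-1)%g k).*2.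
 by rewrite -[(index (l, gb c) L).*2]/(val (Ordinal k2)) wxE mxE -wxE (e0 (Ordinal k2) erefl).
have -> : wx (colp r u) (index (l, gb c) L).*2.+1 = wx u ((p^-1)%g k).*2.+1.
 by rewrite -[(index (l, gb c) L).*2.+1]/(val (Ordinal k3)) wxE mxE -wxE (e1 (Ordinal k3) erefl).
reflexivity.
Qed.

End slices.

(** * Translations act trivially on cohomology *)

Section translation.
Variables (R : realType) (n : nat) (G : geo R n).
Notation F := (gF G).
Notation M := (gM G).
Variables (m : nat) (e : 'I_m -> nat).
Hypothesis sum_e : (\sum_i e i)%N = M.
Notation X := (flag F e M).

Lemma pb_comp (Y Z T : topT) (f : Y -> Z) (g : Z -> T) (a : cochain R T) :
 continuous f -> continuous g -> pb f (pb g a) = pb (g \o f) a.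
move=> fc gc; apply/funext => s; rewrite /pb (@pb_app _ _ _ g a _ (fun t => f (smap s t))) //.
by move=> t; apply: (@continuous_comp _ _ _ (smap s) f); [exact: cts_fun|exact: fc].
Qed.

Lemma homotopy_cohom (Y : topT) (h : Y -> R -> Y) (f : Y -> Y) (a : cochain R Y) :
 (forall y r, cts_at (y, r) (fun p => h p.1 p.2)) -> (forall y, h y 0 = y) ->
 (forall y, h y 1 = f y) -> cob a = 0 -> cohom (pb f a) a.
move=> hc h0 h1 a0; exists (prism h a); apply/funext => s.
have := @prismP R Y Y h setT (fun y r _ => hc y r) a s (fun _ => I).
rewrite a0 (@prism_van _ _ _ _ _ setT) // add0r => ->; rewrite -[RHS]/(pb f a s - a s) /pb.
congr (_ - _); first by apply: eq_app => t; rewrite h1.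
by rewrite -[RHS]app_smap; apply: eq_app => t; rewrite h0.
Qed.

(** Each transposition matrix is joined to the identity by the path [gpath], which gives a homotopy
    of the translation to the identity; a permutation is a product of transpositions. *)
Lemma act_perm_cohom (h : 'S_n) (a : cochain R X) : cob a = 0 ->
 cohom (pb (fun V => actf V (perm_mx (gs G h))) a) a.
have [ts -> _] := prod_tpermP h; elim: ts a => [|t ts ih] a a0.
 rewrite big_nil gs1 perm_mx1.
 have -> : (fun V : X => actf V 1%:M) = id by apply/funext => V; exact: (act1 sum_e).
 have -> : pb id a = a by apply/funext => s; rewrite /pb app_smap.
 exact: cohom_refl.
rewrite big_cons gsM; set r := (\prod_(_ <- _) _)%g in ih *.
have pu s : perm_mx (gs G s) \in @unitmx F M by exact: unitmx_perm.
have -> : (fun V : X => actf V (perm_mx (gs G (tperm t.1 t.2) * gs G r))) =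
 (fun V => actf V (perm_mx (gs G r))) \o (fun V => actf V (perm_mx (gs G (tperm t.1 t.2)))).
 by apply/funext => V /=; rewrite perm_mxM (act_mul sum_e).
have c1 s : continuous (fun V : X => actf V (perm_mx (gs G s))) by exact: (act_cts1 sum_e).
rewrite -pb_comp //; apply: cohom_trans (ih a a0).
have b0 : cob (pb (fun V : X => actf V (perm_mx (gs G r))) a) = 0.
 by rewrite (pb_cobE (c1 r)) a0 (pb0 _).
have [gam [gc gu g0 g1]] := gpath G t.1 t.2.
apply: (homotopy_cohom (h := fun V r => actf V (gam r))) b0 => [V q|V|V].
- apply: (@continuous_comp _ _ _ (fun p : X * R => (p.1, gam p.2)) (fun q => actf q.1 q.2)); last exact: (act_cts sum_e).
 apply: pair_cts; first exact: cvg_fst.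
 by apply: (@continuous_comp _ _ _ snd gam); [exact: cvg_snd|exact: gc].
- by rewrite g0 (act1 sum_e).
- by rewrite g1.
Qed.

End translation.

(** * Product of a divisor class with a pulled-back class *)

Section adjacent_product.
Variables (R : realType) (n : nat) (G : geo R n) (j : 'I_n.-1) (v : 'S_n).
Hypothesis dv : desc j v.
Notation F := (gF G).
Notation M := (gM G).
Notation em d := (fun i => gem G (d i)).
Notation PL := (pl (@gb _ _ G)).
Notation d1 := (fun _ : 'I_n => 1%N).
Notation X := (flag F (em d1) M).
Notation SC w := (gsc G (operm w)).
Notation D w := (gD G (operm w)).
Notation om := (@osp_map n n.-1 (em d1) (em (dj_dim j)) M (fun i => phij j i) (phi_em G (phij j))).
Notation se := (sum_em G (sum_d1 n)).
Notation mono := (@phij_mono n j).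

Definition vK : osp (dj_dim j) n := osp_comp (phij j) v.
Definition ws : 'S_n := (v * sj j)%g.
Definition x0 : 'S_n := (wtop n * sj j)%g.
(** [posp] and [posq] are the blocks where [v] has the labels [hi j] and [lo j]; in [ws] these two
    labels are exchanged. *)
Definition posp : 'I_n := (v^-1 (hi j))%g.
Definition posq : 'I_n := (v^-1 (lo j))%g.

Lemma liftv : lift_of (phij j) vK v. Proof. exact/desc_lift. Qed.
Lemma pq_lt : (posp < posq)%N. Proof. exact: dv. Qed.
Lemma ws_phi c : phij j (ws c) = vK c.
rewrite /ws permM /vK osp_compE; case: (tpermP (lo j) (hi j) (v c)) => [->|->|//]; by rewrite phij_lohi.
Qed.
Lemma om_ws : om (D ws) = gD G vK.
by apply: ospP => l; rewrite osp_mapE !gDE opermE ws_phi. Qed.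

Lemma phij_le (i i' : 'I_n) : i' != lo j -> (phij j i <= phij j i')%N = (i <= i')%N.
move=> il; apply/idP/idP; last exact: mono.
apply: contraTT; rewrite -!ltnNge => lt; rewrite ltn_neqAle mono ?(ltnW lt) // andbT.
by apply/eqP => /val_inj/phij_eq/(_ lt)[E _]; rewrite E eqxx in il.
Qed.

Lemma vK_pq c : vK c = phij j (lo j) -> c = posp \/ c = posq.
rewrite /vK osp_compE /posp /posq => E; have [lt|lt|E'] := ltngtP (v c) (lo j).
- by have [E1 _] := phij_eq E lt; move: lt; rewrite E1 ltnn.
- have [_ E1] := phij_eq (esym E) lt; by left; rewrite -E1 permK.
- by right; rewrite -(val_inj E') permK.
Qed.

Lemma ws_p : ws posp = lo j. Proof. by rewrite /ws /posp permM permKV tpermR. Qed.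
Lemma ws_q : ws posq = hi j. Proof. by rewrite /ws /posq permM permKV tpermL. Qed.
Lemma ws_lo (l : 'I_M) : (D ws l == lo j) = (gb (g0 := G) l == posp).
by rewrite gDE opermE -ws_p (inj_eq perm_inj). Qed.
Lemma over_lo (I : osp (em d1) M) (l : 'I_M) : om I = gD G vK -> I l = lo j -> gb l = posp \/ gb l = posq.
by move=> E Il; apply: vK_pq; rewrite -gDE -E osp_mapE Il. Qed.
Lemma card_lo (I : osp (em d1) M) : #|[pred l | I l == lo j]| = #|[pred l | gb (g0 := G) l == posp]|.
rewrite (osp_card I) -(osp_card (D ws) (lo j)); apply: eq_card => l; by rewrite !inE ws_lo.
Qed.

(** Among the cells over that of [vK] only the distribution of the merged labels over the blocks
    [posp] and [posq] varies; in [ws] the smaller label fills the earlier block, which maximises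
    every entry of the rank table. *)
Lemma over_max (I : osp (em d1) M) : om I = gD G vK -> forall i k, (rI I i k <= rI (D ws) i k)%N.
move=> E i k; have [->|il] := eqVneq i (lo j); last first.
 rewrite !rIE; apply: eq_leq; apply: eq_bigr => l _; congr (nat_of_bool (_ && _)).
 by rewrite -!(phij_le _ il) -(osp_mapE (phi_em G (phij j))) -[in RHS](osp_mapE (phi_em G (phij j))) E om_ws.
have sp (J : osp (em d1) M) : rI J (lo j) k = (\sum_l ((J l < lo j) && (l < k)) + \sum_l ((J l == lo j) && (l < k)))%N.
 rewrite rIE -big_split; apply: eq_bigr => l _ /=; rewrite leq_eqVlt -val_eqE.
 by case: ltngtP; case: (l < k)%N.
rewrite !sp leq_add //.
 apply: eq_leq; apply: eq_bigr => l _; congr (nat_of_bool (_ && _)).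
 case: (posnP j) => j0; first by rewrite (_ : (lo j : nat) = 0%N) ?ltn0 //.
 have jn : (j.-1 < n)%N by have := ltn_ord j; lia.
 have lE (x : 'I_n) : (x < lo j)%N = (x <= Ordinal jn)%N by rewrite /= -[in LHS](prednK j0) ltnS.
 have ne : Ordinal jn != lo j by rewrite -val_eqE /=; lia.
 rewrite !lE -!(phij_le _ ne) -(osp_mapE (phi_em G (phij j))) -[in RHS](osp_mapE (phi_em G (phij j))) E om_ws //.
have [/existsP[l0 /and3P[/eqP I0 l0k q0]]|nex] := boolP [exists l, [&& I l == lo j, (l < k)%N & gb l == posq]].
 apply: (@leq_trans (\sum_l (I l == lo j))%N); first by apply: leq_sum => l _; case: eqP; case: (l < k)%N.
 have -> : (\sum_l (I l == lo j) = #|[pred l | I l == lo j]|)%N.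
 by rewrite -sum1_card [RHS]big_mkcond; apply: eq_bigr => l _; rewrite inE; case: eqP.
 rewrite card_lo -sum1_card big_mkcond; apply: leq_sum => l _; rewrite ws_lo inE.
 case: eqP => //= lp; rewrite (ltn_trans _ l0k) //; apply: gb_mono; rewrite lp (eqP q0); exact: pq_lt.
apply: leq_sum => l _; rewrite ws_lo; case: eqP => //= Il; case: (ltnP l k) => //= lk.
have [->|lq] := over_lo E Il; first by rewrite eqxx.
by case/existsP: nex; exists l; rewrite Il lk lq !eqxx.
Qed.

(** The cells that can carry the product: those over the boundary of the cell of [vK], and over this
    cell only [ws], the point cell of the fibre. *)
Definition Zs : {set osp (em d1) M} :=
 [set I in upZ G (phij j) vK | (om I == gD G vK) ==> (I == D ws)]%SET.
Notation clZ := (cells_of (@schubert_cell F n (em d1) M) Zs).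
Notation clU := (cells_of (@schubert_cell F n (em d1) M) (upZ G (phij j) vK)).

Lemma over_eq (L : osp (em d1) M) : L \in upZ G (phij j) vK ->
 (forall i k, (k <= M)%N -> (rI L i k <= rI (D ws) i k)%N) -> om L = gD G vK.
move=> LU r; apply: (@rI_eq _ _ G _ _ (om L) (gD G vK)); last exact: (upZ_rank (@sum_dj n j) LU).
rewrite -om_ws; exact: (rI_osp_map mono (phi_em G (phij j)) r).
Qed.

Lemma Zs_ws (L : osp (em d1) M) : L \in Zs -> (forall i k, (k <= M)%N -> (rI L i k <= rI (D ws) i k)%N) -> L = D ws.
rewrite inE => /andP[LU /implyP h] r; apply/eqP/h/eqP; exact: over_eq.
Qed.

Lemma Zs_mate (I : osp (em d1) M) : I \in Zs -> gmate I \in Zs.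
rewrite inE => /andP[IU /implyP h]; rewrite inE; apply/andP; split; first by exact: (upZ_mate (@sum_dj n j) IU).
apply/implyP => /eqP E.
have [s sw sE] := gmate_sw I; have oI : om I = gD G vK.
 apply: ospP => l; have := congr1 (fun J : osp (em (dj_dim j)) M => J (s^-1 l)%g) E.
 rewrite sE osp_map_comp osp_compE permKV !gDE => ->; congr (vK _).
 by rewrite -(gbsw_gb (s^-1 l)%g sw) permKV.
by have /eqP E' := h (introT eqP oI); rewrite E' gmate_D.
Qed.

Lemma Zs_sub : ~` clU `<=` ~` clZ.
by move=> V h [L]; rewrite inE => /andP[LU _] LV; apply: h; exists L. Qed.

Lemma Zs_chart (I : osp (em d1) M) : om I = gD G vK -> I != D ws -> @chart F _ _ _ I `<=` ~` clZ.
move=> E NI V NV [L LZ LV]; have r := chart_rank NV LV.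
have Lw : L = D ws by apply: Zs_ws => // i k kM; apply: leq_trans (r i k kM) _; exact: over_max.
case/negP: NI; apply/eqP; apply: rI_eq => i k kM; first exact: over_max.
by rewrite -Lw; exact: r.
Qed.

Lemma not_Zs (I : osp (em d1) M) : I \in upZ G (phij j) vK -> I \notin Zs ->
 om I = gD G vK /\ I != D ws.
by move=> IU; rewrite inE IU /= negb_imply => /andP[/eqP]. Qed.

Lemma Zs_open : open (~` clZ).
rewrite openE => V VZ; have [I IV] := cell_cover se V.
have [IU|IU] := boolP (I \in upZ G (phij j) vK).
 have IZ : I \notin Zs by apply/negP => IZ; apply: VZ; exists I.
 have [oI nI] := not_Zs IU IZ; have /cell_chart[NV _] := IV.
 apply: filterS (Zs_chart oI nI) _; apply: open_nbhs_nbhs; split; last exact: NV.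
 exact: (chart_open (gF G) se I).
apply: filterS Zs_sub _; apply: open_nbhs_nbhs; split; first exact: (upZ_open G (@sum_dj n j) mono _).
by move=> [L LU LV]; case/negP: IU; rewrite (cell_inj IV LV).
Qed.

(** Chosen so that the translated divisor meets the preimage of the cell of [vK] only in the cell of
    [ws], and transversally there. *)
Definition shift : 'S_n := (v * wtop n)%g.
Definition gmx : 'M[F]_M := perm_mx (gs G shift).
Lemma gmx_unit : gmx \in unitmx. Proof. exact: unitmx_perm. Qed.

Lemma block_cut (c0 : 'I_n) : exists2 k, (k <= M)%N & forall l : 'I_M, (l < k)%N = (gb l <= c0)%N.
have mon (l l' : 'I_M) : (l <= l')%N -> (gb l <= gb l')%N.
 by move=> ll; rewrite leqNgt; apply/negP => /gb_mono; rewrite ltnNge ll.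
have [/existsP[l1 h1]|h] := boolP [exists l : 'I_M, (c0 < gb l)%N]; last first.
 exists M => // l; rewrite ltn_ord; apply/esym; rewrite leqNgt; apply: contraNN h => h.
 by apply/existsP; exists l.
case: (arg_minnP (P := fun l : 'I_M => (c0 < gb l)%N) (fun l : 'I_M => l : nat) h1) => l0 h0 hm.
exists l0; first exact: ltnW.
move=> l; apply/idP/idP => [lt|]; first by rewrite leqNgt; apply/negP => /hm; rewrite leqNgt lt.
by move=> lc; rewrite ltnNge; apply/negP => /mon h; move: h0; rewrite ltnNge (leq_trans h lc).
Qed.

Definition topS : {vspace 'rV[F]_M} := row_span [pred l | (lo j < v (gb l))%N] (1%:M : 'M[F]_M).
Notation S := topS.

(** The divisor is the condition that two spaces of complementary dimension meet: [x0] has the label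
    [lo j] one block earlier than [wtop], and the translation turns the standard space up to that
    block into [topS]. *)
Lemma top_dim V : closure (@schubert_cell F _ _ _ (D x0)) (actf V gmx) -> (gbeta G <= \dim (V (lo j) :&: topS))%N.
move=> clx; have [L LW] := cell_cover se (actf V gmx).
have c0n : (n - j.+2 < n)%N by have := ltn_ord j; lia.
have [k kM kE] := block_cut (Ordinal c0n).
have rk := closure_rank se clx LW (lo j) kM.
have lowb : (gbeta G <= rI (D x0) (lo j) k)%N.
 rewrite -(gb_card G (Ordinal c0n)); apply: subset_leq_card; apply/fintype.subsetP => l; rewrite !inE => /eqP lc.
 rewrite kE lc leqnn andbT gDE opermE lc /x0 permM.
 have -> : wtop n (Ordinal c0n) = hi j by apply: val_inj; rewrite /= wtopE /=; have := ltn_ord j; lia.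
 by rewrite tpermR.
pose f : 'Hom('rV[F]_M, 'rV[F]_M) := linfun (mulmxr gmx).
have finj : injective f by move=> a b; rewrite !lfunE /= => /(congr1 (mulmxr (invmx gmx))) /=; rewrite !mulmxK ?gmx_unit.
have kf : lker f == 0%VS by apply/lker0P.
have fS : (f @: S)%VS = std_space F M k.
 rewrite /topS -row_span_mul mul1mx /std_space -(row_span_perm [pred l : 'I_M | (l < k)%N] 1%:M (gs G shift)).
 rewrite row_permE mulmx1; apply: eq_row_span => l /=; rewrite kE gsE /shift permM wtopE /=.
 by have := ltn_ord (v (gb l)); have := ltn_ord j; lia.
apply: leq_trans lowb (leq_trans rk _); rewrite /rI -(LW (lo j) k kM) ffunE gmx_unit -/f -fS.
 have -> : (f @: V (lo j) :&: f @: S = f @: (V (lo j) :&: S))%VS.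
 apply/vspaceP => w; rewrite memv_cap; apply/andP/memv_imgP => [[/memv_imgP[x xV ->] /memv_imgP[y yE /finj xy]]|[x]].
 by exists x => //; rewrite memv_cap xV xy.
 by rewrite memv_cap => /andP[xV xS] ->; split; apply: memv_img.
 by rewrite limg_dim_eq // (eqP kf) capv0.
Qed.

(** In a triangular frame the rows whose [v]-label is at most [j] span a space that meets [topS]
    trivially, so at least [gbeta] other rows have label at most [j]. Over [vK] these lie in block
    [posp] and fill it, which is the labelling [ws]. *)
Lemma support_ws (I : osp (em d1) M) V : schubert_cell I V -> om I = gD G vK ->
 closure (@schubert_cell F _ _ _ (D x0)) (actf V gmx) -> I = D ws.
move=> IV oI /top_dim dS.
have /cellP[g [gu gl VE]] := IV.
have gd d : g d d != 0 by move: gu; rewrite (lower_unit gl) => /forallP/(_ d).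
pose T := [pred l | (I l <= lo j)%N && (v (gb l) <= lo j)%N].
pose B := [pred l | (I l <= lo j)%N && (lo j < v (gb l))%N].
have cap0 : ((V (lo j) :&: S) :&: row_span T g = 0)%VS.
 apply/eqP; rewrite -subv0; apply/subvP => w; rewrite !memv_cap memv0.
 case/andP => /andP[_ /row_spanP[c c0 wE]] /row_spanP[c' c'0 wE'].
 suff c'z : c' = 0 by rewrite wE' c'z mul0mx.
 have wd d : T d -> w 0 d = 0.
 by move=> /andP[_ vd]; rewrite wE mulmx1 c0 //= -leqNgt.
 apply/rowP => d; rewrite mxE; have [q] := ubnP (M - d)%N; elim: q d => // q ih d dq.
 have [Td|nT] := boolP (T d); last exact: c'0.
 have := wd d Td; rewrite wE' mxE (bigD1 d) //= big1 ?addr0 => [|l ld].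
 by move=> /eqP; rewrite mulf_eq0 (negbTE (gd d)) orbF => /eqP.
 case: (ltngtP l d) => lt; first by rewrite (gl l d lt) mulr0.
 by rewrite ih ?mul0r //; have := ltn_ord l; move: dq lt; clear; lia.
 by move: ld; rewrite (val_inj lt) eqxx.
have dV : \dim (V (lo j)) = (#|T| + #|B|)%N.
 rewrite VE frE // dim_row_span // -(cardID [pred l | (v (gb l) <= lo j)%N] [pred l | (I l <= lo j)%N]).
 by congr (_ + _)%N; apply: eq_card => l; rewrite !inE // -ltnNge andbC.
have leB : (gbeta G <= #|B|)%N.
 have := dimvS (_ : (V (lo j) :&: S + row_span T g <= V (lo j))%VS); rewrite dimv_disjoint_sum // dV dim_row_span //.
 move=> /(_ _)/(fun h => leq_trans (leq_add dS (leqnn _)) h) h; suff : (gbeta G + #|T| <= #|T| + #|B|)%N by rewrite addnC leq_add2l.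
 apply: h; rewrite subv_add capvSl /= VE frE //; apply: sub_span => w /mapP[l]; rewrite mem_enum inE => /andP[li _] ->.
 by apply: map_f; rewrite mem_enum inE.
have Bp l : B l -> I l = lo j /\ gb l = posp.
 move=> /andP[Il vl]; have pE : phij j (I l) = phij j (v (gb l)).
 by rewrite -(osp_mapE (phi_em G (phij j))) oI gDE osp_compE.
 have [E1 E2] := phij_eq pE (leq_ltn_trans Il vl); split=> //.
 by rewrite /posp -E2 permK.
have BE l : gb l = posp -> I l = lo j.
 move=> lp; have sub : B \subset [pred l | gb l == posp] by apply/fintype.subsetP => x /Bp[_ /eqP].
 have /subset_leqif_card[_ ] := sub; rewrite gb_card eqn_leq leB andbT => E.
 have sB : [pred l | gb (g0 := G) l == posp] \subset B by rewrite -E -(gb_card G posp) subset_leq_card.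
 have /fintype.subsetP/(_ l) := sB; rewrite inE lp eqxx => h; exact: (Bp l (h isT)).1.
have BQ l : gb l = posq -> I l = hi j.
 move=> lq; have Il : I l <> lo j.
 move=> Il; have sub : [pred l | gb l == posp] \subset [pred l | I l == lo j].
 by apply/fintype.subsetP => x; rewrite !inE => /eqP/BE ->.
 have /subset_leqif_card[_ ] := sub; rewrite card_lo eqxx => /esym/fintype.subsetP/(_ l); rewrite !inE Il lq eqxx => /(_ isT)/eqP E.
 by have := pq_lt; rewrite E ltnn.
 have pE : phij j (I l) = phij j (lo j).
 by rewrite -(osp_mapE (phi_em G (phij j))) oI gDE osp_compE lq /posq permKV.
 have [lt|lt|E'] := ltngtP (I l) (lo j).
 - by have [E1 _] := phij_eq pE lt.
 - by have [_ E1] := phij_eq (esym pE) lt.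
 - by case: Il; exact: val_inj.
apply: ospP => l; rewrite gDE opermE.
have [/eqP lp|lp] := boolP (gb l == posp); first by rewrite lp ws_p; exact: BE.
have [/eqP lq|lq] := boolP (gb l == posq); first by rewrite lq ws_q; exact: BQ.
have pE : phij j (I l) = phij j (ws (gb l)).
 by rewrite -(osp_mapE (phi_em G (phij j))) oI gDE ws_phi.
have nlo : vK (gb l) <> phij j (lo j) by move=> /vK_pq[] E; [rewrite E eqxx in lp|rewrite E eqxx in lq].
have [lt|lt|E'] := ltngtP (I l) (ws (gb l)).
- by have [E1 _] := phij_eq pE lt; case: nlo; rewrite -ws_phi -pE E1.
- by have [E1 _] := phij_eq (esym pE) lt; case: nlo; rewrite -ws_phi E1.
- exact: val_inj.
Qed.

Notation A := {ffun 'S_n -> rat^o}.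
Notation gm := gmx.
Notation Cell := (@schubert_cell F n (em d1) M).
Notation cx0 := [set V : X | closure (Cell (D x0)) (actf V gm)].
Notation pm := (@pmap R n G n.-1 (dj_dim j) (phij j)).
(** The translated divisor class times the pullback from partial flags, a representative of the
    product whose two supports meet properly. *)
Definition zz : cochain R X :=
 cupc (pb (fun V : X => actf V gm) (SC x0)) (pb pm (gsc G vK)).

Lemma actg_cts : continuous (fun V : X => actf V gm).
exact: (act_cts1 se gmx_unit). Qed.
Lemma pm_cts : continuous pm.
exact: (pmap_cts (@sum_dj n j) mono). Qed.

Lemma zz_mstr : cohom zz (ecl (mstr G x0 v)).
have [sx _ hx _] := gscP G (operm x0) (sum_d1 n); have [sv _ _ _] := gscP G vK (@sum_dj n j).
have bv : cob (pb pm (gsc G vK)) = 0 by rewrite (pb_cobE pm_cts) sv (pb0 _).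
apply: cohom_trans (cohom_cupl bv (act_perm_cohom se shift sx)) _.
apply: cohom_trans (mstr_cup G x0 v).
exact: (cohom_cupr hx sx (pull_lift G (@sum_dj n j) mono liftv)).
Qed.

Lemma zz_coc : cob zz = 0.
have [sx _ _ _] := gscP G (operm x0) (sum_d1 n); have [sv _ _ _] := gscP G vK (@sum_dj n j).
by apply: cocycle_cupc; [rewrite (pb_cobE actg_cts) sx (pb0 _)|rewrite (pb_cobE pm_cts) sv (pb0 _)].
Qed.

Lemma wlen_x0 : wlen x0 = 1%N.
by rewrite /x0 wlen_mul ?wlen_top // desc_wtop. Qed.
Lemma size_vK : size (PL vK) = (gbeta G * wlen v)%N.
by rewrite -(pl_lift G mono liftv) size_pl_operm. Qed.

Lemma zz_deg : hdeg (gbeta G * (wlen v).+1).*2 zz.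
have [_ _ hx _] := gscP G (operm x0) (sum_d1 n); have [_ _ hv _] := gscP G vK (@sum_dj n j).
rewrite mulnS doubleD; apply: hdeg_cupc; apply: pb_hdeg.
 by rewrite size_pl_operm wlen_x0 muln1 in hx.
by rewrite size_vK in hv.
Qed.

(** [zz] vanishes on simplices off the divisor and on simplices off the preimage, but perhaps not on
    all simplices off the intersection; [small_exact] supplies the correction. *)
Lemma zz_split : exists c, [/\ van (~` clZ `&` ~` cx0) c, van (~` clU) c,
 hdeg (gbeta G * (wlen v).+1).*2 (zz - cob c) & van (~` clZ) (zz - cob c)].
have [_ vx _ _] := gscP G (operm x0) (sum_d1 n); have [_ vv _ _] := gscP G vK (@sum_dj n j).
have oU : open (~` clU) by exact: (upZ_open G (@sum_dj n j) mono _).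
have o1 : open (~` clZ `&` ~` cx0).
 apply: openI; first exact: Zs_open.
 rewrite (_ : ~` cx0 = (fun V : X => actf V gm) @^-1` (~` closure (Cell (D x0)))) //.
 apply: open_comp; first by move=> V _; exact: actg_cts.
 by apply: closed_openC; exact: closed_closure.
have v1 : van (~` clZ `&` ~` cx0) zz.
 by apply: van_cupcl; apply: pb_van vx => V [].
have v2 : van (~` clU) zz.
 apply: van_cupcr; apply: pb_van vv => V; by rewrite (upZ_cells G (@sum_dj n j) mono).
have cov : ~` clZ `<=` (~` clZ `&` ~` cx0) `|` ~` clU.
 move=> V VZ; have [VU|VU] := pselect (clU V); last by right.
 left; split=> // cV; apply: VZ; case: VU => I IU IV; exists I => //; apply: contrapT => /negP IZ.
 have [oI nI] := not_Zs IU IZ; move/eqP: nI; apply; exact: (support_ws IV oI cV).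
have [e [e1 e2 ez]] : exists b, [/\ van (~` clZ `&` ~` cx0) b, van (~` clU) b &
 forall s, img_in ((~` clZ `&` ~` cx0) `|` ~` clU) s -> cob b s = zz s].
 by apply: small_exact => //; rewrite zz_coc.
have [i iE] : exists i, (gbeta G * (wlen v).+1).*2 = i.+1.
 have : (0 < (gbeta G * (wlen v).+1).*2)%N by rewrite double_gt0 muln_gt0 gbeta_gt0.
 by case: _.*2 => // i _; exists i.
have zd := zz_deg; rewrite iE in zd *.
exists (cut (~` clZ) (trunc i e)); split.
- apply: van_cut; apply: van_sub (van_trunc i e1) => V []; done.
- by apply: van_cut; apply: van_sub (van_trunc i e2) => V [].
- apply: hdegB => //; apply: hdeg_cob => s si; rewrite /cut; case: asboolP => // _; exact: (hdeg_trunc _ si).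
- move=> s sZ; rewrite -[LHS]/(zz s - cob (cut (~` clZ) (trunc i e)) s).
 rewrite (@eq_cob _ _ (~` clZ) _ (trunc i e)) //; last by move=> s' s'Z; rewrite cutE.
 rewrite cob_trunc /trunc; case: (eqVneq (sdim s) i.+1) => [_|/eqP si]; last by rewrite zd ?subrr.
 by rewrite ez ?subrr // => t; apply: cov; exact: sZ.
Qed.

Lemma evS_ecl m (d : 'I_m -> nat) (w : osp d n) (b : A) (f : 'S_n -> cochain R (flag F (em d) M)) :
 evS w (\sum_u b u *: f u) = \sum_u b u * evS w (f u).
rewrite /evS; set k := (size _).*2; set h := (fun x : nat -> R => fr _ _).
transitivity (\sum_u ev k h (b u *: f u)); last by apply: eq_bigr => u _; exact: ev_scale.
elim/big_rec2: _ => [|u x y _ <-]; first by rewrite -(scale0r (0 : cochain R _)) ev_scale mul0r.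
by rewrite /ev /app; case: pselect => // _; rewrite addr0.
Qed.

Lemma Zs_off (L : osp (em d1) M) (V : X) : L \in Zs -> L != D ws -> chart (D ws) V ->
 ~ closure (schubert_cell L) V.
move=> LZ Lw cV LV; have [K KV] := cell_cover se V; case/negP: Lw; apply/eqP; apply: (Zs_ws LZ) => i k kM.
exact: (leq_trans (closure_rank se LV KV i kM) (chart_rank cV KV i kM)).
Qed.

Lemma sl_chart (x : nat -> R) w : chart (D w) (fr (D w) (1%:M + nl (@gb _ _ G) (@kap _ _ G) (PL (operm w)) x)).
apply: chart_fr => l c; rewrite !gDE mxE mem_pl => cl.
by rewrite [(_ < operm w (gb c))%N]ltnNge cl andbF.
Qed.

(** The product expands in classes of cells of [Zs]. One over the boundary of [vK] has a lift of
    larger degree than [v] below it, so the degree forces it to be that lift, hence to lie in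
    [inR j]. Only [ws] is left, and its coefficient is read on its slice. *)
Theorem mulx_local c : hdeg (gbeta G * (wlen v).+1).*2 (zz - cob c) -> van (~` clZ) (zz - cob c) ->
 inR j (mstr G x0 v - evS (operm ws) (zz - cob c) *: ew ws).
Proof.
set z1 := zz - cob c => zd zv.
have z0 : cob z1 = 0 by rewrite /z1 linearB /= zz_coc cob_cob subrr.
have [lam lamP [b bZ bE]] := gspan (sum_d1 n) Zs_mate Zs_open z0 zv zd.
pose lf : A := [ffun w => lam (operm w)].
have sE : \sum_w lam w *: gsc G w = ecl lf.
 by rewrite sum_osp; apply: eq_bigr => w _; rewrite ffunE.
have mE : mstr G x0 v = lf.
 apply: (@ecl_inj _ _ G); apply: cohom_trans (cohom_sym zz_mstr) _; apply: (@cohom_trans _ _ _ z1).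
 by exists c; rewrite /z1 opprB addrCA subrr addr0.
 by exists b; rewrite bE sE.
have lws : evS (operm ws) z1 = lf ws.
 have vb : van (@chart F n (em d1) M (D ws) `&` ~` schubert_cell (D ws)) b.
 apply: van_sub bZ => V [cV nV] [L LZ LV]; apply: nV; rewrite -(Zs_ws LZ) // => i k kM.
 exact: chart_rank cV LV i k kM.
 have := gexact (sum_d1 n) vb; rewrite bE sE ev_sub => /eqP; rewrite subr_eq0 => /eqP.
 rewrite -/(evS (operm ws) z1) -/(evS (operm ws) (ecl lf)) => ->.
 rewrite /ecl evS_ecl (bigD1 ws) //= big1 ?addr0 => [|w ww]; first by have [_ _ ->] := scP G ws; rewrite mulr1.
 have [->|lw] := eqVneq (lf w) 0; first by rewrite mul0r.
 rewrite [X in _ * X](_ : _ = 0) ?mulr0 //; move: lw; rewrite ffunE => /lamP[wZ _].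
 have [_ vw _ _] := gscP G (operm w) (sum_d1 n).
 rewrite /evS /ev /app; case: pselect => // fc; apply: vw => t; apply: Zs_off wZ _ (sl_chart _ _).
 by apply: contraNneq ww => /gD_inj/operm_inj ->.
rewrite lws mE => w ndw; rewrite !ffunE.
have [->|ww] := eqVneq w ws; first by rewrite -[_ *: _]/(_ * _) mulr1 subrr.
rewrite -[_ *: _]/(_ * _) mulr0 subr0; apply/eqP/negPn/negP => lw.
have [wZ /double_inj sz] := lamP _ lw; have wU : D w \in upZ G (phij j) vK by move: wZ; rewrite inE => /andP[].
have [K wK omK] := om_perm G (phij j) w; have [le eq] := size_pl_map G mono wK.
have r := upZ_rank (@sum_dj n j) wU; rewrite omK in r.
have KvK : K <> vK.
 move=> E; move: wZ; rewrite inE omK E eqxx => /andP[_ /= /eqP/gD_inj/operm_inj ww']; by rewrite ww' eqxx in ww.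
have nE : gD G vK <> gD G K by move=> /gD_inj E; apply: KvK.
have := codim_lt r nE; rewrite !gcodim ltn_pmul2l ?ggam_gt0 // size_vK.
have [u lu] := lift_exists (phij j) K; have suE := pl_lift G mono lu.
rewrite -suE size_pl_operm ltn_pmul2l ?gbeta_gt0 // => lt.
have : lift_of (phij j) K w.
 apply: eq; apply/eqP; rewrite eqn_leq le sz -suE size_pl_operm leq_mul2l lt orbT //.
have -> : K = osp_comp (phij j) w by apply: ospP => l; rewrite osp_compE wK.
by move=> /desc_lift; apply/negP.
Qed.

Notation NL := (nl (@gb _ _ G) (@kap _ _ G)).
Notation pp := posp.
Notation pq := posq.
Notation w0 := ws.
Notation K0 := vK.
Notation sg := (gs G shift)^-1%g.

(** The normal directions of the translated divisor at [ws]: the single block of entries with row in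
    [posp] and column in [posq] ([mem_XL]). *)
Definition XL : seq ('I_M * 'I_n) := [seq (sg p.1, shift^-1%g p.2) | p <- PL (operm x0)].
Notation PLv := (PL K0).
Lemma gb_sg l : gb (sg l) = shift^-1%g (gb l).
by apply: (@perm_inj _ shift); rewrite -gsE !permKV. Qed.

Lemma mem_x0 (c c' : 'I_n) : (c < c')%N && (x0 c < x0 c')%N = (shift^-1%g c == pp) && (shift^-1%g c' == pq).
have h1 k : (shift^-1%g k == pp) = (k == (n - j.+2)%N :> nat).
 rewrite -(inj_eq (@perm_inj _ shift)) permKV /shift permM /posp permKV -val_eqE /= wtopE /=; done.
have h2 k : (shift^-1%g k == pq) = (k == (n - j.+1)%N :> nat).
 rewrite -(inj_eq (@perm_inj _ shift)) permKV /shift permM /posq permKV -val_eqE /= wtopE /=; done.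
rewrite h1 h2 /x0 !permM; have jn := ltn_ord j; have cn := ltn_ord c; have cn' := ltn_ord c'.
have tE k : (sj j (wtop n k) : nat) = if (k == (n - j.+2)%N :> nat) then j : nat else if (k == (n - j.+1)%N :> nat) then j.+1 else (n - k.+1)%N.
 have kn := ltn_ord k; rewrite /sj; case: tpermP => [/(congr1 val)|/(congr1 val)|/eqP + /eqP]; rewrite -?val_eqE /= wtopE /= => e1.
 - have -> : (k == (n - j.+2)%N :> nat) = false by apply/eqP; lia.
 by have -> : (k == (n - j.+1)%N :> nat) by apply/eqP; lia.
 - by have -> : (k == (n - j.+2)%N :> nat) by apply/eqP; lia.
 move=> e2; have -> : (k == (n - j.+2)%N :> nat) = false by apply/eqP; lia.
 by have -> : (k == (n - j.+1)%N :> nat) = false by apply/eqP; lia.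
rewrite !tE; do 4?[case: ifP => /eqP ?]; apply/idP/idP; lia.
Qed.

Lemma mem_XL l c : ((l, c) \in XL) = (gb l == pp) && (c == pq).
apply/mapP/andP => [[[l' c']]|[/eqP lp /eqP cq]].
 by rewrite mem_pl !opermE mem_x0 => /andP[h1 h2] [-> ->]; rewrite gb_sg.
exists (gs G shift l, shift c); last by rewrite /= !permK.
by rewrite mem_pl !opermE mem_x0 -gb_sg !permK lp cq !eqxx.
Qed.

Lemma uniq_XL : uniq XL.
by rewrite map_inj_uniq ?uniq_pl // => -[a b] [c d] [/perm_inj -> /perm_inj ->]. Qed.
Lemma size_XL : size XL = size (PL (operm x0)). Proof. exact: size_map. Qed.
Lemma pp_pq : pp != pq.
by rewrite -val_eqE; have := pq_lt; case: ltngtP. Qed.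
Lemma XL_K (l : 'I_M) c : gb l = pp -> c = pq -> K0 (gb l) = K0 c.
by move=> -> ->; rewrite -!ws_phi ws_p ws_q phij_lohi. Qed.

Lemma XL_PLv p : p \in XL -> p \notin PLv.
case: p => l c; rewrite mem_XL mem_pl => /andP[/eqP lp /eqP cq].
by rewrite (XL_K lp cq) ltnn andbF.
Qed.

Lemma perm_XL : perm_eq (XL ++ PLv) (PL (operm w0)).
apply: uniq_perm; rewrite ?uniq_pl // ?cat_uniq ?uniq_XL ?uniq_pl ?andbT //.
 by apply/hasPn => p pv; apply/negP => /XL_PLv; rewrite pv.
move=> [l c]; rewrite mem_cat mem_XL !mem_pl !opermE -!ws_phi; apply/orP/andP => [[/andP[/eqP lp /eqP cq]|/andP[-> lt]]|[lc lt]].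
- by rewrite lp cq pq_lt // ws_p ws_q /=.
- by split=> //; rewrite ltnNge; apply/negP => /mono; rewrite leqNgt lt.
- have := mono (ltnW lt); rewrite leq_eqVlt => /orP[/eqP/val_inj/phij_eq/(_ lt)[E1 E2]|lt']; last by right; rewrite lc.
 left; rewrite -(inj_eq (@perm_inj _ w0)) E1 ws_p eqxx /=.
 by rewrite -(inj_eq (@perm_inj _ w0)) E2 ws_q.
Qed.

Lemma nl_XL x l c : NL XL x l c != 0 -> gb l = pp /\ gb c = pq.
by rewrite mxE mem_XL; case: andP => [[/eqP -> /eqP ->]//|]; rewrite eqxx. Qed.

Lemma nl_XLr x l c : NL XL x (sg l) (sg c) = NL (PL (operm x0)) x l c.
have fi : injective (fun p : 'I_M * 'I_n => (sg p.1, shift^-1%g p.2)).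
 by move=> [a b] [c' d] [/perm_inj -> /perm_inj ->].
have E : (sg l, gb (sg c)) = (fun p : 'I_M * 'I_n => (sg p.1, shift^-1%g p.2)) (l, gb c) by rewrite /= gb_sg.
rewrite !mxE E /XL mem_map // index_map //; case: ifP => // _.
by rewrite -[LHS](@kap_gs _ _ G _ _ shift) permKV.
Qed.

Lemma nl_v x l c : NL PLv x l c != 0 -> (gb l < gb c)%N /\ (K0 (gb l) < K0 (gb c))%N.
exact: nl_pl. Qed.
Definition xtype (B : 'M[F]_M) := forall l c, B l c != 0 -> gb l = pp /\ gb c = pq.
Definition kntype (N : 'M[F]_M) := forall l c, N l c != 0 -> (K0 (gb l) < K0 (gb c))%N.
Lemma XN_E (X0 X1 N : 'M[F]_M) l c : (X0 + N + X1 *m N) l c = X0 l c + N l c + \sum_k X1 l k * N k c.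
by rewrite !mxE. Qed.

Lemma XN_ntype (X0 X1 N : 'M[F]_M) : xtype X0 -> xtype X1 -> kntype N -> ntype (D w0) (X0 + N + X1 *m N).
move=> hX hX1 hN l c; rewrite !gDE !opermE => cl; rewrite XN_E.
have X00 : X0 l c = 0.
 by apply/eqP/negPn/negP => /hX[lp cq]; move: cl; rewrite lp cq ws_p ws_q /= ltnn.
have lt k k' : (K0 k < K0 k')%N -> (w0 k < w0 k')%N.
 by rewrite -!ws_phi ltnNge => h; rewrite ltnNge; apply: contraNN h => /mono.
have N00 : N l c = 0 by apply/eqP/negPn/negP => /hN/lt; rewrite ltnNge cl.
rewrite X00 N00 big1 ?addr0 // => k _; apply/eqP/negPn/negP; rewrite mulf_eq0 negb_or => /andP[/hX1[lp kq] /hN].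
rewrite kq -(XL_K lp (erefl _)) => /lt; by rewrite ltnNge cl.
Qed.

Lemma xtype0 : xtype 0. Proof. by move=> l c; rewrite mxE eqxx. Qed.
Lemma kntype0 : kntype 0. Proof. by move=> l c; rewrite mxE eqxx. Qed.

Lemma unit_XN (X0 N : 'M[F]_M) : xtype X0 -> kntype N ->
 [/\ 1%:M + X0 \in unitmx, 1%:M + N \in unitmx & (1%:M + X0) *m (1%:M + N) = 1%:M + (X0 + N + X0 *m N)].
move=> hX hN; split.
- apply: (ntype_unit (I := D w0)); have := XN_ntype hX hX kntype0; by rewrite addr0 mulmx0 addr0.
- apply: (ntype_unit (I := D w0)); have := XN_ntype xtype0 xtype0 hN; by rewrite add0r mul0mx addr0.
by rewrite mulmxDl mul1mx mulmxDr mulmx1 -!addrA; congr (_ + _); rewrite addrCA.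
Qed.

Lemma hXL x : xtype (NL XL x). Proof. exact: nl_XL. Qed.
Lemma hNL x : kntype (NL PLv x). Proof. by move=> l c /nl_v[]. Qed.

(** Only the cell of [ws] is possible, so the entries above the diagonal vanish. The cross term
    lives in the rows of [posp] and involves only the rows of [posq], which are free of it and
    vanish on their own. *)
Lemma XN_off x x' y : clZ (fr (D w0) (1%:M + (NL XL x + NL PLv y + NL XL x' *m NL PLv y))) ->
 (forall i, (i < (size XL).*2)%N -> x i = 0) /\ (forall i, (i < (size PLv).*2)%N -> y i = 0).
have hX := @hXL x; have hX1 := @hXL x'; have hN := @hNL y; have nt := XN_ntype hX hX1 hN.
case=> L LZ LV; have Lw : L = D w0 by apply: (Zs_ws LZ) => i k kM; exact: (chart_rank (chart_fr nt) LV).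
subst L; have [_ A0] := (cell_chart _ _).1 LV; rewrite coordA_fr // in A0.
have X00 l c : NL XL x l c = 0.
 apply/eqP/negPn/negP => h; have [lp cq] := hX _ _ h; case/negP: h.
 have lc : (l < c)%N by apply: (@gb_mono _ _ G); rewrite lp cq; exact: pq_lt.
 have := A0 l c lc; rewrite XN_E.
 have -> : NL PLv y l c = 0 by apply/eqP/negPn/negP => /hN; rewrite (XL_K lp cq) ltnn.
 rewrite big1 ?addr0 => [->//|k _]; apply/eqP/negPn/negP; rewrite mulf_eq0 negb_or => /andP[/hX1[_ kq] /hN].
 by rewrite kq cq ltnn.
split; first exact: nl_eq0 uniq_XL X00.
apply: nl_eq0 (uniq_pl _ _) _ => l c; have [k] := ubnP (K0 (gb c)); elim: k c => // k ih c; rewrite ltnS => ck.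
apply/eqP/negPn/negP => h; have [lt _] := nl_v h; case/negP: h.
have := A0 l c (gb_mono lt); rewrite XN_E X00 add0r.
have [lp|lp] := eqVneq (gb l) pp; last first.
 by rewrite big1 ?addr0 => [->//|k' _]; apply/eqP/negPn/negP; rewrite mulf_eq0 negb_or => /andP[/hX1[E _]]; rewrite E eqxx in lp.
rewrite big1 ?addr0 => [->//|k' _]; apply/eqP/negPn/negP; rewrite mulf_eq0 negb_or => /andP[/hX1[_ kq] h].
have [ltk _] := nl_v h; have := A0 k' c (gb_mono ltk); rewrite XN_E.
have -> : NL XL x k' c = 0 by rewrite X00.
rewrite add0r big1 ?addr0 => [e|k2 _]; first by rewrite e eqxx in h.
by apply/eqP/negPn/negP; rewrite mulf_eq0 negb_or => /andP[/hX1[E _] _]; move: pp_pq; rewrite -E kq eqxx.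
Qed.

(** A vector of the space of index [lo j] lying in [topS] can only combine the rows of [posp]; by
    dimension all these rows lie in [topS], and their entries in [posq] are those of [X0]. *)
Lemma top_zero (X0 N : 'M[F]_M) : xtype X0 -> kntype N ->
 (gbeta G <= \dim (fr (D w0) ((1%:M + X0) *m (1%:M + N)) (lo j) :&: topS))%N -> forall l c, X0 l c = 0.
move=> hX hN; have [Xu Nu _] := unit_XN hX hN; set g := _ *m _; have gu : g \in unitmx by rewrite unitmx_mul Xu.
have low (c : 'rV[F]_M) : c *m g \in topS -> forall d, (v (gb d) <= lo j)%N -> (c *m (1%:M + X0)) 0 d = 0.
 rewrite /g mulmxA; set u := c *m _ => /row_spanP[c' c'0]; rewrite mulmx1 => cE d.
 have [k] := ubnP (v (gb d)); elim: k d => // k ih d; rewrite ltnS => dk dlo.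
 have := c'0 d; rewrite /= -leqNgt => /(_ dlo); rewrite -cE mulmxDr mulmx1 mxE [X in _ + X]mxE big1 ?addr0 // => l _.
 apply/eqP/negPn/negP; rewrite mulf_eq0 negb_or => /andP[ul /hN lt]; case/negP: ul; apply/eqP.
 have lt' : (v (gb l) < v (gb d))%N.
 move: lt; rewrite /vK !osp_compE ltnNge => h; rewrite ltnNge; apply: contraNN h; exact: mono.
 apply: ih; [exact: leq_trans lt' dk|exact: leq_trans (ltnW lt') dlo].
have uE (c : 'rV[F]_M) d : gb d != pq -> (c *m (1%:M + X0)) 0 d = c 0 d.
 move=> dq; rewrite mulmxDr mulmx1 mxE [X in _ + X]mxE big1 ?addr0 // => k _.
 by apply/eqP/negPn/negP; rewrite mulf_eq0 negb_or => /andP[_ /hX[_ E]]; rewrite E eqxx in dq.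
have vq (l : 'I_M) : gb l = pq -> v (gb l) = lo j by move=> ->; rewrite /posq permKV.
have sub : (fr (D w0) g (lo j) :&: topS <= row_span [pred l | gb (g0 := G) l == pp] g)%VS.
 apply/subvP => w; rewrite memv_cap frE // => /andP[/row_spanP[c c0 ->] /low cl]; apply/row_spanP; exists c => // l lp.
 have [lle|/c0//] := boolP (D w0 l <= lo j)%N.
 have lne : D w0 l != lo j by rewrite ws_lo.
 have llt : (w0 (gb l) < lo j)%N by rewrite ltn_neqAle; move: lle lne; rewrite gDE opermE -val_eqE => -> ->.
 have vl : v (gb l) = w0 (gb l).
 move: llt; rewrite /ws permM; case: tpermP => [E|E|//]; first by rewrite ltnNge /= ltnW.
 by rewrite ltnn.
 rewrite -(uE c) ?cl ?vl ?(ltnW llt) //; apply/eqP => lq; by move: llt; rewrite -vl vq // ltnn.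
move=> le l c; apply/eqP/negPn/negP => h; have [lp cq] := hX _ _ h.
have E : (fr (D w0) g (lo j) :&: topS)%VS = row_span [pred l | gb (g0 := G) l == pp] g.
 by apply/eqP; rewrite eqEdim sub dim_row_span // gb_card.
have : row l g \in row_span [pred l | gb (g0 := G) l == pp] g by apply: row_mem_span; rewrite /= lp.
rewrite -E memv_cap rowE => /andP[_ /low/(_ c)]; rewrite vq // leqnn => /(_ isT).
rewrite -rowE mxE mxE [X in X + _]mxE; case: eqP => [lc|_]; first by move: pp_pq; rewrite -lp -cq lc eqxx.
by rewrite add0r => X00; rewrite X00 eqxx in h.
Qed.

Notation Y := 'rV[R]_((size PLv).*2 + (size XL).*2).
Notation Sx := (simp R ((size PLv).*2 + (size XL).*2)).
(** The product of the two unipotent matrices instead of their sum: the left factor stabilises the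
    partial flag, so the projection sees only the second factor, and when that is trivial the
    translate is the slice of the divisor ([SS_pm], [SS_act]). *)
Definition SS (y : Y) : X := fr (D w0) ((1%:M + NL XL (wx (jproj y))) *m (1%:M + NL PLv (wx (kproj y)))).

Lemma rv_cts (T : topT) (f g : T -> 'M[F]_M) t : cts_at t f -> cts_at t g ->
 cts_at t (fun x => f x + g x).
move=> fc gc; apply: mx_cts => l k.
rewrite (_ : (fun x => (f x + g x) l k) = fun x => f x l k + g x l k); last by apply/funext => x; rewrite mxE.
by apply: addf_cts; apply: coord_cts.
Qed.

Lemma wx_comp (T : topT) c (f : T -> 'rV[R]_c) t : cts_at t f ->
 forall i, cts_at t (fun x => wx (f x) i : R^o).
by move=> fc i; apply: (@continuous_comp _ _ _ f (fun y => wx y i : R^o)) => //; exact: wx_cts. Qed.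

Lemma SS_cts : continuous SS.
move=> y; apply: (@fr_cts F n (em d1) M se (D w0) Y (fun y : Y => (1%:M + NL XL (wx (jproj y))) *m (1%:M + NL PLv (wx (kproj y))))).
 apply: mulmx_cts; apply: rv_cts; try exact: cst_continuous; apply: nl_cts; apply: wx_comp;
 [exact: jproj_cts|exact: kproj_cts].
by have [h1 h2 _] := unit_XN (@hXL (wx (jproj y))) (@hNL (wx (kproj y))); rewrite unitmx_mul h1.
Qed.

Lemma SS_pm y : pm (SS y) = slc G K0 (kproj y).
have [h1 h2 _] := unit_XN (@hXL (wx (jproj y))) (@hNL (wx (kproj y))).
have gu : (1%:M + NL XL (wx (jproj y))) *m (1%:M + NL PLv (wx (kproj y))) \in unitmx by rewrite unitmx_mul h1.
rewrite /SS (pmap_fr mono _ gu) /slc; transitivity (fr (gD G K0) ((1%:M + NL XL (wx (jproj y))) *m (1%:M + NL PLv (wx (kproj y))))).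
 by congr (fr _ _); exact: om_ws.
apply/(fr_parab (gD G K0) gu h2).
rewrite mulmxK // => l k; rewrite !gDE mxE => lt; rewrite mxE; case: eqP => [lk|_]; first by rewrite lk ltnn in lt.
by rewrite add0r; apply/eqP/negPn/negP => /nl_XL[lp kq]; rewrite (XL_K lp kq) ltnn in lt.
Qed.

Lemma SS_act x : actf (fr (D w0) (1%:M + NL XL x)) gm = fr (D x0) (1%:M + NL (PL (operm x0)) x).
have [h1 _ _] := unit_XN (@hXL x) (@hNL x); rewrite act_fr ?gmx_unit //.
rewrite (@fr_perm F n (em d1) M _ (D x0) _ sg); last 2 first.
- move=> l; rewrite !gDE !opermE gb_sg /ws /x0 !permM; congr (sj j _).
 by rewrite /shift invMg permM permKV wtopV.
- by rewrite unitmx_mul h1 gmx_unit.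
have E L l' c' : (1%:M + NL L x) l' c' = (l' == c')%:R + NL L x l' c' by rewrite mxE [X in X + _]mxE.
congr fr; apply/matrixP => l c; rewrite [LHS]mxE (_ : gm = perm_mx sg^-1); last by rewrite /gmx invgK.
by rewrite -col_permE [LHS]mxE !E nl_XLr (inj_eq perm_inj).
Qed.

Lemma rZ_cts (T : topT) c (f : T -> R) (g : T -> 'rV[R]_c) t : cts_at t (f : T -> R^o) ->
 cts_at t g -> cts_at t (fun x => f x *: g x).
move=> fc gc; apply: mx_cts => l k.
rewrite (_ : (fun x => (f x *: g x) l k) = fun x => f x * g x l k); last by apply/funext => x; rewrite mxE.
by apply: mulf_cts => //; apply: coord_cts.
Qed.

Lemma SS_clZ y : clZ (SS y) -> y = 0.
have [_ _ E] := unit_XN (@hXL (wx (jproj y))) (@hNL (wx (kproj y))); rewrite /SS E => /XN_off[h1 h2].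
by apply: jkproj0; apply: wx_eq0.
Qed.

Lemma SS_cx0 (x : 'rV[R]_((size XL).*2)) y :
 cx0 (fr (D w0) ((1%:M + NL XL (wx x)) *m (1%:M + NL PLv y))) -> x = 0.
move=> /top_dim le; have X00 := top_zero (@hXL (wx x)) (@hNL y) le.
by apply: wx_eq0; exact: nl_eq0 uniq_XL X00.
Qed.

(** The slice of [ws] deforms to [SS], along which the two classes become pullbacks from the two
    factors up to a prism; [local_product] then gives 1 times 1. *)
Theorem local_one c : van (~` clZ `&` ~` cx0) c -> van (~` clU) c ->
 hdeg (gbeta G * (wlen v).+1).*2 (zz - cob c) -> van (~` clZ) (zz - cob c) ->
 evS (operm w0) (zz - cob c) = 1.
Proof.
set z1 := zz - cob c => c1 c2 zd zv.
have z0 : cob z1 = 0 by rewrite /z1 linearB /= zz_coc cob_cob subrr.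
have -> : evS (operm w0) z1 = evalv (pb SS z1).
 have un (x x' y : nat -> R) : 1%:M + (NL XL x + NL PLv y + NL XL x' *m NL PLv y) \in unitmx.
 by apply: (ntype_unit (I := D w0)); apply: XN_ntype; [exact: hXL|exact: hXL|exact: hNL].
 have catE x : NL (XL ++ PLv) x = NL XL x + NL PLv (fun i => x ((size XL).*2 + i)%N) +
 NL XL (wx (0 : 'rV[R]_1)) *m NL PLv (fun i => x ((size XL).*2 + i)%N).
 by rewrite nl_wx0 mul0mx addr0 nl_cat //; exact: XL_PLv.
 have sE : (size (XL ++ PLv)).*2 = ((size PLv).*2 + (size XL).*2)%N by rewrite size_cat doubleD addnC.
 rewrite /evS -(@ev_perm R n G n (em d1) (D w0) (XL ++ PLv) (PL (operm w0)) z1 se _ perm_XL z0); first last.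
 - apply: pb_van zv => y; rewrite /nz /= catE => /eqP y0 /XN_off[h1 h2]; apply: y0; apply: wx_eq0 => i.
 move=> il; have il' := il; rewrite size_cat doubleD in il'; have [/h1//|ge] := ltnP i (size XL).*2.
 by rewrite -(subnKC ge); apply: h2; rewrite ltn_subLR.
 - by move=> x; rewrite catE; exact: un.
 - by rewrite (perm_uniq perm_XL) uniq_pl.
 rewrite evE => [|x y xy]; last by congr (fr _ (_ + _)); exact: nl_ext.
 rewrite sE /evalv pb_app; last exact: vsimpv_cts.
 (* [r] scales the cross term: the homotopy runs from the linear slice to [SS], and by [XN_off] its
    boundary never meets the support. *)
 pose h (t : Sx) (r : R) : X :=
 fr (D w0) (1%:M + (NL XL (wx (jproj (vsimp (set_val t)))) + NL PLv (wx (kproj (vsimp (set_val t)))) +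
 NL XL (wx (r *: jproj (vsimp (set_val t)))) *m NL PLv (wx (kproj (vsimp (set_val t)))))).
 have e1 : app z1 (fun t => SS (vsimp (set_val t))) = app z1 (h^~ 1).
 apply: eq_app => t; rewrite /h /SS scale1r; congr fr.
 by have [_ _ ->] := unit_XN (@hXL (wx (jproj (vsimp (set_val t))))) (@hNL (wx (kproj (vsimp (set_val t))))).
 rewrite e1 (app_homotopy (U := setT) (V := ~` clZ)) //.
 - apply: eq_app => t; rewrite /h scale0r nl_wx0 mul0mx addr0; congr (fr _ (_ + _)).
 rewrite nl_cat; last exact: XL_PLv.
 congr (_ + _); first by apply: nl_ext => i il; rewrite wx_jproj.
 by apply: nl_ext => i il; rewrite wx_kproj.
 - move=> t r; have vc : cts_at (t, r) (fun p : Sx * R => vsimp (set_val p.1)).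
 apply: (@continuous_comp _ _ _ fst (fun t : Sx => vsimp (set_val t))); first exact: cvg_fst.
 exact: vsimpv_cts.
 have jc : cts_at (t, r) (fun p : Sx * R => jproj (vsimp (set_val p.1))).
 apply: (@continuous_comp _ _ _ (fun p : Sx * R => vsimp (set_val p.1)) (@jproj R _ _)); [exact: vc|exact: jproj_cts].
 have kc : cts_at (t, r) (fun p : Sx * R => kproj (vsimp (set_val p.1))).
 apply: (@continuous_comp _ _ _ (fun p : Sx * R => vsimp (set_val p.1)) (@kproj R _ _)); [exact: vc|exact: kproj_cts].
 apply: (@fr_cts F n (em d1) M se (D w0) _ (fun p : Sx * R =>
 1%:M + (NL XL (wx (jproj (vsimp (set_val p.1)))) + NL PLv (wx (kproj (vsimp (set_val p.1)))) +
 NL XL (wx (p.2 *: jproj (vsimp (set_val p.1)))) *m NL PLv (wx (kproj (vsimp (set_val p.1))))))); last exact: un.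
 apply: rv_cts; first exact: cst_continuous.
 apply: rv_cts; first by apply: rv_cts; apply: nl_cts; apply: wx_comp.
 apply: mulmx_cts; apply: nl_cts; apply: wx_comp; last exact: kc.
 by apply: rZ_cts; [exact: cvg_snd|exact: jc].
 - move=> t r i r01 ti /XN_off[h1 h2].
 have v0 : vsimp (set_val t) = 0 by apply: jkproj0; apply: wx_eq0.
 by have := simp_eq_gt0 (stdP t) v0 i; rewrite ti ltxx.
 - by move=> s _; rewrite z0.
have [sx vx hx ex] := gscP G (operm x0) (sum_d1 n); have [sv vv hv ev0] := gscP G K0 (@sum_dj n j).
pose a0 := pb (@slc R n G n d1 (operm x0) (size XL).*2) (SC x0).
pose b0 := pb (@slc R n G n.-1 (dj_dim j) K0 (size PLv).*2) (gsc G K0).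
have ea : evalv a0 = 1 by rewrite /a0 size_XL (slc_eval _ _ (sum_d1 n)).
have eb : evalv b0 = 1 by rewrite /b0 (slc_eval _ _ (@sum_dj n j)).
(* Contracts the second factor, so that the pullback of the divisor class depends on [jproj]
   only. *)
pose h (y : Y) (r : R) : X := actf (fr (D w0) ((1%:M + NL XL (wx (jproj y))) *m (1%:M + NL PLv (wx ((1 - r) *: kproj y))))) gm.
have hc y r : cts_at (y, r) (fun p => h p.1 p.2).
 have jc : cts_at (y, r) (fun p : Y * R => jproj p.1).
 apply: (@continuous_comp _ _ _ fst (@jproj R _ _)); [exact: cvg_fst|exact: jproj_cts].
 have kc : cts_at (y, r) (fun p : Y * R => kproj p.1).
 apply: (@continuous_comp _ _ _ fst (@kproj R _ _)); [exact: cvg_fst|exact: kproj_cts].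
 apply: (@continuous_comp _ _ _ (fun p : Y * R => fr (D w0) ((1%:M + NL XL (wx (jproj p.1))) *m (1%:M + NL PLv (wx ((1 - p.2) *: kproj p.1))))) (fun V : X => actf V gm)); last exact: actg_cts.
 apply: (@fr_cts F n (em d1) M se (D w0) _ (fun p : Y * R => (1%:M + NL XL (wx (jproj p.1))) *m (1%:M + NL PLv (wx ((1 - p.2) *: kproj p.1))))).
 apply: mulmx_cts; apply: rv_cts; [exact: cst_continuous|apply: nl_cts; apply: wx_comp; exact: jc|exact: cst_continuous|].
 apply: nl_cts; apply: wx_comp; apply: rZ_cts; last exact: kc.
 by apply: subf_cts; [exact: cstf_cts|exact: cvg_snd].
 by have [u1 u2 _] := unit_XN (@hXL (wx (jproj y))) (@hNL (wx ((1 - r) *: kproj y))); rewrite unitmx_mul u1.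
pose P := prism h (SC x0).
have PE : cob P = pb (@jproj R _ _) a0 - pb SS (pb (fun V : X => actf V gm) (SC x0)).
 apply/funext => s; have := @prismP R Y X h setT (fun y r _ => hc y r) (SC x0) s (fun _ => I).
 rewrite sx (@prism_van _ _ _ _ _ setT) // add0r => ->; rewrite -[RHS]/(pb (@jproj R _ _) a0 s - pb SS _ s).
 rewrite /a0 (pb_comp _ (@jproj_cts R _ _)); last by apply: slc_cts; exact: sum_d1.
 rewrite (pb_comp _ SS_cts); last exact: actg_cts.
 congr (_ - _); apply: eq_app => t; rewrite /h; first by rewrite subrr scale0r nl_wx0 addr0 mulmx1 SS_act.
 by rewrite subr0 scale1r.
have Pv : van [set y : Y | jproj y != 0] P.
 move=> s sj; apply: (prism_van vx) => t r _ cl; have /= /eqP := sj t; apply; exact: SS_cx0 cl.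
pose b1 := pb (@kproj R (size XL).*2 (size PLv).*2) b0.
have b1E : pb SS (pb pm (gsc G K0)) = b1.
 rewrite /b1 /b0 (pb_comp _ SS_cts); last exact: pm_cts.
 rewrite (pb_comp _ (@kproj_cts R _ _)); last by apply: slc_cts; exact: sum_dj.
 by congr (pb _ _); apply/funext => y /=; rewrite SS_pm.
have b00 : cob b0 = 0 by rewrite /b0 pb_cobE ?sv ?(pb0 _) //; apply: slc_cts; exact: sum_dj.
have b10 : cob b1 = 0 by rewrite /b1 (pb_cobE (@kproj_cts R _ _)) b00 (pb0 _).
have b0z : van (@nz R (size PLv).*2) b0 by apply: slc_van; exact: sum_dj.
have b1z : van [set y : Y | kproj y != 0] b1 by apply: pb_van b0z.
(* The prism term and the correction [c] together vanish off each of the two coordinate subspaces,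
   as [local_product] requires. *)
pose e := cupc P b1 + pb SS c.
have zE : pb SS z1 = cupc (pb (@jproj R (size XL).*2 (size PLv).*2) a0) b1 - cob e.
 rewrite /z1 pbB /zz (pb_cupcE SS_cts) b1E /e linearD /= cob_cupc b10 cupc0r addr0 PE (pb_cobE SS_cts).
 have cB (x y z : cochain R Y) : cupc (x - y) z = cupc x z - cupc y z.
 by rewrite -(scaleN1r y) cupcDl cupcZl scaleN1r.
 by rewrite cB opprD opprB addrA; congr (_ - _); rewrite addrCA subrr addr0.
rewrite (@local_product R (size XL).*2 (size PLv).*2 a0 b0 (pb SS z1) e) ?ea ?eb ?mulr1 //.
- by apply: slc_cocycle; [exact: sum_d1|exact: sx].
- by rewrite /a0 size_XL; by apply: slc_van; exact: sum_d1.
- by apply: pb_hdeg; rewrite size_XL.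
- by apply: slc_cocycle; [exact: sum_dj|exact: sv].
- exact: pb_hdeg.
- by move=> s _; rewrite (pb_cobE SS_cts) z0 (pb0 _).
- by apply: pb_van zv => y; rewrite /nz /= => /eqP y0 /SS_clZ.
- apply: vanD; first exact: van_cupcl.
 apply: pb_van c1 => y /= /eqP y0; split; first by move=> /SS_clZ E; apply: y0; rewrite E jproj0.
 by move=> /SS_cx0.
- apply: vanD; first exact: van_cupcr.
 apply: pb_van c2 => y /= /eqP y0; rewrite (upZ_cells G (@sum_dj n j) mono) => cl; apply: y0.
 by move: cl; rewrite /preimage /= SS_pm => h0; apply: wx_eq0; apply: slc_off h0; exact: sum_dj.
Qed.

Theorem mulG_x : inR j (mulG G (xj j) (ew v) - ew ws).
Proof.
have [c [c1 c2 zd zv]] := zz_split; have := mulx_local zd zv.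
by rewrite (local_one c1 c2 zd zv) scale1r -mulG_ew.
Qed.

End adjacent_product.

(** * Choice of Schubert cocycles *)

Section strat_classes.
Variables (R : realType) (X : topT) (S : strat R X) (T : finType) (D : T -> S).
Hypothesis D_inj : injective D.
Hypothesis D_good : forall w, mate (D w) = D w.
Hypothesis D_surj : forall I, mate I = I -> exists w, I = D w.

(** Bad cells get the default 0, so that sums may range over all cells. *)
Definition scl (I : S) : cochain R X :=
 if pselect (mate I = I) is left h then proj1_sig (cid (schubert_exists h)) else 0.
Lemma sclP I : mate I = I -> [/\ cob (scl I) = 0,
 van (~` closure (Om I)) (scl I), hdeg (cd I) (scl I) & slev I (scl I) = 1].
by move=> mI; rewrite /scl; case: pselect => // h; case: cid. Qed.

Lemma scl_sum (lam : S -> rat) : (forall K, lam K != 0 -> mate K = K) ->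
 \sum_K lam K *: scl K = \sum_w lam (D w) *: scl (D w).
move=> lamg; transitivity (\sum_(K in D @: [set: T]%SET) lam K *: scl K); last first.
 by rewrite big_imset /=; [apply: eq_bigl => w; rewrite inE|move=> w w' _ _; exact: D_inj].
rewrite [LHS](bigID (mem (D @: [set: T]%SET))) /= [X in _ + X]big1 ?addr0 // => K KD.
have [->|/lamg/D_surj[w E]] := eqVneq (lam K) 0; first by rewrite scale0r.
by case/negP: KD; rewrite E imset_f ?inE.
Qed.

Lemma scl_span Z i a : mstable Z -> open (~` cells_of (Om (s := S)) Z) -> cob a = 0 ->
 van (~` cells_of (Om (s := S)) Z) a -> hdeg i a ->
 exists2 lam : T -> rat, (forall w, lam w != 0 -> D w \in Z /\ cd (D w) = i) &
 exists2 b, van (~` cells_of (Om (s := S)) Z) b & cob b = a - \sum_w lam w *: scl (D w).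
move=> mZ oZ a0 aZ ai; have [lam lamP [b bZ bE]] := schubert_span sclP mZ oZ a0 aZ ai.
exists (fun w => lam (D w)); first by move=> w /lamP[].
by exists b => //; rewrite bE scl_sum // => K /lamP[].
Qed.

Lemma scl_free (lam : T -> rat) : cohom (\sum_w lam w *: scl (D w)) 0 -> forall w, lam w = 0.
move=> [b bE] w; pose lamS K := if [pick w | D w == K] is Some w then lam w else 0.
have lamE w' : lamS (D w') = lam w'.
 by rewrite /lamS; case: pickP => [u /eqP/D_inj -> //|/(_ w')]; rewrite eqxx.
rewrite -lamE; apply: (schubert_free sclP (lam := lamS) (b := b)) => [K|].
 by rewrite /lamS; case: pickP => // u /eqP <-; rewrite D_good eqxx.
rewrite bE subr0 scl_sum; first by apply: eq_bigr => u _; rewrite lamE.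
by move=> K; rewrite /lamS; case: pickP => [u /eqP <- //|]; rewrite eqxx.
Qed.

Lemma scl_exact w b : van (Nb (D w) `&` ~` Om (D w)) b -> slev (D w) (cob b) = 0.
by move=> h; apply: (slev_exact h). Qed.
End strat_classes.

(** * Paths from the identity to transposition matrices *)

Section swap_path.
Variables (R : realType) (F : numFieldType) (emb : {rmorphism R -> F}) (M : nat) (N L : 'M[F]_M).
Hypothesis emb_cts : continuous (emb : R^o -> F^o).
Hypotheses (NN : N *m N = N + N) (NL : N *m L = L + L) (LN : L *m N = L + L) (LL : L *m L = - (N + N)).

(* With [N] twice a projector and [L] acting as [N] times the imaginary unit, [1 + a N + b L] acts on the
 image of [N] as the complex number [1 + 2 a + 2 b i]; the path joins 1 to -1 avoiding 0. *)
Lemma swap_path : exists gam : R -> 'M[F]_M,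
 [/\ continuous gam, forall t, gam t \in unitmx, gam 0 = 1%:M & gam 1 = 1%:M - N].
have mulE (a b a' b' : F) : (1%:M + a *: N + b *: L) *m (1%:M + a' *: N + b' *: L) =
 1%:M + (a + a' + (a * a' - b * b') *+ 2) *: N + (b + b' + (a * b' + b * a') *+ 2) *: L.
 rewrite !mulmxDl !mulmxDr !mul1mx !mulmx1 -!scalemxAl -!scalemxAr NN NL LN LL.
 by apply/matrixP => l c; rewrite !mxE; ring.
exists (fun t => 1%:M + emb (- t) *: N + emb (2 * t * (1 - t)) *: L); split.
- move=> t; apply: mx_cts => l c.
 rewrite (_ : (fun x => _) = fun x : R => (1%:M : 'M[F]_M) l c + emb (- x) * N l c + emb (2 * x * (1 - x)) * L l c); last first.
 by apply/funext => x; rewrite mxE [X in X + _]mxE [X in _ + X + _]mxE [X in _ + X]mxE.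
 have ce (f : R -> R) : cts_at t (f : R -> R^o) -> cts_at t (fun x => emb (f x) : F^o).
 by move=> fc; apply: (@continuous_comp _ _ _ (f : R -> R^o) (emb : R^o -> F^o)) => //; exact: emb_cts.
 have ct : cts_at t (fun x : R => x : R^o) by move=> A.
 apply: addf_cts; last first.
 apply: mulf_cts; last exact: cstf_cts.
 apply: ce; apply: mulf_cts; first by apply: mulf_cts => //; exact: cstf_cts.
 by apply: subf_cts => //; exact: cstf_cts.
 apply: addf_cts; first exact: cstf_cts.
 by apply: mulf_cts; [apply: ce; exact: oppf_cts|exact: cstf_cts].
- move=> t; set a := - t; set b := 2 * t * (1 - t); pose D := (1 + a *+ 2) ^+ 2 + (b *+ 2) ^+ 2.
 have D0 : D != 0.
 rewrite /D paddr_eq0 ?sqr_ge0 // !sqrf_eq0 /a /b; apply/negP => /andP[/eqP h1 /eqP h2].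
 have t2 : t = 1 / 2 by lra.
 by move: h2; rewrite t2; lra.
 pose a' := ((1 + a *+ 2) / D - 1) / 2; pose b' := - b / D.
 have E1 : a + a' + (a * a' - b * b') *+ 2 = 0.
 apply: (mulfI D0); rewrite mulr0 /a' /b'.
 transitivity ((a - 1 / 2 - a) * D + (1 + a *+ 2) * (1 / 2) * (1 + a *+ 2) + 2 * b * b); first by field.
 by rewrite /D; field.
 have E2 : b + b' + (a * b' + b * a') *+ 2 = 0.
 by apply: (mulfI D0); rewrite mulr0 /a' /b'; field.
 have := mulE (emb a) (emb b) (emb a') (emb b'); rewrite -!rmorphM -!rmorphB -!rmorphD -!rmorphMn -!rmorphD /=.
 by rewrite E1 E2 rmorph0 !scale0r !addr0 => /mulmx1_unit[].
- by rewrite oppr0 mulr0 mul0r rmorph0 !scale0r !addr0.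
- by apply/matrixP => l c; rewrite subrr mulr0 rmorph0 rmorphN rmorph1 !mxE; ring.
Qed.

End swap_path.
Section swap_vector.
Variables (F : numFieldType) (n : nat) (p q : 'I_n).
Hypothesis pq : p != q.
Definition uv (c : 'I_n) : F := (c == p)%:R - (c == q)%:R.

Lemma uv_sum : \sum_c uv c * uv c = 2.
rewrite (bigD1 p) //= (bigD1 q) 1?eq_sym //= big1 ?addr0 => [|c /andP[cp cq]].
 have qp : (q == p) = false by rewrite eq_sym (negbTE pq).
 by rewrite /uv !eqxx qp (negbTE pq) /=; ring.
by rewrite /uv (negbTE cp) (negbTE cq); ring.
Qed.

Lemma uv_swap c c' : (c == c')%:R - uv c * uv c' = (tperm p q c == c')%:R.
rewrite /uv; case: tpermP => [->|->|/eqP cp /eqP cq].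
- by rewrite eqxx (negbTE pq) (eq_sym p c') (eq_sym q c') /=; ring.
- by rewrite eqxx (eq_sym q p) (negbTE pq) (eq_sym p c') (eq_sym q c') /=; ring.
by rewrite (negbTE cp) (negbTE cq) subrr mul0r subr0.
Qed.

End swap_vector.

(** * The complex case *)

Section complex_geometry.
Variables (R : realType) (n : nat).
Notation C := (Cx R).
Definition kapc (a b : R) (_ : 'I_n) : C := (a +i* b)%C.
Notation PLc := (@pl n n id).
Notation NLc := (@nl R C n n id kapc).
Definition scc m (d : 'I_m -> nat) (w : osp d n) : cochain R (flag C d n) :=
 if pselect ((\sum_i d i)%N = n) is left sd then scl (S := cplx_strat R sd) w else 0.
Section fields.
Variables (m : nat) (d : 'I_m -> nat).
Hypothesis sd : (\sum_i d i)%N = n.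

Lemma slev_c (w : osp d n) a : slev (S := cplx_strat R sd) w a =
 ev (size (PLc w)).*2 (fun x => fr w (1%:M + NLc (PLc w) x)) a.
rewrite evE => [|x y xy].
 apply: eq_app => t; congr (fr w (_ + _)); apply/matrixP => l c; rewrite /= cnrmE mxE; reflexivity.
congr (fr _ (_ + _)); apply/matrixP => l c; rewrite !mxE; case: ifP => // h; have := h; rewrite -index_mem => h'.
by rewrite !xy ?ltn_double // -doubleS leq_double.
Qed.

End fields.

(** With u the difference of two basis vectors the transposition is the reflection 1 - u u^T, and u
    u^T is twice a projector since u has square length 2; [swap_path] applies with L = iN. *)
Lemma pathc (p q : 'I_n) : exists gam : R -> 'M[C]_n, [/\ continuous gam,
 forall t, gam t \in unitmx, gam 0 = 1%:M & gam 1 = perm_mx (tperm p q)].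
have [->|pq] := eqVneq p q.
 exists (fun=> 1%:M); split=> //; first exact: cst_continuous.
 by move=> t; exact: unitmx1.
 by rewrite tperm1 perm_mx1.
pose N : 'M[C]_n := \matrix_(l, c) (uv C p q l * uv C p q c).
have NN : N *m N = N + N.
 apply/matrixP => l c; rewrite !mxE; under eq_bigr => k _ do rewrite !mxE.
 transitivity (uv C p q l * (\sum_k uv C p q k * uv C p q k) * uv C p q c).
 by rewrite mulr_sumr mulr_suml; apply: eq_bigr => k _; ring.
 by rewrite uv_sum //; ring.
have ii : ('i%C : C) * 'i%C = -1 by rewrite -expr2 sqr_i.
have [||||gam [g1 g2 g3 g4]] := @swap_path R C (real_complex R) n N ('i%C *: N) _ NN.
- by move=> x; apply: Cx_cts => /=; [move=> A|exact: cst_continuous].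
- by rewrite -scalemxAr NN scalerDr.
- by rewrite -scalemxAl NN scalerDr.
- by rewrite -scalemxAl -scalemxAr scalerA ii NN scaleN1r.
exists gam; split=> //; rewrite g4; apply/matrixP => l c; rewrite !mxE -uv_swap //.
Qed.

Definition geoC : geo R n.
apply: (@Geo R n C n id id id 1 1 kapc (fun s => s = 1%g) (fun m d w => w) (fun m d w => w) scc) => //.
- by move=> c; rewrite (eq_card (B := pred1 c)) ?card1.
- move=> T f g t l fc gc; apply: Cx_cts => //.
- by move=> a b c /(_ c erefl) [-> ->].
- exact: pathc.
- by move=> m d I; exists 1%g => //; apply: ospP => l; rewrite osp_compE perm1.
- by move=> s l ->; rewrite perm1.
- move=> m d w K s V W sd -> wV KV KW; apply: (clos_cells sd wV KV).
 by rewrite (_ : K = osp_comp K 1) //; apply: ospP => l; rewrite osp_compE perm1.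
- by move=> m d w; rewrite mul1n.
- move=> m d w sd; rewrite /scc; case: pselect => // sd'; rewrite -slev_c.
 exact: (@sclP R _ (cplx_strat R sd') w).
- move=> m d Z i a sd mZ oZ a0 aZ ai; rewrite /scc; case: pselect => // sd'.
 exact: (@scl_span R _ (cplx_strat R sd') _ id (@inj_id _) (fun I _ => ex_intro _ I erefl) Z i a).
- move=> m d lam sd; rewrite /scc; case: pselect => // sd'.
 exact: (@scl_free R _ (cplx_strat R sd') _ id (@inj_id _) (fun=> erefl) (fun I _ => ex_intro _ I erefl) lam).
- move=> m d w b sd bv; rewrite -(slev_c sd).
 exact: (@scl_exact R _ (cplx_strat R sd) _ id).
Defined.

End complex_geometry.

(** * The real case *)

Section real_geometry.
Variables (R : realType) (n : nat).
Definition kapr (a b : R) (l : 'I_n.*2) : R := if odd l then b else a.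
Notation PLr := (@pl n n.*2 (@half_ord n)).
Notation NLr := (@nl R R n n.*2 (@half_ord n) kapr).
Lemma liftp_subproof (s : 'S_n) (l : 'I_n.*2) : ((s (half_ord l)).*2 + odd l < n.*2)%N.
by have := ltn_ord (s (half_ord l)); case: (odd l); rewrite ?addn1 ?addn0 ?ltn_Sdouble ?ltn_double. Qed.
Lemma half_lt (s : 'S_n) l : half_ord (Ordinal (liftp_subproof s l)) = s (half_ord l).
by apply: val_inj; rewrite /= addnC half_bit_double. Qed.
Lemma odd_lt (s : 'S_n) l : odd (Ordinal (liftp_subproof s l)) = odd l.
by rewrite /= oddD odd_double; case: (odd l). Qed.
Lemma half_odd_inj (l l' : 'I_n.*2) : half_ord l = half_ord l' -> odd l = odd l' -> l = l'.
by move=> /(congr1 val) /= h o; apply: val_inj; rewrite /= -(odd_double_half l) o h odd_double_half. Qed.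

Lemma liftp_inj (s : 'S_n) : injective (fun l => Ordinal (liftp_subproof s l)).
move=> l l' /= E; apply: half_odd_inj; last by rewrite -(odd_lt s l) -(odd_lt s l') E.
by have := congr1 (@half_ord n) E; rewrite !half_lt => /perm_inj.
Qed.

Definition liftp (s : 'S_n) : 'S_n.*2 := perm (@liftp_inj s).
Lemma half_liftp s l : half_ord (liftp s l) = s (half_ord l).
by rewrite permE half_lt. Qed.
Lemma odd_liftp s (l : 'I_n.*2) : odd (liftp s l) = odd l.
by rewrite permE odd_lt. Qed.
Lemma half_ord_lt (l l' : 'I_n.*2) : (half_ord l < half_ord l')%N -> (l < l')%N.
by move=> h; rewrite ltnNge; apply: contraTN h => /half_leq; rewrite -leqNgt. Qed.

Lemma pairs_flatten (T U : Type) (P : pred (T * U)) (Q : pred (T * 'I_n)) (h0 h1 : 'I_n -> U) (s : seq T) (t : seq 'I_n) :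
 (forall l c, P (l, h0 c) = Q (l, c)) -> (forall l c, P (l, h1 c) = Q (l, c)) ->
 [seq p <- [seq (l, c) | l <- s, c <- flatten [seq [:: h0 c; h1 c] | c <- t]] | P p] =
 flatten [seq [:: (p.1, h0 p.2); (p.1, h1 p.2)] | p <- [seq p <- [seq (l, c) | l <- s, c <- t] | Q p]].
move=> e0 e1; elim: s => //= l s ih; rewrite !filter_cat map_cat flatten_cat ih; congr (_ ++ _).
by elim: t {ih} => //= c t ih; rewrite e0 e1 ih; case: (Q _).
Qed.

Lemma enum_double : enum 'I_n.*2 = flatten [seq [:: o0 c; o1 c] | c <- enum 'I_n].
apply: (inj_map val_inj); rewrite val_enum_ord map_flatten -map_comp.
rewrite (eq_map (g := (fun k => [:: k.*2; k.*2.+1]) \o (val : 'I_n -> nat))) // map_comp val_enum_ord.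
have E a k : iota a.*2 k.*2 = flatten [seq [:: k.*2; k.*2.+1] | k <- iota a k].
 by elim: k a => //= k ih a; rewrite -ih.
exact: (E 0%N).
Qed.

Section fields.
Variables (m : nat) (d : 'I_m -> nat).
Notation e := (fun i => (d i).*2).
Hypothesis sd : (\sum_i d i)%N = n.

Lemma double_ospE (w : osp d n) l : double_osp w l = w (half_ord l).
by rewrite ffunE. Qed.

(** The two columns of a block follow each other in the lexicographic order, so the normal pairs of
    a doubled partition come as consecutive couples, in the order of the complex coordinates. *)
Lemma normal_double (w : osp d n) : normal_pairs (double_osp w) =
 flatten [seq [:: (p.1, o0 p.2); (p.1, o1 p.2)] | p <- PLr w].
transitivity [seq p : 'I_n.*2 * 'I_n.*2 <- [seq (l, c) | l <- enum 'I_n.*2, c <- flatten [seq [:: o0 c; o1 c] | c <- enum 'I_n]] |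
 (p.1 < p.2)%N && (double_osp w p.1 < double_osp w p.2)%N]; first by rewrite -enum_double.
apply: pairs_flatten => l c /=; rewrite !double_ospE ?half_o0 ?half_o1.
 have [->|] := eqVneq (half_ord l) c; first by rewrite ltnn !andbF.
 move=> lc; congr (_ && _); apply/idP/idP => [lt|lt]; last by apply: (@half_ord_lt l (o0 c)); rewrite half_o0.
 by rewrite ltn_neqAle lc /=; have := half_leq (ltnW lt); rewrite /= doubleK.
have [->|] := eqVneq (half_ord l) c; first by rewrite ltnn !andbF.
move=> lc; congr (_ && _); apply/idP/idP => [lt|lt]; last by apply: (@half_ord_lt l (o1 c)); rewrite half_o1.
by rewrite ltn_neqAle lc /=; have := half_leq (ltnW lt); rewrite /= uphalf_double.
Qed.

Lemma size_flat (L : seq ('I_n.*2 * 'I_n)) : size (flatten [seq [:: (p.1, o0 p.2); (p.1, o1 p.2)] | p <- L]) = (size L).*2.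
by elim: L => //= p L ->. Qed.
Lemma codim_double (w : osp d n) : codim (double_osp w) = (size (PLr w)).*2.
by rewrite /codim normal_double size_flat. Qed.

Lemma index_flat (L : seq ('I_n.*2 * 'I_n)) (l c : 'I_n.*2) : (l, half_ord c) \in L ->
 (l, c) \in flatten [seq [:: (p.1, o0 p.2); (p.1, o1 p.2)] | p <- L] /\
 index (l, c) (flatten [seq [:: (p.1, o0 p.2); (p.1, o1 p.2)] | p <- L]) = ((index (l, half_ord c) L).*2 + odd c)%N.
elim: L => //= -[l' c'] L ih; rewrite inE => lc /=.
have E0 : ((l', o0 c') == (l, c)) = ((l', c') == (l, half_ord c)) && ~~ odd c.
 apply/eqP/andP => [[<- <-]|[/eqP[-> ->] oc]]; first by rewrite half_o0 /= odd_double.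
 by congr pair; apply: half_odd_inj; rewrite ?half_o0 //= odd_double (negbTE oc).
have E1 : ((l', o1 c') == (l, c)) = ((l', c') == (l, half_ord c)) && odd c.
 apply/eqP/andP => [[<- <-]|[/eqP[-> ->] oc]]; first by rewrite half_o1 /= odd_double.
 by congr pair; apply: half_odd_inj; rewrite ?half_o1 //= odd_double oc.
rewrite !inE ![(l, c) == _]eq_sym E0 E1; have [_|ne] := eqVneq (l', c') (l, half_ord c).
 by case: (odd c).
have /ih[-> ->] : (l, half_ord c) \in L by move: lc; rewrite eq_sym (negbTE ne).
by rewrite /= doubleS !addSn.
Qed.

Lemma mem_flat (w : osp d n) (l c : 'I_n.*2) : (l, c) \in normal_pairs (double_osp w) -> (l, half_ord c) \in PLr w.
rewrite mem_np mem_pl !double_ospE => /andP[lc lt]; rewrite lt andbT ltn_neqAle half_leq ?(ltnW lc) // andbT.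
by apply: contraTneq lt => /val_inj ->; rewrite ltnn.
Qed.

Lemma sum_double : (\sum_i e i)%N = n.*2.
by rewrite -sd -muln2 big_distrl; apply: eq_bigr => i _ /=; rewrite muln2. Qed.

Lemma real_entry (w : osp d n) (x : nat -> R) l c :
 (if (l, c) \in normal_pairs (double_osp w) then x (index (l, c) (normal_pairs (double_osp w))) else 0) =
 NLr (PLr w) x l c.
rewrite mxE; case: ifP => [h|h].
 have h' := mem_flat h; rewrite h' /kapr normal_double (index_flat h').2.
 by case: (odd c); rewrite ?addn1 ?addn0.
by case: ifP => // /index_flat[]; rewrite -normal_double h.
Qed.

Lemma slev_r (w : osp d n) a : slev (S := real_strat R sum_double) (double_osp w) a =
 ev (size (PLr w)).*2 (fun x => fr (double_osp w) (1%:M + NLr (PLr w) x)) a.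
rewrite evE => [|x y xy]; last first.
 congr (fr _ (_ + _)); apply/matrixP => l c; rewrite !mxE; case: ifP => // h; have := h; rewrite -index_mem => h'.
 by rewrite !xy ?ltn_double // -doubleS leq_double.
rewrite -codim_double.
apply: eq_app => t; congr (fr _ (_ + _)); apply/matrixP => l c; rewrite /= rnrmE -real_entry; reflexivity.
Qed.

End fields.
Definition scr m (d : 'I_m -> nat) (w : osp d n) : cochain R (flag R (fun i => (d i).*2) n.*2) :=
 if pselect ((\sum_i d i)%N = n) is left sd then scl (S := real_strat R (sum_double sd)) (double_osp w) else 0.

Lemma sum_halves (f : 'I_n.*2 -> R) : \sum_l f l = \sum_c (f (o0 c) + f (o1 c)).
rewrite (partition_big (@half_ord n) xpredT) //=; apply: eq_bigr => c _.
rewrite (bigD1 (o0 c)) ?half_o0 //= (bigD1 (o1 c)) /=; last by rewrite half_o1 eqxx eq_sym o01_neq.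
by rewrite big1 ?addr0 // => l /andP[/andP[]]; rewrite half_eq => /orP[]/eqP->; rewrite eqxx.
Qed.

(** The same reflection acts on both coordinates of each block; the quarter turn [J] of the plane
    replaces the imaginary unit. *)
Lemma pathr (p q : 'I_n) : exists gam : R -> 'M[R]_n.*2, [/\ continuous gam,
 forall t, gam t \in unitmx, gam 0 = 1%:M & gam 1 = perm_mx (liftp (tperm p q))].
have [->|pq] := eqVneq p q.
 exists (fun=> 1%:M); split=> //; first exact: cst_continuous.
 by move=> t; exact: unitmx1.
 rewrite tperm1 (_ : liftp 1 = 1%g) ?perm_mx1 //; apply/permP => l; apply: half_odd_inj; by rewrite ?half_liftp ?odd_liftp !perm1.
pose u (l : 'I_n.*2) := uv R p q (half_ord l).
pose T (A : bool -> bool -> R) : 'M[R]_n.*2 := \matrix_(l, c) (A (odd l) (odd c) * (u l * u c)).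
have TT A B : T A *m T B = T (fun x y => (A x false * B false y + A x true * B true y) *+ 2).
 apply/matrixP => l c; rewrite !mxE; under eq_bigr => k _ do rewrite !mxE.
 rewrite sum_halves; transitivity ((A (odd l) false * B false (odd c) + A (odd l) true * B true (odd c)) *
 (u l * u c) * \sum_k uv R p q k * uv R p q k); last by rewrite uv_sum //; ring.
 rewrite mulr_sumr; apply: eq_bigr => k _; rewrite /u /= half_o0 half_o1 odd_double /=; ring.
pose dl (x y : bool) : R := (x == y)%:R; pose J (x y : bool) : R := (x == ~~ y)%:R * (-1) ^+ x.
have [|||||gam [g1 g2 g3 g4]] := @swap_path R R idfun n.*2 (T dl) (T J) _.
- by move=> x A.
- by rewrite TT; apply/matrixP => l c; rewrite !mxE /dl; case: (odd l); case: (odd c) => /=; ring.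
- by rewrite TT; apply/matrixP => l c; rewrite !mxE /dl /J; case: (odd l); case: (odd c) => /=; ring.
- by rewrite TT; apply/matrixP => l c; rewrite !mxE /dl /J; case: (odd l); case: (odd c) => /=; ring.
- by rewrite TT; apply/matrixP => l c; rewrite !mxE /dl /J; case: (odd l); case: (odd c) => /=; ring.
exists gam; split=> //; rewrite g4; apply/matrixP => l c; rewrite !mxE /dl.
have lE (x y : 'I_n.*2) : (x == y) = (odd x == odd y) && (half_ord x == half_ord y).
 by apply/eqP/andP => [->|[/eqP ho /eqP hh]]; [rewrite !eqxx|exact: half_odd_inj].
rewrite !lE odd_liftp half_liftp /u; case: (odd l == odd c) => /=; last by ring.
by rewrite -(uv_swap R pq); ring.
Qed.

Definition geoR : geo R n.
apply: (@Geo R n R n.*2 (@half_ord n) liftp double 2 2 kapr (fun s => s = 1%g \/ exists c, s = swp c)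
 (fun m d w => double_osp w) (fun m d I => rmate I) scr) => //.
- exact: half_ord_lt.
- move=> c; rewrite -sum1_card big_mkcond sum_blocks (bigD1 c) //= big1 => [|c' cc].
 by rewrite !inE half_o0 half_o1 eqxx.
 by rewrite !inE half_o0 half_o1 (negbTE cc).
- exact: half_liftp.
- by apply/permP => l; apply: half_odd_inj; rewrite ?half_liftp ?odd_liftp !perm1.
- by move=> s t; apply/permP => l; apply: half_odd_inj; rewrite permM ?half_liftp ?odd_liftp // permM.
- exact: doubleD.
- by move=> m d w l; rewrite double_ospE.
- by move=> l; rewrite /kapr if_same.
- by move=> T f g t l fc gc; rewrite /kapr; case: (odd l).
- move=> a b c h; split; [have := h (o0 c) (half_o0 c)|have := h (o1 c) (half_o1 c)]; by rewrite /kapr /= odd_double.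
- by move=> a b s l; rewrite /kapr odd_liftp.
- exact: pathr.
- by move=> m d w; exact: double_good.
- move=> m d I; rewrite /rmate; case: fb => [c|]; first by exists (swp c) => //; right; exists c.
 by exists 1%g; [left|apply: ospP => l; rewrite osp_compE perm1].
- move=> s l [->|[c ->]]; first by rewrite perm1.
 by case: tpermP => [->|->|//]; rewrite half_o0 half_o1.
- move=> m d w K s V W sd [->|[c ->]] wV KV KW; last first.
 exact: (closure_block (sum_double sd) (double_good w) wV KV KW).
 apply: (clos_cells (sum_double sd) wV KV).
 by rewrite (_ : K = osp_comp K 1) //; apply: ospP => l; rewrite osp_compE perm1.
- by move=> m d w; rewrite codim_double; lia.
- move=> m d w sd; rewrite /scr; case: pselect => // sd'; rewrite -(slev_r sd') -codim_double.
 exact: (@sclP R _ (real_strat R (sum_double sd')) (double_osp w) (double_good w)).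
- move=> m d Z i a sd mZ oZ a0 aZ ai; rewrite /scr; case: pselect => // sd'.
 have [] := @scl_span R _ (real_strat R (sum_double sd')) _ (@double_osp m d n) _ _ Z i a mZ oZ a0 aZ ai.
 + by move=> w w' E; apply: ospP => c; have := congr1 (fun I : osp (fun i => (d i).*2) n.*2 => I (o0 c)) E; rewrite !double_ospE half_o0.
 + by move=> I /good_double.
 by move=> lam h hb; exists lam => // w /h[wZ wi]; split=> //; rewrite -codim_double.
- move=> m d lam sd; rewrite /scr; case: pselect => // sd'.
 apply: (@scl_free R _ (real_strat R (sum_double sd')) _ (@double_osp m d n)).
 + by move=> w w' E; apply: ospP => c; have := congr1 (fun I : osp (fun i => (d i).*2) n.*2 => I (o0 c)) E; rewrite !double_ospE half_o0.
 + by move=> w; exact: double_good.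
 + by move=> I /good_double.
- move=> m d w b sd bv; rewrite -(slev_r sd).
 exact: (@scl_exact R _ (real_strat R (sum_double sd)) _ (@double_osp m d n) w b bv).
Defined.

End real_geometry.

(** * From cochains back to cohomology classes *)

Section classes_and_cochains.
Variables (R : realType) (X : topT).
Implicit Types (y z : cocycle R X).

Lemma coclass_cohom y z : coclass y = coclass z <-> cohom (val y) (val z).
split=> [/coclass_eq/is_exactP[b bE]|[b bE]]; first by exists b; rewrite bE linearB.
by apply/coclass_eq/is_exactP; exists b; rewrite bE linearB.
Qed.

Lemma cocycleP y : cob (val y) = 0.
by apply/is_cocycleP; exact: valP. Qed.

(** [cup] multiplies chosen representatives; other ones differ by coboundaries. Homogeneity of the
    left factor is used to move a coboundary past it with a single sign. *)
Lemma cup_coclass i y z : hdeg i (val y) -> cup (coclass y) (coclass z) = coclass (cocycle_cup y z).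
move=> hy; apply/coclass_cohom => /=.
have ry (x : cocycle R X) : cohom (val (generic_quotient.repr (coclass x))) (val x).
 by apply: (coclass_cohom _ _).1; rewrite /coclass generic_quotient.reprK.
apply: cohom_trans (cohom_cupl (cocycleP _) (ry y)) _.
exact: cohom_cupr hy (cocycleP _) (ry z).
Qed.

Lemma coclass0 : coclass (0 : cocycle R X) = 0.
by apply: (addrI (coclass 0)); rewrite -coclassD !addr0. Qed.

Lemma coclass_sum (T : finType) (c : T -> rat) (z : T -> cocycle R X) :
 \sum_t c t *: coclass (z t) = coclass (\sum_t c t *: z t).
rewrite (big_morph _ (@coclassD R X) coclass0); apply: eq_bigr => t _.
by rewrite -[LHS]/(cohomology_scale _ _) -coclassZ.
Qed.

Lemma cup_coclass_sum i y z (T : finType) (c : T -> rat) (w : T -> cocycle R X) : hdeg i (val y) ->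
 cup (coclass y) (coclass z) = \sum_t c t *: coclass (w t) <->
 cohom (cupc (val y) (val z)) (\sum_t c t *: val (w t)).
move=> hy; rewrite coclass_sum (cup_coclass _ hy); have -> : \sum_t c t *: val (w t) = val (\sum_t c t *: w t).
 by rewrite linear_sum; apply: eq_bigr => t _; rewrite linearZ.
exact: coclass_cohom.
Qed.

End classes_and_cochains.

(** [a0] itself witnesses existence. For uniqueness, a relative class is its value on the slice
    times [a0], and any two slices satisfying [normal_simplex] are the same map. *)
Lemma schubert_class_ofE (R : realType) (F : numFieldType) m (e : 'I_m -> nat) M (I : osp e M) k
 (N : (nat -> R) -> 'M[F]_M) (a0 : cocycle R (flag F e M)) :
 let h := fun x => fr I (1%:M + N x) in
 (forall x, 1%:M + N x \in unitmx) ->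
 hdeg k (val a0) -> van (~` closure (schubert_cell I)) (val a0) -> ev k h (val a0) = 1 ->
 (forall a, cob a = 0 -> van (~` closure (schubert_cell I)) a -> hdeg k a -> cohom a (ev k h a *: val a0)) ->
 schubert_class_of I k N = coclass a0.
move=> h Nu ha va ea top; apply: xget_unique => [|x [a [<- ha' va' [s sN s1]]]].
 have [fc|nc] := pselect (continuous (fun t : simp R k => h (fun j => set_val t 0 (inord j.+1) - set_val t 0 0))); last first.
 by move: ea; rewrite /ev /app; case: pselect.
 exists a0; split=> //; first by move=> s /eqP; exact: ha.
 exists (mkcts fc); first by move=> t i; rewrite /= /h frE.
 by rewrite -ea /ev (@app_simp _ _ _ _ (mkcts fc)).
apply/coclass_cohom; have -> : val a0 = ev k h (val a) *: val a0.
 rewrite -[LHS]scale1r -s1 /ev (@app_simp _ _ _ _ s) // => t; apply: flagP => i.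
 by rewrite sN /h frE.
apply: top => [||s' sk]; [exact: cocycleP|exact: va'|by apply: ha'; apply/eqP].
Qed.

Section geo_classes.
Variables (R : realType) (n : nat) (G : geo R n) (m : nat) (d : 'I_m -> nat).
Hypothesis sd : (\sum_i d i)%N = n.
Notation F := (gF G).
Notation M := (gM G).
Notation em := (fun i => gem G (d i)).
Notation PL := (pl (@gb _ _ G)).
Notation NL := (nl (@gb _ _ G) (@kap _ _ G)).
Notation se := (sum_em G sd).

Definition gcl (w : osp d n) : cocycle R (flag F em M) :=
 Cocycle (introT (is_cocycleP _) (let: And4 h _ _ _ := gscP G w sd in h)).

(** In the degree of the codimension the only cell of the closure that can contribute is the open
    one, so the class is determined by its value on the slice. *)
Lemma geo_top (w : osp d n) a : cob a = 0 -> van (~` closure (@schubert_cell F m em M (gD G w))) a ->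
 hdeg (size (PL w)).*2 a -> cohom a (evS w a *: gsc G w).
move=> a0 av ad; pose Z : {set osp em M} :=
 [set I | `[< exists2 V, closure (@schubert_cell F _ _ _ (gD G w)) V & schubert_cell I V >]]%SET.
have ZE : cells_of (@schubert_cell F m em M) Z = closure (@schubert_cell F m em M (gD G w)).
 apply/seteqP; split=> V; last first.
 by move=> KV; have [I IV] := cell_cover se V; exists I => //; rewrite inE; apply/asboolP; exists V.
 case=> I; rewrite inE => /asboolP[W KW IW] IV; exact: (clos_cells se KW IW).
have [|||||lam lamP [b bZ bE]] := @gspan R n G m d Z (size (PL w)).*2 a sd.
- move=> I; rewrite inE => /asboolP[V KV IV]; rewrite inE; apply/asboolP.
 have [s sw ->] := gmate_sw I; exists (fr (osp_comp I s) 1%:M); last exact: cell_fr1.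
 by apply: (gclosure_sw sd sw KV IV); exact: cell_fr1.
- by rewrite ZE; apply: closed_openC; exact: closed_closure.
- exact: a0.
- by rewrite ZE.
- exact: ad.
have lam0 v : v != w -> lam v = 0.
 move=> vw; apply/eqP/negPn/negP => /lamP[]; rewrite inE => /asboolP[V KV IV] /double_inj sz.
 have r := closure_rank se KV IV; have nE : gD G w <> gD G v by move=> /gD_inj E; rewrite E eqxx in vw.
 by have := codim_lt r nE; rewrite !gcodim sz ltnn.
have sE : \sum_v lam v *: gsc G v = lam w *: gsc G w.
 by rewrite (bigD1 w) //= big1 ?addr0 // => v vw; rewrite lam0 // scale0r.
rewrite sE in bE; suff -> : evS w a = lam w by exists b.
have [_ _ _ ew1] := gscP G w sd.
have := @gexact R n G m d w b sd; rewrite bE ev_sub ev_scale ew1 mulr1 => e0.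
apply/eqP; rewrite -subr_eq0 /evS; apply/eqP; apply: e0.
rewrite ZE in bZ; apply: van_sub bZ => V [cV nV] clV; apply: nV.
have [L LV] := cell_cover se V.
suff <- : L = gD G w by [].
by apply: rI_eq => i k kM; [exact: (chart_rank cV LV)|exact: (closure_rank se clV LV)].
Qed.

Lemma geo_class (w : osp d n) : schubert_class_of (gD G w) (size (PL w)).*2 (NL (PL w)) = coclass (gcl w).
have [_ v1 v2 v3] := gscP G w sd; apply: schubert_class_ofE => // [x|a a0 av ad].
 by apply: (ntype_unit (I := gD G w)) => l c; rewrite !gDE mxE mem_pl => cl; rewrite [(_ < w (gb c))%N]ltnNge cl andbF.
exact: geo_top.
Qed.

Lemma geo_cup (K L : osp d n) (c : osp d n -> rat) :
 cup (coclass (gcl K)) (coclass (gcl L)) = \sum_N c N *: coclass (gcl N) <->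
 cohom (cupc (gsc G K) (gsc G L)) (\sum_N c N *: gsc G N).
by have [_ _ h _] := gscP G K sd; exact: (@cup_coclass_sum _ _ _ (gcl K) (gcl L) _ c gcl h). Qed.

End geo_classes.

(** Every hypothesis of [mul_unique] was derived from the fields of [geo], so it holds for both
    geometries. *)
Lemma geo_mstr (R : realType) n (G G' : geo R n) u v : mstr G u v = mstr G' u v.
rewrite -!mulG_ew; apply: mul_unique.
- by move=> a b; exact: mulG_c.
- by move=> a b r; exact: mulG_a.
- by move=> a b r; exact: mulG_Dl.
- by move=> k a b; exact: mulG_Zl.
- by move=> a; exact: mulG_1.
- by move=> k l a b; exact: mulG_hom.
- by move=> j a b; exact: mulG_R.
- by move=> j w dw; exact: mulG_x.
- by move=> a b; exact: mulG_c.
- by move=> a b r; exact: mulG_a.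
- by move=> a b r; exact: mulG_Dl.
- by move=> k a b; exact: mulG_Zl.
- by move=> a; exact: mulG_1.
- by move=> k l a b; exact: mulG_hom.
- by move=> j a b; exact: mulG_R.
- by move=> j w dw; exact: mulG_x.
Qed.

(** * Identification of the classes and conclusion *)

Section comparison.
Variables (R : realType) (m n : nat) (d : 'I_m -> nat).
Hypothesis sd : (\sum_i d i)%N = n.

Lemma complex_class (I : osp d n) : complex_schubert_class R I = coclass (gcl (geoC R n) sd I).
rewrite -geo_class /complex_schubert_class; congr (schubert_class_of _ _ _); apply/funext => x.
apply/matrixP => l c; rewrite mxE; exact: (sum_normal (F := Cx R) I (fun j => (x j.*2 +i* x j.*2.+1)%C)).
Qed.

Lemma real_class (I : osp d n) : real_schubert_class R (double_osp I) = coclass (gcl (geoR R n) sd I).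
rewrite -geo_class /real_schubert_class codim_double; congr (schubert_class_of _ _ _); apply/funext => x.
by apply/matrixP => l c; rewrite -[RHS](real_entry I x l c); exact: (sum_normal (F := R)).
Qed.

Lemma std_monotone : exists phi : osp d n, forall i j : 'I_n, (i <= j)%N -> (phi i <= phi j)%N.
have [phi phiE] := std_osp sd; exists phi => i j ij; rewrite phiE.
by apply: leq_ltn_trans ij _; rewrite -phiE.
Qed.

End comparison.

Theorem corollary4p3 (R : realType) (m n : nat) (d : 'I_m -> nat)
    (d_gt0 : forall i, (0 < d i)%N) (sum_d : (\sum_i d i)%N = n)
    (c : osp d n -> osp d n -> osp d n -> rat)
    (cE : forall I J : osp d n,
      cup (complex_schubert_class R I) (complex_schubert_class R J) =
      \sum_(K : osp d n) c I J K *: complex_schubert_class R K) :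
  forall I J : osp d n,
    cup (real_schubert_class R (double_osp I))
        (real_schubert_class R (double_osp J)) =
    \sum_(K : osp d n) c I J K *: real_schubert_class R (double_osp K).
Proof.
move=> I J; have [phi mono] := std_monotone sum_d.
have hC : cup (coclass (gcl (geoC R n) sum_d I)) (coclass (gcl (geoC R n) sum_d J)) =
    \sum_K c I J K *: coclass (gcl (geoC R n) sum_d K).
  by have := cE I J; rewrite !(complex_class R sum_d) => ->; apply: eq_bigr => K _; rewrite (complex_class R sum_d).
(* The given complex constants become structure constants on permutations through the lifts for a
   monotone labelling [phi]. *)
have eC := prod_lift sum_d mono ((geo_cup _ _ _ _ _).1 hC).
have [c' hR] := prod_lift_exists (geoR R n) sum_d I J.
have eR := prod_lift sum_d mono hR; have E := eR; rewrite (geo_mstr _ (geoC R n)) eC in E.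
(* Distinct partitions have distinct lifts, so the coefficients can be read off the two
   expansions. *)
have cc' K : c I J K = c' K.
  have S (b : osp d n -> rat) : (\sum_N b N *: ew (liftw phi N) : {ffun 'S_n -> rat^o}) (liftw phi K) = b K.
    rewrite sum_ffunE (bigD1 K) //= big1 ?addr0 => [|N NK]; first by rewrite !ffunE eqxx [LHS]mulr1.
    rewrite !ffunE (_ : (liftw phi K == liftw phi N) = false) ?[LHS]mulr0 //.
    by apply: contraNF NK => /eqP/liftw_inj ->.
  by rewrite -[LHS]S E S.
rewrite !(real_class R sum_d); transitivity (\sum_K c I J K *: coclass (gcl (geoR R n) sum_d K)); last first.
  by apply: eq_bigr => K _; rewrite (real_class R sum_d).
apply: (geo_cup (geoR R n) sum_d I J (c I J)).2; rewrite (eq_bigr (fun K => c' K *: gsc (geoR R n) K)) // => K _; by rewrite cc'.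
Qed.
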